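(* Assume that for every maximal Abelian subalgebra $\mathfrak a\subset\mathfrak p$ and every $\beta\in\mathfrak a$ the function $\mu_{\mathfrak p}^\beta:M\to\mathbb R$ has a unique local maximum. If $\nu\in\mathscr P(M)$ is a $\mathrm K$-invariant smooth probability measure on $M$ and $0$ belongs to the interior $\Omega(\mu_{\mathfrak p})$ in $\mathfrak p$ of the convex hull of $\mu_{\mathfrak p}(M)$, then the map $F_\nu:\mathrm G\to\mathfrak p$, $F_\nu(g)=\mathfrak F(g\cdot\nu)$, descends to a diffeomorphism $\overline F_\nu:\mathrm G/\mathrm K\rightarrow\Omega(\mu_{\mathfrak p})$.
   Context: Setting. $(Z,J,\omega)$ is a compact connected Kähler manifold, $\mathrm U$ is a compact connected Lie group with Lie algebra $\mathfrak u$ and complexification $\mathrm U^{\mathbb C}$, with Cartan decomposition $\mathrm U^{\mathbb C}=\mathrm U\exp(i\mathfrak u)$. $\mathrm U^{\mathbb C}$ acts holomorphically on $Z$, and $\mathrm U$ preserves $\omega$ and acts in a Hamiltonian fashion with $\mathrm U$-equivariant momentum mapping $\mu:Z\to\mathfrak u^*\cong\mathfrak u$ (identification via an $\mathrm{Ad}(\mathrm U)$-invariant scalar product). $B$ is a nondegenerate $\mathrm{Ad}(\mathrm U^{\mathbb C})$-invariant symmetric $\mathbb R$-bilinear form on $\mathfrak u^{\mathbb C}=\mathfrak u\oplus i\mathfrak u$, positive definite on $i\mathfrak u$, negative definite on $\mathfrak u$, with $\mathfrak u\perp i\mathfrak u$; $\langle\cdot,\cdot\rangle$ is its restriction to $i\mathfrak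 u$. $\mathrm G\subseteq\mathrm U^{\mathbb C}$ is a compatible subgroup, i.e. a closed connected subgroup with $\mathrm G=\mathrm K\exp(\mathfrak p)$, where $\mathrm K=\mathrm G\cap\mathrm U$ and $\mathfrak p=\mathfrak g\cap i\mathfrak u$ is $\mathrm K$-stable. The $\mathrm G$-gradient map $\mu_{\mathfrak p}:Z\to\mathfrak p$ is $-i$ times the orthogonal projection of $\mu$ onto $i\mathfrak p\subset\mathfrak u$; it is $\mathrm K$-equivariant, and conventions are normalized so that for every $\beta\in\mathfrak p$ the fundamental vector field $\beta_Z$, $\beta_Z(z)=\frac{d}{dt}|_{t=0}\exp(t\beta)\cdot z$, is the gradient of $\mu_{\mathfrak p}^\beta=\langle\mu_{\mathfrak p},\beta\rangle$ for the Kähler metric determined by $\omega$ and $J$. $M\subset Z$ is a compact $\mathrm G$-stable real submanifold, and $\mu_{\mathfrak p}$ also denotes the restriction to $M$. Measures. $\mathscr P(M)$ is the set of Borel probability measures on $M$ with the weak$^*$ topology; $\mathrm G$ acts on it by pushforward, $g\cdot\nu=g_*\nu$. The gradient map is $\mathfrak F:\mathscr P(M)\to\mathfrak p$, $\mathfrak F(\nu)=\int_M\mu_{\mathfrak p}(x)\,d\nu(x)$. A measure on $M$ is smooth if in any chart it has a smooth positive density with respect to the Lebesgue measure of the chart. Conventions. A function has a ''unique local maximum'' if every local maximum of it is a global maximum. Under the stated assumption it is known that $\mu_{\mathfrak a}(M)$ is a (convex) polytope for each maximal Abelian $\mathfrak a\subset\mathfrak p$, where $\mu_{\mathfrak a}$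 is $\mu_{\mathfrak p}$ followed by orthogonal projection onto $\mathfrak a$, and that for each $\beta\in\mathfrak a$ the set of $x\in M$ such that $\lim_{t\to+\infty}\exp(t\beta)\cdot x$ lies in the maximum set of $\mu_{\mathfrak p}^\beta$ is open and dense, with complement a finite union of submanifolds of positive codimension. *)

(* Defs.v *)
From HB Require Import structures.
From mathcomp Require Import all_boot all_order all_algebra.
From mathcomp Require Import sesquilinear.
From mathcomp Require Import all_classical all_reals all_analysis.

Set Implicit Arguments.
Unset Strict Implicit.
Unset Printing Implicit Defensive.

Import Order.TTheory GRing.Theory Num.Theory.
Import numFieldNormedType.Exports.

Local Open Scope classical_set_scope.
Local Open Scope ring_scope.

(* C^k and C^oo maps on an open subset A of a (finite-dimensional) normed
   space; the derivative of order k.+1 is taken directionally. *)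
Fixpoint Ck (R : realType) (V W : normedModType R) (k : nat) (A : set V)
    (f : V -> W) : Prop :=
  if k is k'.+1 then
    (forall x, A x -> differentiable f x) /\
    (forall v, Ck k' A (fun x => 'd f x v))
  else forall x, A x -> {for x, continuous f}.

Definition Coo (R : realType) (V W : normedModType R) (A : set V)
  (f : V -> W) : Prop := forall k, Ck k A f.

(* Manifolds.  As usual for charted spaces with a preferred chart
   [chart_at x] around each point x, the tangent space at x is the model
   space E, read through [chart_at x].  The records carry data only; the
   axioms are in [is_manifold]. *)
Record chart (E T : Type) := Chart {
  cdom : set T;
  cfwd : T -> E;
  cbwd : E -> T }.

Record charted_space (R : realType) (E : normedModType R) := ChartedSpace {
  carrier :> ptopologicalType;
  atlas : set (chart E carrier);
  chart_at : carrier -> chart E carrier }.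

HB.instance Definition _ (X Y : ptopologicalType) := Pointed.on (X * Y)%type.

Section manifolds.
Context {R : realType}.

Definition is_chart (E : normedModType R) (T : topologicalType)
    (phi : chart E T) : Prop :=
  [/\ open (cdom phi),
      open (cfwd phi @` cdom phi),
      forall x, cdom phi x -> cbwd phi (cfwd phi x) = x,
      forall x, cdom phi x -> {for x, continuous (cfwd phi)} &
      forall y, (cfwd phi @` cdom phi) y -> {for y, continuous (cbwd phi)}].

Definition transition (E : normedModType R) (T : Type) (phi psi : chart E T)
  : E -> E := cfwd psi \o cbwd phi.

Definition overlap (E : normedModType R) (T : Type) (phi psi : chart E T)
  : set E := cfwd phi @` (cdom phi `&` cdom psi).

Definition compatible_charts (E : normedModType R) (T : Type)
    (phi psi : chart E T) : Prop :=
  Coo (overlap phi psi) (transition phi psi) /\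
  Coo (overlap psi phi) (transition psi phi).

Definition is_manifold (E : normedModType R) (X : charted_space E) : Prop :=
  [/\ hausdorff_space X,
      @second_countable X,
      forall phi, atlas phi -> is_chart (phi : chart E X),
      forall phi psi, atlas phi -> atlas psi ->
        compatible_charts (phi : chart E X) psi &
      forall x : X, atlas (chart_at x) /\ cdom (chart_at x) x].

(* A chart of the maximal atlas. *)
Definition is_smooth_chart (E : normedModType R) (X : charted_space E)
    (phi : chart E X) : Prop :=
  is_chart phi /\ forall psi, atlas psi -> compatible_charts phi psi.

Definition euclid (V : normedModType R) : charted_space V :=
  @ChartedSpace R V V [set Chart setT id id] (fun _ => Chart setT id id).

Definition prod_chart (E F S T : Type) (phi : chart E S) (psi : chart F T)
  : chart (E * F) (S * T) :=
  Chart (cdom phi `*` cdom psi)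
        (fun p => (cfwd phi p.1, cfwd psi p.2))
        (fun p => (cbwd phi p.1, cbwd psi p.2)).

Definition prod_space (E F : normedModType R) (X : charted_space E)
    (Y : charted_space F) : charted_space (E * F)%type :=
  @ChartedSpace R (E * F)%type (X * Y)%type
    [set chi | exists phi psi,
       [/\ atlas phi, atlas psi & chi = prod_chart phi psi]]
    (fun p => prod_chart (chart_at p.1) (chart_at p.2)).

Section maps.
Context {E F : normedModType R} (X : charted_space E) (Y : charted_space F).

(* smoothness on an open set A *)
Definition smooth_on (A : set X) (f : X -> Y) : Prop :=
  (forall x, A x -> {for x, continuous f}) /\
  forall phi psi, atlas phi -> atlas psi ->
    Coo (cfwd phi @` (A `&` cdom phi `&` (f @^-1` cdom psi)))
        (cfwd psi \o f \o cbwd phi).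

Definition smooth (f : X -> Y) : Prop := smooth_on setT f.

Definition tangent_map (f : X -> Y) (x : X) : E -> F :=
  'd (cfwd (chart_at (f x)) \o f \o cbwd (chart_at x)) (cfwd (chart_at x) x).

Definition smooth_embedding (f : X -> Y) : Prop :=
  [/\ smooth f, injective f,
      forall x, injective (tangent_map f x) &
      forall A : set X, open A -> exists2 B : set Y, open B & A = f @^-1` B].
End maps.

Definition diffeomorphism (E F : normedModType R) (X : charted_space E)
    (Y : charted_space F) (f : X -> Y) : Prop :=
  smooth f /\ exists g : Y -> X, [/\ smooth g, cancel f g & cancel g f].

(* f is a diffeomorphism of X onto the subset A of V.  A need not be open in V
   (it will be open in a linear subspace), so smoothness of the inverse on A
   means, as usual, that it extends locally to a smooth map. *)
Definition diffeomorphism_onto (E V : normedModType R) (X : charted_space E)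
    (A : set V) (f : X -> V) : Prop :=
  smooth (f : X -> euclid V) /\
  exists g : V -> X,
    [/\ forall x, A (f x),
        cancel f g,
        forall y, A y -> f (g y) = y &
        forall y, A y -> exists (W : set V) (h : V -> X),
          [/\ open W, W y, smooth_on (W : set (euclid V)) h &
              forall z, W z -> A z -> h z = g z]].

(* Complex manifolds: charts take values in C^n = R^n (+) R^n, and multiplication
   by i in the model space is the complex structure J of the tangent spaces. *)
Definition Jmul (n : nat) (v : 'rV[R]_(n + n)) : 'rV[R]_(n + n) :=
  row_mx (- rsubmx v) (lsubmx v).

Definition is_complex_manifold (n : nat) (Z : charted_space 'rV[R]_(n + n))
  : Prop :=
  is_manifold Z /\
  forall phi psi : chart 'rV[R]_(n + n) Z, atlas phi -> atlas psi ->
    forall x, overlap phi psi x -> forall v,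
      'd (transition phi psi) x (Jmul v) = Jmul ('d (transition phi psi) x v).

Definition holomorphic (E F : normedModType R) (X : charted_space E)
    (Y : charted_space F) (JE : E -> E) (JF : F -> F) (f : X -> Y) : Prop :=
  smooth f /\
  forall x v, tangent_map f x (JE v) = JF (tangent_map f x v).

Definition Jprod (n m : nat) (v : 'rV[R]_(n + n) * 'rV[R]_(m + m)) :=
  (Jmul v.1, Jmul v.2).

(* Two-tensors: omega z is a bilinear form on the tangent space at z. *)
Definition tensor_in_chart (n : nat) (Z : charted_space 'rV[R]_n)
    (omega : Z -> {biscalar 'rV[R]_n}) (phi : chart 'rV[R]_n Z)
    (x v w : 'rV[R]_n) : R^o :=
  let z := cbwd phi x in
  let D := 'd (transition phi (chart_at z)) x in
  omega z (D v) (D w).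

Definition is_kaehler_form (n : nat) (Z : charted_space 'rV[R]_(n + n))
    (omega : Z -> {biscalar 'rV[R]_(n + n)}) : Prop :=
  [/\ forall phi, atlas phi -> forall v w,
        Coo (cfwd phi @` cdom phi)
            (fun x => tensor_in_chart omega phi x v w),
      forall z v, omega z v v = 0,
      forall phi, atlas phi -> forall x, (cfwd phi @` cdom phi) x ->
        forall u v w,
        'd (fun y => tensor_in_chart omega phi y v w) x u +
        'd (fun y => tensor_in_chart omega phi y w u) x v +
        'd (fun y => tensor_in_chart omega phi y u v) x w = 0,
      forall z v w, omega z (Jmul v) (Jmul w) = omega z v w &
      forall z v, v != 0 -> 0 < omega z v (Jmul v)].

Definition kaehler_metric (n : nat) (Z : charted_space 'rV[R]_(n + n))
    (omega : Z -> {biscalar 'rV[R]_(n + n)}) (z : Z) (v w : 'rV[R]_(n + n))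
  : R := omega z v (Jmul w).

Definition compact_connected (T : topologicalType) : Prop :=
  compact [set: T] /\ connected [set: T].

End manifolds.

Section lie_groups.
Context {R : realType}.

Record lie_space (E : normedModType R) := LieSpace {
  lie_sort :> charted_space E;
  lie_one : lie_sort;
  lie_mul : lie_sort -> lie_sort -> lie_sort;
  lie_inv : lie_sort -> lie_sort }.

Definition group_axioms (E : normedModType R) (G : lie_space E) : Prop :=
  [/\ associative (@lie_mul _ G),
      left_id (lie_one G) (@lie_mul _ G) &
      left_inverse (lie_one G) (@lie_inv _ G) (@lie_mul _ G)].

Definition is_lie_group (E : normedModType R) (G : lie_space E) : Prop :=
  [/\ is_manifold G, group_axioms G,
      smooth ((fun p => lie_mul p.1 p.2) : prod_space G G -> G) &
      smooth (@lie_inv _ G)].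

Definition is_complex_lie_group (n : nat) (G : lie_space 'rV[R]_(n + n))
  : Prop :=
  [/\ is_complex_manifold G, group_axioms G,
      holomorphic (@Jprod R n n) (@Jmul R n)
        ((fun p => lie_mul p.1 p.2) : prod_space G G -> G) &
      holomorphic (@Jmul R n) (@Jmul R n) (@lie_inv _ G)].

Definition lie_hom (E F : normedModType R) (G : lie_space E) (H : lie_space F)
    (f : G -> H) : Prop :=
  smooth f /\ forall x y, f (lie_mul x y) = lie_mul (f x) (f y).

(* The Lie algebra of G is its tangent space E at the identity. *)
Definition lie_diff (E F : normedModType R) (G : lie_space E)
    (H : lie_space F) (f : G -> H) : E -> F := tangent_map f (lie_one G).

Section one_group.
Context {E : normedModType R} (G : lie_space E).

Definition one_parameter_subgroup (xi : E) (gamma : R^o -> G) : Prop :=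
  [/\ smooth (gamma : euclid R^o -> G),
      forall s t, gamma (s + t) = lie_mul (gamma s) (gamma t) &
      tangent_map (gamma : euclid R^o -> G) 0 1 = xi].

Definition lie_exp (xi : E) : G :=
  xget (lie_one G) [set g | exists2 gamma, one_parameter_subgroup xi gamma &
                                           gamma 1 = g].

Definition Ad (g : G) : E -> E :=
  tangent_map (fun h : G => lie_mul (lie_mul g h) (lie_inv g)) (lie_one G).

Definition lie_bracket (xi eta : E) : E :=
  derive1 (fun t : R => Ad (lie_exp (t *: xi)) eta) 0.
End one_group.

(* c : U -> H is the complexification of the compact Lie group U: it is
   universal among the homomorphisms of U into complex Lie groups, it is
   injective, and (x, i xi) |-> c(x) exp(i xi) is a diffeomorphism of U x iu
   onto H (Cartan decomposition). *)
Definition is_complexification (k d : nat) (U : lie_space 'rV[R]_k)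
    (H : lie_space 'rV[R]_(d + d)) (c : U -> H) : Prop :=
  [/\ is_complex_lie_group H,
      lie_hom c /\ injective c,
      forall (m : nat) (L : lie_space 'rV[R]_(m + m)) (f : U -> L),
        is_complex_lie_group L -> lie_hom f ->
        exists! F : H -> L,
          [/\ holomorphic (@Jmul R d) (@Jmul R m) F,
              forall x y, F (lie_mul x y) = lie_mul (F x) (F y) &
              forall x, F (c x) = f x] &
      diffeomorphism
        ((fun p => lie_mul (c p.1) (lie_exp H (Jmul (lie_diff c p.2))))
           : prod_space U (euclid 'rV[R]_k) -> H)].

Definition closed_lie_subgroup (E F : normedModType R) (G : lie_space E)
    (H : lie_space F) (j : G -> H) : Prop :=
  [/\ is_lie_group G, lie_hom j, smooth_embedding j & closed (range j)].

(* Q with projection pi is the homogeneous manifold G/K, K being a subgroup: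
   the fibres of pi are the cosets gK, and the smooth structure of Q is the one
   for which pi is a submersion. *)
Definition is_homogeneous_space (E F : normedModType R) (G : lie_space E)
    (K : set G) (Q : charted_space F) (pi : G -> Q) : Prop :=
  [/\ is_manifold Q,
      smooth pi,
      forall q, exists g, pi g = q,
      forall g w, exists v, tangent_map pi g v = w &
      forall g h, pi g = pi h <-> K (lie_mul (lie_inv g) h)].

Definition is_holomorphic_action (d n : nat) (H : lie_space 'rV[R]_(d + d))
    (Z : charted_space 'rV[R]_(n + n)) (act : H -> Z -> Z) : Prop :=
  [/\ forall z, act (lie_one H) z = z,
      forall g h z, act (lie_mul g h) z = act g (act h z) &
      holomorphic (@Jprod R d n) (@Jmul R n)
        ((fun p => act p.1 p.2) : prod_space H Z -> Z)].

Definition fundamental_field (E F : normedModType R) (H : lie_space E)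
    (Z : charted_space F) (act : H -> Z -> Z) (xi : E) (z : Z) : F :=
  tangent_map ((fun t => act (lie_exp H (t *: xi)) z) : euclid R^o -> Z) 0 1.

End lie_groups.

Section gradient_maps.
Context {R : realType} {n k d m : nat}.
Variables (Z : charted_space 'rV[R]_(n + n))
  (omega : Z -> {biscalar 'rV[R]_(n + n)})
  (U : lie_space 'rV[R]_k) (H : lie_space 'rV[R]_(d + d)) (c : U -> H)
  (act : H -> Z -> Z)
  (G : lie_space 'rV[R]_m) (j : G -> H).

(* The Lie algebra u inside u^C = T_1 H. *)
Definition liealg_u : set 'rV[R]_(d + d) := range (lie_diff c).

Definition preserves_form : Prop :=
  forall x z v w,
    omega (act (c x) z) (tangent_map (act (c x)) z v)
                        (tangent_map (act (c x)) z w) = omega z v w.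

Definition Ad_invariant_scalar_product (s : {biscalar 'rV[R]_(d + d)})
  : Prop :=
  [/\ forall xi eta, liealg_u xi -> liealg_u eta -> s xi eta = s eta xi,
      forall xi, liealg_u xi -> xi != 0 -> 0 < s xi xi &
      forall x xi eta, liealg_u xi -> liealg_u eta ->
        s (Ad (c x) xi) (Ad (c x) eta) = s xi eta].

(* Equivariant momentum map, with u^* identified with u through s.  The sign
   convention is d(mu^xi) = omega(-, xi_Z); with the metric omega(-, J -) it
   makes the fundamental fields of elements of p the gradients of the
   components of the gradient map -i proj(mu). *)
Definition is_momentum_map (s : {biscalar 'rV[R]_(d + d)})
    (mu : Z -> 'rV[R]_(d + d)) : Prop :=
  [/\ forall z, liealg_u (mu z),
      smooth (mu : Z -> euclid 'rV[R]_(d + d)),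
      forall x z, mu (act (c x) z) = Ad (c x) (mu z) &
      forall xi, liealg_u xi -> forall z v,
        tangent_map ((fun y => s (mu y) xi) : Z -> euclid R^o) z v =
        omega z v (fundamental_field act xi z)].

Definition is_invariant_form (B : {biscalar 'rV[R]_(d + d)}) : Prop :=
  [/\ forall xi eta, B xi eta = B eta xi,
      forall xi, (forall eta, B xi eta = 0) -> xi = 0,
      forall (h : H) xi eta, B (Ad h xi) (Ad h eta) = B xi eta,
      forall xi, liealg_u xi -> xi != 0 ->
        B xi xi < 0 /\ 0 < B (Jmul xi) (Jmul xi) &
      forall xi eta, liealg_u xi -> liealg_u eta -> B xi (Jmul eta) = 0].

(* K = G /\ U and p = g /\ iu *)
Definition grp_K : set G := [set g | range c (j g)].

Definition liealg_p : set 'rV[R]_(d + d) :=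
  range (lie_diff j) `&` (@Jmul R d @` liealg_u).

Definition is_compatible_subgroup : Prop :=
  [/\ closed_lie_subgroup j,
      connected [set: G],
      forall g, grp_K g -> forall beta, liealg_p beta ->
        liealg_p (Ad (j g) beta),
      forall beta, liealg_p beta -> range j (lie_exp H beta) &
      forall g, exists2 x, grp_K x &
        exists2 beta, liealg_p beta & j g = lie_mul (j x) (lie_exp H beta)].

(* mup = - i . proj(mu), where proj is the s-orthogonal projection onto ip. *)
Definition is_gradient_map (s : {biscalar 'rV[R]_(d + d)})
    (mu mup : Z -> 'rV[R]_(d + d)) : Prop :=
  forall z, liealg_p (mup z) /\
    forall beta, liealg_p beta -> s (mu z - Jmul (mup z)) (Jmul beta) = 0.

Definition gradient_normalization (B : {biscalar 'rV[R]_(d + d)})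
    (mup : Z -> 'rV[R]_(d + d)) : Prop :=
  forall beta, liealg_p beta -> forall z v,
    tangent_map ((fun y => B (mup y) beta) : Z -> euclid R^o) z v =
    kaehler_metric omega z (fundamental_field act beta z) v.

Definition abelian_subalgebra (a : set 'rV[R]_(d + d)) : Prop :=
  [/\ a 0, forall (t : R) xi eta, a xi -> a eta -> a (t *: xi + eta) &
      forall xi eta, a xi -> a eta -> lie_bracket H xi eta = 0].

Definition maximal_abelian_in_p (a : set 'rV[R]_(d + d)) : Prop :=
  [/\ abelian_subalgebra a, a `<=` liealg_p &
      forall b, abelian_subalgebra b -> b `<=` liealg_p -> a `<=` b -> b = a].

End gradient_maps.

Definition unique_local_max {R : realType} {T : topologicalType} (f : T -> R)
  : Prop :=
  forall x, (\forall y \near x, f y <= f x) -> forall y, f y <= f x.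

Definition convex_hull {R : realType} {V : normedModType R} (A : set V)
  : set V := smallest (fun C : set V => @convex_set R V C) A.

(* interior of A relative to the linear subspace p *)
Definition relative_interior {R : realType} {V : normedModType R}
    (p A : set V) : set V :=
  [set x | p x /\ \forall y \near x, p y -> A y].

Notation borel T := (g_sigma_algebraType (@open T)).

Section measures.
Context {R : realType}.
Local Open Scope ereal_scope.

Definition is_lebesgue (r : nat) (lam : {measure set (borel 'rV[R]_r) -> \bar R})
  : Prop :=
  forall a b : 'rV[R]_r, (forall i, a 0 i <= b 0 i)%R ->
    lam [set x : 'rV[R]_r | forall i, (a 0 i <= x 0 i <= b 0 i)%R] =
    (\prod_i (b 0 i - a 0 i)%R)%:E.

Definition is_smooth_measure (r : nat) (M : charted_space 'rV[R]_r)
    (nu : set (borel M) -> \bar R) : Prop :=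
  exists2 lam : {measure set (borel 'rV[R]_r) -> \bar R}, is_lebesgue lam &
  forall phi : chart 'rV[R]_r M, is_smooth_chart phi ->
  exists rho : 'rV[R]_r -> R^o,
    [/\ Coo (cfwd phi @` cdom phi) rho,
        forall y, (cfwd phi @` cdom phi) y -> (0 < rho y)%R &
        forall A : set (borel M), measurable A -> A `<=` cdom phi ->
          nu A = \int[lam]_(y in cfwd phi @` A) (rho y)%:E].

Definition push (M : ptopologicalType) (f : M -> M)
    (nu : set (borel M) -> \bar R) : set (borel M) -> \bar R :=
  @pushforward _ _ (borel M) (borel M) R nu f.

(* integral of a vector-valued function, coordinatewise *)
Definition vec_integral (M : ptopologicalType) (r : nat)
    (nu : set (borel M) -> \bar R) (f : M -> 'rV[R]_r) : 'rV[R]_r :=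
  \row_i fine (\int[nu]_(x in [set: borel M]) (f x 0%R i)%:E).

End measures.

(* The gradient map on measures evaluated along the orbit G.nu, the measure
   g.nu being the pushforward of nu by x |-> g.x. *)
Definition orbit_gradient_map {R : realType} {m d r : nat}
    (G : lie_space 'rV[R]_m) (M : charted_space 'rV[R]_r)
    (actM : G -> M -> M) (mupM : M -> 'rV[R]_d)
    (nu : set (borel M) -> \bar R) (g : G) : 'rV[R]_d :=
  vec_integral (push (actM g) nu) mupM.

(* Main.v *)
(* Write F g for the integral of the gradient map over the measure g.nu.  By the
   Cartan decomposition G = exp(p) K and K-invariance, F factors through p ~ R^e
   as Phi a = F (exp a).  For beta in p, let f be the beta-component of the
   gradient map; its gradient flow is exp(t beta).  Along t |-> exp(t beta) the
   beta-component of F is the average of f over the flow, so it increases, and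
   its derivative is the average of the squared norm of the gradient; this makes
   Phi a local diffeomorphism.

   Properness of Phi onto Omega amounts to the fact that this average tends to
   max f, i.e. that almost every point flows to the maximum.  Near a critical
   point, i beta generates a one-parameter group of isometries in a compact
   group, whence a Lojasiewicz inequality; so orbits below the maximum are
   captured near critical points, none of which is a local maximum on M by
   assumption.  Each of these points then has an unstable direction on M, and a
   cone argument shows that the points captured near it meet every line in this
   direction at most once locally, hence form a null set.

   Finally a proper local diffeomorphism onto the convex set Omega in which
   Phi 0 has a single preimage is bijective. *)
Require Import Defs.
From HB Require Import structures.
From mathcomp Require Import all_boot all_order all_algebra.
From mathcomp Require Import perm sesquilinear ring lra zify.
From mathcomp Require Import all_classical all_reals all_analysis measurable_realfun.

Set Implicit Arguments.
Unset Strict Implicit.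
Unset Printing Implicit Defensive.

Import Order.TTheory GRing.Theory Num.Theory.
Import numFieldNormedType.Exports.

Local Open Scope classical_set_scope.
Local Open Scope ring_scope.

(** One-parameter groups in the direction of [i u] come from the Cartan decomposition, those in [U]
    from limits of powers; every flow is thus given by the group action and no differential equation
    is solved. The obstacle is that critical points need not be isolated and that no Morse-Bott
    normal form is at hand. It is replaced by an estimate at a fixed point of the compact group. Let
    [W] be the field there and [S] its derivative: the component of [W] outside the range of [S] is
    of order [o(W)], so a Newton iteration with a pseudoinverse of [S] reaches a zero of [W] at
    distance [O(W)] from any nearby point. The gradient is [J W] up to sign, hence of the same
    length, and the function is constant on the nearby zeros; so it differs from its critical value
    by [O(W^2)]. This exponent bounds the lengths of orbits near a critical point, and since nearby
    critical points share one value, finitely many of them control a compact critical set. The plane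
    [p] is the row space of a matrix, so that the analysis takes place on row vectors with the sup
    norm. *)

Definition mklin {R : realType} {U V : normedModType R} (f : U -> V)
  (lf : linear f) : {linear U -> V} :=
  HB.pack f (GRing.isLinear.Build _ _ _ _ _ lf).

(** * Differentials as epsilon estimates *)

Section differentials.
Context {R : realType}.
Implicit Types U V W : normedModType R.

(** Translation to 0 turns the little-o of the definition into this estimate; conversely, a
    continuous linear map that satisfies it is the differential by [diff_unique]. Most differentials
    below are computed in this form. *)
Lemma is_diff_epsP V W (f : V -> W) (x : V) (L : {linear V -> W}) :
  is_diff x f L <-> continuous L /\
  forall e, 0 < e -> \forall y \near x, `|f y - f x - L (y - x)| <= e * `|y - x|.
Proof.
split.
  move=> [df dL]; split; first by rewrite -dL; exact: diff_continuous.
  move=> e e0; have := diff_locally df; rewrite dL => /eqaddoP /(_ e e0) H.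
  rewrite (near_shift 0); near=> h => /=.
  rewrite !subr0 addrK.
  have : `|(f \o shift x - (cst (f x) + L)) h| <= e * `|h| by near: h.
  rewrite -[(_ - _) h]/(f (h + x) - (f x + L h)) opprD addrA.
  by rewrite [h + x]addrC.
move=> [cL H].
have E : f \o shift x = cst (f x) + L +o_0 id.
  apply/eqaddoP => e e0; have := H e e0; rewrite (near_shift 0) => K.
  apply: filterS K => h /=; rewrite !subr0 addrK.
  by rewrite -[(_ - _) h]/(f (h + x) - (f x + L h)) opprD addrA.
have dE := diff_unique cL E.
by apply: DiffDef => //; apply/diff_locallyP; rewrite dE.
Unshelve. all: by end_near. Qed.

Lemma near_eq_is_diff V W (f g : V -> W) (x : V) (df : V -> W) :
  (\forall y \near x, f y = g y) -> is_diff x f df -> is_diff x g df.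
Proof.
move=> fg [dx E].
have /is_diff_epsP [c H] : is_diff x f ('d f x) by exact: DiffDef.
suff : is_diff x g ('d f x) by rewrite E.
apply/is_diff_epsP; split => // e e0.
have fgx := nbhs_singleton fg.
by apply: filterS2 fg (H e e0) => y <-; rewrite fgx.
Qed.

Lemma near_eq_diff V W (f g : V -> W) (x : V) :
  (\forall y \near x, f y = g y) -> differentiable f x ->
  differentiable g x /\ 'd g x = 'd f x :> (V -> W).
Proof.
move=> fg /differentiableP d; have := near_eq_is_diff fg d => d2.
by split; [exact: ex_diff | exact: diff_val].
Qed.

Lemma is_diff_eps V W (f : V -> W) (x : V) : differentiable f x ->
  forall e, 0 < e -> \forall y \near x, `|f y - f x - 'd f x (y - x)| <= e * `|y - x|.
Proof. by move=> /differentiableP /is_diff_epsP []. Qed.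

Lemma continuous_normP V W (f : V -> W) (x : V) : {for x, continuous f} <->
  forall e, 0 < e -> \forall y \near x, `|f y - f x| <= e.
Proof.
split=> [/cvgrPdist_le H e /H|H]; first by apply: filterS => y; rewrite distrC.
by apply/cvgrPdist_le => e /H; apply: filterS => y; rewrite distrC.
Qed.

Lemma near_norm_le V (x : V) (e : R) : 0 < e -> \forall y \near x, `|y - x| <= e.
Proof. by move=> e0; have /continuous_normP := @cvg_id _ (nbhs x); exact. Qed.

End differentials.

(** * Maps of class C^k *)

Section Ck_calculus.
Context {R : realType}.
Implicit Types U V W : normedModType R.

Lemma Ck_sub V W k (A B : set V) (f : V -> W) : A `<=` B -> Ck k B f -> Ck k A f.
Proof.
move=> AB; elim: k f => [|k IH] f /= => [H x /AB|[H1 H2]]; first exact: H.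
by split => [x /AB /H1//|v]; apply: IH.
Qed.

Lemma Ck_eq V W k (A : set V) (f g : V -> W) : open A ->
  (forall x, A x -> f x = g x) -> Ck k A f -> Ck k A g.
Proof.
move=> oA; elim: k f g => [|k IH] f g fg /=.
  move=> H x Ax; have := H x Ax; rewrite /prop_for /continuous_at -(fg x Ax).
  move=> fx; apply: cvg_trans fx; apply: near_eq_cvg.
  by have /open_nbhs_nbhs : open_nbhs x A by []; apply: filterS => y /fg ->.
have nfg x : A x -> \forall y \near x, f y = g y.
  move=> Ax; have /open_nbhs_nbhs : open_nbhs x A by [].
  by apply: filterS => y /fg.
move=> [H1 H2]; split.
  by move=> x Ax; have [] := near_eq_diff (nfg x Ax) (H1 x Ax).
move=> v; apply: IH (H2 v) => x Ax.
exact: (esym (congr1 (fun h => h v) (near_eq_diff (nfg x Ax) (H1 x Ax)).2)).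
Qed.

Lemma CkS V W k (A : set V) (f : V -> W) : Ck k.+1 A f -> Ck k A f.
Proof.
elim: k f => [|k IH] f [H1 H2].
  by move=> x Ax; apply: differentiable_continuous; exact: H1.
by split => // v; apply: IH.
Qed.

Lemma Ck_near V W k (A : set V) (f : V -> W) :
  (forall x, A x -> exists2 N : set V, N x & Ck k N f) -> Ck k A f.
Proof.
elim: k f => [|k IH] f H /=.
  by move=> x /H [N Nx HN]; exact: HN.
split=> [x /H [N Nx [HN _]]|v]; first exact: HN.
by apply: IH => x /H [N Nx [_ HN]]; exists N; [exact: Nx|exact: HN].
Qed.

Lemma Ck_cst V W k (A : set V) (c : W) : Ck k A (cst c : V -> W).
Proof.
elim: k c => [|k IH] c /=; first by move=> x _; exact: cst_continuous.
split=> [x _|v]; first exact: differentiable_cst.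
have -> : (fun x : V => 'd (cst c) x v) = cst (0 : W).
  by apply/funext => x; rewrite diff_cst.
exact: IH.
Qed.

Lemma Ck_lin U V W k (A : set U) (f : U -> V) (L : {linear V -> W}) :
  open A -> continuous L -> Ck k A f -> Ck k A (L \o f).
Proof.
move=> oA cL; elim: k f => [|k IH] f /=.
  by move=> H x Ax; apply: continuous_comp; [exact: H|exact: cL].
have dL y : differentiable L y by exact: linear_differentiable.
move=> [H1 H2]; split=> [x Ax|v].
  by apply: differentiable_comp => //; exact: H1.
apply: (@Ck_eq _ _ _ _ (L \o (fun x => 'd f x v))) => //; last exact/IH/H2.
move=> x Ax; rewrite (diff_comp (H1 x Ax) (dL _)) /=.
by rewrite diff_lin.
Qed.

Lemma CkD U V k (A : set U) (f g : U -> V) :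
  open A -> Ck k A f -> Ck k A g -> Ck k A (f \+ g).
Proof.
move=> oA; elim: k f g => [|k IH] f g /=.
  by move=> H1 H2 x Ax; apply: continuousD; [exact: H1|exact: H2].
move=> [f1 f2] [g1 g2]; split=> [x Ax|v].
  by apply: differentiableD; [exact: f1|exact: g1].
apply: (@Ck_eq _ _ _ _ ((fun x => 'd f x v) \+ (fun x => 'd g x v))) => //.
  by move=> x Ax; rewrite diffD//; [exact: f1|exact: g1].
exact: IH.
Qed.

Lemma Ck_sum U V k (A : set U) n (f : 'I_n -> U -> V) :
  open A -> (forall i, Ck k A (f i)) -> Ck k A (fun x => \sum_(i < n) f i x).
Proof.
move=> oA; elim: n f => [|n IH] f Hf.
  rewrite (_ : (fun _ => _) = cst 0); first exact: Ck_cst.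
  by apply/funext => x; rewrite big_ord0.
rewrite (_ : (fun _ => _) = (f ord0) \+ (fun x => \sum_(i < n) f (lift ord0 i) x)).
  by apply: CkD => //; apply: IH.
by apply/funext => x; rewrite big_ord_recl.
Qed.

End Ck_calculus.

(** Scaling with the scalar taken in [R^o], so that it can be declared bilinear between normed
    modules and the differential of a bilinear map gives the product rule. *)
Definition scalev {R : realType} {V : normedModType R} (k : R^o) (v : V) : V := k *: v.

Lemma scalev_is_bilinear {R : realType} {V : normedModType R} :
  bilinear_for (GRing.Scale.Law.clone R V *:%R _)
    (GRing.Scale.Law.clone R V *:%R _) (@scalev R V).
Proof.
split=> [v a x y|k a x y] /=; first by rewrite /scalev scalerDl scalerA.
by rewrite /scalev scalerDr !scalerA mulrC.
Qed.
HB.instance Definition _ (R : realType) (V : normedModType R) :=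
  bilinear_isBilinear.Build R R^o V V _ _ (@scalev R V) (@scalev_is_bilinear R V).

(** A finite spanning family with continuous coordinate functionals: this form passes to products
    and makes every linear map continuous. *)
Definition findim {R : realType} (V : normedModType R) := exists n (e : 'I_n -> V)
  (l : 'I_n -> {linear V -> R^o}),
  (forall i, continuous (l i)) /\ forall v, v = \sum_(i < n) l i v *: e i.

Section Ck_comp.
Context {R : realType}.
Implicit Types U V W : normedModType R.

Lemma CkZ U V k (A : set U) (f : U -> R^o) (g : U -> V) :
  open A -> Ck k A f -> Ck k A g -> Ck k A (fun x => f x *: g x).
Proof.
move=> oA; elim: k f g => [|k IH] f g /=.
  by move=> H1 H2 x Ax; apply: continuousZ; [exact: H1|exact: H2].
move=> [f1 f2] [g1 g2].
have sc : continuous (fun p : R^o * V => scalev p.1 p.2) by exact: scale_continuous.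
have E x : A x -> is_diff x (fun x => f x *: g x)
    (fun v => f x *: 'd g x v + 'd f x v *: g x).
  move=> Ax; have fx := f1 x Ax; have gx := g1 x Ax.
  have d2 := differentiable_pair fx gx.
  have d1 := differentiable_bilin (f x, g x) sc.
  rewrite (_ : (fun x => f x *: g x) = (fun p => scalev p.1 p.2) \o (fun x => (f x, g x)))//.
  apply: DiffDef; first exact: differentiable_comp.
  by rewrite diff_comp//; apply/funext => v /=; rewrite diff_bilin// diff_pair.
split=> [x Ax|v]; first by have [] := E x Ax.
apply: (@Ck_eq _ _ _ _ _ ((fun x => f x *: 'd g x v) \+ (fun x => 'd f x v *: g x))) => //.
  by move=> x Ax; have [_ D] := E x Ax; exact: (esym (congr1 (fun h => h v) D)).
by apply: CkD => //; apply: IH => //; apply: CkS.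
Qed.

Lemma findim_continuous V W (L : {linear V -> W}) : findim V -> continuous L.
Proof.
move=> [n [e [l [cl H]]]].
have -> : (L : V -> W) = fun v => \sum_(i < n) l i v *: L (e i).
  by apply/funext => v; rewrite {1}(H v) linear_sum; apply: eq_bigr => i _; rewrite linearZ.
have : Ck 0 setT (fun v => \sum_(i < n) l i v *: L (e i)).
  apply: Ck_sum => [|i]; first exact: openT.
  apply: CkZ; [exact: openT| |exact: Ck_cst] => x _; exact: cl.
by move=> K x; exact: K.
Qed.

(** Induction on [k]. Expanding ['d f x v] along the vectors [e i] turns the chain rule into a
    finite sum of products of two functions, each covered by the induction hypothesis or by
    linearity; this is where the middle space has to be of finite dimension. *)
Lemma Ck_comp U V W k (A : set U) (B : set V) (f : U -> V) (g : V -> W) :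
  findim V -> open A -> open B -> (forall x, A x -> B (f x)) ->
  Ck k A f -> Ck k B g -> Ck k A (g \o f).
Proof.
move=> fV oA oB; elim: k f g => [|k IH] f g fAB.
  by move=> H1 H2 x Ax; apply: continuous_comp; [exact: H1|exact/H2/fAB].
move=> fk gk; have := fk; have := gk; move=> [g1 g2] [f1 f2]; split=> [x Ax|v].
  by apply: differentiable_comp; [exact: f1|exact/g1/fAB].
have [n [e [l [cl H]]]] := fV.
apply: (@Ck_eq _ _ _ _ _ (fun x => \sum_(i < n) l i ('d f x v) *: 'd g (f x) (e i))) => //.
  move=> x Ax; rewrite (diff_comp (f1 _ Ax) (g1 _ (fAB _ Ax))) /=.
  by rewrite [in RHS](H ('d f x v)) linear_sum; apply: eq_bigr => i _; rewrite linearZ.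
apply: Ck_sum => // i; apply: CkZ => //.
  by apply: (@Ck_lin _ _ _ _ k A (fun x => 'd f x v) (l i)); [exact: oA|exact: cl|exact: f2].
by apply: (IH f (fun y => 'd g y (e i))); [exact: fAB|exact: (CkS fk)|exact: g2].
Qed.

Lemma Ck_linear V W k (A : set V) (L : {linear V -> W}) : continuous L -> Ck k A L.
Proof.
move=> cL; apply: (@Ck_sub _ _ _ _ _ setT) => //.
case: k => [x _|k]; first exact: cL.
split=> [x _|v]; first exact: linear_differentiable.
have -> : (fun x => 'd L x v) = cst (L v) by apply/funext => x; rewrite diff_lin.
exact: Ck_cst.
Qed.

Lemma Ck_id V k (A : set V) : Ck k A (@id V).
Proof. by apply: (@Ck_linear V V k A idfun) => x; exact: cvg_id. Qed.

Lemma Ck_pair U V W k (A : set U) (f : U -> V) (g : U -> W) :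
  open A -> Ck k A f -> Ck k A g -> Ck k A (fun x => (f x, g x)).
Proof.
move=> oA; elim: k f g => [|k IH] f g /=.
  by move=> H1 H2 x Ax; apply: cvg_pair; [exact: H1|exact: H2].
move=> [f1 f2] [g1 g2]; split=> [x Ax|v].
  by apply: differentiable_pair; [exact: f1|exact: g1].
apply: (@Ck_eq _ _ _ _ _ (fun x => ('d f x v, 'd g x v))) => //; last exact: IH.
by move=> x Ax; rewrite diff_pair//; [exact: f1|exact: g1].
Qed.

Lemma findim_Ro : findim R^o.
Proof.
exists 1, (fun=> 1), (fun=> idfun); split => [i x|v]; first exact: cvg_id.
by rewrite big_ord1 /= [RHS]mulr1.
Qed.

Lemma findim_rV n : findim 'rV[R]_n.
Proof.
have lin (i : 'I_n) : linear_for *:%R (fun v : 'rV[R]_n => v 0 i : R^o).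
  by move=> a u v /=; rewrite !mxE.
pose l (i : 'I_n) : {linear 'rV[R]_n -> R^o} :=
  HB.pack (fun v : 'rV[R]_n => v 0 i : R^o) (GRing.isLinear.Build _ _ _ _ _ (lin i)).
exists n, (fun i => delta_mx 0 i), l; split=> [i x|v]; last exact: row_sum_delta.
exact: (@coord_continuous R 1 n 0 i).
Qed.

Lemma findim_prod V W : findim V -> findim W -> findim (V * W)%type.
Proof.
move=> [n [e [l [cl Hl]]]] [m [e' [l' [cl' Hl']]]].
have linf : linear_for *:%R (fst : V * W -> V) by move=> a u v.
have lins : linear_for *:%R (snd : V * W -> W) by move=> a u v.
pose f : {linear (V * W)%type -> V} := HB.pack (fst : V * W -> V) (GRing.isLinear.Build _ _ _ _ _ linf).
pose s : {linear (V * W)%type -> W} := HB.pack (snd : V * W -> W) (GRing.isLinear.Build _ _ _ _ _ lins).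
exists (n + m)%N, (fun i => match fintype.split i with inl i => (e i, 0) | inr i => (0, e' i) end).
exists (fun i => match fintype.split i with inl i => (l i \o f : {linear _ -> _})
  | inr i => (l' i \o s : {linear _ -> _}) end); split.
  move=> i; case: (fintype.split i) => {}i x.
    by apply: continuous_comp; [exact: cvg_fst|exact: cl].
  by apply: continuous_comp; [exact: cvg_snd|exact: cl'].
move=> [v w]; rewrite big_split_ord /=.
under eq_bigr do rewrite (unsplitK (inl _)).
under [X in _ + X]eq_bigr do rewrite (unsplitK (inr _)).
apply: injective_projections; rewrite /=.
  rewrite -[RHS]/(f (_ + _)) linearD !linear_sum [X in _ + X]big1 => [|i _].
    by rewrite addr0 {1}(Hl v); apply: eq_bigr => i _; rewrite linearZ.
  by rewrite linearZ /= scaler0.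
rewrite -[RHS]/(s (_ + _)) linearD !linear_sum [X in X + _]big1 => [|i _].
  by rewrite add0r {1}(Hl' w); apply: eq_bigr => i _; rewrite linearZ.
by rewrite linearZ /= scaler0.
Qed.

End Ck_comp.

(** * Mean value inequalities and strict differentiability *)

Section mean_value.
Context {R : realType}.
Implicit Types U V W : normedModType R.

Lemma diff_line V W (f : V -> W) (x v : V) (t : R) :
  differentiable f (x + t *: v) ->
  is_derive t 1 (fun s : R => f (x + s *: v)) ('d f (x + t *: v) v).
Proof.
move=> df.
have lin : linear (fun s : R^o => s *: v) by move=> a y z; rewrite scalerDl scalerA.
pose l := mklin lin.
have dl : is_diff t (fun s : R^o => x + s *: v) l.
  apply/is_diff_epsP; split => [|e e0]; first exact/findim_continuous/findim_Ro.
  near=> s; rewrite /= opprD addrACA subrr add0r -scalerBl subrr normr0.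
  by rewrite mulr_ge0// ltW.
have dc : differentiable (f \o (fun s : R^o => x + s *: v)) (t : R^o).
  by apply: differentiable_comp; [have [] := dl|].
have D : derivable (fun s : R => f (x + s *: v)) t 1 by exact: diff_derivable.
have [dl1 dl2] := dl.
apply: DeriveDef => //; rewrite deriveE //.
transitivity (('d f (x + t *: v) \o 'd (fun s : R^o => x + s *: v) t) 1).
  by rewrite -diff_comp.
by rewrite /= dl2 /= scale1r.
Unshelve. all: by end_near. Qed.

Lemma coord_norm_le n (v : 'rV[R]_n) j : `|v 0 j| <= `|v|.
Proof.
rewrite [leRHS]/Num.norm /= mx_normrE.
exact: (le_bigmax _ (fun ij : 'I_1 * 'I_n => `|v ij.1 ij.2|) (0, j)).
Qed.

Lemma rV_norm_le n (v : 'rV[R]_n) (K : R) :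
  0 <= K -> (forall j, `|v 0 j| <= K) -> `|v| <= K.
Proof.
move=> K0 H; rewrite [leLHS]/Num.norm /= mx_normrE; apply: bigmax_le => //= -[i j] _ /=.
by rewrite (ord1 i).
Qed.

(* Coordinatewise, so that the mean value theorem applies to vector-valued
   maps for the sup norm. *)
Lemma mvt_rV V n (f : V -> 'rV[R]_n) (x y : V) (L : {linear V -> 'rV[R]_n}) (K : R) :
  (forall t : R, 0 <= t <= 1 -> differentiable f (x + t *: (y - x)) /\
     `|'d f (x + t *: (y - x)) (y - x) - L (y - x)| <= K) ->
  `|f y - f x - L (y - x)| <= K.
Proof.
move=> H; have K0 : 0 <= K by have [_] := H 0 (introT andP (conj (lexx _) ler01)); exact: le_trans.
apply: rV_norm_le => // j; rewrite !mxE.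
pose g := fun s : R => f (x + s *: (y - x)) 0 j.
have dg (t : R) : 0 <= t <= 1 -> is_derive t 1 g ('d f (x + t *: (y - x)) (y - x) 0 j).
  move=> t01; have [df _] := H t t01; have [D E] := diff_line df.
  by apply: DeriveDef; [move/derivable_mxP: D; exact|rewrite -E derive_mx// mxE].
have [| |c c01] := @MVT_segment R g (fun t => 'd f (x + t *: (y - x)) (y - x) 0 j) 0 1 ler01.
- by move=> t; rewrite in_itv /= => /andP[t0 t1]; apply: dg; rewrite !ltW.
- apply: derivable_within_continuous => t; rewrite in_itv /= => t01.
  by have [] := dg t t01.
rewrite /g scale1r scale0r addr0 [x + _]addrC subrK subr0 mulr1 => ->.
move: c01; rewrite in_itv /= => c01; have [_] := H c c01; apply: le_trans.
have := coord_norm_le ('d f (x + c *: (y - x)) (y - x) - L (y - x)) j.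
by rewrite !mxE.
Qed.

Lemma linear_bounded_findim V W (L : {linear V -> W}) : findim V ->
  exists2 C, 0 < C & forall v, `|L v| <= C * `|v|.
Proof. by move=> fV; apply: linear_lipschitz; exact: findim_continuous. Qed.

(** [Ck 1] gives continuity of ['d f z v] for each fixed [v] only. Control at the finitely many
    vectors [b i], together with bounded coordinates, makes it uniform in [v]. *)
Lemma C1_diff_near V W (A : set V) (f : V -> W) (x : V) (e : R) : findim V ->
  open A -> A x -> Ck 1 A f -> 0 < e ->
  \forall z \near x, forall v, `|'d f z v - 'd f x v| <= e * `|v|.
Proof.
move=> [n [b [l [cl Hl]]]] oA Ax [_ H2] e0.
have [C C0 HC] : exists2 C : R, 0 < C & forall i v, `|l i v| <= C * `|v|.
  have K i := @linear_lipschitz _ _ _ (l i) (cl i).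
  pose c i := sval (cid2 (K i)).
  have c0 i : 0 < c i by rewrite /c; case: cid2.
  have cE i v : `|l i v| <= c i * `|v| by rewrite /c; case: cid2.
  exists (1 + \sum_i c i); first by rewrite ltr_pwDl// sumr_ge0// => i _; exact/ltW.
  move=> i v; apply: (le_trans (cE i v)); rewrite ler_wpM2r//.
  rewrite (bigD1 i)//= addrCA lerDl addr_ge0// sumr_ge0// => ? _; exact/ltW.
(* The successor keeps the quotient meaningful in dimension 0. *)
pose d := e / (C * n.+1%:R).
have d0 : 0 < d by rewrite divr_gt0// mulr_gt0.
have : \forall z \near x, forall i, `|'d f z (b i) - 'd f x (b i)| < d.
  apply: filter_forall => i; have := H2 (b i) x Ax.
  by move=> /cvgrPdist_lt /(_ d d0); apply: filterS => z; rewrite distrC.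
apply: filterS => z Hz v.
have -> : 'd f z v - 'd f x v = \sum_(i < n) l i v *: ('d f z (b i) - 'd f x (b i)).
  under eq_bigr do rewrite scalerBr; rewrite sumrB; congr (_ - _);
    by rewrite {1}(Hl v) linear_sum; apply: eq_bigr => i _; rewrite linearZ.
rewrite (le_trans (ler_norm_sum _ _ _))//; apply: (@le_trans _ _ (\sum_(i < n) (C * `|v|) * d)).
  apply: ler_sum => i _; rewrite normrZ ler_pM//.
  exact/ltW/Hz.
rewrite sumr_const card_ord -mulr_natr /d.
have -> : C * `|v| * (e / (C * n.+1%:R)) * n%:R = (n%:R / n.+1%:R) * (e * `|v|).
  by field; rewrite gt_eqF ?addn1//= gt_eqF// addrC natr1.
rewrite ler_piMl ?mulr_ge0 ?(ltW e0)// ler_pdivrMr// mul1r ler_nat.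
exact: leqnSn.
Qed.

Lemma ball_segment V (a x y : V) r (t : R) : ball a r x -> ball a r y ->
  0 <= t <= 1 -> ball a r (x + t *: (y - x)).
Proof.
rewrite -!ball_normE /= => ax ay /andP[t0 t1].
have -> : a - (x + t *: (y - x)) = (1 - t) *: (a - x) + t *: (a - y).
  rewrite [in RHS]scalerBl scale1r -[RHS]addrA [- _ + _]addrC -scalerBr opprB [_ + (x - a)]addrC.
  by rewrite addrA subrK opprD addrA -scalerN opprB.
apply: (le_lt_trans (ler_normD _ _)); rewrite !normrZ !ger0_norm ?subr_ge0//.
have [->|tn] := eqVneq t 0; first by rewrite subr0 mul1r mul0r addr0.
have tp : 0 < t by rewrite lt_neqAle eq_sym tn.
have : t * `|a - y| < t * r by rewrite ltr_pM2l.
have : (1 - t) * `|a - x| <= (1 - t) * r by rewrite ler_wpM2l ?subr_ge0// ltW.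
lra.
Qed.

(** Strict differentiability: the mean value inequality for [f] minus its differential at [x],
    applied on a segment of the ball. *)
Lemma C1_strict V n (A : set V) (f : V -> 'rV[R]_n) (x : V) (e : R) : findim V ->
  open A -> A x -> Ck 1 A f -> 0 < e ->
  \forall r \near 0^'+, forall y z, ball x r y -> ball x r z ->
    [/\ A y, differentiable f y, forall v, `|'d f y v - 'd f x v| <= e * `|v| &
     `|f z - f y - 'd f x (z - y)| <= e * `|z - y|].
Proof.
move=> fV oA Ax f1 e0; have := C1_diff_near fV oA Ax f1 e0.
have /filterI : \forall z \near x, A z by have /open_nbhs_nbhs : open_nbhs x A by [].
move=> /[apply] /nbhs_ballP[r /= r0 Hr].
near=> s => y z sy sz.
have sr : s <= r by near: s; exact: nbhs_right_le.
have Hs w : ball x s w -> A w /\ forall v, `|'d f w v - 'd f x v| <= e * `|v|.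
  by move=> sw; apply: Hr; exact: le_ball sw.
have dfA w : A w -> differentiable f w by have [f2 _] := f1; exact: f2.
have [Ay Hy] := Hs y sy; split => //; first exact: dfA.
apply: mvt_rV => t t01; have [Aw Hw] := Hs _ (ball_segment sy sz t01).
by split; [exact: dfA|exact: Hw].
Unshelve. all: by end_near. Qed.

(* The quantity minimised, [|Y z| + |z - x| / (4 C)], decreases along [T] unless
   [Y z = 0]: this replaces the convergence of the iterates of [T]. *)
Lemma chord_zero n m (Y : 'rV[R]_n -> 'rV[R]_m) (T : 'rV[R]_n -> 'rV[R]_n) x (C : R) :
  0 < C ->
  (forall z, `|z - x| <= 4 * C * `|Y x| -> {for z, continuous Y}) ->
  (forall z, `|z - x| <= 4 * C * `|Y x| -> `|Y z| <= `|Y x| ->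
     `|T z - z| <= C * `|Y z| /\ `|Y (T z)| <= 2^-1 * `|Y z|) ->
  exists2 q, `|q - x| <= 4 * C * `|Y x| & Y q = 0.
Proof.
move=> C0 cY HT; pose D := [set z : 'rV[R]_n | `|z - x| <= 4 * C * `|Y x|].
have C4 : 0 < 4 * C by rewrite mulr_gt0.
have Dx : D x by rewrite /D /= subrr normr0 mulr_ge0// ltW.
have cD : compact D.
  have -> : D = closed_ball_ (fun u => `|u|) x (4 * C * `|Y x|).
    by apply/seteqP; split => z; rewrite /D /closed_ball_ /= distrC.
  apply: bounded_closed_compact; last exact: closed_closed_ball_.
  exists (`|x| + 4 * C * `|Y x|); split; first exact: num_real.
  move=> t tgt z /=; rewrite /closed_ball_ /= => zx.
  apply: le_trans (ltW tgt); rewrite -[z](subrK x) addrC.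
  by rewrite (le_trans (ler_normD _ _))// lerD2l distrC.
pose g z := `|Y z| + `|z - x| / (4 * C).
have [| |q Dq Hq] := @EVT_min_rV R n g D _ cD; first by exists x.
  move=> z; apply: continuous_in_subspaceT => {}z; rewrite inE => Dz.
  apply: (@continuousD _ _ _ (fun z => `|Y z|) (fun z => `|z - x| / (4 * C))).
    by apply: continuous_comp (cY z Dz) _; exact: norm_continuous.
  apply: continuousM; last exact: cst_continuous.
  apply: continuous_comp; last exact: norm_continuous.
  by apply: continuousB => //; exact: cst_continuous.
move: Dq; rewrite inE => Dq; exists q => //.
have := Hq x; rewrite inE => /(_ Dx); rewrite /g subrr normr0 mul0r addr0 => qx.
have Yq : `|Y q| <= `|Y x| by apply: le_trans qx; rewrite lerDl divr_ge0// ltW.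
have [T1 T2] := HT q Dq Yq.
(* A step of [T] costs at most a quarter of [|Y q|] in the second term of [g] and gains half of it
   in the first, so minimality leaves only [Y q = 0]. *)
have T3 : `|T q - x| / (4 * C) <= `|q - x| / (4 * C) + `|Y q| / 4.
  rewrite -[T q](subrK q) -addrA addrC (le_trans (ler_wpM2r _ (ler_normD _ _)))//.
    by rewrite invr_ge0 ltW.
  rewrite mulrDl lerD2l ler_pdivrMr// (le_trans T1)//.
  by rewrite mulrA divfK// mulrC.
have DT : D (T q).
  have : `|T q - x| / (4 * C) <= `|Y x|.
    by apply: (le_trans T3); move: qx; have := normr_ge0 (Y q); lra.
  by rewrite ler_pdivrMr// mulrC.
have := Hq (T q); rewrite inE => /(_ DT); rewrite /g => H.
apply/eqP; rewrite -normr_le0; have := normr_ge0 (Y q); lra.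
Qed.

End mean_value.

(** * Coordinates, determinants and inverse matrices *)

Section Ck_real.
Context {R : realType}.
Implicit Types U V W : normedModType R.

Lemma Ck_rV V n k (A : set V) (f : V -> 'rV[R]_n) : open A ->
  (forall j, Ck k A (fun x => f x 0 j : R^o)) -> Ck k A f.
Proof.
move=> oA H.
apply: (@Ck_eq _ _ _ _ _ (fun x => \sum_(j < n) (f x 0 j : R^o) *: (delta_mx 0 j : 'rV[R]_n))) => //.
  by move=> x _; rewrite [RHS]row_sum_delta.
by apply: Ck_sum => // j; apply: CkZ => //; exact: Ck_cst.
Qed.

Lemma coord_is_linear n (j : 'I_n) : linear (fun v : 'rV[R]_n => v 0 j : R^o).
Proof. by move=> a u v; rewrite !mxE. Qed.

Definition rV_coord n (j : 'I_n) : {linear 'rV[R]_n -> R^o} := mklin (@coord_is_linear n j).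

Lemma Ck_coord V n k (A : set V) (f : V -> 'rV[R]_n) j : open A ->
  Ck k A f -> Ck k A (fun x => f x 0 j : R^o).
Proof.
move=> oA fk; apply: (@Ck_lin _ _ _ _ k A f (rV_coord j)) => //.
exact/findim_continuous/findim_rV.
Qed.

Lemma CkM V k (A : set V) (f g : V -> R^o) : open A ->
  Ck k A f -> Ck k A g -> Ck k A (fun x => f x * g x : R^o).
Proof. by move=> oA fk gk; exact: (@CkZ _ _ R^o k A f g oA fk gk). Qed.

Lemma Ck_prod V k (A : set V) n (f : 'I_n -> V -> R^o) : open A ->
  (forall i, Ck k A (f i)) -> Ck k A (fun x => \prod_(i < n) f i x : R^o).
Proof.
move=> oA; elim: n f => [|n IH] f Hf.
  rewrite (_ : (fun _ => _) = cst 1); first exact: Ck_cst.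
  by apply/funext => x; rewrite big_ord0.
rewrite (_ : (fun _ => _) = (fun x => f ord0 x * \prod_(i < n) (f (lift ord0 i) x))).
  by apply: CkM => //; apply: IH.
by apply/funext => x; rewrite big_ord_recl.
Qed.

Lemma CkN V W k (A : set V) (f : V -> W) : open A -> Ck k A f -> Ck k A (fun x => - f x).
Proof.
move=> oA fk; apply: (@Ck_eq _ _ _ _ _ (fun x => (-1 : R^o) *: f x)) => //.
  by move=> x _; rewrite scaleN1r.
by apply: CkZ => //; exact: Ck_cst.
Qed.

Lemma is_diffV_at V (f : V -> R^o) x : differentiable f x -> f x != 0 ->
  is_diff x (fun x => (f x)^-1 : R^o) (fun v => - ((f x)^-1 * (f x)^-1 * 'd f x v)).
Proof.
move=> df f0; have dV := dinv f0.
have [dc E] := dV.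
have D2 : is_diff (f x) (fun y : R^o => y^-1 : R^o) (fun h : R^o => (- (f x) ^- 2) *: h).
  have lin : linear (fun h : R^o => (- (f x) ^- 2) *: h : R^o).
    by move=> a u v; rewrite scalerDr !scalerA mulrC.
  have cl : continuous (mklin lin) by exact/findim_continuous/findim_Ro.
  have D := diff_unique cl E.
  by apply: DiffDef; [apply/diff_locallyP; rewrite D|rewrite D].
have [d2 e2] := D2.
have dd := differentiable_comp df d2.
have ee := diff_comp df d2; apply: DiffDef; first exact: dd.
transitivity ('d (fun y : R^o => y^-1 : R^o) (f x) \o 'd f x); first exact: ee.
by rewrite e2; apply/funext => v /=; rewrite scaleNr expr2 invfM.
Qed.

Lemma CkV V k (A : set V) (f : V -> R^o) : open A -> (forall x, A x -> f x != 0) ->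
  Ck k A f -> Ck k A (fun x => (f x)^-1 : R^o).
Proof.
move=> oA f0; elim: k => [|k IH].
  by move=> fk x Ax; apply: (@continuousV R V (f : V -> R) x); [exact: f0|exact: fk].
move=> fk; have [f1 f2] := fk; split=> [x Ax|v].
  by have [] := is_diffV_at (f1 x Ax) (f0 x Ax).
apply: (@Ck_eq _ _ _ _ _ (fun x => - ((f x)^-1 * (f x)^-1 * 'd f x v) : R^o)) => //.
  move=> x Ax; have [_ /(congr1 (fun h => h v)) E] := is_diffV_at (f1 x Ax) (f0 x Ax).
  exact: esym E.
have H := IH (CkS fk).
by apply: CkN => //; apply: CkM => //; [exact: CkM|exact: f2].
Qed.

Lemma Ck_det V k (A : set V) n (J : V -> 'M[R]_n) : open A ->
  (forall i j, Ck k A (fun x => J x i j : R^o)) -> Ck k A (fun x => \det (J x) : R^o).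
Proof.
move=> oA H.
apply: (@Ck_eq _ _ _ _ _
   (fun x => \sum_(i < #|{: 'S_n}|) ((-1) ^+ (enum_val i : {perm 'I_n}) : R^o) *
      \prod_(j < n) J x j ((enum_val i : {perm 'I_n}) j) : R^o)) => //.
  move=> x _; rewrite /determinant [RHS](reindex (enum_val : 'I_#|{: 'S_n}| -> _)) //=.
  exact/onW_bij/enum_val_bij.
apply: Ck_sum => // i; apply: CkM => //; first exact: Ck_cst.
exact: Ck_prod.
Qed.

(** Cramer's rule: an entry of the inverse is a cofactor divided by the determinant, and both are
    polynomials in the entries. *)
Lemma Ck_invmx V k (A : set V) n (J : V -> 'M[R]_n) : open A ->
  (forall x, A x -> J x \in unitmx) ->
  (forall i j, Ck k A (fun x => J x i j : R^o)) ->
  forall i j, Ck k A (fun x => invmx (J x) i j : R^o).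
Proof.
move=> oA uJ H i j.
apply: (@Ck_eq _ _ _ _ _ (fun x => (\det (J x))^-1 *
   ((-1) ^+ (j + i) * \det (row' j (col' i (J x)))) : R^o)) => //.
  by move=> x Ax; rewrite /invmx uJ// !mxE.
apply: CkM => //.
  apply: CkV => //; last exact: Ck_det.
  by move=> x Ax; have := uJ x Ax; rewrite unitmxE unitfE.
apply: CkM => //; first exact: Ck_cst.
by apply: Ck_det => // i' j'; apply: Ck_eq (H (lift j i') (lift i j')) => // x _; rewrite !mxE.
Qed.

End Ck_real.

(** * The inverse function theorem *)

Section inverse_function.
Context {R : realType}.

Lemma normr_subl0 (V : normedModType R) (a b : V) (K : R) :
  `|a - b| <= K -> a = 0 -> `|b| <= K.
Proof. by move=> + a0; rewrite a0 sub0r normrN. Qed.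

(** Preimages come from [chord_zero], for the chord iteration with the fixed inverse of ['d f x0];
    injectivity and the Lipschitz bound of the inverse come from [expand]. Smoothness is
    bootstrapped: the differential of [g] is the inverse of that of [f] at [g y], so Cramer's rule
    raises the order of [g] by one. *)
Theorem inverse_function n (f : 'rV[R]_n -> 'rV[R]_n) (A : set 'rV[R]_n) x0 :
  open A -> A x0 -> Coo A f -> (forall v, 'd f x0 v = 0 -> v = 0) ->
  exists (D E : set 'rV[R]_n) (g : 'rV[R]_n -> 'rV[R]_n),
    [/\ [/\ open D, D x0 & D `<=` A], open E,
      forall x, D x -> E (f x) /\ g (f x) = x,
      forall y, E y -> D (g y) /\ f (g y) = y & Coo E g].
Proof.
move=> oA Ax0 fA inj0.
have f1 : Ck 1 A f by exact: fA.
have dfx x : A x -> differentiable f x by have [H _] := f1; exact: H.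
pose J x := lin1_mx ('d f x).
have JE x v : 'd f x v = v *m J x by rewrite mul_rV_lin1.
have unitJ x : (forall v, 'd f x v = 0 -> v = 0) -> J x \in unitmx.
  move=> inj; rewrite -row_free_unit; apply/row_freeP.
  have : kermx (J x) = 0.
    apply/row_matrixP => i; rewrite row0; apply: inj.
    by rewrite JE -row_mul mulmx_ker row0.
  by move/eqP; rewrite kermx_eq0 => /row_freeP.
pose T (v : 'rV[R]_n) : 'rV[R]_n := v *m invmx (J x0).
have linT : linear T by move=> a u v; rewrite /T mulmxDl scalemxAl.
have [C C0 HC] := linear_bounded_findim (mklin linT) (@findim_rV R n).
have TJ v : T ('d f x0 v) = v by rewrite /T JE mulmxK// unitJ.
have JT v : 'd f x0 (T v) = v by rewrite /T JE mulmxKV// unitJ.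
have nT v : `|T v| <= C * `|v| by exact: HC.
(* With this error, [C] times the remainder is at most half of the distance and can be absorbed. *)
have e0 : 0 < (2 * C)^-1 by rewrite invr_gt0 mulr_gt0.
have := C1_strict (@findim_rV R n) oA Ax0 f1 e0.
have := @nbhs_right_gt R 0; move=> /filterI /[apply] /filter_ex[r [r0 Hr]].
have expand x x' : ball x0 r x -> ball x0 r x' -> `|x' - x| <= 2 * C * `|f x' - f x|.
  move=> bx bx'; have [_ _ _ H] := Hr _ _ bx bx'.
  have : `|x' - x| <= C * (`|f x' - f x| + (2 * C)^-1 * `|x' - x|).
    rewrite -{1}[x' - x]TJ (le_trans (nT _))// ler_wpM2l ?(ltW C0)//.
    rewrite -['d f x0 _](subKr (f x' - f x)) (le_trans (ler_normB _ _))// lerD2l.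
    by rewrite (le_trans _ H)// lexx.
  rewrite mulrDr mulrA invfM mulrCA divff ?gt_eqF// mulr1; lra.
(* The search for a zero stays within [4 C |Y x0|] of [x0], and one more chord step adds at most
   [C |Y x0|]; the constant 5 keeps both inside the ball. *)
pose eta := r / (5 * C).
have eta0 : 0 < eta by rewrite divr_gt0// mulr_gt0.
have surj y : ball (f x0) eta y -> exists2 x, ball x0 r x & f x = y.
  move=> by0; pose Y z := f z - y.
  have Y0 : 4 * C * `|Y x0| < r.
    move: by0; rewrite -ball_normE /= -/(Y x0) /eta ltr_pdivlMr ?mulr_gt0// => h.
    have := normr_ge0 (Y x0); nra.
  have inb z : `|z - x0| <= 4 * C * `|Y x0| -> ball x0 r z.
    by move=> h; rewrite -ball_normE /= distrC (le_lt_trans h).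
  have [| |q q1 q2] := @chord_zero R n n Y (fun z => z - T (Y z)) x0 C C0.
  - move=> z /inb bz; have [Az dz _ _] := Hr z z bz bz.
    by apply: continuousB; [exact: differentiable_continuous|exact: cst_continuous].
  - move=> z zx Yz; have bz := inb z zx; set z' := z - T (Y z).
    have dz : z' - z = - T (Y z) by rewrite /z' addrAC subrr sub0r.
    have nz : `|z' - z| <= C * `|Y z| by rewrite dz normrN nT.
    have bz' : ball x0 r z'.
      rewrite -ball_normE /= distrC -[z'](subrK z) -addrA (le_lt_trans (ler_normD _ _))//.
      move: by0; rewrite -ball_normE /= -/(Y x0) /eta ltr_pdivlMr ?mulr_gt0// => h.
      have : C * `|Y z| <= C * `|Y x0| by rewrite ler_wpM2l// ltW.
      lra.
    split=> //; have [_ _ _] := Hr _ _ bz bz'.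
    rewrite dz linearN opprK JT /Y addrA subrK.
    move=> /le_trans; apply; rewrite normrN invfM -mulrA ler_wpM2l ?invr_ge0//.
    by rewrite mulrC ler_pdivrMr// mulrC nT.
  exists q; first exact: inb.
  by apply/eqP; rewrite -subr_eq0; apply/eqP.
pose E := ball (f x0) eta.
pose D := [set x | ball x0 r x /\ E (f x)].
pose g y := xget x0 [set x | ball x0 r x /\ f x = y].
have gP y : E y -> ball x0 r (g y) /\ f (g y) = y.
  move=> Ey; have [x bx fx] := surj y Ey.
  by rewrite /g; case: xgetP => [x' -> []//|] /(_ x); case; split.
have finj x x' : ball x0 r x -> ball x0 r x' -> f x = f x' -> x = x'.
  move=> bx bx' ff; have := expand _ _ bx' bx; rewrite ff subrr normr0 mulr0.
  by rewrite normr_le0 subr_eq0 => /eqP.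
have oE : open E by exact: ball_open.
have bA x : ball x0 r x -> A x by move=> bx; have [] := Hr x x bx bx.
have oD : open D.
  rewrite openE => x [bx Ex]; have cf := differentiable_continuous (dfx _ (bA _ bx)).
  have n1 : \forall y \near x, ball x0 r y.
    by apply: open_nbhs_nbhs; split => //; exact: ball_open.
  have n2 : \forall y \near x, E (f y).
    by apply: cf; apply: open_nbhs_nbhs; split.
  exact: filterI.
have injd x : ball x0 r x -> forall v, 'd f x v = 0 -> v = 0.
  move=> bx v dv; have [Ax dx Hx _] := Hr x x bx bx.
  have h := normr_subl0 (Hx v) dv.
  have h2 := nT ('d f x0 v); rewrite TJ in h2.
  apply/eqP; rewrite -normr_le0.
  have : `|v| <= C * ((2 * C)^-1 * `|v|) by rewrite (le_trans h2)// ler_wpM2l// ltW.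
  rewrite mulrA invfM mulrCA divff ?gt_eqF// mulr1; have := normr_ge0 v; lra.
have lipg y y' : E y -> E y' -> `|g y' - g y| <= 2 * C * `|y' - y|.
  move=> Ey Ey'; have [b1 f_1] := gP y Ey; have [b2 f_2] := gP y' Ey'.
  by have := expand _ _ b1 b2; rewrite f_1 f_2.
have nE y : E y -> \forall z \near y, E z by move=> Ey; apply: open_nbhs_nbhs.
have cg y : E y -> {for y, continuous g}.
  move=> Ey; apply/continuous_normP => e e1.
  have : \forall z \near y, `|z - y| <= e / (2 * C).
    by apply: near_norm_le; rewrite divr_gt0// mulr_gt0.
  have := nE y Ey; apply: filterS2 => z Ez; rewrite ler_pdivlMr ?mulr_gt0// => h.
  by rewrite (le_trans (lipg _ _ Ey Ez))// mulrC.
pose Ji y (v : 'rV[R]_n) : 'rV[R]_n := v *m invmx (J (g y)).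
have linJi y : linear (Ji y) by move=> a u v; rewrite /Ji mulmxDl scalemxAl.
have dg y : E y -> is_diff y g (mklin (linJi y)).
  move=> Ey; have [b1 f_1] := gP y Ey; have inj1 := injd _ b1.
  apply/is_diff_epsP; split => [|e e1]; first exact/findim_continuous/findim_rV.
  have [C' C'0 HC'] := linear_bounded_findim (mklin (linJi y)) (@findim_rV R n).
  have := is_diff_eps (dfx _ (bA _ b1)).
  have ee : 0 < e / (2 * C * C') by rewrite divr_gt0// !mulr_gt0.
  move=> /(_ _ ee) /(cg y Ey); have := nE y Ey; apply: filterS2 => z Ez.
  rewrite /= f_1 (gP z Ez).2 => h.
  have -> : g z - g y - Ji y (z - y) = Ji y ('d f (g y) (g z - g y) - (z - y)).
    have E1 : Ji y ('d f (g y) (g z - g y)) = g z - g y.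
      by rewrite /Ji JE mulmxK// unitJ.
    by rewrite -{1}E1 /Ji -mulmxBl.
  rewrite (le_trans (HC' _))// distrC.
  have := lipg _ _ Ey Ez => hl.
  rewrite (le_trans (ler_wpM2l (ltW C'0) h))//.
  rewrite (le_trans (ler_wpM2l (ltW C'0) (ler_wpM2l (ltW ee) hl)))//.
  rewrite le_eqVlt; apply/orP; left; apply/eqP; field.
  by rewrite !gt_eqF.
exists D, E, g; split.
- split; [exact: oD|by split; exact: ballxx|by move=> x [bx _]; exact: bA].
- exact: oE.
- by move=> x [bx Ex]; split => //; have [b1 f_1] := gP _ Ex; exact: finj.
- by move=> y Ey; have [b1 f_1] := gP _ Ey; split => //; split=> //; rewrite f_1.
- elim=> [|k IH]; first exact: cg.
  split=> [y Ey|v]; first by have [] := dg y Ey.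
  apply: (@Ck_eq _ _ _ _ _ (fun y => v *m invmx (J (g y))) _ oE).
    by move=> y Ey; have [_ /(congr1 (fun h => h v)) Eq] := dg y Ey; exact: esym Eq.
  apply: (Ck_rV oE) => j.
  apply: (@Ck_eq _ _ _ _ _ (fun y => \sum_(i < n) (v 0 i : R^o) * (invmx (J (g y)) i j : R^o) : R^o) _ oE).
    by move=> y Ey; rewrite mxE.
  apply: (Ck_sum oE) => i; apply: (CkM oE); first exact: Ck_cst.
  apply: (@Ck_invmx _ _ _ _ _ (fun y => J (g y)) oE).
    by move=> y Ey; apply/unitJ/injd; exact: (gP y Ey).1.
  move=> i' j'.
  apply: (@Ck_eq _ _ _ _ _ (fun y => 'd f (g y) (delta_mx 0 i') 0 j' : R^o) _ oE).
    by move=> y Ey; rewrite mxE.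
  apply: (Ck_coord _ oE).
  apply: (@Ck_comp _ _ _ _ k E A g (fun x => 'd f x (delta_mx 0 i')) _ oE oA).
  + exact: findim_rV.
  + by move=> y Ey; exact/bA/(gP y Ey).1.
  + exact: IH.
  + by have [_ H] := fA k.+1; exact: H.
Qed.

End inverse_function.

(** * Smoothness at a point *)

Section Coo_at.
Context {R : realType}.
Implicit Types U V W : normedModType R.

(** One neighbourhood serves all orders of differentiability, so smoothness at a point spreads to
    the nearby points. *)
Definition Coo_at V W (f : V -> W) (x : V) :=
  exists A : set V, [/\ open A, A x & Coo A f].

Lemma open_nearP (T : topologicalType) (P : set T) (x : T) :
  (\forall y \near x, P y) -> exists A : set T, [/\ open A, A x & A `<=` P].
Proof. by rewrite /prop_near1 /= nbhsE => -[A [oA Ax] AP]; exists A. Qed.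

Lemma open_near (T : topologicalType) (A : set T) (x : T) : open A -> A x ->
  \forall y \near x, A y.
Proof. by move=> oA Ax; exact: open_nbhs_nbhs. Qed.

Lemma open_in_near (T : topologicalType) (A : set T) :
  (forall x, A x -> \forall y \near x, A y) -> open A.
Proof. by move=> H; rewrite openE => x /H. Qed.

Lemma Coo_at_eq V W (f g : V -> W) x : (\forall y \near x, f y = g y) ->
  Coo_at f x -> Coo_at g x.
Proof.
move=> /open_nearP[B [oB Bx BE]] [A [oA Ax fA]]; exists (A `&` B); split => //.
  exact: openI.
by move=> k; apply: Ck_eq (Ck_sub _ (fA k)) => [|y [_ /BE]|y []//]; first exact: openI.
Qed.

Lemma Coo_at_cst V W (c : W) (x : V) : Coo_at (cst c) x.
Proof. by exists setT; split => //; [exact: openT|move=> k; exact: Ck_cst]. Qed.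

Lemma Coo_at_linear V W (L : {linear V -> W}) (x : V) : continuous L -> Coo_at L x.
Proof. by move=> cL; exists setT; split => //; [exact: openT|move=> k; exact: Ck_linear]. Qed.

Lemma Coo_at_id V (x : V) : Coo_at id x.
Proof. by exists setT; split => //; [exact: openT|move=> k; exact: Ck_id]. Qed.

Lemma Coo_at_continuous V W (f : V -> W) x : Coo_at f x -> {for x, continuous f}.
Proof. by move=> [A [_ Ax /(_ 0%N)]]; exact. Qed.

Lemma Coo_at_differentiable V W (f : V -> W) x : Coo_at f x -> differentiable f x.
Proof. by move=> [A [_ Ax /(_ 1%N)[+ _]]]; exact. Qed.

Lemma Coo_at_near V W (f : V -> W) x : Coo_at f x -> \forall y \near x, Coo_at f y.
Proof. by move=> [A [oA Ax fA]]; apply: filterS (open_near oA Ax) => y Ay; exists A. Qed.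

Lemma Coo_at_diff V W (f : V -> W) x v : Coo_at f x -> Coo_at (fun x => 'd f x v) x.
Proof. by move=> [A [oA Ax fA]]; exists A; split => // k; have [_] := fA k.+1; exact. Qed.

Lemma Coo_openP V W (A : set V) (f : V -> W) : open A ->
  Coo A f <-> forall x, A x -> Coo_at f x.
Proof.
move=> oA; split=> [fA x Ax|H k]; first by exists A.
by apply: Ck_near => x /H [B [_ Bx fB]]; exists B.
Qed.

Lemma open_preimage_on (T S : topologicalType) (A : set T) (B : set S) (f : T -> S) :
  open A -> open B -> (forall x, A x -> {for x, continuous f}) -> open (A `&` f @^-1` B).
Proof.
move=> oA oB cf; apply: open_in_near => x [Ax Bfx].
have := cf x Ax _ (open_near oB Bfx); have := open_near oA Ax; exact: filterI.
Qed.

Lemma Coo_at_comp U V W (f : U -> V) (g : V -> W) x : findim V ->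
  Coo_at f x -> Coo_at g (f x) -> Coo_at (g \o f) x.
Proof.
move=> fV [A [oA Ax fA]] [B [oB Bx gB]].
have oAB : open (A `&` f @^-1` B) by apply: open_preimage_on => //; exact: (fA 0%N).
exists (A `&` f @^-1` B); split => // k.
by apply: Ck_comp fV oAB oB _ (Ck_sub _ (fA k)) (gB k) => y [].
Qed.

Lemma Coo_at_pair U V W (f : U -> V) (g : U -> W) x :
  Coo_at f x -> Coo_at g x -> Coo_at (fun y => (f y, g y)) x.
Proof.
move=> [A [oA Ax fA]] [B [oB Bx gB]]; have oAB := openI oA oB.
exists (A `&` B); split => // k; apply: (Ck_pair oAB).
  by apply: Ck_sub (fA k) => y [].
by apply: Ck_sub (gB k) => y [].
Qed.

Lemma Coo_at_fst U V W (f : U -> (V * W)%type) x : Coo_at f x -> Coo_at (fst \o f) x.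
Proof.
have lin : linear (fst : V * W -> V) by move=> a u v.
move=> [A [oA Ax fA]]; exists A; split => // k.
by apply: (@Ck_lin _ _ _ _ k A f (mklin lin) oA _ (fA k)) => y; exact: cvg_fst.
Qed.

Lemma Coo_at_snd U V W (f : U -> (V * W)%type) x : Coo_at f x -> Coo_at (snd \o f) x.
Proof.
have lin : linear (snd : V * W -> W) by move=> a u v.
move=> [A [oA Ax fA]]; exists A; split => // k.
by apply: (@Ck_lin _ _ _ _ k A f (mklin lin) oA _ (fA k)) => y; exact: cvg_snd.
Qed.

End Coo_at.

(** * Manifolds and tangent maps *)

Section charts.
Context {R : realType}.

(** The local structure shared by manifolds, their products and the linear spaces [euclid V], on
    which the chart calculus rests. *)
Definition mfld (E : normedModType R) (X : charted_space E) : Prop :=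
  [/\ findim E, forall phi : chart E X, atlas phi -> is_chart phi,
    forall phi psi : chart E X, atlas phi -> atlas psi -> compatible_charts phi psi &
    forall x : X, atlas (chart_at x) /\ cdom (chart_at x) x].

Lemma is_manifold_mfld (n : nat) (X : charted_space 'rV[R]_n) : is_manifold X -> mfld X.
Proof. by move=> [_ _ H1 H2 H3]; split => //; exact: findim_rV. Qed.

Lemma euclid_mfld (V : normedModType R) : findim V -> mfld (euclid V).
Proof.
move=> fV; split => //.
- move=> phi ->; split => //=; first exact: openT.
  + by rewrite image_id; exact: openT.
  + by move=> x _; exact: cvg_id.
  + by move=> x _; exact: cvg_id.
- by move=> phi psi -> ->; split => k; exact: Ck_id.
Qed.

Section one_chart.
Context {E : normedModType R} {T : topologicalType} (phi : chart E T).
Hypothesis cphi : is_chart phi.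

Lemma chart_cbwdK x : cdom phi x -> cbwd phi (cfwd phi x) = x.
Proof. by have [_ _ H _ _] := cphi; exact: H. Qed.

Lemma chart_imgP y : (cfwd phi @` cdom phi) y ->
  cdom phi (cbwd phi y) /\ cfwd phi (cbwd phi y) = y.
Proof. by move=> [x dx <-]; rewrite chart_cbwdK. Qed.

Lemma chart_img x : cdom phi x -> (cfwd phi @` cdom phi) (cfwd phi x).
Proof. by move=> dx; exists x. Qed.

Lemma near_cbwd_at (P : set T) y : (cfwd phi @` cdom phi) y ->
  (\forall z \near cbwd phi y, P z) -> \forall z \near y, P (cbwd phi z).
Proof. by move=> iy H; have [_ _ _ _ c] := cphi; exact: c iy _ H. Qed.

Lemma near_cbwd (P : set T) x : cdom phi x -> (\forall z \near x, P z) ->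
  \forall y \near cfwd phi x, P (cbwd phi y).
Proof.
by move=> dx H; apply: near_cbwd_at; [exact: chart_img|rewrite chart_cbwdK].
Qed.

Lemma near_img y : (cfwd phi @` cdom phi) y ->
  \forall z \near y, (cfwd phi @` cdom phi) z.
Proof. by move=> iy; apply: open_near => //; have [] := cphi. Qed.

Lemma near_dom x : cdom phi x -> \forall z \near x, cdom phi z.
Proof. by move=> iy; apply: open_near => //; have [] := cphi. Qed.

Lemma near_cfwd (P : set E) x : cdom phi x -> (\forall y \near cfwd phi x, P y) ->
  \forall z \near x, P (cfwd phi z).
Proof. by move=> dx H; have [_ _ _ c _] := cphi; exact: c dx _ H. Qed.

Lemma open_chart_image (A : set T) : open A -> A `<=` cdom phi -> open (cfwd phi @` A).
Proof.
move=> oA Ad; apply: open_in_near => _ [x Ax <-]; have dx := Ad x Ax.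
have := near_cbwd dx (open_near oA Ax); have := near_img (chart_img dx).
apply: filterS2 => y iy Ay; exists (cbwd phi y) => //.
by have [] := chart_imgP iy.
Qed.
End one_chart.

Section change.
Context {E : normedModType R} (X : charted_space E) (mX : mfld X).
Implicit Types phi psi : chart E X.

Lemma atlas_chart phi : atlas phi -> is_chart phi.
Proof. by have [_ H _ _] := mX; exact: H. Qed.

Lemma atlas_at (x : X) : atlas (chart_at x).
Proof. by have [_ _ _ /(_ x)[]] := mX. Qed.

Lemma dom_at (x : X) : cdom (chart_at x) x.
Proof. by have [_ _ _ /(_ x)[]] := mX. Qed.

Lemma chart_at_is (x : X) : is_chart (chart_at x).
Proof. exact/atlas_chart/atlas_at. Qed.

Lemma mfld_findim : findim E. Proof. by case: mX. Qed.

Lemma open_overlap phi psi : atlas phi -> atlas psi -> open (overlap phi psi).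
Proof.
move=> /atlas_chart cphi /atlas_chart cpsi; apply: (open_chart_image cphi).
  by apply: openI; [have [] := cphi|have [] := cpsi].
by move=> x [].
Qed.

Lemma transition_Coo_at phi psi x : atlas phi -> atlas psi -> cdom phi x -> cdom psi x ->
  Coo_at (transition phi psi) (cfwd phi x).
Proof.
move=> aphi apsi dx dx'; have [_ _ /(_ _ _ aphi apsi)[H _] _] := mX.
by exists (overlap phi psi); split => //; [exact: open_overlap|exists x].
Qed.
End change.

End charts.

Section smooth_at.
Context {R : realType}.

Definition loc (E F : normedModType R) (X : charted_space E) (Y : charted_space F)
  (f : X -> Y) (x : X) : E -> F := cfwd (chart_at (f x)) \o f \o cbwd (chart_at x).

(** Continuity is a separate clause because chart maps are total functions: outside the domain of
    the chart at [f x], the expression [loc f x] takes meaningless values and could be smooth even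
    if [f] jumps. *)
Definition smat (E F : normedModType R) (X : charted_space E) (Y : charted_space F)
  (f : X -> Y) (x : X) : Prop :=
  {for x, continuous f} /\ Coo_at (loc f x) (cfwd (chart_at x) x).

(** Differentiability at one point, which is all that is known at first of curves built as
    limits. *)
Definition mdiff (E F : normedModType R) (X : charted_space E) (Y : charted_space F)
  (f : X -> Y) (x : X) : Prop :=
  {for x, continuous f} /\ differentiable (loc f x) (cfwd (chart_at x) x).

Section two.
Context {E F : normedModType R} (X : charted_space E) (Y : charted_space F).
Hypotheses (mX : mfld X) (mY : mfld Y).
Implicit Type f : X -> Y.

Lemma smat_mdiff f x : smat f x -> mdiff f x.
Proof. by move=> [c d]; split => //; exact: Coo_at_differentiable. Qed.

Lemma near_chart_change f x (phi phi' : chart E X) (psi psi' : chart F Y) :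
  {for x, continuous f} -> atlas phi -> atlas phi' -> atlas psi -> atlas psi' ->
  cdom phi x -> cdom phi' x -> cdom psi (f x) -> cdom psi' (f x) ->
  \forall y \near cfwd phi' x,
   (transition psi psi' \o (cfwd psi \o f \o cbwd phi) \o transition phi' phi) y =
   (cfwd psi' \o f \o cbwd phi') y.
Proof.
move=> cf a a' b b' d d' e e'.
have cp := atlas_chart mX a; have cp' := atlas_chart mX a'.
have cq := atlas_chart mY b; have cq' := atlas_chart mY b'.
have := near_cbwd cp' d' (near_dom cp d).
have := near_cbwd cp' d' (cf _ (near_dom cq e)).
apply: filterS2 => y h1 h2; rewrite /transition /=.
by rewrite (chart_cbwdK cp)// (chart_cbwdK cq).
Qed.

Lemma Coo_at_chart_change f x (phi phi' : chart E X) (psi psi' : chart F Y) :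
  {for x, continuous f} -> atlas phi -> atlas phi' -> atlas psi -> atlas psi' ->
  cdom phi x -> cdom phi' x -> cdom psi (f x) -> cdom psi' (f x) ->
  Coo_at (cfwd psi \o f \o cbwd phi) (cfwd phi x) ->
  Coo_at (cfwd psi' \o f \o cbwd phi') (cfwd phi' x).
Proof.
move=> cf a a' b b' d d' e e' H.
apply: Coo_at_eq (near_chart_change cf a a' b b' d d' e e') _.
have tx : transition phi' phi (cfwd phi' x) = cfwd phi x.
  by rewrite /transition /= (chart_cbwdK (atlas_chart mX a')).
apply: Coo_at_comp (mfld_findim mX) (transition_Coo_at mX a' a d' d) _.
apply: Coo_at_comp (mfld_findim mY) _ _; rewrite tx //=.
by rewrite (chart_cbwdK (atlas_chart mX a))//; exact: transition_Coo_at.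
Qed.

Lemma smatP f x (phi : chart E X) (psi : chart F Y) : atlas phi -> atlas psi ->
  cdom phi x -> cdom psi (f x) ->
  smat f x <-> {for x, continuous f} /\ Coo_at (cfwd psi \o f \o cbwd phi) (cfwd phi x).
Proof.
move=> a b d e; split => -[cf H]; split => //.
  by apply: Coo_at_chart_change cf _ _ _ _ _ _ _ _ H => //;
    do ?[exact: atlas_at|exact: dom_at].
by apply: Coo_at_chart_change cf _ _ _ _ _ _ _ _ H => //;
    do ?[exact: atlas_at|exact: dom_at].
Qed.

Lemma smat_eq f g x : (\forall y \near x, f y = g y) -> smat f x -> smat g x.
Proof.
move=> fg [cf H]; have fgx := nbhs_singleton fg; split.
  rewrite /prop_for /continuous_at -fgx.
  by apply: cvg_trans cf; exact: near_eq_cvg.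
rewrite /loc -fgx; apply: Coo_at_eq H.
have := near_cbwd (chart_at_is mX x) (dom_at mX x) fg.
by apply: filterS => y; rewrite /loc /= => ->.
Qed.

Lemma open_smooth_dom f (A : set X) (phi : chart E X) (psi : chart F Y) :
  atlas phi -> atlas psi -> open A -> (forall x, A x -> {for x, continuous f}) ->
  open (cfwd phi @` (A `&` cdom phi `&` (f @^-1` cdom psi))).
Proof.
move=> a b oA cf; have cp := atlas_chart mX a; have cq := atlas_chart mY b.
apply: (open_chart_image cp); last by move=> x [[]].
apply: open_preimage_on.
- by apply: openI => //; have [] := cp.
- by have [] := cq.
- by move=> x [Ax _]; exact: cf.
Qed.

Lemma smooth_on_smatP f (A : set X) : open A ->
  smooth_on A f <-> forall x, A x -> smat f x.
Proof.
move=> oA; split=> [[cf H] x Ax|H].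
  split; first exact: cf.
  have a := atlas_at mX x; have b := atlas_at mY (f x).
  exists (cfwd (chart_at x) @` (A `&` cdom (chart_at x) `&` (f @^-1` cdom (chart_at (f x))))).
  split; [exact: open_smooth_dom| |exact: H].
  by exists x => //; split; [split|] => //; exact: dom_at.
have cf x : A x -> {for x, continuous f} by move=> /H[].
split => // phi psi a b.
apply/Coo_openP; first exact: open_smooth_dom.
by move=> _ [x [[Ax dx] ex] <-]; have /(smatP a b dx ex)[] := H x Ax.
Qed.

Lemma smooth_smatP f : smooth f <-> forall x, smat f x.
Proof.
by rewrite /smooth smooth_on_smatP; [split=> H x; [exact: H|move=> _; exact: H]|exact: openT].
Qed.

End two.

Lemma smat_euclidP (V W : normedModType R) (f : V -> W) x : findim V -> findim W ->
  smat (f : euclid V -> euclid W) x <-> Coo_at f x.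
Proof.
by move=> fV fW; split => [[]//|H]; split => //; exact: Coo_at_continuous H.
Qed.

Section comp.
Context {E F K : normedModType R} (X : charted_space E) (Y : charted_space F)
  (Z : charted_space K).
Hypotheses (mX : mfld X) (mY : mfld Y) (mZ : mfld Z).

Lemma near_loc_comp (f : X -> Y) (g : Y -> Z) x : {for x, continuous f} ->
  \forall y \near cfwd (chart_at x) x, (loc g (f x) \o loc f x) y = loc (g \o f) x y.
Proof.
move=> cf; have n := cf _ (near_dom (chart_at_is mY (f x)) (dom_at mY (f x))).
have := near_cbwd (chart_at_is mX x) (dom_at mX x) n.
by apply: filterS => y h; rewrite /loc /= (chart_cbwdK (chart_at_is mY (f x))).
Qed.

Lemma loc_at (f : X -> Y) x : loc f x (cfwd (chart_at x) x) = cfwd (chart_at (f x)) (f x).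
Proof. by rewrite /loc /= (chart_cbwdK (chart_at_is mX x) (dom_at mX x)). Qed.

Lemma smat_comp (f : X -> Y) (g : Y -> Z) x : smat f x -> smat g (f x) -> smat (g \o f) x.
Proof.
move=> [cf Hf] [cg Hg]; split; first exact: continuous_comp.
apply: Coo_at_eq (near_loc_comp g cf) _.
by apply: Coo_at_comp (mfld_findim mY) Hf _; rewrite loc_at.
Qed.

Lemma mdiff_comp (f : X -> Y) (g : Y -> Z) x : mdiff f x -> mdiff g (f x) ->
  mdiff (g \o f) x /\
  forall v, tangent_map (g \o f) x v = tangent_map g (f x) (tangent_map f x v).
Proof.
move=> [cf Hf] [cg Hg]; have n := near_loc_comp g cf.
have Hg' : differentiable (loc g (f x)) (loc f x (cfwd (chart_at x) x)) by rewrite loc_at.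
have [d e] := near_eq_diff n (differentiable_comp Hf Hg').
split; first by split; first exact: continuous_comp.
move=> v; rewrite /tangent_map.
transitivity ('d (loc g (f x) \o loc f x) (cfwd (chart_at x) x) v).
  exact: (congr1 (fun h => h v) e).
transitivity (('d (loc g (f x)) (loc f x (cfwd (chart_at x) x)) \o 'd (loc f x) (cfwd (chart_at x) x)) v).
  exact: (congr1 (fun h => h v) (diff_comp Hf Hg')).
by rewrite /= loc_at.
Qed.

End comp.
End smooth_at.
Lemma continuous_pair_at (S T1 T2 : topologicalType) (f : S -> T1) (g : S -> T2) x :
  {for x, continuous f} -> {for x, continuous g} ->
  {for x, continuous (fun y => (f y, g y))}.
Proof.
move=> cf cg A [[P Q] /= [nP nQ] PQ].
have h1 : \forall y \near x, P (f y) := cf _ nP.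
have h2 : \forall y \near x, Q (g y) := cg _ nQ.
by rewrite /nbhs /=; apply: filterS2 h1 h2 => y Py Qy; exact: PQ.
Qed.

Section smooth_more.
Context {R : realType}.

Section linear.
Context {E F : normedModType R} (X : charted_space E) (Y : charted_space F) (f : X -> Y) (x : X).
Lemma tangent0 : tangent_map f x 0 = 0. Proof. exact: linear0. Qed.
Lemma tangentD u v : tangent_map f x (u + v) = tangent_map f x u + tangent_map f x v.
Proof. exact: linearD. Qed.
Lemma tangentN u : tangent_map f x (- u) = - tangent_map f x u.
Proof. exact: linearN. Qed.
Lemma tangentZ (a : R) u : tangent_map f x (a *: u) = a *: tangent_map f x u.
Proof. exact: linearZ. Qed.
Lemma tangent_linear : linear (tangent_map f x).
Proof. by move=> a u v; rewrite tangentD tangentZ. Qed.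
End linear.

Lemma mdiff_eq (E F : normedModType R) (X : charted_space E) (Y : charted_space F)
  (mX : mfld X) (f g : X -> Y) x : (\forall y \near x, f y = g y) -> mdiff f x ->
  mdiff g x /\ forall v, tangent_map g x v = tangent_map f x v.
Proof.
move=> fg [cf H]; have fgx := nbhs_singleton fg.
have n : \forall y \near cfwd (chart_at x) x, loc f x y = loc g x y.
  have := near_cbwd (chart_at_is mX x) (dom_at mX x) fg.
  by apply: filterS => y; rewrite /loc /= -fgx => ->.
have [d e] := near_eq_diff n H; split; last by move=> v; exact: (congr1 (fun h => h v) e).
split => //; rewrite /prop_for /continuous_at -fgx.
by apply: cvg_trans cf; exact: near_eq_cvg.
Qed.

Lemma smat_cst (E F : normedModType R) (X : charted_space E) (Y : charted_space F)
  (c : Y) (x : X) : smat (cst c : X -> Y) x.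
Proof.
split; first exact: cst_continuous.
exact: (Coo_at_cst (cfwd (chart_at c) c) (cfwd (chart_at x) x)).
Qed.

Lemma tangent_cst (E F : normedModType R) (X : charted_space E) (Y : charted_space F)
  (c : Y) (x : X) v : tangent_map (cst c : X -> Y) x v = 0.
Proof.
exact: (congr1 (fun h => h v) (@diff_cst _ _ _ (cfwd (chart_at c) c) (cfwd (chart_at x) x))).
Qed.

Section charts.
Context {E : normedModType R} (X : charted_space E) (mX : mfld X).

Lemma smat_id (x : X) : smat (id : X -> X) x.
Proof.
split; first exact: cvg_id.
have cx := chart_at_is mX x; have dx := dom_at mX x.
apply: Coo_at_eq (Coo_at_id _).
apply: filterS (near_img cx (chart_img dx)) => y iy.
by rewrite /loc /=; have [] := chart_imgP cx iy.
Qed.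

Lemma tangent_id (x : X) v : tangent_map (id : X -> X) x v = v.
Proof.
have cx := chart_at_is mX x; have dx := dom_at mX x.
have n : \forall y \near cfwd (chart_at x) x, id y = loc (id : X -> X) x y.
  apply: filterS (near_img cx (chart_img dx)) => y iy.
  by rewrite /loc /=; have [] := chart_imgP cx iy.
have [_ e] := near_eq_is_diff n (is_diff_id (cfwd (chart_at x) x)).
exact: (congr1 (fun h => h v) e).
Qed.

Lemma smat_cfwd (phi : chart E X) x : atlas phi -> cdom phi x ->
  smat (cfwd phi : X -> euclid E) x.
Proof.
move=> a d; have cx := chart_at_is mX x; have dx := dom_at mX x.
split; first by have [_ _ _ c _] := atlas_chart mX a; exact: c.
exact: transition_Coo_at (atlas_at mX x) a dx d.
Qed.

Lemma smat_cbwd (phi : chart E X) y : atlas phi -> (cfwd phi @` cdom phi) y ->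
  smat (cbwd phi : euclid E -> X) y.
Proof.
move=> a iy; have cp := atlas_chart mX a; have [d e] := chart_imgP cp iy.
split; first by have [_ _ _ _ c] := cp; exact: c.
have := transition_Coo_at mX a (atlas_at mX (cbwd phi y)) d (dom_at mX (cbwd phi y)).
by rewrite e.
Qed.

End charts.

Section products.
Context {E F : normedModType R} (X : charted_space E) (Y : charted_space F).
Hypotheses (mX : mfld X) (mY : mfld Y).

Lemma nbhs_pair (x : X) (y : Y) (P : set X) (Q : set Y) :
  nbhs x P -> nbhs y Q -> \forall p \near (x, y), P p.1 /\ Q p.2.
Proof. by move=> nP nQ; exists (P, Q). Qed.

Lemma prod_is_chart (phi : chart E X) (psi : chart F Y) :
  is_chart phi -> is_chart psi -> is_chart (prod_chart phi psi : chart _ (X * Y)%type).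
Proof.
move=> cp cq.
have img : cfwd (prod_chart phi psi) @` cdom (prod_chart phi psi) =
    (cfwd phi @` cdom phi) `*` (cfwd psi @` cdom psi).
  apply/seteqP; split => [_ [[x y] [/= dx dy] <-]|[_ _] [/= [x dx <-] [y dy <-]]].
    by split; [exists x|exists y].
  by exists (x, y).
split.
- by apply: open_in_near => -[x y] [/= dx dy]; apply: nbhs_pair; exact: near_dom.
- rewrite img; apply: open_in_near => -[u v] [/= iu iv].
  by exists ((cfwd phi @` cdom phi), (cfwd psi @` cdom psi)) => //; split; exact: near_img.
- by move=> [x y] [/= dx dy]; rewrite !chart_cbwdK.
- move=> [x y] [/= dx dy]; have [_ _ _ c _] := cp; have [_ _ _ c' _] := cq.
  apply: continuous_pair_at.
    by apply: continuous_comp; [exact: cvg_fst|exact: c].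
  by apply: continuous_comp; [exact: cvg_snd|exact: c'].
- rewrite img => -[u v] [/= iu iv]; have [_ _ _ _ c] := cp; have [_ _ _ _ c'] := cq.
  apply: continuous_pair_at.
    by apply: continuous_comp; [exact: cvg_fst|exact: c].
  by apply: continuous_comp; [exact: cvg_snd|exact: c'].
Qed.

Lemma prod_mfld : mfld (prod_space X Y).
Proof.
have half (phi phi' : chart E X) (psi psi' : chart F Y) :
    atlas phi -> atlas phi' -> atlas psi -> atlas psi' ->
    Coo (overlap (prod_chart phi psi) (prod_chart phi' psi'))
     (transition (prod_chart phi psi) (prod_chart phi' psi')).
  move=> a a' b b'.
  have P1 := prod_is_chart (atlas_chart mX a) (atlas_chart mY b).
  have P2 := prod_is_chart (atlas_chart mX a') (atlas_chart mY b').
  have oo : open (overlap (prod_chart phi psi : chart _ (X * Y)%type) (prod_chart phi' psi')).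
    apply: (open_chart_image P1); last by move=> x [].
    by apply: openI; [have [] := P1|have [] := P2].
  apply/Coo_openP => // _ [[x y] [[/= dx dy] [/= dx' dy']] <-] /=.
  have t1 := transition_Coo_at mX a a' dx dx'.
  have t2 := transition_Coo_at mY b b' dy dy'.
  apply: (@Coo_at_pair _ _ _ _ (fun p => transition phi phi' p.1) (fun p => transition psi psi' p.2)).
    apply: (@Coo_at_comp _ _ _ _ fst) => //; first exact: mfld_findim mX.
    exact/Coo_at_fst/Coo_at_id.
  apply: (@Coo_at_comp _ _ _ _ snd) => //; first exact: mfld_findim mY.
  exact/Coo_at_snd/Coo_at_id.
split.
- by apply: findim_prod; [exact: mfld_findim mX|exact: mfld_findim mY].
- by move=> _ [phi [psi [a b ->]]]; apply: prod_is_chart; exact: atlas_chart.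
- by move=> _ _ [phi [psi [a b ->]]] [phi' [psi' [a' b' ->]]]; split; exact: half.
- move=> [x y] /=; split; last by split => /=; exact: dom_at.
  by exists (chart_at x), (chart_at y); split => //; exact: atlas_at.
Qed.

Lemma smat_fst p : smat (fst : prod_space X Y -> X) p.
Proof.
case: p => x y; split; first exact: cvg_fst.
have cx := chart_at_is mX x; have dx := dom_at mX x.
apply: (@Coo_at_eq _ _ _ fst); last exact/Coo_at_fst/Coo_at_id.
have n := near_img cx (chart_img dx).
have : \forall q \near (cfwd (chart_at x) x, cfwd (chart_at y) y),
   (cfwd (chart_at x) @` cdom (chart_at x)) q.1 by exact: (cvg_fst n).
by apply: filterS => -[u v] /= iu; rewrite /loc /=; have [] := chart_imgP cx iu.
Qed.

Lemma smat_snd p : smat (snd : prod_space X Y -> Y) p.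
Proof.
case: p => x y; split; first exact: cvg_snd.
have cx := chart_at_is mY y; have dx := dom_at mY y.
apply: (@Coo_at_eq _ _ _ snd); last exact/Coo_at_snd/Coo_at_id.
have n := near_img cx (chart_img dx).
have : \forall q \near (cfwd (chart_at x) x, cfwd (chart_at y) y),
   (cfwd (chart_at y) @` cdom (chart_at y)) q.2 by exact: (cvg_snd n).
by apply: filterS => -[u v] /= iu; rewrite /loc /=; have [] := chart_imgP cx iu.
Qed.

Context {K : normedModType R} (Z : charted_space K).

Lemma smat_pair (f : Z -> X) (g : Z -> Y) z : smat f z -> smat g z ->
  smat ((fun z => (f z, g z)) : Z -> prod_space X Y) z.
Proof.
move=> [cf Hf] [cg Hg]; split; first exact: continuous_pair_at.
exact: (Coo_at_pair Hf Hg).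
Qed.

Lemma mdiff_pair (f : Z -> X) (g : Z -> Y) z : mdiff f z -> mdiff g z ->
  mdiff ((fun z => (f z, g z)) : Z -> prod_space X Y) z /\
  forall v, tangent_map ((fun z => (f z, g z)) : Z -> prod_space X Y) z v =
    (tangent_map f z v, tangent_map g z v).
Proof.
move=> [cf Hf] [cg Hg]; split.
  split; first exact: continuous_pair_at.
  exact: (differentiable_pair Hf Hg).
move=> v; exact: (congr1 (fun h => h v) (diff_pair Hf Hg)).
Qed.

End products.

Lemma tangent_comp (E F K : normedModType R) (X : charted_space E) (Y : charted_space F)
  (Z : charted_space K) (mX : mfld X) (mY : mfld Y) (f : X -> Y) (g : Y -> Z) x v :
  smat f x -> smat g (f x) ->
  tangent_map (g \o f) x v = tangent_map g (f x) (tangent_map f x v).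
Proof.
by move=> /smat_mdiff hf /smat_mdiff hg; have [_ ->] := mdiff_comp mX mY hf hg.
Qed.

End smooth_more.

(** * Lie groups and one-parameter subgroups *)

Section curves.
Context {R : realType}.

Lemma locally_constant_R (T : Type) (f : R -> T) :
  (forall t, \forall s \near t, f s = f t) -> forall t, f t = f 0.
Proof.
move=> H; pose A := [set t | f t = f 0].
have oA : open A by apply: open_in_near => t At; apply: filterS (H t) => s; rewrite /A /= => ->.
have cA : open (~` A).
  apply: open_in_near => t At; apply: filterS (H t) => s e h; apply: At.
  by rewrite /A /= -e.
have cT : connected [set: R] by apply/connected_intervalP => x y _ _ z _.
suff AT : A = setT by move=> t; have : A t by rewrite AT.
apply: cT.
- by exists 0.
- by exists A => //; rewrite setTI.
- by exists A; [rewrite -[A]setCK; exact: open_closedC|rewrite setTI].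
Qed.

Lemma near_diff_zero_constant n (f : R -> 'rV[R]_n) t :
  (\forall s \near t, is_diff (s : R^o) (f : R^o -> _) (fun=> 0)) ->
  \forall s \near t, f s = f t.
Proof.
move=> /nbhs_ballP[r /= r0 H]; apply/nbhs_ballP; exists r => // s bs.
have lin : linear (fun _ : R^o => 0 : 'rV[R]_n).
  by move=> a u v; rewrite scaler0 addr0.
have := @mvt_rV R R^o n f t s (mklin lin) 0.
rewrite /= subr0 => h; apply/eqP; rewrite -subr_eq0 -normr_le0; apply: h => u u01.
have [d e] := H _ (@ball_segment R R^o t t s r u (ballxx t r0) bs u01); split; first exact: d.
by rewrite e subr0 normr0.
Qed.

(** In a chart, zero velocity gives local constancy by the mean value inequality; connectedness of
    the line does the rest. *)
Lemma mdiff_curve_constant n (X : charted_space 'rV[R]_n) (mX : mfld X) (g : R -> X) :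
  (forall t, mdiff (g : euclid R^o -> X) t) ->
  (forall t, tangent_map (g : euclid R^o -> X) t 1 = 0) -> forall t, g t = g 0.
Proof.
move=> dg tg; have mR : mfld (euclid R^o) by exact/euclid_mfld/findim_Ro.
apply: locally_constant_R => t; set phi := chart_at (g t).
have cp := chart_at_is mX (g t); have dp := dom_at mX (g t).
have n1 : \forall s \near t, cdom phi (g s).
  by have [c _] := dg t; exact: c _ (near_dom cp dp).
have n2 : \forall s \near t, is_diff (s : R^o) (cfwd phi \o g : R^o -> _) (fun=> 0).
  apply: filterS n1 => s ds.
  have m1 := smat_mdiff (smat_cfwd mX (atlas_at mX (g t)) ds).
  have [[_ d] T] := mdiff_comp mR mX (dg s) m1.
  apply: DiffDef; first exact: d.
  apply/funext => v.
  have := T 1; rewrite tg tangent0 => T1.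
  have -> : v = (v : R) *: (1 : R^o) by rewrite /GRing.scale /= mulr1.
  rewrite linearZ /=; apply/eqP; rewrite scaler_eq0; apply/orP; right; apply/eqP; exact: T1.
have := near_diff_zero_constant n2; apply: filterS2 n1 => s ds /= e.
by rewrite -(chart_cbwdK cp dp) -(chart_cbwdK cp ds) e.
Qed.

End curves.

Section real_curves.
Context {R : realType}.
Let mR : mfld (euclid R^o) := euclid_mfld (@findim_Ro R).

Lemma smat_real_affine (a b t : R) :
  smat ((fun s : R => a * s + b) : euclid R^o -> euclid R^o) t.
Proof.
apply/smat_euclidP; [exact: findim_Ro|exact: findim_Ro|].
exists setT; split => //; first exact: openT.
move=> k; apply: (@CkD _ _ _ k setT (fun s : R^o => a * s : R^o) (cst b)); [exact: openT| |exact: Ck_cst].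
by apply: CkM; [exact: openT|exact: Ck_cst|exact: Ck_id].
Qed.

Lemma tangent_real_affine (a b t : R) :
  tangent_map ((fun s : R => a * s + b) : euclid R^o -> euclid R^o) t 1 = a.
Proof.
have lin : linear (fun s : R^o => a * s : R^o).
  by move=> c u v; rewrite mulrDr /GRing.scale /= mulrCA.
have D : is_diff (t : R^o) (fun s : R^o => a * s + b : R^o) (mklin lin).
  apply/is_diff_epsP; split => [|e e0]; first exact/findim_continuous/findim_Ro.
  near=> s; rewrite /= [a * s + b]addrC [a * t + b]addrC opprD addrACA subrr add0r.
  by rewrite mulrBr subrr normr0 mulr_ge0// ltW.
have [_ e] := D; transitivity (mklin lin (1 : R^o)); first exact: (congr1 (fun h => h (1 : R^o)) e).
by rewrite /= mulr1.
Unshelve. all: by end_near. Qed.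

(** Near [u] the curve [d] is the image under [h] of [c] near 0. In this way a functional equation
    carries differentiability at 0 to all times. *)
Lemma curve_translate (E F : normedModType R) (X : charted_space E) (Y : charted_space F)
  (mX : mfld X) (c : R -> X) (h : X -> Y) (d : R -> Y) (u : R) :
  mdiff (c : euclid R^o -> X) 0 -> smat h (c 0) -> (forall s, d s = h (c (s - u))) ->
  mdiff (d : euclid R^o -> Y) u /\
  tangent_map (d : euclid R^o -> Y) u 1 =
    tangent_map h (c 0) (tangent_map (c : euclid R^o -> X) 0 1).
Proof.
move=> dc sh E1.
have s1 := smat_mdiff (smat_real_affine 1 (- u) u).
have u0 : 1 * u + - u = 0 by rewrite mul1r subrr.
have dc' : mdiff (c : euclid R^o -> X) (1 * u + - u) by rewrite u0.
have [d1 t1] := mdiff_comp mR mR s1 dc'.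
have s2 : mdiff h ((c \o (fun s : R => 1 * s + - u)) u) by rewrite /= u0; exact: smat_mdiff.
have [d2 t2] := mdiff_comp mR mX d1 s2.
have n : \forall s \near (u : euclid R^o), (h \o (c \o (fun s : R => 1 * s + - u))) s = d s.
  by apply: filterE => s /=; rewrite mul1r E1.
have [d3 t3] := mdiff_eq mR n d2; split; first exact: d3.
by rewrite t3 t2 t1 tangent_real_affine /= u0.
Qed.
End real_curves.

Section lie.
Context {R : realType}.

(** The common consequences of [is_lie_group] and [is_complex_lie_group], in pointwise form. *)
Definition lieg (E : normedModType R) (G : lie_space E) : Prop :=
  [/\ mfld G, group_axioms G,
      forall p, smat ((fun p => lie_mul p.1 p.2) : prod_space G G -> G) p &
      forall g, smat (@lie_inv _ _ G) g].

Lemma lie_group_lieg n (G : lie_space 'rV[R]_n) : is_lie_group G -> lieg G.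
Proof.
move=> [/is_manifold_mfld mG aG sm si]; split => //.
  by apply/smooth_smatP => //; exact: prod_mfld.
exact/smooth_smatP.
Qed.

Lemma complex_lie_group_lieg n (G : lie_space 'rV[R]_(n + n)) :
  is_complex_lie_group G -> lieg G.
Proof.
move=> [[/is_manifold_mfld mG _] aG [sm _] [si _]]; split => //.
  by apply/smooth_smatP => //; exact: prod_mfld.
exact/smooth_smatP.
Qed.

Section group.
Context {E : normedModType R} (G : lie_space E) (LG : lieg G).
Local Notation "x ** y" := (lie_mul x y) (at level 40, left associativity).
Local Notation one := (lie_one G).
Local Notation inv := (@lie_inv _ _ G).

Lemma lie_mfld : mfld G. Proof. by case: LG. Qed.
Lemma lmulA (x y z : G) : x ** (y ** z) = x ** y ** z.
Proof. by case: LG => _ [H _ _] _ _; exact: H. Qed.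
Lemma lmul1 (x : G) : one ** x = x.
Proof. by case: LG => _ [_ H _] _ _; exact: H. Qed.
Lemma lmulV (x : G) : inv x ** x = one.
Proof. by case: LG => _ [_ _ H] _ _; exact: H. Qed.
Lemma lmulrV (x : G) : x ** inv x = one.
Proof.
by rewrite -[LHS]lmul1 -{1}(lmulV (inv x)) -lmulA [inv x ** _]lmulA lmulV lmul1 lmulV.
Qed.
Lemma lmulr1 (x : G) : x ** one = x.
Proof. by rewrite -(lmulV x) lmulA lmulrV lmul1. Qed.
Lemma lmul_injl (x y z : G) : x ** y = x ** z -> y = z.
Proof. by move=> e; rewrite -[y]lmul1 -[z]lmul1 -(lmulV x) -!lmulA e. Qed.
Lemma lmul_injr (x y z : G) : y ** x = z ** x -> y = z.
Proof. by move=> e; rewrite -[y]lmulr1 -[z]lmulr1 -(lmulrV x) !lmulA e. Qed.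
Lemma linvK (x : G) : inv (inv x) = x.
Proof. by apply: (@lmul_injl (inv x)); rewrite lmulrV lmulV. Qed.
Lemma linvM (x y : G) : inv (x ** y) = inv y ** inv x.
Proof.
apply: (@lmul_injl (x ** y)); rewrite lmulrV lmulA -[x ** y ** _]lmulA lmulrV.
by rewrite lmulr1 lmulrV.
Qed.
Lemma linv1 : inv one = one.
Proof. by rewrite -[LHS]lmul1 lmulrV. Qed.
Lemma smat_lmul (F : normedModType R) (X : charted_space F) (mX : mfld X)
  (f g : X -> G) x : smat f x -> smat g x -> smat (fun x => f x ** g x) x.
Proof.
move=> sf sg; have := smat_pair sf sg => sp.
case: LG => _ _ sm _.
exact: (smat_comp mX (prod_mfld lie_mfld lie_mfld) sp (sm _)).
Qed.

Lemma smat_linv (F : normedModType R) (X : charted_space F) (mX : mfld X)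
  (f : X -> G) x : smat f x -> smat (fun x => inv (f x)) x.
Proof.
by move=> sf; case: LG => _ _ _ si; exact: (smat_comp mX lie_mfld sf (si _)).
Qed.

(** On each of the two summands [(u, 0)] and [(0, v)], multiplication restricts to the identity of
    the group. *)
Lemma tangent_lmul1 (u v : E) :
  tangent_map ((fun p => p.1 ** p.2) : prod_space G G -> G) (one, one) (u, v) = u + v.
Proof.
have mG := lie_mfld; have mGG := prod_mfld mG mG; case: LG => _ _ sm _.
have -> : (u, v) = (u, 0) + (0, v) by congr (_, _); rewrite /= ?addr0 ?add0r.
rewrite tangentD; congr (_ + _).
  have [_ T] := mdiff_pair (smat_mdiff (smat_id mG one)) (smat_mdiff (smat_cst one one)).
  have := tangent_comp mG mGG u (smat_pair (smat_id mG one) (smat_cst one one)) (sm (one, one)).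
  rewrite T tangent_id// tangent_cst => <-.
  rewrite (_ : _ \o _ = id) ?tangent_id//.
  by apply/funext => x /=; rewrite lmulr1.
have [_ T] := mdiff_pair (smat_mdiff (smat_cst one one)) (smat_mdiff (smat_id mG one)).
have := tangent_comp mG mGG v (smat_pair (smat_cst one one) (smat_id mG one)) (sm (one, one)).
rewrite T tangent_id// tangent_cst => <-.
rewrite (_ : _ \o _ = id) ?tangent_id//.
by apply/funext => x /=; rewrite lmul1.
Qed.

End group.
End lie.
Section one_param.
Context {R : realType} {n : nat} (G : lie_space 'rV[R]_n) (LG : lieg G).
Local Notation "x ** y" := (lie_mul x y) (at level 40, left associativity).
Local Notation one := (lie_one G).
Local Notation inv := (@lie_inv _ _ G).
Let mR : mfld (euclid R^o) := euclid_mfld (@findim_Ro R).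
Let mG : mfld G := lie_mfld LG.

(* A weakening of [one_parameter_subgroup], as produced by limits of powers. *)
Definition one_param_diff (xi : 'rV[R]_n) (g : R -> G) :=
  [/\ forall s t, g (s + t) = g s ** g t, mdiff (g : euclid R^o -> G) 0 &
      tangent_map (g : euclid R^o -> G) 0 1 = xi].

Lemma one_parameter_subgroup_diff xi (g : R^o -> G) :
  one_parameter_subgroup xi g -> one_param_diff xi g.
Proof.
by move=> [sg hg tg]; split => //; apply: smat_mdiff; exact: ((smooth_smatP mR mG g).1 sg).
Qed.

Lemma one_param0 xi g : one_param_diff xi g -> g 0 = one.
Proof.
move=> [hg _ _]; have := hg 0 0; rewrite addr0 => e.
by apply: (@lmul_injl _ _ _ LG (g 0)); rewrite -e lmulr1.
Qed.

Lemma one_paramN xi g t : one_param_diff xi g -> g (- t) = inv (g t).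
Proof.
move=> H; apply: (@lmul_injl _ _ _ LG (g t)); rewrite lmulrV//.
by have [hg _ _] := H; rewrite -hg subrr; exact: one_param0 H.
Qed.

(** The curve [e s = g1 s g2 (- s)] has zero velocity at 0, and [e (s + u) = g1 u e s g2 (- u)]
    transports this to every time; so [e] is constant. *)
Lemma one_param_unique xi g1 g2 : one_param_diff xi g1 -> one_param_diff xi g2 ->
  forall t, g1 t = g2 t.
Proof.
move=> H1 H2 t; have [h1 d1 t1] := H1; have [h2 d2 t2] := H2.
pose e s := g1 s ** g2 (- s).
have gm1 : mdiff ((fun s => g2 (- s)) : euclid R^o -> G) 0 /\
    tangent_map ((fun s => g2 (- s)) : euclid R^o -> G) 0 1 = - xi.
  have s1 := smat_mdiff (@smat_real_affine R (-1) 0 0).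
  have d0 : mdiff (g2 : euclid R^o -> G) (-1 * 0 + 0) by rewrite mulr0 addr0.
  have [da ta] := mdiff_comp mR mR s1 d0.
  have [db tb] : mdiff ((fun s => g2 (- s)) : euclid R^o -> G) 0 /\
    forall v, tangent_map ((fun s => g2 (- s)) : euclid R^o -> G) 0 v =
     tangent_map (g2 \o (fun s => -1 * s + 0) : euclid R^o -> G) 0 v.
    by apply: (mdiff_eq mR) da; apply: filterE => s /=; rewrite mulN1r addr0.
  split=> //; rewrite tb ta tangent_real_affine mulr0 addr0.
  by rewrite -t2 -tangentN; congr (tangent_map _ _ _); rewrite mulr1.
have [gm2 gm3] := gm1.
have [de te] : mdiff (e : euclid R^o -> G) 0 /\ tangent_map (e : euclid R^o -> G) 0 1 = 0.
  have [dp tp] := mdiff_pair d1 gm2.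
  have [_ _ sm _] := LG.
  have [dm tm] := mdiff_comp mR (prod_mfld mG mG) dp (smat_mdiff (sm _)).
  split; first exact: dm.
  rewrite -[LHS]/(tangent_map ((fun p : prod_space G G => p.1 ** p.2) \o (fun s => (g1 s, g2 (- s)))
     : euclid R^o -> G) 0 1) tm tp t1 gm3 /= oppr0 (one_param0 H1) (one_param0 H2).
  by rewrite tangent_lmul1// subrr.
have eD s u : e (s + u) = g1 u ** e s ** g2 (- u).
  by rewrite /e addrC h1 [u + s]addrC opprD h2 !lmulA.
have ce : forall s, e s = e 0.
  have T u : mdiff (e : euclid R^o -> G) u /\ tangent_map (e : euclid R^o -> G) u 1 = 0.
    have sh : smat (fun h => g1 u ** h ** g2 (- u)) (e 0).
      apply: (smat_lmul LG mG); last exact: smat_cst.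
      by apply: (smat_lmul LG mG); [exact: smat_cst|exact: smat_id].
    have [|d ->] := curve_translate (d := e) (u := u) mG de sh; last by split; rewrite // te tangent0.
    by move=> s; rewrite -eD subrK.
  by apply: (mdiff_curve_constant mG) => u; have [] := T u.
have := ce t; rewrite /e oppr0 (one_param0 H1) (one_param0 H2) lmul1// (one_paramN t H2) => E.
by rewrite -[g1 t](lmulr1 LG) -(lmulV LG (g2 t)) lmulA// E lmul1.
Qed.
End one_param.

Section exponential.
Context {R : realType} {n : nat} (G : lie_space 'rV[R]_n) (LG : lieg G).
Let mR : mfld (euclid R^o) := euclid_mfld (@findim_Ro R).
Let mG : mfld G := lie_mfld LG.

Lemma one_parameter_subgroup0 : one_parameter_subgroup 0 (fun _ : R^o => lie_one G).
Proof.
split; last exact: tangent_cst.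
  by apply/(smooth_smatP mR mG) => t; exact: smat_cst.
by move=> s t; rewrite (lmul1 LG).
Qed.

Lemma one_parameter_subgroupZ xi (g : R^o -> G) (t : R) : one_parameter_subgroup xi g ->
  one_parameter_subgroup (t *: xi) (fun s => g (t * s)).
Proof.
move=> [sg hg tg]; have sa s := smat_real_affine t 0 s.
have sg' := (smooth_smatP mR mG g).1 sg.
have e : (fun s => g (t * s)) = g \o (fun s : R => t * s + 0) :> (euclid R^o -> G).
  by apply/funext => s /=; rewrite addr0.
split; rewrite ?e.
- by apply/(smooth_smatP mR mG) => s; exact: (smat_comp mR mR (sa s) (sg' _)).
- by move=> u v /=; rewrite mulrDr hg.
- rewrite (tangent_comp mR mR 1 (sa 0) (sg' _)) tangent_real_affine -tg -tangentZ.
  by rewrite mulr0 addr0 /GRing.scale /= mulr1.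
Qed.

(** [lie_exp] chooses an unspecified one-parameter subgroup; uniqueness makes the choice
    immaterial. *)
Lemma lie_exp_eq xi (g : R^o -> G) : one_parameter_subgroup xi g -> lie_exp G xi = g 1.
Proof.
move=> H; rewrite /lie_exp; case: xgetP => [_ _ [g' H' <-]|/(_ (g 1))]; last by case; exists g.
exact: (one_param_unique LG (one_parameter_subgroup_diff LG H') (one_parameter_subgroup_diff LG H)).
Qed.

Lemma lie_expZ xi (g : R^o -> G) t : one_parameter_subgroup xi g -> lie_exp G (t *: xi) = g t.
Proof. by move=> /(one_parameter_subgroupZ t)/lie_exp_eq ->; rewrite mulr1. Qed.

Lemma lie_exp0 : lie_exp G 0 = lie_one G.
Proof. exact: (lie_exp_eq one_parameter_subgroup0). Qed.

End exponential.

Section complexification.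
Context {R : realType} {k d : nat} (U : lie_space 'rV[R]_k) (H : lie_space 'rV[R]_(d + d))
  (c : U -> H) (hc : is_complexification c) (hU : is_lie_group U).

Lemma complexification_lieg : lieg H.
Proof. by have [? _ _ _] := hc; exact: complex_lie_group_lieg. Qed.

Lemma lie_hom1 : c (lie_one U) = lie_one H.
Proof.
have [_ [[_ h] _] _ _] := hc; have LU := lie_group_lieg hU; have LH := complexification_lieg.
apply: (@lmul_injl _ _ _ LH (c (lie_one U))).
by rewrite -h (lmul1 LU) (lmulr1 LH).
Qed.

Lemma Jmul0 (m : nat) : Jmul (0 : 'rV[R]_(m + m)) = 0.
Proof. by apply/rowP => i; rewrite mxE; case: splitP => j _; rewrite !mxE ?oppr0. Qed.

(* [lie_exp] returns the identity when there is no one-parameter subgroup, and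
   this would contradict the injectivity of the Cartan decomposition. *)
Lemma complexification_one_param (xi : 'rV[R]_k) : exists g : R^o -> H,
  one_parameter_subgroup (Jmul (lie_diff c xi)) g.
Proof.
have LH := complexification_lieg.
apply: contrapT => NH.
have e1 : lie_exp H (Jmul (lie_diff c xi)) = lie_one H.
  by rewrite /lie_exp; case: xgetP => [y _ [g Hg _]|//]; case: NH; exists g.
have e0 : Jmul (lie_diff c 0) = 0 by rewrite /lie_diff tangent0 Jmul0.
have e2 : lie_exp H (Jmul (lie_diff c 0)) = lie_one H by rewrite e0 lie_exp0.
have [_ _ _ [_ [inv [_ /can_inj inj _]]]] := hc.
have := inj (lie_one U, xi) (lie_one U, 0); rewrite /= e1 e2 => /(_ erefl) [xi0].
by apply: NH; exists (fun=> lie_one H); rewrite xi0 e0; exact: one_parameter_subgroup0.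
Qed.

End complexification.

Lemma near_ball_right {R : realType} (V : normedModType R) (x : V) (P : set V) :
  (\forall y \near x, P y) -> \forall r \near 0^'+, forall y, ball x r y -> P y.
Proof.
move=> /nbhs_ballP[r /= r0 H]; near=> q => y xy; apply: H; apply: le_ball xy.
by near: q; exact: nbhs_right_le.
Unshelve. all: by end_near. Qed.

(** * Powers, and one-parameter subgroups of a compact group as their limits *)

Section integer_powers.
Context {R : realType} {E : normedModType R} (G : lie_space E) (LG : lieg G).
Local Notation "x ** y" := (lie_mul x y) (at level 40, left associativity).
Local Notation one := (lie_one G).
Local Notation inv := (@lie_inv _ _ G).

Definition npow (g : G) (k : nat) : G := iter k (fun h => h ** g) one.

Definition zpow (g : G) (z : int) : G :=
  match z with Posz k => npow g k | Negz k => inv (npow g k.+1) end.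

Lemma npowSl g k : npow g k.+1 = g ** npow g k.
Proof.
elim: k => [|k IH]; first by rewrite /npow /= lmul1// lmulr1.
by rewrite {1}/npow iterS -/(npow g k.+1) IH -(lmulA LG) -[npow g k ** g]/(npow g k.+1) IH.
Qed.

Lemma zpowS g z : zpow g (z + 1) = zpow g z ** g.
Proof.
case: z => [k|[|k]].
- by rewrite -[Posz k + 1]/(Posz (k + 1)%N) addn1.
- by rewrite /= /npow /= lmul1// lmulV.
- have -> : Negz k.+1 + 1 = Negz k by rewrite !NegzE -addn1 PoszD opprD subrK.
  by rewrite /zpow (npowSl g k.+1) (linvM LG) -(lmulA LG) (lmulV LG) (lmulr1 LG).
Qed.

Lemma zpowD g y z : zpow g (y + z) = zpow g y ** zpow g z.
Proof.
elim/int_rect: z => [|k IH|k IH]; first by rewrite addr0 /= /npow /= lmulr1.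
  by rewrite -addn1 PoszD addrA zpowS IH -lmulA// -zpowS.
apply: (@lmul_injr _ _ _ LG g); rewrite -zpowS -lmulA// -zpowS.
by rewrite -addn1 PoszD opprD addrA !subrK.
Qed.

End integer_powers.

Section compact_one_param.
Context {R : realType} {n : nat} (G : lie_space 'rV[R]_n) (LG : lieg G).
Hypotheses (cG : compact [set: G]) (hG : hausdorff_space G).
Local Notation "x ** y" := (lie_mul x y) (at level 40, left associativity).
Local Notation one := (lie_one G).
Local Notation inv := (@lie_inv _ _ G).
Let mR : mfld (euclid R^o) := euclid_mfld (@findim_Ro R).
Let mG : mfld G := lie_mfld LG.
Let chi := chart_at one.
Let e0 := cfwd chi one.
Let cc : is_chart chi := chart_at_is mG one.
Let d1 : cdom chi one := dom_at mG one.
Let ac : atlas chi := atlas_at mG one.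

Lemma lmul_continuous (T : Type) (F : set_system T) (FF : Filter F)
  (f g : T -> G) a b : f @ F --> a -> g @ F --> b -> (fun t => f t ** g t) @ F --> a ** b.
Proof.
move=> fa gb; have [_ _ sm _] := LG; have [cm _] := sm (a, b).
have h : (fun t => (f t, g t)) @ F --> (a, b) by exact: cvg_pair.
by move=> P nP; exact: h (cm P nP).
Qed.

(** Strict differentiability of the multiplication in the chart, applied to the points [(u, e0)] and
    [(u, v)]: in the second variable its differential at the identity is the identity, so
    multiplication by the point of coordinate [v] adds [v - e0] up to a small relative error. *)
Lemma near_one_mul (e : R) : 0 < e -> \forall r \near 0^'+,
  (forall u v, ball e0 r u -> ball e0 r v ->
   [/\ (cfwd chi @` cdom chi) u, cdom chi (cbwd chi u ** cbwd chi v) &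
    `|cfwd chi (cbwd chi u ** cbwd chi v) - u - (v - e0)| <= e * `|v - e0|]).
Proof.
move=> ep; pose f (p : 'rV[R]_n * 'rV[R]_n) : 'rV[R]_n := cfwd chi (cbwd chi p.1 ** cbwd chi p.2).
have [_ _ sm _] := LG.
have mul0 : one ** one = one by rewrite lmul1.
have cf : Coo_at f (e0, e0).
  have s := sm (one, one); have mGG := prod_mfld mG mG.
  have ap : atlas (prod_chart chi chi : chart _ (prod_space G G)) by exists chi, chi.
  by have /(smatP mGG mG ap ac)[] := s; rewrite ?mul0//=.
have near1 (P : set G) (F : G * G -> G) : {for (one, one), continuous F} ->
    (\forall g \near F (one, one), P g) ->
    \forall r \near 0^'+, forall u v, ball e0 r u -> ball e0 r v -> P (F (cbwd chi u, cbwd chi v)).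
  move=> cF nP; have : \forall p \near (one, one), P (F p) := cF _ nP.
  move=> [[A B] /= [nA nB] AB].
  have hA := near_cbwd cc d1 nA; have hB := near_cbwd cc d1 nB.
  have := near_ball_right hA; have := near_ball_right hB.
  apply: filterS2 => r rB rA u v bu bv; apply: AB; split => /=; [exact: rA|exact: rB].
have [A [oA A0 fA]] := cf.
have fd : findim ('rV[R]_n * 'rV[R]_n)%type by apply: findim_prod; exact: findim_rV.
have n1 := C1_strict fd oA A0 (fA 1%N) ep.
have n2 : \forall r \near 0^'+, forall u v, ball e0 r u -> ball e0 r v ->
    cdom chi (cbwd chi u ** cbwd chi v).
  apply: (near1 (cdom chi) (fun p => p.1 ** p.2)); first by have [] := sm (one, one).
  by rewrite /= mul0; exact: near_dom.
have n3 : \forall r \near 0^'+, forall u, ball e0 r u -> (cfwd chi @` cdom chi) u.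
  exact: near_ball_right (near_img cc (chart_img d1)).
have df : differentiable f (e0, e0) by exact: Coo_at_differentiable.
have dE w : 'd f (e0, e0) (0, w) = w.
  have E1 : \forall v \near e0, id v = (f \o (fun v => (e0, v))) v.
    apply: filterS (near_img cc (chart_img d1)) => v /(chart_imgP cc)[_ h].
    by rewrite /f /= (chart_cbwdK cc d1) lmul1// h.
  have [_ h1] := near_eq_is_diff E1 (is_diff_id e0).
  have dp : differentiable (fun v : 'rV[R]_n => (e0, v)) e0 by exact: differentiable_pair.
  have h2 := diff_comp dp df.
  have h3 : 'd (fun v : 'rV[R]_n => (e0, v)) e0 w = (0, w).
    have [d_id e_id] := is_diff_id e0.
    rewrite (congr1 (fun h => h w) (diff_pair (differentiable_cst e0 e0) d_id)) /=.
    congr (_, _); last exact: (congr1 (fun h => h w) e_id).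
    exact: (congr1 (fun h => h w) (diff_cst e0 e0)).
  rewrite -h3; transitivity ('d (f \o (fun v => (e0, v))) e0 w).
    exact: esym (congr1 (fun h => h w) h2).
  exact: (congr1 (fun h => h w) h1).
near=> r => u v bu bv.
have h1 : forall y z, ball (e0, e0) r y -> ball (e0, e0) r z ->
  [/\ A y, differentiable f y, forall v, `|'d f y v - 'd f (e0, e0) v| <= e * `|v| &
     `|f z - f y - 'd f (e0, e0) (z - y)| <= e * `|z - y|] by near: r.
have h2 : forall u v, ball e0 r u -> ball e0 r v -> cdom chi (cbwd chi u ** cbwd chi v) by near: r.
have h3 : forall u, ball e0 r u -> (cfwd chi @` cdom chi) u by near: r.
have r0 : 0 < r by near: r; exact: nbhs_right_gt.
have iu := h3 u bu.
split => //; first exact: h2.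
have [_ _ _] := h1 (u, e0) (u, v) (conj bu (ballxx e0 r0)) (conj bu bv).
have -> : (u, v) - (u, e0) = (0, v - e0) by congr (_, _); rewrite /= subrr.
have [_ hu] := chart_imgP cc iu.
rewrite dE /f /= (chart_cbwdK cc d1) lmulr1// hu => /le_trans; apply.
by rewrite ler_wpM2l ?(ltW ep)// prod_normE /= normr0 max_r.
Unshelve. all: by end_near. Qed.

Section limit.
Variable xi : 'rV[R]_n.
Let hN (N : nat) : R := N.+1%:R^-1.
(** A first-order substitute for the exponential of [xi / (N + 1)]; its powers approximate the
    one-parameter subgroup that is sought. *)
Let sg (N : nat) : G := cbwd chi (e0 + hN N *: xi).

Let hN0 N : 0 < hN N. Proof. by rewrite invr_gt0. Qed.

Lemma sg_cvg : sg @ \oo --> one.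
Proof.
have h : (fun N : nat => e0 + hN N *: xi) @ \oo --> e0.
  rewrite -[X in _ --> X]addr0; apply: cvgD; first exact: cvg_cst.
  by rewrite -[X in _ --> X](scale0r xi); apply: cvgZr_tmp; exact: cvg_harmonic.
move=> P nP; have nP' : \forall z \near cbwd chi e0, P z by rewrite /e0 (chart_cbwdK cc d1).
exact: h (near_cbwd_at cc (chart_img d1) nP').
Qed.

(** Each factor contributes an error of at most [e |xi| hN], and the errors add up. As [e <= 1], the
    powers remain within [2 |xi| k hN] of [e0], hence in the ball where the one-step estimate
    holds. *)
Lemma npow_estimate (e r : R) : 0 < e -> e <= 1 ->
  (forall u v, ball e0 r u -> ball e0 r v ->
   [/\ (cfwd chi @` cdom chi) u, cdom chi (cbwd chi u ** cbwd chi v) &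
    `|cfwd chi (cbwd chi u ** cbwd chi v) - u - (v - e0)| <= e * `|v - e0|]) ->
  forall N k, 2 * `|xi| * (k%:R * hN N) < r -> cdom chi (npow (sg N) k) /\
    `|cfwd chi (npow (sg N) k) - e0 - (k%:R * hN N) *: xi| <= e * `|xi| * (k%:R * hN N).
Proof.
move=> ep e1 Hr N; have h0 := hN0 N; elim=> [|k IH] kr.
  by split; [exact: d1|rewrite /npow /= subrr mul0r scale0r subr0 normr0 mulr0].
have x0 := normr_ge0 xi; have kh : 0 <= k%:R * hN N by rewrite mulr_ge0// ltW.
have kE : k.+1%:R * hN N = k%:R * hN N + hN N by rewrite -natr1 mulrDl mul1r.
have xh : 0 <= `|xi| * hN N by rewrite mulr_ge0// ltW.
have xk : 0 <= `|xi| * (k%:R * hN N) by rewrite mulr_ge0.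
have kr' : 2 * `|xi| * (k%:R * hN N) < r.
  by apply: le_lt_trans kr; rewrite kE mulrDr lerDl -mulrA mulr_ge0.
have [dk Ek] := IH kr'; set u := cfwd chi (npow (sg N) k) in Ek.
have bu : ball e0 r u.
  rewrite -ball_normE /= distrC.
  rewrite -[u - e0](subrK ((k%:R * hN N) *: xi)) (le_lt_trans (ler_normD _ _))//.
  rewrite normrZ (ger0_norm kh); apply: le_lt_trans kr'.
  have : e * (`|xi| * (k%:R * hN N)) <= 1 * (`|xi| * (k%:R * hN N)) by rewrite ler_wpM2r.
  move: Ek; rewrite -!mulrA; lra.
have bv : ball e0 r (e0 + hN N *: xi).
  rewrite -ball_normE /= opprD addrA subrr sub0r normrN normrZ ger0_norm ?ltW//.
  apply: le_lt_trans kr; rewrite kE mulrDr -!mulrA; lra.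
have [_ dm Em] := Hr u _ bu bv.
have eu : cbwd chi u = npow (sg N) k by rewrite /u (chart_cbwdK cc dk).
rewrite eu -/(sg N) -[_ ** _]/(npow (sg N) k.+1) in dm Em; split => //.
move: Em; set w := cfwd chi (npow (sg N) k.+1) => Em.
have ev : e0 + hN N *: xi - e0 = hN N *: xi by rewrite addrAC subrr add0r.
rewrite ev normrZ (ger0_norm (ltW h0)) in Em.
have -> : w - e0 - (k.+1%:R * hN N) *: xi =
    (w - u - hN N *: xi) + (u - e0 - (k%:R * hN N) *: xi).
  rewrite kE scalerDl opprD [RHS]addrACA -[in RHS]opprD [hN N *: xi + _]addrC.
  by rewrite -[in LHS]opprD [w - u + _]addrA subrK.
rewrite (le_trans (ler_normD _ _))//.
apply: (le_trans (lerD Em Ek)); rewrite kE; lra.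
Qed.

Lemma closed_bound_limit (T : Type) (F : set_system T) (FF : ProperFilter F)
  (V : normedModType R) (f : T -> V) l c :
  f @ F --> l -> (forall t, `|f t| <= c) -> `|l| <= c.
Proof.
move=> fl fc; have := @closed_cvg _ _ _ FF f (closed_ball_ (fun x => `|x|) 0 c) _ _ l fl.
rewrite /closed_ball_ /= sub0r normrN; apply; first exact: closed_closed_ball_.
by apply: filterE => t; rewrite sub0r normrN.
Qed.

Section ultra.
Variable UF : set_system nat.
Hypotheses (ultra : UltraFilter UF) (UFoo : \oo `<=` UF).
(** The power of [sg N] that should approximate time [t]. An ultrafilter finer than [\oo] makes the
    limits in [N] exist for all real [t] at once, by compactness. *)
Let s t N := zpow (sg N) (Num.floor (N.+1%:R * t : R)).

Let FF : ProperFilter UF := @ultra_proper _ _ ultra.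

Lemma ultra_cvg (f : nat -> G) : exists p : G, f @ UF --> p.
Proof.
have [|p [_ clp]] := cG (F := f @ UF) _; first exact: filterT.
exists p => P nP; have [//|NP] := in_ultra_setVsetC (f @^-1` P) ultra.
by have [x []] := clp (~` P) P NP nP.
Qed.

Let gamma t := projT1 (cid (ultra_cvg (s t))).
Let gammaP t : s t @ UF --> gamma t. Proof. exact: (projT2 (cid (ultra_cvg (s t)))). Qed.

(** Integer parts are additive up to [eN], which is 0 or 1; the extra factor is then [one] or
    [sg N], and tends to [one] in both cases. *)
Lemma gammaD t t' : gamma (t + t') = gamma t ** gamma t'.
Proof.
pose eN N := Num.floor (N.+1%:R * (t + t') : R) - Num.floor (N.+1%:R * t : R)
   - Num.floor (N.+1%:R * t' : R).
have e01 N : eN N = 0 \/ eN N = 1.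
  have := floor_itv (N.+1%:R * (t + t') : R); have := floor_itv (N.+1%:R * t : R).
  have := floor_itv (N.+1%:R * t' : R); rewrite /eN.
  set a := Num.floor (N.+1%:R * (t + t')); set b := Num.floor (N.+1%:R * t).
  set c := Num.floor (N.+1%:R * t'); rewrite mulrDr => /andP[c1 c2] /andP[b1 b2] /andP[a1 a2].
  have : ((a - b - c)%:~R : R) < 2%:~R.
    by rewrite !rmorphB /=; move: c2 b2; rewrite !rmorphD /=; lra.
  have : ((-1)%:~R : R) < (a - b - c)%:~R.
    by rewrite !rmorphB /= rmorphN1; move: a2; rewrite !rmorphD /=; lra.
  rewrite !ltr_int; lia.
have sE N : s (t + t') N = s t N ** s t' N ** zpow (sg N) (eN N).
  rewrite /s -!(zpowD LG); congr (zpow _ _); rewrite /eN; lia.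
have c1 : (fun N => zpow (sg N) (eN N)) @ UF --> one.
  move=> P nP; have : \forall N \near UF, P (sg N) by apply: UFoo; exact: sg_cvg nP.
  apply: filterS => N PN; rewrite /=; case: (e01 N) => ->.
    exact: nbhs_singleton nP.
  by rewrite /zpow /npow /= lmul1.
have := lmul_continuous FF (lmul_continuous FF (@gammaP t) (@gammaP t')) c1.
rewrite lmulr1// => h.
rewrite (_ : (fun N => s t N ** s t' N ** zpow (sg N) (eN N)) = s (t + t')) in h; last first.
  by apply/funext => N; rewrite sE.
exact: (@cvg_unique G hG (s (t + t') @ UF) _ _ _ (@gammaP _) h).
Qed.

Lemma floor_cvg t : (fun N => (Num.floor (N.+1%:R * t : R))%:~R * hN N : R) @ UF --> t.
Proof.
suff h : (fun N => (Num.floor (N.+1%:R * t : R))%:~R * hN N : R) @ \oo --> t.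
  by move=> P nP; apply: UFoo; exact: h P nP.
apply/cvgrPdist_le => e ep.
have := @cvg_harmonic R => /cvgrPdist_le /(_ e ep); apply: filterS => N.
rewrite sub0r normrN /harmonic /= (ger0_norm (ltW (hN0 N))) => hle.
have := floor_itv (N.+1%:R * t : R); set a := Num.floor _; rewrite rmorphD /= => /andP[a1 a2].
have N0 : (0 : R) < N.+1%:R by [].
have -> : t - a%:~R * hN N = (N.+1%:R * t - a%:~R) * hN N.
  by rewrite mulrBl mulrAC mulfV ?mul1r ?gt_eqF.
rewrite normrM (ger0_norm (ltW (hN0 N))) ger0_norm ?subr_ge0//.
apply: le_trans hle; rewrite ler_piMl ?ltW//; rewrite mulr1z in a2; lra.
Qed.

(** The estimate on powers is uniform in [N], so it passes to the limit. The image of a closed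
    coordinate ball is compact, hence closed, which keeps the limit inside the chart. *)
Lemma gamma_right (e : R) : 0 < e -> e <= 1 -> \forall t \near (0 : R)^'+,
  cdom chi (gamma t) /\ `|cfwd chi (gamma t) - e0 - t *: xi| <= e * `|xi| * t.
Proof.
move=> ep e1; have := near_one_mul ep; have := @nbhs_right_gt R 0.
move=> /filterI /[apply] /filter_ex[r [r0 Hr]].
near=> t.
have t0 : 0 < t by near: t; exact: nbhs_right_gt.
have x0 := normr_ge0 xi.
have tr : 2 * `|xi| * t < r.
  have t1 : t <= r / (2 * `|xi| + 1).
    by near: t; apply: nbhs_right_le; rewrite divr_gt0// ltr_pwDr// mulr_ge0.
  have q0 : 0 < 2 * `|xi| + 1 by rewrite ltr_pwDr// mulr_ge0.
  by move: t1; rewrite ler_pdivlMr// => t1; nra.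
have est N : cdom chi (s t N) /\ `|cfwd chi (s t N) - e0 -
     ((Num.floor (N.+1%:R * t : R))%:~R * hN N) *: xi| <= e * `|xi| * t.
  have f0 : 0 <= Num.floor (N.+1%:R * t : R) by rewrite floor_ge0 mulr_ge0// ltW.
  rewrite /s; case E : (Num.floor _) f0 => [k|//] _.
  have kt : k%:R * hN N <= t.
    have := floor_le (N.+1%:R * t : R); rewrite E /= => kt.
    by rewrite /hN ler_pdivrMr// mulrC.
  have [|dk Ek] := @npow_estimate e r ep e1 Hr N k.
    by apply: le_lt_trans tr; rewrite ler_wpM2l// mulr_ge0.
  by split => //; apply: (le_trans Ek); rewrite ler_wpM2l// mulr_ge0// ltW.
pose D := closed_ball_ (fun x => `|x|) e0 (2 * `|xi| * t).
have Dr : D `<=` ball e0 r by move=> u; rewrite /D /closed_ball_ -ball_normE /= => /le_lt_trans; apply.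
have Dimg u : D u -> (cfwd chi @` cdom chi) u.
  by move=> /Dr bu; have [] := Hr u u bu bu.
have cD : compact (cbwd chi @` D).
  apply: continuous_compact.
    apply: continuous_in_subspaceT => u /set_mem Du.
    by have [_ _ _ _ c] := cc; apply: c; exact: Dimg.
  apply: bounded_closed_compact; last exact: closed_closed_ball_.
  exists (`|e0| + 2 * `|xi| * t); split; first exact: num_real.
  move=> q tgt z /=; rewrite /D /closed_ball_ /= => zx.
  apply: le_trans (ltW tgt); rewrite -[z](subrK e0) addrC.
  by rewrite (le_trans (ler_normD _ _))// lerD2l distrC.
have clD := compact_closed hG cD.
have inD N : (cbwd chi @` D) (s t N).
  have [dk Ek] := est N; exists (cfwd chi (s t N)); last by rewrite (chart_cbwdK cc dk).
  rewrite /D /closed_ball_ /= distrC.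
  set a := (Num.floor (N.+1%:R * t : R))%:~R * hN N in Ek.
  rewrite -[_ - e0](subrK (a *: xi)) (le_trans (ler_normD _ _))// normrZ.
  have a0 : 0 <= a by rewrite mulr_ge0// ?(ltW (hN0 N))// ler0z floor_ge0 mulr_ge0// ltW.
  have at' : a <= t.
    by rewrite /a /hN ler_pdivrMr// mulrC floor_le.
  rewrite (ger0_norm a0).
  have : a * `|xi| <= t * `|xi| by rewrite ler_wpM2r.
  have : e * (`|xi| * t) <= 1 * (`|xi| * t) by rewrite ler_wpM2r// mulr_ge0// ltW.
  move: Ek; rewrite -!mulrA; lra.
have [u Du uE] : (cbwd chi @` D) (gamma t).
  apply: (@closed_cvg _ _ _ FF (s t) _ clD _ _ (@gammaP t)).
  by apply: filterE => N; exact: inD.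
have [dg _] := chart_imgP cc (Dimg u Du); rewrite uE in dg.
split => //.
apply: (@closed_bound_limit _ UF FF _ _ _ _ _ (fun N => (est N).2)).
apply: cvgB; last by apply: cvgZr_tmp; exact: floor_cvg.
apply: cvgB; last exact: cvg_cst.
by have [_ _ _ c _] := cc; move=> P nP; exact: (@gammaP t) (c _ dg P nP).
Unshelve. all: by end_near. Qed.

Lemma tangent_linv1 v : tangent_map inv one v = - v.
Proof.
have [_ _ sm si] := LG; have i1 := linv1 LG.
have [dp tp] := mdiff_pair (smat_mdiff (smat_id mG one)) (smat_mdiff (si one)).
have dm := smat_mdiff (sm (one, inv one)).
have [_ T] := mdiff_comp mG (prod_mfld mG mG) dp dm.
have := T v; rewrite tp tangent_id// [(one, inv one)]lock i1 -lock tangent_lmul1//.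
rewrite (_ : _ \o _ = cst one); last by apply/funext => x /=; rewrite lmulrV.
by rewrite tangent_cst => /esym/eqP; rewrite addrC addr_eq0 => /eqP.
Qed.

Lemma gamma0 : gamma 0 = one.
Proof. by apply: (@lmul_injl _ _ _ LG (gamma 0)); rewrite -gammaD addr0 lmulr1. Qed.

Lemma gammaN t : gamma (- t) = inv (gamma t).
Proof.
by apply: (@lmul_injl _ _ _ LG (gamma t)); rewrite -gammaD subrr gamma0 lmulrV.
Qed.

(* For [t < 0] use [gamma t = inv (gamma (- t))] and the derivative of [inv]. *)
Lemma gamma_two_sided (e : R) : 0 < e -> \forall t \near (0 : R),
  cdom chi (gamma t) /\ `|cfwd chi (gamma t) - e0 - t *: xi| <= e * `|t|.
Proof.
(* The factor 4 in [q] leaves room for the error of [gamma_right] together with that of linearizing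
   the inversion. *)
move=> ep; have x0 := normr_ge0 xi.
pose q := e / (4 * (`|xi| + 1)); have q0 : 0 < q by rewrite divr_gt0// mulr_gt0// ltr_wpDl.
pose e' := Num.min q 1.
have e'0 : 0 < e' by rewrite lt_min q0 ltr01.
have e'1 : e' <= 1 by rewrite ge_min lexx orbT.
have e'q : 4 * e' * (`|xi| + 1) <= e.
  have : e' <= q by rewrite ge_min lexx.
  by rewrite /q ler_pdivlMr ?mulr_gt0 ?ltr_wpDl// mulrCA mulrA.
have i1 := linv1 LG.
have [_ _ _ si] := LG.
have [ci di] := smat_mdiff (si one); rewrite /loc i1 in di.
have := is_diff_eps di e'0 => /(near_cfwd cc d1).
rewrite -/chi /= (chart_cbwdK cc d1) i1 -/e0 => nI0.
have nI : \forall g \near one, `|cfwd chi (inv (cbwd chi (cfwd chi g))) - e0 + (cfwd chi g - e0)|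
    <= e' * `|cfwd chi g - e0|.
  apply: filterS nI0 => g; rewrite (_ : 'd _ _ _ = - (cfwd chi g - e0)) ?opprK//.
  have := tangent_linv1 (cfwd chi g - e0).
  by rewrite /tangent_map i1.
have nD : \forall g \near one, cdom chi (inv g).
  by apply: ci; rewrite i1; exact: near_dom.
have nR := gamma_right e'0 e'1.
have [r0 [r00 Hr0]] : exists r0 : R, 0 < r0 /\ forall t, 0 < t < r0 ->
    cdom chi (gamma t) /\ `|cfwd chi (gamma t) - e0 - t *: xi| <= e' * `|xi| * t.
  move: nR => /nbhs_ballP[r0 /= r00 Hr0]; exists r0; split => // t /andP[t0 tr].
  by apply: Hr0 => //; rewrite -ball_normE /= sub0r normrN ger0_norm// ltW.
have cbg : forall t, 0 < t < r0 -> cbwd chi (cfwd chi (gamma t)) = gamma t.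
  by move=> t /Hr0[dt _]; rewrite (chart_cbwdK cc dt).
have near0 (P : set G) : nbhs one P -> exists r1 : R, 0 < r1 /\ forall t, 0 < t < r1 -> P (gamma t).
  move=> nP; have nP' : \forall z \near cbwd chi e0, P z by rewrite /e0 (chart_cbwdK cc d1).
  have /nbhs_ballP[b /= b0 Hb] := near_cbwd_at cc (chart_img d1) nP'.
  pose r1 := Num.min r0 (b / (2 * `|xi| + 1)).
  have y0 : 0 < 2 * `|xi| + 1 by rewrite ltr_wpDl// mulr_ge0.
  exists r1; split; first by rewrite lt_min r00 divr_gt0.
  move=> t; rewrite lt_min => /and3P[t0 tr0 tb].
  have tr : 0 < t < r0 by rewrite t0.
  rewrite -(cbg t tr); apply: Hb; rewrite -ball_normE /= distrC.
  have [_ Et] := Hr0 t tr.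
  rewrite -[_ - e0](subrK (t *: xi)) (le_lt_trans (ler_normD _ _))// normrZ gtr0_norm//.
  move: tb; rewrite ltr_pdivlMr// => tb.
  have : e' * (`|xi| * t) <= 1 * (`|xi| * t) by rewrite ler_wpM2r// mulr_ge0// ltW.
  rewrite -mulrA in Et; rewrite (mulrC t `|xi|); have : 0 <= `|xi| * t by rewrite mulr_ge0// ltW.
  by move: Et; rewrite /e0 -/chi; lra.
have [r1 [r10 Hr1]] := near0 _ (filterI nI nD).
apply/nbhs_ballP; exists (Num.min r0 r1); first by rewrite /= lt_min r00.
move=> t; rewrite -ball_normE /= sub0r normrN lt_min => /andP[tr0 tr1].
have [t0|t0|->] := ltrgt0P t; last first.
- rewrite gamma0 -/e0 subrr scale0r subr0 !normr0 mulr0; split => //; exact: d1.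
- rewrite ltr0_norm// in tr0 tr1 *.
  have tt : 0 < - t by rewrite oppr_gt0.
  have [dt Et] := Hr0 (- t) (introT andP (conj tt tr0)).
  have [It Dt] := Hr1 (- t) (introT andP (conj tt tr1)).
  rewrite -[t]opprK gammaN opprK; split => //.
  rewrite (chart_cbwdK cc dt) in It.
  set y := cfwd chi (gamma (- t)) in Et It; set z := cfwd chi (inv _) in It *.
  have -> : z - e0 - t *: xi = (z - e0 + (y - e0)) - (y - e0 - (- t) *: xi).
    by rewrite opprB addrACA subrr addr0 scaleNr.
  rewrite (le_trans (ler_normB _ _))//.
  have yb : `|y - e0| <= e' * `|xi| * - t + - t * `|xi|.
    rewrite -[y - e0](subrK ((- t) *: xi)) (le_trans (ler_normD _ _))// normrZ gtr0_norm//.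
    by rewrite lerD2r.
  have h1 : e' * `|y - e0| <= e' * (e' * `|xi| * - t + - t * `|xi|) by rewrite ler_wpM2l// ltW.
  have h2 : e' * (e' * `|xi| * - t) <= 1 * (e' * `|xi| * - t).
    by rewrite ler_wpM2r// !mulr_ge0// ltW.
  have h3 : 4 * e' * (`|xi| + 1) * - t <= e * - t by rewrite ler_wpM2r// ltW.
  have h4 : 0 <= e' * `|xi| * - t by rewrite !mulr_ge0// ltW.
  have h5 : 0 <= e' * - t by rewrite !mulr_ge0// ltW.
  have h6 : 4 * e' * (`|xi| + 1) * - t = 4 * (e' * `|xi| * - t) + 4 * (e' * - t) by ring.
  have h7 : e' * (- t * `|xi|) = e' * `|xi| * - t by ring.
  move: Et It h1; rewrite mulrDr h7; lra.
- rewrite gtr0_norm// in tr0 tr1 *.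
  have [dt Et] := Hr0 t (introT andP (conj t0 tr0)); split => //.
  apply: (le_trans Et); rewrite ler_wpM2r ?(ltW t0)//.
  have : 0 <= e' * `|xi| by rewrite mulr_ge0// ltW.
  have : 4 * e' * (`|xi| + 1) = 4 * (e' * `|xi|) + 4 * e' by ring.
  lra.
Qed.

Lemma gamma_one_param : one_param_diff xi gamma.
Proof.
have lin : linear (fun s : R^o => s *: xi) by move=> a y z; rewrite scalerDl scalerA.
have D : is_diff (0 : R^o) (cfwd chi \o gamma : R^o -> _) (mklin lin).
  apply/is_diff_epsP; split => [|e ep]; first exact/findim_continuous/findim_Ro.
  have := gamma_two_sided ep; apply: filterS => t [_].
  by rewrite /= gamma0 -/e0 subr0.
have [dD eD] := D.
have nd : \forall t \near (0 : R), cdom chi (gamma t).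
  by apply: filterS (gamma_two_sided ltr01) => t [].
have lE : loc (gamma : euclid R^o -> G) 0 = cfwd chi \o gamma by rewrite /loc gamma0.
split; first exact: gammaD.
- split; last by rewrite lE; exact: dD.
  have E1 : \forall t \near (0 : R), (cbwd chi \o (cfwd chi \o gamma)) t = gamma t.
    by apply: filterS nd => t dt; rewrite /= (chart_cbwdK cc dt).
  have c1 := differentiable_continuous dD.
  have c2 : {for (0 : R^o), continuous (cbwd chi \o (cfwd chi \o gamma))}.
    apply: continuous_comp c1 _; rewrite /= gamma0.
    by have [_ _ _ _ c] := cc; apply: c; exact: chart_img.
  move: c2; rewrite /prop_for /continuous_at (nbhs_singleton E1) => h.
  by apply: cvg_trans h; exact: near_eq_cvg E1.
- transitivity ('d (loc (gamma : euclid R^o -> G) 0) (0 : R^o) (1 : R^o)); first by [].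
  rewrite lE.
  transitivity (mklin lin (1 : R^o)); first exact: (congr1 (fun h => h (1 : R^o)) eD).
  by rewrite /= scale1r.
Qed.

End ultra.
Lemma compact_one_param : exists g : R -> G, one_param_diff xi g.
Proof.
have [UF [ultra UFoo]] := ultraFilterLemma (eventually_filter : ProperFilter \oo).
by eexists; exact: gamma_one_param ultra UFoo.
Qed.

End limit.

End compact_one_param.

(** * A Lojasiewicz inequality *)

Section lojasiewicz.
Context {R : realType} {N : nat}.
Variables (Y : 'rV[R]_N -> 'rV[R]_N) (f : 'rV[R]_N -> R) (e : 'rV[R]_N) (S : 'M[R]_N).

(** Matrices act on row vectors from the right, so the range of [S] is its row space. This
    projection vanishes exactly on that space and measures the part of a vector that [S] cannot
    produce. *)
Definition corange_proj : 'M[R]_N := 1%:M - pinvmx S *m S.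

Lemma mul_corange_proj : S *m corange_proj = 0.
Proof. by rewrite /corange_proj mulmxBr mulmx1 mulmxA mulmxKpV ?submx_refl// subrr. Qed.

Lemma mulmx_norm_bound m1 m2 (A : 'M[R]_(m1, m2)) :
  exists2 C, 0 < C & forall v : 'rV[R]_m1, `|v *m A| <= C * `|v|.
Proof.
have lin : linear (fun v : 'rV[R]_m1 => v *m A).
  by move=> a u v; rewrite mulmxDl scalemxAl.
exact: (linear_bounded_findim (mklin lin) (@findim_rV R m1)).
Qed.

Hypothesis Y0 : Y e = 0.
Hypothesis strictY : forall eps, 0 < eps -> exists2 r : R, 0 < r &
  forall x y, ball e r x -> ball e r y -> `|Y y - Y x - (y - x) *m S| <= eps * `|y - x|.
Hypothesis projY : forall eps, 0 < eps -> exists2 r : R, 0 < r &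
  forall x, ball e r x -> `|Y x *m corange_proj| <= eps * `|Y x|.

(* Newton's method [x |-> x - Y x S^+] finds a zero of [Y] near [x]. *)
Lemma near_zero : exists C r : R, [/\ 0 < C, 0 < r & forall x, ball e r x ->
  exists2 q, `|q - x| <= C * `|Y x| & Y q = 0].
Proof.
have [C C0 HC] := mulmx_norm_bound (pinvmx S).
(* The two errors of a Newton step are the nonlinear remainder and the component outside the range
   of [S]. Each is at most a quarter of [|Y z|], so the step halves [|Y z|] as [chord_zero]
   requires. *)
have [|r1 r10 H1] := strictY (eps := (4 * C)^-1); first by rewrite invr_gt0 mulr_gt0.
have [|r2 r20 H2] := projY (eps := 4^-1); first by rewrite invr_gt0.
have [|r3 r30 H3] := strictY (eps := 1); first by [].
have [CS CS0 HS] := mulmx_norm_bound S.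
pose r := Num.min r1 r2.
have r0 : 0 < r by rewrite lt_min r10.
have Yx x : ball e r3 x -> `|Y x| <= (1 + CS) * `|x - e|.
  move=> bx; have := H3 e x (ballxx e r30) bx; rewrite Y0 subr0 mul1r => h.
  rewrite -[Y x](subrK ((x - e) *m S)) mulrDl mul1r (le_trans (ler_normD _ _))// lerD//.
exists (4 * C), (Num.min r3 (r / (2 * (1 + 5 * C * (1 + CS))))).
have q0 : 0 < 2 * (1 + 5 * C * (1 + CS)).
  by rewrite mulr_gt0// addr_gt0// !mulr_gt0// addr_gt0.
split; [by rewrite mulr_gt0|by rewrite lt_min r30 divr_gt0|].
move=> x; rewrite -ball_normE /= distrC lt_min => /andP[x3 xr].
have Y1 : `|Y x| <= (1 + CS) * `|x - e|.
  by apply: Yx; rewrite -ball_normE /= distrC.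
rewrite ltr_pdivlMr// in xr.
have nY := normr_ge0 (Y x); have nx := normr_ge0 (x - e).
have CY : 5 * C * `|Y x| <= 5 * C * ((1 + CS) * `|x - e|) by rewrite ler_wpM2l// mulr_ge0// ltW.
have inb z : `|z - x| <= 5 * C * `|Y x| -> ball e r z.
  move=> h; rewrite -ball_normE /= distrC -(subrK x z) -addrA.
  by rewrite (le_lt_trans (ler_normD _ _))//; nra.
have inb1 z : ball e r z -> ball e r1 z by apply: le_ball; rewrite ge_min lexx.
have inb2 z : ball e r z -> ball e r2 z by apply: le_ball; rewrite ge_min lexx orbT.
have C4 z : `|z - x| <= 4 * C * `|Y x| -> ball e r z.
  by move=> h; apply: inb; apply: (le_trans h); rewrite !ler_wpM2r// ?(ltW C0)//; lra.
apply: (@chord_zero R N N Y (fun z => z - Y z *m pinvmx S) x C C0).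
- move=> z /C4/inb1 bz; apply/continuous_normP => eps eps0.
  have nb : \forall y \near z, ball e r1 y.
    by apply: open_nbhs_nbhs; split => //; exact: ball_open.
  have K0 : 0 < (4 * C)^-1 + CS by rewrite addr_gt0// invr_gt0 mulr_gt0.
  have := near_norm_le z (divr_gt0 eps0 K0); apply: filterS2 nb => y by1 yz.
  rewrite -(subrK ((y - z) *m S) (Y y - Y z)) (le_trans (ler_normD _ _))//.
  have := H1 z y bz by1; have := HS (y - z); move: yz; rewrite ler_pdivlMr//; nra.
- move=> z /[dup] zx /C4 bz Yz; set z' := z - _.
  have dz : z' - z = - (Y z *m pinvmx S) by rewrite /z' addrAC subrr sub0r.
  have nz : `|z' - z| <= C * `|Y z| by rewrite dz normrN.
  split=> //.
  have bz' : ball e r z'.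
    apply: inb; rewrite -(subrK z z') -addrA (le_trans (ler_normD _ _))//.
    have : C * `|Y z| <= C * `|Y x| by rewrite ler_wpM2l// ltW.
    nra.
  have h1 := H1 z z' (inb1 _ bz) (inb1 _ bz').
  have h2 := H2 z (inb2 _ bz).
  have E : Y z' = (Y z' - Y z - (z' - z) *m S) + Y z *m corange_proj.
    rewrite dz mulNmx opprK -(mulmxA (Y z)) /corange_proj mulmxBr mulmx1 addrACA.
    by rewrite subrK subrr addr0.
  rewrite E (le_trans (ler_normD _ _))//.
  have : (4 * C)^-1 * `|z' - z| <= 4^-1 * `|Y z|.
    by rewrite invfM -mulrA ler_wpM2l ?invr_ge0// mulrC ler_pdivrMr// mulrC.
  lra.
Qed.

Variable Cf : R.
Hypothesis Cf0 : 0 < Cf.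
Hypothesis dfY : exists2 r : R, 0 < r & forall x, ball e r x -> differentiable (f : _ -> R^o) x /\
  forall v, `|'d (f : _ -> R^o) x v| <= Cf * `|Y x| * `|v|.

Lemma mvt_real (g : 'rV[R]_N -> R) (x y : 'rV[R]_N) (K : R) :
  (forall t : R, 0 <= t <= 1 -> differentiable (g : _ -> R^o) (x + t *: (y - x)) /\
     `|'d (g : _ -> R^o) (x + t *: (y - x)) (y - x)| <= K) ->
  `|g y - g x| <= K.
Proof.
move=> H; pose h := fun s : R => g (x + s *: (y - x)).
have dh (t : R) : 0 <= t <= 1 -> is_derive t 1 h ('d (g : _ -> R^o) (x + t *: (y - x)) (y - x)).
  by move=> t01; have [df _] := H t t01; exact: diff_line df.
have [| |c c01] := @MVT_segment R h (fun t => 'd (g : _ -> R^o) (x + t *: (y - x)) (y - x)) 0 1 ler01.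
- by move=> t; rewrite in_itv /= => /andP[t0 t1]; apply: dh; rewrite !ltW.
- apply: derivable_within_continuous => t; rewrite in_itv /= => t01.
  by have [] := dh t t01.
rewrite /h scale1r scale0r addr0 [x + _]addrC subrK subr0 mulr1 => ->.
by move: c01; rewrite in_itv /= => c01; have [_] := H c c01.
Qed.

(** The bound on the differential gives [|f x - f q| <= K |x - q|^2] when [Y q = 0], and [near_zero]
    provides such a [q] at distance at most [C |Y x|]. It remains to see that [f q = f e]: letting
    [n] grow in [bis] shows that [f] is constant on the zeros of [Y] near [e]. *)
Lemma lojasiewicz_half : exists C r : R, [/\ 0 < C, 0 < r &
  forall x, ball e r x -> `|f x - f e| <= C * `|Y x| ^+ 2].
Proof.
have [C [r1 [C0 r10 HZ]]] := near_zero.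
have [CS CS0 HS] := mulmx_norm_bound S.
have [|r2 r20 H2] := strictY (eps := 1); first by [].
(* With this constant the zero that replaces the midpoint lies within [l / 20] of it, so both halves
   have length at most [3 / 5 l]. Two squares then give the ratio [2 (3 / 5)^2 = 18 / 25], less than
   1. *)
have [|r3 r30 H3] := strictY (eps := (20 * C)^-1); first by rewrite invr_gt0 mulr_gt0.
have [r4 r40 H4] := dfY.
pose r := Num.min (Num.min r1 r2) (Num.min r3 r4).
have r0 : 0 < r by rewrite !lt_min r10 r20 r30.
have B1 z : ball e r z -> ball e r1 z by apply: le_ball; rewrite !ge_min lexx.
have B2 z : ball e r z -> ball e r2 z by apply: le_ball; rewrite !ge_min lexx orbT.
have B3 z : ball e r z -> ball e r3 z by apply: le_ball; rewrite !ge_min lexx !orbT.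
have B4 z : ball e r z -> ball e r4 z by apply: le_ball; rewrite !ge_min lexx !orbT.
have lipY x y : ball e r x -> ball e r y -> `|Y y - Y x| <= (1 + CS) * `|y - x|.
  move=> bx by'; rewrite -(subrK ((y - x) *m S) (Y y - Y x)) (le_trans (ler_normD _ _))//.
  by have := H2 x y (B2 _ bx) (B2 _ by'); have := HS (y - x); lra.
pose K := Cf * (1 + CS).
have K0 : 0 < K by rewrite mulr_gt0// addr_gt0.
have quad q x : ball e r q -> ball e r x -> Y q = 0 -> `|f x - f q| <= K * `|x - q| ^+ 2.
  move=> bq bx Yq; apply: mvt_real => t t01; have bt := ball_segment bq bx t01.
  have [df dfl] := H4 _ (B4 _ bt); split => //.
  apply: (le_trans (dfl _)); rewrite expr2 mulrA ler_wpM2r// /K -mulrA ler_wpM2l ?(ltW Cf0)//.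
  have := lipY q _ bq bt; rewrite Yq subr0 => /le_trans; apply.
  rewrite ler_wpM2l// ?addr_ge0 ?(ltW CS0)// addrAC subrr add0r normrZ.
  by have /andP[t0 t1] := t01; rewrite ger0_norm// ler_piMl.
(* By bisection through zeros near the midpoints, the quadratic bound on
     [|f q - f q'|] decays geometrically. *)
have bis n q q' : `|q - e| + 4 * `|q - q'| < r -> Y q = 0 -> Y q' = 0 ->
    `|f q - f q'| <= K * `|q - q'| ^+ 2 * (18%:R / 25%:R) ^+ n.
  elim: n q q' => [|n IH] q q' qq Yq Yq'.
    have n1 := normr_ge0 (q - q'); have n2 := normr_ge0 (q - e).
    rewrite expr0 mulr1; apply: quad => //.
      rewrite -ball_normE /= distrC -(subrK q q') -addrA (le_lt_trans (ler_normD _ _))//.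
      by rewrite [`|q' - q|]distrC; lra.
    by rewrite -ball_normE /= distrC; lra.
  have n1 := normr_ge0 (q - q'); have n2 := normr_ge0 (q - e).
  set l := `|q - q'| in IH qq n1 *.
  pose m := 2^-1 *: (q + q').
  have mq : m - q = 2^-1 *: (q' - q).
    by apply/rowP => i; rewrite !mxE; field.
  have mq' : m - q' = 2^-1 *: (q - q').
    by apply/rowP => i; rewrite !mxE; field.
  have nm : `|m - q| = 2^-1 * l by rewrite mq normrZ ger0_norm ?invr_ge0// distrC.
  have nm' : `|m - q'| = 2^-1 * l by rewrite mq' normrZ ger0_norm ?invr_ge0.
  have bq : ball e r q by rewrite -ball_normE /= distrC; lra.
  have bq' : ball e r q'.
    rewrite -ball_normE /= distrC -(subrK q q') -addrA (le_lt_trans (ler_normD _ _))//.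
    by rewrite distrC -/l; lra.
  have bm : ball e r m.
    rewrite -ball_normE /= distrC -(subrK q m) -addrA (le_lt_trans (ler_normD _ _))//.
    by rewrite nm; lra.
  have Ym : `|Y m| <= (20 * C)^-1 * l.
    have h1 := H3 q m (B3 _ bq) (B3 _ bm); have h2 := H3 q' m (B3 _ bq') (B3 _ bm).
    have E : Y m = 2^-1 *: ((Y m - Y q - (m - q) *m S) + (Y m - Y q' - (m - q') *m S)).
      rewrite Yq Yq' !subr0 mq mq' -!scalemxAl -(opprB q q') mulNmx scalerN opprK addrACA.
      by rewrite subrr addr0; apply/rowP => i; rewrite !mxE; field.
    rewrite E normrZ ger0_norm ?invr_ge0//.
    have := ler_normD (Y m - Y q - (m - q) *m S) (Y m - Y q' - (m - q') *m S).
    rewrite nm in h1; rewrite nm' in h2.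
    have : 0 <= (20 * C)^-1 * l by rewrite mulr_ge0// invr_ge0 mulr_ge0// ltW.
    lra.
  have [q1 q1m Yq1] := HZ m (B1 _ bm).
  have d1 : `|q1 - m| <= 20^-1 * l.
    apply: (le_trans q1m); apply: (le_trans (ler_wpM2l (ltW C0) Ym)).
    rewrite le_eqVlt; apply/orP; left; apply/eqP; field; by rewrite gt_eqF.
  have dq : `|q - q1| <= 3%:R / 5%:R * l.
    rewrite distrC -(subrK m q1) -addrA (le_trans (ler_normD _ _))// nm; lra.
  have dq' : `|q1 - q'| <= 3%:R / 5%:R * l.
    rewrite -(subrK m q1) -addrA (le_trans (ler_normD _ _))// nm'; lra.
  have c1 : `|q - e| + 4 * `|q - q1| < r by lra.
  (* The second half costs [3 / 5 l] for the new base point and [4 * 3 / 5 l] for the length, in all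
     [3 l], which the weight 4 in the hypothesis covers. *)
  have c2 : `|q1 - e| + 4 * `|q1 - q'| < r.
    have : `|q1 - e| <= `|q - q1| + `|q - e|.
      by rewrite [`|q - q1|]distrC -{1}(subrK q q1) -addrA; exact: ler_normD.
    lra.
  have i1 := IH _ _ c1 Yq Yq1; have i2 := IH _ _ c2 Yq1 Yq'.
  have s1 : `|q - q1| ^+ 2 <= (3%:R / 5%:R * l) ^+ 2 by rewrite ler_pXn2r ?nnegrE ?normr_ge0 ?mulr_ge0.
  have s2 : `|q1 - q'| ^+ 2 <= (3%:R / 5%:R * l) ^+ 2 by rewrite ler_pXn2r ?nnegrE ?normr_ge0 ?mulr_ge0.
  have p0 : 0 <= (18%:R / 25%:R : R) ^+ n by rewrite exprn_ge0.
  have -> : f q - f q' = (f q - f q1) + (f q1 - f q') by rewrite addrA subrK.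
  rewrite (le_trans (ler_normD _ _))//; apply: (le_trans (lerD i1 i2)).
  have k1 : K * `|q - q1| ^+ 2 * (18%:R / 25%:R) ^+ n <=
      K * (3%:R / 5%:R * l) ^+ 2 * (18%:R / 25%:R) ^+ n.
    by rewrite ler_wpM2r// ler_wpM2l// ltW.
  have k2 : K * `|q1 - q'| ^+ 2 * (18%:R / 25%:R) ^+ n <=
      K * (3%:R / 5%:R * l) ^+ 2 * (18%:R / 25%:R) ^+ n.
    by rewrite ler_wpM2r// ler_wpM2l// ltW.
  apply: (le_trans (lerD k1 k2)); rewrite [_ ^+ n.+1]exprS; move: (_ ^+ n) => th.
  by rewrite le_eqVlt; apply/orP; left; apply/eqP; field.
have eqf q : Y q = 0 -> 5 * `|q - e| < r -> f q = f e.
  move=> Yq qr; apply/eqP; rewrite -subr_eq0 -normr_le0.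
  apply/ler_addgt0Pr => eps eps0; rewrite add0r.
  have c : `|q - e| + 4 * `|q - e| < r by lra.
  have A0 : 0 < K * `|q - e| ^+ 2 + 1 by rewrite ltr_wpDl// mulr_ge0// ?exprn_ge0// ltW.
  have /cvgrPdist_le /(_ _ (divr_gt0 eps0 A0)) : GRing.exp (18%:R / 25%:R : R) @ \oo --> (0 : R).
    by apply: cvg_expr; rewrite ger0_norm//; lra.
  move=> /filter_ex[n]; rewrite sub0r normrN => hn.
  apply: (le_trans (bis n q e c Yq Y0)).
  have p0 : 0 <= (18%:R / 25%:R : R) ^+ n by rewrite exprn_ge0.
  rewrite ger0_norm// ler_pdivlMr// in hn.
  have : 0 <= K * `|q - e| ^+ 2 by rewrite mulr_ge0// ?exprn_ge0// ltW.
  by rewrite mulrC; nra.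
exists (K * C ^+ 2), (Num.min (r / 10) (r / (10 * C * (1 + CS)))).
have D0 : 0 < 10 * C * (1 + CS) by rewrite !mulr_gt0// addr_gt0.
split; [by rewrite mulr_gt0// exprn_gt0|by rewrite lt_min !divr_gt0|].
move=> x; rewrite -ball_normE /= distrC lt_min => /andP[x1 x2].
have bx : ball e r x by rewrite -ball_normE /= distrC; lra.
have [q qx Yq] := HZ x (B1 _ bx).
have Yx : `|Y x| <= (1 + CS) * `|x - e|.
  by have := lipY e x (ballxx e r0) bx; rewrite Y0 subr0.
rewrite ltr_pdivlMr// in x2.
have qr : 5 * `|q - e| < r.
  have : `|q - e| <= `|q - x| + `|x - e|.
    by rewrite -{1}(subrK x q) -addrA ler_normD.
  have : C * `|Y x| <= C * ((1 + CS) * `|x - e|) by rewrite ler_wpM2l// ltW.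
  by rewrite -mulrA in x2; nra.
have bq : ball e r q by rewrite -ball_normE /= distrC; have := normr_ge0 (q - e); lra.
rewrite -(eqf q Yq qr); apply: (le_trans (quad q x bq bx Yq)).
rewrite -mulrA ler_wpM2l ?(ltW K0)// -exprMn distrC.
by rewrite ler_pXn2r ?nnegrE ?normr_ge0 ?mulr_ge0// ltW.
Qed.

End lojasiewicz.

(** * Growth and trapping estimates *)

Section gradient_dynamics.
Context {R : realType}.

Lemma nincr_of_derive (h dh : R -> R) (T : R) : 0 <= T ->
  (forall t : R, 0 <= t <= T -> is_derive t 1 h (dh t) /\ dh t <= 0) -> h T <= h 0.
Proof.
move=> T0 H.
have d t : 0 <= t <= T -> derivable h t 1 by move=> /H[[]].
apply: (@ler0_derive1_nincr R h 0 T) => //.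
- by move=> t; rewrite in_itv /= => /andP[/ltW t0 /ltW t1]; apply: d; rewrite t0.
- move=> t; rewrite in_itv /= => /andP[/ltW t0 /ltW t1].
  by have [|[_ e] le0] := H t _; rewrite ?t0// derive1E e.
- by apply: derivable_within_continuous => t; rewrite in_itv /= => /d.
Qed.

Lemma ndecr_of_derive (h dh : R -> R) (T : R) : 0 <= T ->
  (forall t : R, 0 <= t <= T -> is_derive t 1 h (dh t) /\ 0 <= dh t) -> h 0 <= h T.
Proof.
move=> T0 H; rewrite -lerN2.
apply: (@nincr_of_derive (fun t => - h t) (fun t => - dh t)) => // t /H[d p].
by split; [exact: is_deriveN|rewrite oppr_le0].
Qed.

Lemma is_derive_coord n (x : R -> 'rV[R]_n) (v : 'rV[R]_n) (t : R) j :
  is_derive t 1 x v -> is_derive t 1 (fun s => x s 0 j) (v 0 j).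
Proof.
move=> [d e]; apply: DeriveDef; first by move/derivable_mxP: d; exact.
by rewrite -e derive_mx// mxE.
Qed.

(** [X] bounds the length still to be travelled: for each coordinate, [x_j + X] does not increase
    and [x_j - X] does not decrease. *)
Lemma displacement n (x v : R -> 'rV[R]_n) (X dX : R -> R) (T : R) : 0 <= T ->
  (forall t : R, 0 <= t <= T -> [/\ is_derive t 1 x (v t), is_derive t 1 X (dX t) &
     `|v t| <= - dX t]) -> 0 <= X T -> `|x T - x 0| <= X 0.
Proof.
move=> T0 H XT.
have X0 : 0 <= X 0.
  apply: (le_trans XT); apply: (@nincr_of_derive X dX) => // t /H[_ d p].
  by split => //; rewrite -oppr_ge0; apply: le_trans p.
apply: rV_norm_le => // j; rewrite !mxE ler_norml; apply/andP; split.
- have := @ndecr_of_derive (fun t => x t 0 j - X t) (fun t => v t 0 j - dX t) T T0.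
  have K (t : R) : 0 <= t <= T -> is_derive t 1 (fun t0 : R => x t0 0 j - X t0) (v t 0 j - dX t) /\
    0 <= v t 0 j - dX t.
    move=> /H[dx dX' p]; split; first by apply: is_deriveB; exact: is_derive_coord.
    have := coord_norm_le (v t) j; rewrite ler_norml => /andP[h _].
    by move: h p; lra.
  by move=> /(_ K); lra.
- have := @nincr_of_derive (fun t => x t 0 j + X t) (fun t => v t 0 j + dX t) T T0.
  have K (t : R) : 0 <= t <= T -> is_derive t 1 (fun t0 : R => x t0 0 j + X t0) (v t 0 j + dX t) /\
    v t 0 j + dX t <= 0.
    move=> /H[dx dX' p]; split; first by apply: is_deriveD; exact: is_derive_coord.
    have := coord_norm_le (v t) j; rewrite ler_norml => /andP[_ h].
    by move: h p; lra.
  by move=> /(_ K); lra.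
Qed.

Lemma is_derive_mul (g h : R -> R) (t dg dh : R) : is_derive t 1 g dg ->
  is_derive t 1 h dh -> is_derive t 1 (fun s => g s * h s) (g t * dh + h t * dg).
Proof. by move=> d1 d2; have := @is_deriveM R R g h t 1 dg dh d1 d2. Qed.

Lemma is_derive_mulC (a : R) (h : R -> R) (t dh : R) :
  is_derive t 1 h dh -> is_derive t 1 (fun s => a * h s) (a * dh).
Proof.
move=> d; have := is_derive_mul (is_derive_cst a t (1 : R)) d.
by rewrite mulr0 addr0.
Qed.

Lemma is_derive_expRM (a t : R) : is_derive t 1 (fun s : R => expR (a * s)) (a * expR (a * t)).
Proof.
have d : is_derive t 1 (fun s : R => a * s) a.
  by have := is_derive_mulC a (is_derive_id t (1 : R)); rewrite mulr1.
have e : is_derive (a * t) 1 (@expR R) (expR (a * t)) by exact: is_derive_expR.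
by have := @is_derive1_comp R (@expR R) (fun s => a * s) t _ _ e d; rewrite mulrC.
Qed.

(* With the weight [lam t = exp (al t) / eta], [al = 1 / (2 L)], the function
   [K lam u + 1 / (2 al lam)] decreases at least as fast as [x] moves. *)
Lemma decreasing_length n (x v : R -> 'rV[R]_n) (u w : R -> R) (T K L eta : R) :
  0 <= T -> 0 < K -> 0 < L -> 0 < eta ->
  (forall t : R, 0 <= t <= T -> [/\ is_derive t 1 x (v t), is_derive t 1 u (- w t),
     `|v t| ^+ 2 <= K * w t & 0 <= u t <= L * w t]) ->
  `|x T - x 0| <= K * u 0 / eta + L * eta.
Proof.
move=> T0 K0 L0 e0 H; pose al := (2 * L)^-1.
have al0 : 0 < al by rewrite invr_gt0 mulr_gt0.
pose lam (t : R) := expR (al * t) / eta; pose mu (t : R) := expR (- al * t) * eta.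
have lm t : lam t * mu t = 1.
  by rewrite /lam /mu mulrACA -expRD mulNr subrr expR0 mul1r mulVf// gt_eqF.
have lam0 t : 0 < lam t by rewrite divr_gt0// expR_gt0.
have mu0 t : 0 < mu t by rewrite mulr_gt0// expR_gt0.
pose X (t : R) := K * (lam t * u t) + L * mu t.
have dlam (t : R) : is_derive t 1 lam (al * lam t).
  have := is_derive_mulC eta^-1 (is_derive_expRM al t).
  rewrite (_ : (fun s : R => _) = lam); last by apply/funext => z; rewrite /lam mulrC.
  by rewrite (_ : eta^-1 * (al * expR (al * t)) = al * lam t)// /lam; ring.
have dmu (t : R) : is_derive t 1 mu (- al * mu t).
  have := is_derive_mulC eta (is_derive_expRM (- al) t).
  rewrite (_ : (fun s : R => _) = mu); last by apply/funext => z; rewrite /mu mulrC.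
  by rewrite (_ : eta * (- al * expR (- al * t)) = - al * mu t)// /mu; ring.
have -> : K * u 0 / eta + L * eta = X 0.
  by rewrite /X /lam /mu !mulr0 expR0 mul1r; field; rewrite gt_eqF.
apply: (@displacement n x v X (fun t => K * (lam t * - w t + u t * (al * lam t)) + L * (- al * mu t))); first exact: T0.
  move=> t /[dup] tT /H[dx du vw /andP[u0 uw]]; split => //.
    exact: (is_deriveD (is_derive_mulC K (is_derive_mul (dlam t) du)) (is_derive_mulC L (dmu t))).
  have l0 := lam0 t; have m0 := mu0 t; have lmt := lm t; have nv := normr_ge0 (v t).
  have alL : L * al = 2^-1 by rewrite /al invfM mulrCA divff ?mulr1// gt_eqF.
  (* AM-GM: [2 |v| <= lam |v|^2 + 1 / lam] *)
  have amgm : 2 * `|v t| <= lam t * `|v t| ^+ 2 + mu t.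
    have : 0 <= (lam t * `|v t| - 1) ^+ 2 * mu t by rewrite mulr_ge0// ?sqr_ge0// ltW.
    have -> : (lam t * `|v t| - 1) ^+ 2 * mu t = (lam t * mu t) * (lam t * `|v t| ^+ 2)
       - 2 * (lam t * mu t) * `|v t| + mu t by ring.
    by rewrite lmt; lra.
  have h1 : lam t * `|v t| ^+ 2 <= lam t * (K * w t) by rewrite ler_wpM2l// ltW.
  have h2 : al * u t <= 2^-1 * w t.
    by rewrite -alL [L * al]mulrC -mulrA ler_wpM2l// ltW.
  have h3 : (K * lam t) * (al * u t) <= (K * lam t) * (2^-1 * w t).
    by rewrite ler_wpM2l// mulr_ge0// ltW.
  have -> : - (K * (lam t * - w t + u t * (al * lam t)) + L * (- al * mu t)) =
    K * lam t * w t - (K * lam t) * (al * u t) + (L * al) * mu t by ring.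
  rewrite alL; move: h1 h3 amgm.
  have -> : K * lam t * (2^-1 * w t) = 2^-1 * (lam t * (K * w t)) by ring.
  have -> : K * lam t * w t = lam t * (K * w t) by ring.
  lra.
have [|_ _ _ /andP[u0 _]] := H T _; first by rewrite T0 lexx.
rewrite /X addr_ge0// mulr_ge0 ?(ltW K0) ?(ltW L0) ?(ltW (mu0 T))//.
by rewrite mulr_ge0// ltW.
Qed.

(** Time reversal of [decreasing_length]. *)
Lemma increasing_length n (x v : R -> 'rV[R]_n) (u w : R -> R) (T K L eta : R) :
  0 <= T -> 0 < K -> 0 < L -> 0 < eta ->
  (forall t : R, 0 <= t <= T -> [/\ is_derive t 1 x (v t), is_derive t 1 u (w t),
     `|v t| ^+ 2 <= K * w t & 0 <= u t <= L * w t]) ->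
  `|x T - x 0| <= K * u T / eta + L * eta.
Proof.
move=> T0 K0 L0 e0 H.
have := @decreasing_length n (fun t => x (T - t)) (fun t => - v (T - t)) (fun t => u (T - t))
  (fun t => w (T - t)) T K L eta T0 K0 L0 e0.
rewrite subrr subr0 distrC; apply => t /andP[t0 tT].
have [|dx du h1 h2] := H (T - t); first by rewrite subr_ge0 tT lerBlDr lerDl.
have ds : is_derive t 1 (fun s => T - s) (-1).
  by rewrite -[-1]add0r; apply: is_deriveB.
split => //; last by rewrite normrN.
  apply: DeriveDef.
    apply/derivable_mxP => i j; rewrite (ord1 i).
    have := @is_derive1_comp R _ _ t _ _ (is_derive_coord j dx) ds.
    by case.
  apply/rowP => j; rewrite derive_mx.
    rewrite mxE; have := @is_derive1_comp R _ _ t _ _ (is_derive_coord j dx) ds.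
    by case => _ ->; rewrite mulrN1 mxE.
  apply/derivable_mxP => i j'; rewrite (ord1 i).
  by have := @is_derive1_comp R _ _ t _ _ (is_derive_coord j' dx) ds; case.
have := @is_derive1_comp R _ _ t _ _ du ds; by rewrite mulrN1.
Qed.

(** The product of [h] with [exp (- a t)] does not decrease. *)
Lemma exponential_growth (h dh : R -> R) (a : R) : 
  (forall t : R, 0 <= t -> is_derive t 1 h (dh t) /\ a * h t <= dh t) ->
  forall t : R, 0 <= t -> expR (a * t) * h 0 <= h t.
Proof.
move=> H t t0.
have := @ndecr_of_derive (fun t => expR (- a * t) * h t)
  (fun t => expR (- a * t) * dh t + h t * (- a * expR (- a * t))) t t0.
rewrite mulr0 expR0 mul1r => K.
have : h 0 <= expR (- a * t) * h t.
  apply: K => s /andP[s0 _]; have [dhs le] := H s s0; split.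
    exact: is_derive_mul (is_derive_expRM (- a) s) dhs.
  have -> : expR (- a * s) * dh s + h s * (- a * expR (- a * s)) =
    expR (- a * s) * (dh s - a * h s) by ring.
  by rewrite mulr_ge0 ?expR_ge0// subr_ge0.
move=> le; have := ler_wpM2l (expR_ge0 (a * t)) le.
by rewrite mulrA -expRD mulNr subrr expR0 mul1r.
Qed.

Lemma unbounded_exponential (a b B : R) : 0 < a -> 0 < b ->
  exists2 t, 0 <= t & B < expR (a * t) * b.
Proof.
move=> a0 b0; exists (`|B| / (a * b)).
  by rewrite divr_ge0// mulr_ge0// ltW.
have h : a * (`|B| / (a * b)) * b = `|B| by field; rewrite !gt_eqF.
have : 1 + a * (`|B| / (a * b)) <= expR (a * (`|B| / (a * b))) by exact: expR_ge1Dx.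
move=> /(ler_wpM2r (ltW b0)); rewrite mulrDl mul1r h.
have := ler_norm B; lra.
Qed.

End gradient_dynamics.
Section cone.
Context {R : realType} {N : nat}.

(* [Q_c v = b (v A, v) - c b (v, v)] grows exponentially along the difference of
   two trajectories as long as both stay near [e]. *)
Variables (b : 'rV[R]_N -> 'rV[R]_N -> R) (A : 'M[R]_N).
Hypotheses (bl : forall a u v w, b (a *: u + v) w = a * b u w + b v w)
  (bC : forall u v, b u v = b v u) (bpos : forall v, v != 0 -> 0 < b v v)
  (bA : forall u v, b (u *m A) v = b u (v *m A)).

Lemma bform0 u : b 0 u = 0.
Proof. by have := bl 1 0 0 u; rewrite scale1r addr0 mul1r; lra. Qed.
Lemma bformD u v w : b (u + v) w = b u w + b v w.
Proof. by have := bl 1 u v w; rewrite scale1r mul1r. Qed.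
Lemma bformZ a u w : b (a *: u) w = a * b u w.
Proof. by have := bl a u 0 w; rewrite bform0 !addr0. Qed.
Lemma bformB u v w : b (u - v) w = b u w - b v w.
Proof. by rewrite bformD -scaleN1r bformZ mulN1r. Qed.
Lemma bformDr u v w : b u (v + w) = b u v + b u w.
Proof. by rewrite bC bformD !(bC u). Qed.
Lemma bformZr a u w : b u (a *: w) = a * b u w.
Proof. by rewrite bC bformZ bC. Qed.
Lemma bformBr u v w : b u (v - w) = b u v - b u w.
Proof. by rewrite bC bformB !(bC u). Qed.
Lemma bform_sum u n (F : 'I_n -> 'rV[R]_N) : b (\sum_i F i) u = \sum_i b (F i) u.
Proof.
by elim/big_rec2 : _ => [|i x y _ <-]; rewrite ?bform0// bformD.
Qed.

Lemma bform_bound : exists2 C, 0 < C & forall u v, `|b u v| <= C * `|u| * `|v|.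
Proof.
pose C := \sum_(i < N) \sum_(j < N) `|b (delta_mx 0 i) (delta_mx 0 j)|.
have C0 : 0 <= C by rewrite /C sumr_ge0// => i _; rewrite sumr_ge0.
exists (C + 1); first by rewrite ltr_wpDl.
move=> u v; rewrite -mulrA mulrDl mul1r.
suff : `|b u v| <= C * (`|u| * `|v|).
  have : 0 <= `|u| * `|v| by rewrite mulr_ge0.
  by lra.
rewrite {1}(row_sum_delta u) bform_sum (le_trans (ler_norm_sum _ _ _))//.
rewrite mulr_suml ler_sum// => i _.
rewrite bformZ bC {1}(row_sum_delta v) bform_sum normrM mulr_suml.
have : `|\sum_(j < N) b (v 0 j *: delta_mx 0 j) (delta_mx 0 i)| <=
   \sum_(j < N) `|b (delta_mx 0 i) (delta_mx 0 j)| * `|v|.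
  rewrite (le_trans (ler_norm_sum _ _ _))// ler_sum// => j _.
  by rewrite bformZ normrM mulrC bC ler_wpM2l// coord_norm_le.
move=> h; apply: (le_trans (ler_pM _ _ (coord_norm_le u i) h)) => //.
rewrite mulr_sumr ler_sum// => j _; rewrite mulrCA.
by rewrite ler_wpM2l.
Qed.

(** [k] is the minimum of the form on the unit sphere, which is compact; homogeneity gives the
    rest. *)
Lemma bform_pos : exists2 k, 0 < k & forall v, k * `|v| ^+ 2 <= b v v.
Proof.
have [C C0 HC] := bform_bound.
pose Sp := [set v : 'rV[R]_N | `|v| = 1].
have cS : compact Sp.
  apply: bounded_closed_compact.
    by exists 1; split; [exact: num_real|move=> x x1 v /= ->; exact: ltW].
  have -> : Sp = (fun v : 'rV[R]_N => `|v|) @^-1` [set 1 : R] by [].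
  by apply: preimage_closed => [v _|]; [exact: norm_continuous|exact: closed_eq].
have cb : continuous (fun v => b v v).
  move=> v; apply/(@continuous_normP R _ R^o) => e e0.
  pose B := `|v| + 1; have B0 : 0 < B by rewrite ltr_wpDl.
  have k0 : 0 < C * (2 * B + 1) by rewrite mulr_gt0// addr_gt0// mulr_gt0.
  have n1 := near_norm_le v (divr_gt0 e0 k0); have n2 := near_norm_le v (ltr01 : 0 < (1:R)).
  apply: filterS2 n1 n2 => u; rewrite ler_pdivlMr// => u1 u2.
  have -> : b u u - b v v = b (u - v) u + b v (u - v).
    by rewrite bformB bformBr addrA subrK.
  have nu : `|u| <= B by rewrite -[u](subrK v) addrC (le_trans (ler_normD _ _))// lerD2l.
  have nv : `|v| <= B by rewrite /B lerDl.
  rewrite (le_trans (ler_normD _ _))//; apply: (le_trans (lerD (HC _ _) (HC _ _))).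
  apply: le_trans u1; rewrite -!mulrA mulrCA [`|u - v| * _]mulrCA.
  have h1 : `|u - v| * `|u| <= `|u - v| * B by rewrite ler_wpM2l.
  have h2 : `|v| * `|u - v| <= B * `|u - v| by rewrite ler_wpM2r.
  have h3 := ler_wpM2l (ltW C0) h1; have h4 := ler_wpM2l (ltW C0) h2.
  have h5 : 0 <= C * `|u - v| by rewrite mulr_ge0// ltW.
  by move: h3 h4 h5; lra.
have hom v : v != 0 -> b v v = `|v| ^+ 2 * b (`|v|^-1 *: v) (`|v|^-1 *: v).
  by move=> v0; rewrite bformZ bformZr; field; rewrite normr_eq0.
have unitS v : v != 0 -> Sp (`|v|^-1 *: v).
  by move=> v0; rewrite /Sp /= normrZ ger0_norm ?invr_ge0// mulVf// normr_eq0.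
(* In dimension 0 the sphere is empty. *)
have [[w Sw]|S0] := pselect (Sp !=set0); last first.
  exists 1 => // v; have [->|v0] := eqVneq v 0; last by case: S0; exists (`|v|^-1 *: v); exact: unitS.
  by rewrite normr0 expr0n /= mulr0 bform0.
have [| |q] := @EVT_min_rV R N (fun v => b v v) Sp _ cS; first by exists w.
  by apply: continuous_subspaceT.
rewrite inE => Sq Hq; exists (b q q).
  apply: bpos; apply/eqP => q0; move: Sq; rewrite /Sp /= q0 normr0 => /esym/eqP.
  by rewrite oner_eq0.
move=> v; have [->|v0] := eqVneq v 0; first by rewrite normr0 expr0n /= mulr0 bform0.
rewrite (hom v v0) mulrC ler_wpM2l ?sqr_ge0//; apply: Hq; rewrite inE; exact: unitS.
Qed.

Variable c : R.
Hypotheses (c0 : 0 < c) (uc : A - c%:M \in unitmx).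

Definition cone_form (v : 'rV[R]_N) : R := b (v *m A) v - c * b v v.

(** Write [x] for the difference and [D = A - c]. The derivative of the form along [x] is [2 c]
    times the form, plus [2 b (x D, x D)], plus an error. As [D] is invertible, the middle term
    dominates the error; a positive initial value would grow exponentially, against the bound
    [B]. *)
Lemma cone_trapped : exists2 eps, 0 < eps & forall (x1 x2 v1 v2 : R -> 'rV[R]_N) (B : R),
  (forall t : R, 0 <= t -> [/\ is_derive t 1 x1 (v1 t), is_derive t 1 x2 (v2 t),
      `|(v2 t - v1 t) - (x2 t - x1 t) *m A| <= eps * `|x2 t - x1 t| &
      `|x2 t - x1 t| <= B]) ->
  cone_form (x2 0 - x1 0) <= 0.
Proof.
have [C C0 HC] := bform_bound; have [k k0 Hk] := bform_pos.
have [D D0 HD] := mulmx_norm_bound (invmx (A - c%:M)).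
have [F F0 HF] := mulmx_norm_bound (A - c%:M).
have NE v : v *m (A - c%:M) = v *m A - c *: v by rewrite mulmxBr mul_mx_scalar.
have cfE v : cone_form v = b (v *m (A - c%:M)) v by rewrite NE bformB bformZ.
have symN u w : b (u *m (A - c%:M)) w = b (w *m (A - c%:M)) u.
  by rewrite !NE !bformB !bformZ bA (bC u (w *m A)) (bC u w).
(* b (v N, v N) >= kap |v|^2 *)
pose kap := k / D ^+ 2; have kap0 : 0 < kap by rewrite divr_gt0// exprn_gt0.
have Hkap v : kap * `|v| ^+ 2 <= b (v *m (A - c%:M)) (v *m (A - c%:M)).
  apply: le_trans (Hk _); rewrite /kap -mulrA ler_wpM2l ?(ltW k0)//.
  rewrite mulrC ler_pdivrMr ?exprn_gt0// mulrC -exprMn ler_pXn2r// ?nnegrE ?mulr_ge0// ?(ltW D0)//.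
  by rewrite -{1}[v](mulmxK uc) HD.
exists (kap / (C * F)); first by rewrite divr_gt0// mulr_gt0.
move=> x1 x2 v1 v2 B H; rewrite leNgt; apply/negP => Q0.
pose x t := x2 t - x1 t; pose v t := v2 t - v1 t.
have dx (t : R) : 0 <= t -> is_derive t 1 x (v t) by move=> /H[d1 d2 _ _]; exact: is_deriveB.
have dQ (t : R) : 0 <= t -> is_derive t 1 (fun s => cone_form (x s)) (2 * b (x t *m (A - c%:M)) (v t)).
  move=> t0; have d := dx t t0.
  have [M HM] : exists M : 'M[R]_N, forall u w, b u w = \sum_i \sum_j u 0 i * w 0 j * M i j.
    exists (\matrix_(i, j) b (delta_mx 0 i) (delta_mx 0 j)) => u w.
    rewrite {1}(row_sum_delta u) bform_sum; apply: eq_bigr => i _.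
    rewrite bformZ bC {1}(row_sum_delta w) bform_sum mulr_sumr; apply: eq_bigr => j _.
    by rewrite bformZ bC mxE mulrA.
  have dN : forall j, is_derive t 1 (fun s => (x s *m (A - c%:M)) 0 j) ((v t *m (A - c%:M)) 0 j).
    move=> j; rewrite mxE.
    have -> : (fun s => (x s *m (A - c%:M)) 0 j) = fun s => \sum_i (x s 0 i * (A - c%:M) i j).
      by apply/funext => s; rewrite mxE.
    have := @is_derive_sum R R R N (fun i s => x s 0 i * (A - c%:M) i j) t 1
      (fun i => v t 0 i * (A - c%:M) i j).
    rewrite (_ : \sum_(i < N) (fun s => x s 0 i * (A - c%:M) i j) =
       (fun s => \sum_i (x s 0 i * (A - c%:M) i j))); last by apply/funext => s; rewrite fct_sumE.
    apply=> i; have := is_derive_mulC ((A - c%:M) i j) (is_derive_coord i d).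
    by rewrite mulrC (_ : (fun s : R => _) = fun s => x s 0 i * (A - c%:M) i j)//; apply/funext => s; rewrite mulrC.
  have -> : (fun s => cone_form (x s)) =
     fun s => \sum_i \sum_j ((x s *m (A - c%:M)) 0 i * x s 0 j * M i j).
    by apply/funext => s; rewrite cfE HM.
  have -> : 2 * b (x t *m (A - c%:M)) (v t) = \sum_i \sum_j
     ((x t *m (A - c%:M)) 0 i * v t 0 j + x t 0 j * (v t *m (A - c%:M)) 0 i) * M i j.
    have -> : 2 * b (x t *m (A - c%:M)) (v t) = b (x t *m (A - c%:M)) (v t) + b (v t *m (A - c%:M)) (x t).
      by rewrite mulr_natl mulr2n; congr (_ + _); exact: symN.
    rewrite !HM -big_split /=; apply: eq_bigr => i _; rewrite -big_split /=; apply: eq_bigr => j _.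
    by rewrite mulrDl; congr (_ + _); rewrite [x t 0 j * _]mulrC.
  have dsum n (g : 'I_n -> R -> R) dg : (forall i, is_derive t 1 (g i) (dg i)) ->
     is_derive t 1 (fun s => \sum_i g i s) (\sum_i dg i).
    move=> Hg; have := @is_derive_sum R R R n g t 1 dg Hg.
    by rewrite (_ : \sum_(i < n) g i = (fun s => \sum_i g i s))//; apply/funext => s; rewrite fct_sumE.
  apply: (dsum N) => i; apply: (dsum N) => j.
  have := is_derive_mulC (M i j) (is_derive_mul (dN i) (is_derive_coord j d)).
  rewrite mulrC (_ : (fun s : R => _) = fun s => (x s *m (A - c%:M)) 0 i * x s 0 j * M i j)//.
  by apply/funext => s; rewrite mulrC.
have grow := @exponential_growth R (fun s => cone_form (x s))
   (fun t => 2 * b (x t *m (A - c%:M)) (v t)) (2 * c).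
have {}grow : forall t : R, 0 <= t -> expR (2 * c * t) * cone_form (x 0) <= cone_form (x t).
  apply: grow => t t0; split; first exact: dQ.
  have [_ _ Her _] := H t t0; rewrite -/(x t) -/(v t) in Her.
  set er := v t - x t *m A in Her.
  have -> : v t = x t *m (A - c%:M) + c *: x t + er by rewrite NE subrK /er addrC subrK.
  clearbody er; rewrite !bformDr bformZr -cfE.
  have h1 := Hkap (x t).
  have h2 : `|b (x t *m (A - c%:M)) er| <= kap * `|x t| ^+ 2.
    apply: (le_trans (HC _ _)).
    have e1 : C * `|x t *m (A - c%:M)| * `|er| <= C * (F * `|x t|) * (kap / (C * F) * `|x t|).
      by apply: ler_pM => //; [rewrite mulr_ge0// ltW|rewrite ler_wpM2l// ltW].
    apply: (le_trans e1); rewrite le_eqVlt; apply/orP; left; apply/eqP; field.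
    by rewrite !gt_eqF.
  move: h2; rewrite ler_norml => /andP[h2 _]; rewrite !mulrDr mulrA; lra.
have [CA CA0 HCA] := mulmx_norm_bound A.
have [|t t0] := @unbounded_exponential R (2 * c) (cone_form (x 0)) (C * F * B ^+ 2) _ Q0.
  by rewrite mulr_gt0.
apply/negP; rewrite -leNgt; apply: (le_trans (grow t t0)).
have [_ _ _ xB] := H t t0; rewrite -/(x t) in xB.
rewrite cfE; apply: (le_trans (ler_norm _)); apply: (le_trans (HC _ _)).
rewrite -!mulrA ler_wpM2l ?(ltW C0)// expr2 [F * _]mulrA; apply: ler_pM => //.
by apply: (le_trans (HF _)); rewrite ler_wpM2l// ltW.
Qed.

End cone.

(** Only roots of the characteristic polynomial make [A - c] singular, and among the [N + 1]
    distinct values [c1 / (i + 2)] one is not a root. All of them lie below the Rayleigh quotient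
    [c1] of [w], so [w] is inside the cone. *)
Lemma cone_exists (R : realType) (N : nat) (b : 'rV[R]_N -> 'rV[R]_N -> R) (A : 'M[R]_N) w :
  (forall a u v w, b (a *: u + v) w = a * b u w + b v w) ->
  (forall v, v != 0 -> 0 < b v v) -> 0 < b (w *m A) w ->
  exists c, [/\ 0 < c, A - c%:M \in unitmx & 0 < cone_form b A c w].
Proof.
move=> bl bpos bw.
have w0 : w != 0.
  apply/eqP => w0; move: bw; rewrite w0 mul0mx.
  by have := bl 1 0 0 0; rewrite scale1r addr0 mul1r; lra.
pose c1 := b (w *m A) w / b w w; have c10 : 0 < c1 by rewrite divr_gt0// bpos.
pose s := [seq c1 / i.+2%:R | i <- iota 0 N.+1].
have us : uniq s.
  rewrite map_inj_uniq ?iota_uniq// => i j /(mulfI (lt0r_neq0 c10)) /invr_inj /eqP.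
  by rewrite eqr_nat eqSS eqSS => /eqP.
have [c cs nr] : exists2 c, c \in s & ~~ root (char_poly A) c.
  apply/hasP; rewrite has_predC; apply/negP => /(max_poly_roots (monic_neq0 (char_poly_monic A))) /(_ us).
  by rewrite size_map size_iota size_char_poly ltnn.
exists c; move: cs => /mapP[i _ cE].
have c0 : 0 < c by rewrite cE divr_gt0.
split => //.
  rewrite -row_free_unit -kermx_eq0; apply: contraR nr => kn.
  by rewrite -eigenvalue_root_char.
by rewrite /cone_form subr_gt0 -ltr_pdivlMr ?bpos// -/c1 cE ltr_pdivrMr// ltr_pMr// ltr1n.
Qed.

(** * Actions read in charts *)

Section schwarz.
Context {R : realType}.

Lemma second_difference (V : normedModType R) (f : V -> R^o) (x u v : V) (K e : R) :
  (forall s : R, 0 <= s <= 1 ->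
     [/\ differentiable f (x + s *: u), differentiable f (x + s *: u + v) &
     `|'d f (x + s *: u + v) u - 'd f (x + s *: u) u - K| <= e]) ->
  `|f (x + u + v) - f (x + u) - f (x + v) + f x - K| <= e.
Proof.
move=> H; pose g (s : R) : R := f (x + s *: u + v) - f (x + s *: u).
have dg (s : R) : 0 <= s <= 1 -> is_derive s 1 g ('d f (x + s *: u + v) u - 'd f (x + s *: u) u).
  move=> s01; have [d1 d2 _] := H s s01; apply: is_deriveB; last exact: diff_line d1.
  have d' : differentiable f (x + v + s *: u) by rewrite addrAC.
  have E : (fun s0 : R => f (x + s0 *: u + v)) = (fun s0 : R => f (x + v + s0 *: u)).
    by apply/funext => y; rewrite addrAC.
  by rewrite E [x + s *: u + v]addrAC; exact: diff_line d'.
have [| |c c01] := @MVT_segment R g (fun s => 'd f (x + s *: u + v) u - 'd f (x + s *: u) u) 0 1 ler01.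
- by move=> t; rewrite in_itv /= => /andP[t0 t1]; apply: dg; rewrite !ltW.
- apply: derivable_within_continuous => t; rewrite in_itv /= => t01.
  by have [] := dg t t01.
rewrite /g !scale1r !scale0r !addr0 subr0 mulr1 => E.
have -> : f (x + u + v) - f (x + u) - f (x + v) + f x = f (x + u + v) - f (x + u) - (f (x + v) - f x).
  by rewrite opprB !addrA addrAC.
rewrite E.
by move: c01; rewrite in_itv /= => c01; have [] := H c c01.
Qed.

(** The second difference of [f] along [h u] and [h v] is symmetric, and each mixed derivative times
    [h ^ 2] approximates it up to [e h ^ 2]. *)
Lemma schwarz_symmetry (V : normedModType R) (f : V -> R^o) (x u v : V) :
  Coo_at f x -> 'd (fun y => 'd f y u) x v = 'd (fun y => 'd f y v) x u.
Proof.
move=> Cf.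
have gen (h a b f0 w l1 l2 : R) : l1 = l2 + h * w ->
    h * a - h * b - h ^+ 2 * w = h * ((a - f0 - l1) - (b - f0 - l2)) by move=> ->; ring.
have side (u' v' : V) (e : R) : 0 < e -> \forall h \near (0 : R)^'+,
    `|f (x + h *: u' + h *: v') - f (x + h *: u') - f (x + h *: v') + f x
      - h ^+ 2 * 'd (fun y => 'd f y u') x v'| <= e * h ^+ 2.
  move=> e0; have Du := Coo_at_differentiable (Coo_at_diff u' Cf).
  pose M := 2 * `|u'| + `|v'| + 1.
  have M0 : 0 < M by rewrite ltr_wpDl// addr_ge0// mulr_ge0.
  have n1 := is_diff_eps Du (divr_gt0 e0 M0).
  have n2 : \forall y \near x, differentiable f y.
    by apply: filterS (Coo_at_near Cf) => y; exact: Coo_at_differentiable.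
  have n12 : \forall y \near x, `|'d f y u' - 'd f x u' - 'd (fun y => 'd f y u') x (y - x)|
      <= e / M * `|y - x| /\ differentiable f y by exact: filterI n1 n2.
  have /nbhs_ballP[r0 /= r00 Hr0] := n12.
  near=> h.
  have h0 : 0 < h by near: h; exact: nbhs_right_gt.
  have hs : h * M < r0.
    rewrite -ltr_pdivlMr//; near: h; apply: nbhs_right_lt; exact: divr_gt0.
  apply: second_difference => s /andP[s0 s1].
  have sh : `|s *: (h *: u')| <= h * `|u'|.
    by rewrite !normrZ (ger0_norm s0) (ger0_norm (ltW h0)) ler_piMl// mulr_ge0// ltW.
  have na : `|x + s *: (h *: u') + h *: v' - x| <= h * (`|u'| + `|v'|).
    have -> : x + s *: (h *: u') + h *: v' - x = s *: (h *: u') + h *: v'.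
      by rewrite -[x + _ + _]addrA [x + _]addrC addrK.
    by rewrite (le_trans (ler_normD _ _))// mulrDr lerD// normrZ (ger0_norm (ltW h0)).
  have nb : `|x + s *: (h *: u') - x| <= h * `|u'| by rewrite addrC addKr.
  have nn y : `|y - x| <= h * (`|u'| + `|v'|) -> ball x r0 y.
    move=> le; rewrite -ball_normE /ball_ /= distrC (le_lt_trans le)// (le_lt_trans _ hs)//.
    rewrite ler_pM2l// /M; have := normr_ge0 u'; lra.
  have [e1 d1] := Hr0 _ (nn _ na).
  have nb' : `|x + s *: (h *: u') - x| <= h * (`|u'| + `|v'|).
    by rewrite (le_trans nb)// ler_pM2l// lerDl.
  have [e2 d2] := Hr0 _ (nn _ nb').
  split => //.
  move: e1 e2; set a := x + _ + _; set b := x + s *: _ => e1 e2.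
  have ab : 'd (fun y => 'd f y u') x (a - x) =
     'd (fun y => 'd f y u') x (b - x) + h * 'd (fun y => 'd f y u') x v'.
    have -> : a - x = (b - x) + h *: v' by rewrite /a -/b addrAC.
    by rewrite linearD linearZ.
  have dZ y : 'd f y (h *: u') = h * 'd f y u' by exact: linearZ.
  rewrite !dZ; have -> : h * 'd f a u' - h * 'd f b u' - h ^+ 2 * 'd (fun y => 'd f y u') x v'
     = h * (('d f a u' - 'd f x u' - 'd (fun y => 'd f y u') x (a - x)) -
       ('d f b u' - 'd f x u' - 'd (fun y => 'd f y u') x (b - x))).
    exact: gen ab.
  rewrite normrM (ger0_norm (ltW h0)).
  have k : e / M * `|a - x| + e / M * `|b - x| <= e * h.
    rewrite -mulrDr -mulrA ler_pM2l//.
    rewrite mulrC ler_pdivrMr// (le_trans (lerD na nb))//.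
    rewrite -mulrDr ler_pM2l// /M; have := normr_ge0 u'; lra.
  have -> : e * h ^+ 2 = h * (e * h) by ring.
  by rewrite ler_pM2l// (le_trans _ k)// (le_trans (ler_normB _ _))// lerD.
apply/eqP; rewrite -subr_eq0 -normr_le0; apply/ler_addgt0Pl => e e0; rewrite addr0.
have e20 : 0 < e / 2 by rewrite divr_gt0.
apply: (@filter_const _ (0 : R)^'+).
apply: filterS3 (nbhs_right_gt (0 : R)) (side u v _ e20) (side v u _ e20) => h h0 s1 s2.
have hh : 0 < h ^+ 2 by rewrite exprn_gt0.
rewrite -(ler_pM2l hh) -{1}(ger0_norm (ltW hh)) -normrM.
set A := 'd _ x v in s1 *; set B := 'd _ x u in s2 *.
rewrite [x + h *: v + _]addrAC [f (x + h *: u + h *: v) - f (x + h *: v) - _]addrAC in s2.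
move: s1 s2; set Q := f (x + h *: u + h *: v) - _ - _ + _ => s1 s2.
have -> : h ^+ 2 * (A - B) = (Q - h ^+ 2 * B) - (Q - h ^+ 2 * A) by ring.
rewrite (le_trans (ler_normB _ _))// (le_trans (lerD s2 s1))//.
by rewrite -mulrDl mulrC -splitr.
Unshelve. all: by end_near.
Qed.
End schwarz.

Section action.
Context {R : realType} {k N : nat} (L : lie_space 'rV[R]_k) (Z : charted_space 'rV[R]_N).
Hypotheses (LL : lieg L) (mZ : mfld Z).
Variable act : L -> Z -> Z.
Hypotheses (act1 : forall z, act (lie_one L) z = z)
  (actM : forall g h z, act (lie_mul g h) z = act g (act h z))
  (sact : forall p, smat ((fun p => act p.1 p.2) : prod_space L Z -> Z) p).
Let mL := lie_mfld LL.
Let mR : mfld (euclid R^o) := euclid_mfld (@findim_Ro R).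

Lemma smat_act (E : normedModType R) (X : charted_space E) (mX : mfld X)
  (f : X -> L) (g : X -> Z) x : smat f x -> smat g x -> smat (fun x => act (f x) (g x)) x.
Proof.
by move=> sf sg; exact: (smat_comp mX (prod_mfld mL mZ) (smat_pair sf sg) (sact _)).
Qed.

Lemma smat_act_pt g z : smat (act g) z.
Proof. exact: (smat_act mZ (smat_cst g z) (smat_id mZ z)). Qed.

Lemma smat_orbit h z : smat (fun g => act g z) h.
Proof. exact: (smat_act mL (smat_id mL h) (smat_cst z h)). Qed.

(** The differential of the orbit map at the identity: linear in [xi] by construction, and defined
    without reference to [lie_exp]. [fundamental_orbit] identifies it with [fundamental_field] on
    [p]. *)
Definition orbit_field (xi : 'rV[R]_k) (z : Z) : 'rV[R]_N :=
  tangent_map (fun g => act g z) (lie_one L) xi.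

Variables (xi : 'rV[R]_k) (g : R -> L).
Hypothesis Hg : one_param_diff xi g.

Lemma orbit_curve z t : mdiff ((fun s => act (g s) z) : euclid R^o -> Z) t /\
  tangent_map ((fun s => act (g s) z) : euclid R^o -> Z) t 1 = orbit_field xi (act (g t) z).
Proof.
have [hg dg tg] := Hg; rewrite /orbit_field -tg -(one_param0 LL Hg).
have := @curve_translate R _ _ L Z mL g (fun h => act h (act (g t) z))
  (fun s => act (g s) z) t dg (smat_orbit _ _).
by apply => s; rewrite -actM -hg subrK.
Qed.

(** The flow preserves its own field; a zero of the field is therefore fixed for all times, as
    [fixed_of_field0] concludes. *)
Lemma orbit_curve_pushed z t : tangent_map ((fun s => act (g s) z) : euclid R^o -> Z) t 1 =
  tangent_map (act (g t)) z (orbit_field xi z).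
Proof.
have [d0 t0] := orbit_curve z 0; have [hg _ _] := Hg.
rewrite (one_param0 LL Hg) act1 in t0; rewrite -t0.
have := @curve_translate R _ _ Z Z mZ (fun s => act (g s) z) (act (g t))
  (fun s => act (g s) z) t d0 (smat_act_pt _ _).
rewrite (one_param0 LL Hg) act1 => h.
by have [|_ ->] := h _ => // s; rewrite -actM -hg addrC subrK.
Qed.

Lemma orbit_derive (E : normedModType R) (F : Z -> E) z t :
  findim E -> smat (F : Z -> euclid E) (act (g t) z) ->
  is_derive t 1 (fun s => F (act (g s) z))
    (tangent_map (F : Z -> euclid E) (act (g t) z) (orbit_field xi (act (g t) z))).
Proof.
move=> fE sF; have [d ->] : mdiff ((fun s => act (g s) z) : euclid R^o -> Z) t /\
    orbit_field xi (act (g t) z) = tangent_map ((fun s => act (g s) z) : euclid R^o -> Z) t 1.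
  by have [d ->] := orbit_curve z t.
have [[_ dd] T] := mdiff_comp mR mZ d (smat_mdiff sF).
rewrite -T; have D : differentiable ((fun s => F (act (g s) z)) : R^o -> E) t by exact: dd.
apply: DeriveDef; first exact: diff_derivable.
by rewrite deriveE.
Qed.

Lemma fixed_of_field0 z : orbit_field xi z = 0 -> forall t, act (g t) z = z.
Proof.
move=> V0 t; rewrite -[RHS]act1 -(one_param0 LL Hg).
apply: (@mdiff_curve_constant R N Z mZ (fun s => act (g s) z)) => s.
  by have [] := orbit_curve z s.
by rewrite orbit_curve_pushed V0 tangent0.
Qed.

Section chart.
Variable p : Z.
Let phi := chart_at p.
Let e := cfwd phi p.
Let cp : is_chart phi := chart_at_is mZ p.
Let dp : cdom phi p := dom_at mZ p.
Let ap : atlas phi := atlas_at mZ p.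

Definition chart_field (x : 'rV[R]_N) : 'rV[R]_N :=
  tangent_map (cfwd phi : Z -> euclid 'rV[R]_N) (cbwd phi x) (orbit_field xi (cbwd phi x)).

Lemma orbit_chart_derive z t : cdom phi (act (g t) z) ->
  is_derive t 1 (fun s => cfwd phi (act (g s) z)) (chart_field (cfwd phi (act (g t) z))).
Proof.
move=> d; rewrite /chart_field (chart_cbwdK cp d).
apply: orbit_derive; first exact: findim_rV.
exact: (smat_cfwd mZ ap d).
Qed.

Lemma chart_field_inv x : (cfwd phi @` cdom phi) x ->
  tangent_map (cbwd phi : euclid 'rV[R]_N -> Z) x (chart_field x) = orbit_field xi (cbwd phi x).
Proof.
move=> ix; have [dx ex] := chart_imgP cp ix.
have mE : mfld (euclid 'rV[R]_N) by exact/euclid_mfld/findim_rV.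
have s1 := smat_cfwd mZ ap dx.
have s2 : smat (cbwd phi : euclid 'rV[R]_N -> Z) (cfwd phi (cbwd phi x)).
  by rewrite ex; exact: smat_cbwd.
have T := tangent_comp mZ mE (orbit_field xi (cbwd phi x)) s1 s2.
rewrite ex in T; rewrite -T.
have n : \forall z \near cbwd phi x, id z = (cbwd phi \o cfwd phi) z.
  by apply: filterS (near_dom cp dx) => z dz /=; rewrite (chart_cbwdK cp dz).
have [_ ->] := mdiff_eq mZ n (smat_mdiff (smat_id mZ _)).
by rewrite tangent_id.
Qed.

End chart.
End action.

Section partial_diff.
Context {R : realType}.
Implicit Types U V W : normedModType R.

Lemma near_eq_diffE U V (f g : U -> V) x w : (\forall y \near x, f y = g y) ->
  differentiable f x -> 'd f x w = 'd g x w.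
Proof. by move=> fg df; have [_ E] := near_eq_diff fg df; exact: (esym (congr1 (fun h => h w) E)). Qed.

Lemma norm_inr U V (v : V) : `|(0 : U, v)| = `|v|.
Proof. by rewrite prod_normE /= normr0 (max_idPr _). Qed.

Lemma norm_inl U V (v : U) : `|(v, 0 : V)| = `|v|.
Proof. by rewrite prod_normE /= normr0 (max_idPl _). Qed.

Lemma is_diffE U V (f df : U -> V) x : is_diff x f df ->
  differentiable f x /\ forall v, 'd f x v = df v.
Proof. by case=> d e; split => // v; rewrite -e. Qed.

Lemma inr_linear U V : linear (fun v : V => (0 : U, v)).
Proof.
move=> a u v; rewrite -[RHS]/(a *: (0 : U) + 0, a *: u + v); congr pair.
by rewrite scaler0 addr0.
Qed.

Lemma inl_linear U V : linear (fun v : U => (v, 0 : V)).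
Proof.
move=> a u v; rewrite -[RHS]/(a *: u + v, a *: (0 : V) + 0); congr pair.
by rewrite scaler0 addr0.
Qed.

Lemma Coo_at_pairl U V (y : U) (x : V) : Coo_at (fun z => (y, z)) x.
Proof. exact: (Coo_at_pair (Coo_at_cst y x) (Coo_at_id x)). Qed.

Lemma Coo_at_pairr U V (y : U) (x : V) : Coo_at (fun z => (z, x)) y.
Proof. exact: (Coo_at_pair (Coo_at_id y) (Coo_at_cst x y)). Qed.

Lemma near_pairr U V (y : U) (x : V) (P : set (U * V)) : (\forall q \near (y, x), P q) ->
  \forall z \near x, P (y, z).
Proof.
by move=> H; have c := Coo_at_continuous (Coo_at_pairl y x); exact: c H.
Qed.

Lemma near_pairl U V (y : U) (x : V) (P : set (U * V)) : (\forall q \near (y, x), P q) ->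
  \forall z \near y, P (z, x).
Proof.
by move=> H; have c := Coo_at_continuous (Coo_at_pairr y x); exact: c H.
Qed.

Lemma is_diff_snd U V W (F : U * V -> W) (y : U) (x : V) : differentiable F (y, x) ->
  differentiable (fun z => F (y, z)) x /\ forall v, 'd (fun z => F (y, z)) x v = 'd F (y, x) (0, v).
Proof.
move=> dF.
have lin : linear (fun v : V => 'd F (y, x) (0, v)).
  by move=> a u v; rewrite -linearP; congr ('d F (y, x) _); exact: inr_linear.
pose L := mklin lin.
suff D : is_diff x (fun z => F (y, z)) L.
  by have [d E] := is_diffE D; split=> // v; rewrite E.
apply/is_diff_epsP; split => [v|e e0].
  apply: (@continuous_comp _ _ _ (fun v : V => (0 : U, v)) ('d F (y, x))); last exact: diff_continuous.
  exact: (Coo_at_continuous (Coo_at_pairl (0 : U) v)).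
have := near_pairr (is_diff_eps dF e0); apply: filterS => z /=.
by rewrite -[(y, z) - (y, x)]/(y - y, z - x) subrr norm_inr.
Qed.

Lemma is_diff_fst U V W (F : U * V -> W) (y : U) (x : V) : differentiable F (y, x) ->
  differentiable (fun z => F (z, x)) y /\ forall v, 'd (fun z => F (z, x)) y v = 'd F (y, x) (v, 0).
Proof.
move=> dF.
have lin : linear (fun v : U => 'd F (y, x) (v, 0)).
  by move=> a u v; rewrite -linearP; congr ('d F (y, x) _); exact: inl_linear.
pose L := mklin lin.
suff D : is_diff y (fun z => F (z, x)) L.
  by have [d E] := is_diffE D; split=> // v; rewrite E.
apply/is_diff_epsP; split => [v|e e0].
  apply: (@continuous_comp _ _ _ (fun v : U => (v, 0 : V)) ('d F (y, x))); last exact: diff_continuous.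
  exact: (Coo_at_continuous (Coo_at_pairr v (0 : V))).
have := near_pairl (is_diff_eps dF e0); apply: filterS => z /=.
by rewrite -[(z, x) - (y, x)]/(z - y, x - x) subrr norm_inl.
Qed.

Lemma schwarz_symmetry_rV V n (f : V -> 'rV[R]_n) (x u v : V) :
  Coo_at f x -> 'd (fun y => 'd f y u) x v = 'd (fun y => 'd f y v) x u.
Proof.
move=> Cf; apply/rowP => i.
have dc (g : V -> 'rV[R]_n) y w : differentiable g y ->
    differentiable (fun z => g z 0 i : R^o) y /\ 'd (fun z => g z 0 i : R^o) y w = 'd g y w 0 i.
  move=> dg; have D : is_diff y (rV_coord i \o g) (rV_coord i \o 'd g y).
    have h1 : is_diff y g ('d g y) by apply/differentiableP.
    have cc : continuous (rV_coord i : 'rV[R]_n -> R^o) by exact: findim_continuous (findim_rV _).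
    have h2 : is_diff (g y) (rV_coord i) (rV_coord i).
      by apply: DiffDef; [exact: linear_differentiable|exact: diff_lin].
    exact: is_diff_comp.
  by have [dd E] := is_diffE D; split=> //; rewrite E.
have di (w z : V) : 'd (fun y => 'd f y w) x z 0 i = 'd (fun y => 'd (fun z => f z 0 i : R^o) y w) x z.
  have [D <-] := dc _ _ z (Coo_at_differentiable (Coo_at_diff w Cf)).
  have n1 : \forall y \near x, ('d f y w 0 i : R^o) = 'd (fun z => f z 0 i : R^o) y w.
    by apply: filterS (Coo_at_near Cf) => y /Coo_at_differentiable df; have [_ ->] := dc _ _ w df.
  exact: near_eq_diffE n1 D.
rewrite !di; apply: schwarz_symmetry.
have C2 : Coo_at (rV_coord i : 'rV[R]_n -> R^o) (f x).
  by apply: Coo_at_linear; exact: findim_continuous (findim_rV _).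
exact: (Coo_at_comp (findim_rV n) Cf C2).
Qed.
End partial_diff.

Section action_charts.
Context {R : realType} {k N : nat} (L : lie_space 'rV[R]_k) (Z : charted_space 'rV[R]_N).
Hypotheses (LL : lieg L) (mZ : mfld Z).
Variable act : L -> Z -> Z.
Hypotheses (act1 : forall z, act (lie_one L) z = z)
  (actM : forall g h z, act (lie_mul g h) z = act g (act h z))
  (sact : forall p, smat ((fun p => act p.1 p.2) : prod_space L Z -> Z) p).
Let mL := lie_mfld LL.

Definition act_chart (chi : chart 'rV[R]_k L) (phi psi : chart 'rV[R]_N Z)
  (q : 'rV[R]_k * 'rV[R]_N) : 'rV[R]_N := cfwd psi (act (cbwd chi q.1) (cbwd phi q.2)).

Lemma act_chart_smat chi phi y x : atlas chi -> atlas phi ->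
  (cfwd chi @` cdom chi) y -> (cfwd phi @` cdom phi) x ->
  smat ((fun q => act (cbwd chi q.1) (cbwd phi q.2)) : euclid ('rV[R]_k * 'rV[R]_N)%type -> Z) (y, x).
Proof.
move=> achi aphi iy ix.
have fP : findim ('rV[R]_k * 'rV[R]_N)%type by exact/findim_prod/findim_rV/findim_rV.
have mP := euclid_mfld fP.
apply: (smat_act LL mZ sact mP).
- apply: (smat_comp mP (euclid_mfld (findim_rV k)) (f := (fst : euclid ('rV[R]_k * 'rV[R]_N)%type -> euclid 'rV[R]_k))).
    apply/(smat_euclidP _ _ fP (findim_rV k)); exact: (Coo_at_fst (Coo_at_id (y, x))).
  exact: (smat_cbwd mL achi).
- apply: (smat_comp mP (euclid_mfld (findim_rV N)) (f := (snd : euclid ('rV[R]_k * 'rV[R]_N)%type -> euclid 'rV[R]_N))).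
    apply/(smat_euclidP _ _ fP (findim_rV N)); exact: (Coo_at_snd (Coo_at_id (y, x))).
  exact: (smat_cbwd mZ aphi).
Qed.

Lemma act_chart_Coo chi phi psi y x : atlas chi -> atlas phi -> atlas psi ->
  (cfwd chi @` cdom chi) y -> (cfwd phi @` cdom phi) x ->
  cdom psi (act (cbwd chi y) (cbwd phi x)) -> Coo_at (act_chart chi phi psi) (y, x).
Proof.
move=> achi aphi apsi iy ix d.
have fP : findim ('rV[R]_k * 'rV[R]_N)%type by exact/findim_prod/findim_rV/findim_rV.
apply/(smat_euclidP _ _ fP (findim_rV N)).
by apply: (smat_comp (euclid_mfld fP) mZ (act_chart_smat achi aphi iy ix)); exact: (smat_cfwd mZ apsi).
Qed.

Variable p : Z.
Let phi := chart_at p.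
Let e := cfwd phi p.
Let cp : is_chart phi := chart_at_is mZ p.
Let dp : cdom phi p := dom_at mZ p.
Let ap : atlas phi := atlas_at mZ p.
Let chi := chart_at (lie_one L).
Let c1 : is_chart chi := chart_at_is mL (lie_one L).
Let d1 : cdom chi (lie_one L) := dom_at mL (lie_one L).

(** As a partial derivative of the smooth map [act_chart] in the group variable, the field is smooth
    in [x]. *)
Lemma chart_field_partial xi x : (cfwd phi @` cdom phi) x ->
  chart_field act xi p x = 'd (act_chart chi phi phi) (cfwd chi (lie_one L), x) (xi, 0).
Proof.
move=> ix; have [dx ex] := chart_imgP cp ix.
have d : cdom phi (act (cbwd chi (cfwd chi (lie_one L))) (cbwd phi x)).
  by rewrite (chart_cbwdK c1 d1) act1.
have C := act_chart_Coo (atlas_at mL _) ap ap (chart_img d1) ix d.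
have [_ <-] := is_diff_fst (Coo_at_differentiable C).
have s2 : smat (cfwd phi : Z -> euclid 'rV[R]_N) (act (lie_one L) (cbwd phi x)).
  by rewrite act1; exact: (smat_cfwd mZ ap dx).
have T := tangent_comp mL mZ xi (smat_orbit LL mZ sact (lie_one L) (cbwd phi x)) s2.
by rewrite act1 in T; rewrite /chart_field /orbit_field -T.
Qed.

Lemma chart_field_Coo xi x : (cfwd phi @` cdom phi) x -> Coo_at (chart_field act xi p) x.
Proof.
move=> ix; have [dx ex] := chart_imgP cp ix.
have d : cdom phi (act (cbwd chi (cfwd chi (lie_one L))) (cbwd phi x)).
  by rewrite (chart_cbwdK c1 d1) act1.
have C := act_chart_Coo (atlas_at mL _) ap ap (chart_img d1) ix d.
apply: (@Coo_at_eq _ _ _ (fun x => 'd (act_chart chi phi phi) (cfwd chi (lie_one L), x) (xi, 0))).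
  by apply: filterS (near_img cp ix) => z iz; rewrite chart_field_partial.
exact: (Coo_at_comp (findim_prod (findim_rV k) (findim_rV N)) (Coo_at_pairl (cfwd chi (lie_one L)) x)
  (Coo_at_diff (xi, 0) C)).
Qed.

End action_charts.
Section derive_comp.
Context {R : realType}.

Lemma is_derive_comp (V W : normedModType R) (x : R -> V) (F : V -> W) (t : R) v :
  is_derive t 1 x v -> differentiable F (x t) ->
  is_derive t 1 (fun s => F (x s)) ('d F (x t) v).
Proof.
move=> [dx ex] dF; have dx' : differentiable (x : R^o -> V) t by exact/derivable1_diffP.
have e' : 'd (x : R^o -> V) t 1 = v by rewrite -deriveE.
have dc : differentiable ((F \o x) : R^o -> W) t by exact: differentiable_comp.
apply: DeriveDef; first exact/derivable1_diffP.
rewrite deriveE//.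
have D := @diff_comp _ _ _ _ x F t dx' dF.
by rewrite (congr1 (fun h => h (1 : R^o)) D) /= e'.
Qed.

Lemma is_derive_linear (V W : normedModType R) (x : R -> V) (L : {linear V -> W}) (t : R) v :
  findim V -> is_derive t 1 x v -> is_derive t 1 (fun s => L (x s)) (L v).
Proof.
move=> fV dx; have cL : continuous L by exact: findim_continuous.
have := is_derive_comp dx (linear_differentiable (x t) cL).
by rewrite diff_lin.
Qed.

Lemma is_derive_mulmx_coord n m (x : R -> 'rV[R]_n) (P : 'M[R]_(n, m)) j (t : R) v :
  is_derive t 1 x v -> is_derive t 1 (fun s => (x s *m P) 0 j) ((v *m P) 0 j).
Proof.
move=> dx; pose L : {linear 'rV[R]_n -> 'rV[R]_m} := mulmxr P.
exact: is_derive_coord (is_derive_linear L (findim_rV n) dx).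
Qed.

Lemma is_derive_shift (V : normedModType R) (x : R -> V) (s : R) v :
  is_derive (0 : R) 1 x v -> is_derive s 1 (fun t => x (t - s)) v.
Proof.
move=> [dx ex]; have d1 : is_derive s 1 (fun t : R => t - s) 1.
  have := @is_deriveB R R^o R^o id (cst s) s 1 1 0 (is_derive_id _ _) (is_derive_cst _ _ _).
  by rewrite subr0.
have dx' : differentiable (x : R^o -> V) (s - s) by rewrite subrr; exact/derivable1_diffP.
have := is_derive_comp d1 dx'; rewrite subrr -deriveE ?ex//.
exact/derivable1_diffP.
Qed.

Lemma is_derive0_constant (h : R -> R) (T : R) : 0 <= T ->
  (forall t : R, 0 <= t <= T -> is_derive t 1 h 0) -> h T = h 0.
Proof.
move=> T0 H; apply/eqP; rewrite eq_le; apply/andP; split.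
  by apply: (@nincr_of_derive R h (fun _ => 0) T T0) => t /H.
by apply: (@ndecr_of_derive R h (fun _ => 0) T T0) => t /H.
Qed.

End derive_comp.

Lemma dist_le_split {R : realType} (V : normedModType R) (x y a b c : V) (K : R) :
  x = a -> y = b -> `|a - c| <= K / 2 -> `|b - c| <= K / 2 -> `|x - y| <= K.
Proof.
move=> -> -> h1 h2; have -> : a - b = (a - c) - (b - c) by rewrite opprB addrA subrK.
by rewrite (le_trans (ler_normB _ _))// [leRHS]splitr lerD.
Qed.

(** * Fixed points of compact one-parameter groups *)

Section compact_fixed_point.
Context {R : realType} {k N : nat} (U : lie_space 'rV[R]_k) (Z : charted_space 'rV[R]_N).
Hypotheses (LU : lieg U) (mZ : mfld Z) (hZ : hausdorff_space Z) (cU : compact [set: U]).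
Variable a : U -> Z -> Z.
Hypotheses (a1 : forall z, a (lie_one U) z = z)
  (aM : forall g h z, a (lie_mul g h) z = a g (a h z))
  (sa : forall p, smat ((fun p => a p.1 p.2) : prod_space U Z -> Z) p).
Variables (xi : 'rV[R]_k) (g : R -> U) (p : Z).
Hypotheses (Hg : one_param_diff xi g) (p0 : orbit_field a xi p = 0).
Let mU := lie_mfld LU.
Let phi := chart_at p.
Let e := cfwd phi p.
Let cp : is_chart phi := chart_at_is mZ p.
Let dp : cdom phi p := dom_at mZ p.
Let ap : atlas phi := atlas_at mZ p.
Let W := chart_field a xi p.

Definition act_at (u : U) (x : 'rV[R]_N) : 'rV[R]_N := cfwd phi (a u (cbwd phi x)).

Lemma act_at_chart (chi : chart 'rV[R]_k U) u x : is_chart chi -> cdom chi u ->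
  act_at u x = act_chart a chi phi phi (cfwd chi u, x).
Proof. by move=> cc du; rewrite /act_chart /= chart_cbwdK. Qed.

(** The stabilizer of [p] is closed in [U], hence compact, and the estimates that hold near each of
    its elements become uniform. This is the point where compactness of [U] enters the local
    analysis. *)
Lemma uniform_stabilizer eps : 0 < eps -> \forall x \near e, forall u, a u p = p ->
  [/\ cdom phi (a u (cbwd phi x)), `|act_at u x - e| <= 1, differentiable (act_at u) x &
      forall v, `|'d (act_at u) x v - 'd (act_at u) e v| <= eps * `|v|].
Proof.
move=> eps0; pose St := [set u | a u p = p].
have cSt : compact St.
  apply: (subclosed_compact _ cU) => //.
  apply: (@preimage_closed _ _ (fun u => a u p) [set p]).
    by move=> u _; have [] := smat_orbit LU mZ sa u p.
  exact: compact_closed hZ (@compact_set1 _ p).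
have := (compact_near_coveringP St).1 cSt _ (nbhs e) (fun x u =>
  [/\ cdom phi (a u (cbwd phi x)), `|act_at u x - e| <= 1, differentiable (act_at u) x &
      forall v, `|'d (act_at u) x v - 'd (act_at u) e v| <= eps * `|v|]).
move=> /(_ (nbhs_filter e)) H; apply: H.
move=> u0 Su0; pose chi := chart_at u0.
have cc : is_chart chi := chart_at_is mU u0.
have du := dom_at mU u0; have ac := atlas_at mU u0.
pose F := act_chart a chi phi phi; pose q0 := (cfwd chi u0, e).
have fP : findim ('rV[R]_k * 'rV[R]_N)%type by exact/findim_prod/findim_rV/findim_rV.
have sm := act_chart_smat LU mZ sa ac ap (chart_img du) (chart_img dp).
have E0 : a (cbwd chi q0.1) (cbwd phi q0.2) = p.
  by rewrite /q0 /= (chart_cbwdK cc du) (chart_cbwdK cp dp).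
have d0 : cdom phi (a (cbwd chi q0.1) (cbwd phi q0.2)) by rewrite E0.
have CF : Coo_at F q0 := act_chart_Coo LU mZ sa ac ap ap (chart_img du) (chart_img dp) d0.
have F0 : F q0 = e by rewrite /F /act_chart E0.
have [c0 _] := sm.
have n1 : \forall q \near q0, cdom phi (a (cbwd chi q.1) (cbwd phi q.2)).
  by apply: c0; exact: (near_dom cp d0).
have n2 : \forall q \near q0, `|F q - e| <= 1.
  have := Coo_at_continuous CF; rewrite continuous_normP => /(_ 1 ltr01).
  by rewrite F0.
have n3 : \forall q \near q0, differentiable F q.
  by apply: filterS (Coo_at_near CF) => q; exact: Coo_at_differentiable.
have n4 : \forall q \near q0, forall v, `|'d F q v - 'd F q0 v| <= eps / 2 * `|v|.
  have [A [oA Ax fA]] := CF; exact: (C1_diff_near fP oA Ax (fA 1%N) (divr_gt0 eps0 (ltr0Sn R 1))).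
have [[A B] /= [nA nB] AB] : \forall q \near q0, [/\ cdom phi (a (cbwd chi q.1) (cbwd phi q.2)),
    `|F q - e| <= 1, differentiable F q & forall v, `|'d F q v - 'd F q0 v| <= eps / 2 * `|v|].
  by apply: filterS2 (filterI n1 n2) (filterI n3 n4) => q [? ?] [].
exists ([set u | cdom chi u /\ A (cfwd chi u)], B).
  split => //=; apply: filterI; first exact: near_dom.
  exact: (near_cfwd cc du nA).
move=> [u x] /= [[dcu Au] Bx].
have E : act_at u = (fun x => F (cfwd chi u, x)) by apply/funext => z; exact: act_at_chart.
have [h1 h2 h3 h4] := AB (cfwd chi u, x) (conj Au Bx).
have [_ _ h3' h4'] := AB (cfwd chi u, e) (conj Au (nbhs_singleton nB)).
rewrite E; have [D1 D2] := is_diff_snd h3; have [_ D2'] := is_diff_snd h3'.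
split => //; first by move: h1; rewrite /= (chart_cbwdK cc dcu).
move=> v; have k1 := h4 (0, v); have k2 := h4' (0, v).
rewrite norm_inr mulrAC in k1; rewrite norm_inr mulrAC in k2.
exact: dist_le_split (D2 v) (D2' v) k1 k2.
Qed.

Let fixg t : a (g t) p = p := fixed_of_field0 LU mZ a1 aM sa Hg p0 t.

Lemma act_at_e u : a u p = p -> act_at u e = e.
Proof. by rewrite /act_at (chart_cbwdK cp dp) => ->. Qed.

Lemma act_atM u v x : cdom phi (a v (cbwd phi x)) ->
  act_at (lie_mul u v) x = act_at u (act_at v x).
Proof. by move=> d; rewrite /act_at aM (chart_cbwdK cp d). Qed.

Variable S : 'M[R]_N.
Hypothesis HS : forall v, v *m S = 'd W e v.

(** Symmetry of second derivatives exchanges time and space, so the linearized flow at the fixed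
    point is generated by the derivative [S] of the field. *)
Lemma diff_flow_derive w : is_derive (0 : R) 1 (fun h => 'd (act_at (g h)) e w) (w *m S).
Proof.
pose chi := chart_at (lie_one U); pose F := act_chart a chi phi phi.
have c1 : is_chart chi := chart_at_is mU _; have d1 : cdom chi (lie_one U) := dom_at mU _.
pose y0 := cfwd chi (lie_one U).
have [hg [cg dg] tg] := Hg; have g0 := one_param0 LU Hg.
have d0 : cdom phi (a (cbwd chi y0) (cbwd phi e)).
  by rewrite (chart_cbwdK c1 d1) (chart_cbwdK cp dp) a1.
have CF : Coo_at F (y0, e) :=
  act_chart_Coo LU mZ sa (atlas_at mU _) ap ap (chart_img d1) (chart_img dp) d0.
have fP : findim ('rV[R]_k * 'rV[R]_N)%type by exact/findim_prod/findim_rV/findim_rV.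
pose x (h : R) := cfwd chi (g h).
have dx : is_derive (0 : R) 1 x xi.
  have dg' : differentiable (x : R^o -> 'rV[R]_k) 0.
    by move: dg; rewrite /loc g0; exact.
  apply: DeriveDef; first exact/derivable1_diffP.
  have E : 'd (x : R^o -> 'rV[R]_k) 0 1 = xi by move: tg; rewrite /tangent_map g0; exact.
  by rewrite deriveE; [exact: E|exact: dg'].
pose K (y : 'rV[R]_k) := 'd F (y, e) (0, w).
have CK : Coo_at K y0 := Coo_at_comp fP (Coo_at_pairr y0 e) (Coo_at_diff (0, w) CF).
have x0 : x 0 = y0 by rewrite /x g0.
have dK : differentiable K (x 0) by rewrite x0; exact: Coo_at_differentiable.
have := is_derive_comp dx dK; rewrite x0.
have -> : 'd K y0 xi = w *m S.
  have [_ ->] := is_diff_fst (Coo_at_differentiable (Coo_at_diff (0, w) CF)).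
  rewrite schwarz_symmetry_rV// HS.
  have [D ED] := is_diff_snd (Coo_at_differentiable (Coo_at_diff (xi, 0) CF)).
  rewrite -ED; have n : \forall x \near e, 'd F (y0, x) (xi, 0) = W x.
    by apply: filterS (near_img cp (chart_img dp)) => z iz; rewrite /W (chart_field_partial LU mZ a1 sa).
  exact: near_eq_diffE n D.
have n3 : \forall y \near x 0, differentiable F (y, e).
  rewrite x0; apply: (near_pairl (P := fun q => differentiable F q)).
  by apply: filterS (Coo_at_near CF) => q; exact: Coo_at_differentiable.
have cx : {for (0 : R^o), continuous (x : R^o -> 'rV[R]_k)}.
  by have [d _] := dx; apply: differentiable_continuous; exact/derivable1_diffP.
have n : \forall h \near (0 : R^o), K (x h) = 'd (act_at (g h)) e w.
  have n4 : \forall h \near (0 : R^o), differentiable F (x h, e) := cx _ n3; have n5 : \forall h \near (0 : R^o), cdom chi (g h).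
    by apply: cg; rewrite g0; exact: (near_dom c1).
  apply: filterS2 n4 n5 => h d dc.
  have E : act_at (g h) = (fun z => F (x h, z)) by apply/funext => z; exact: act_at_chart.
  by rewrite E; have [_ ->] := is_diff_snd d.
by move=> D; exact: (near_eq_is_derive n D).
Qed.

(** The linearized flow moves a vector only within the range of [S], which [P] annihilates. *)
Lemma diff_flow_proj (P : 'M[R]_N) w (T : R) : S *m P = 0 -> 0 <= T ->
  'd (act_at (g T)) e w *m P = w *m P.
Proof.
move=> SP T0; apply/rowP => j.
pose m (s : R) : R := ('d (act_at (g s)) e w *m P) 0 j.
have [hg _ _] := Hg.
have e1 u : a u p = p -> [/\ cdom phi (a u (cbwd phi e)), differentiable (act_at u) e & act_at u e = e].
  by move=> up; have [] := nbhs_singleton (uniform_stabilizer ltr01) _ up; split=> //; exact: act_at_e.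
have -> : ('d (act_at (g T)) e w *m P) 0 j = m 0.
  apply: (is_derive0_constant (h := m) T0) => s _.
  pose ws := 'd (act_at (g s)) e w.
  have D := is_derive_shift s (diff_flow_derive ws).
  have -> : m = fun t => ('d (act_at (g (t - s))) e ws *m P) 0 j.
    apply/funext => t; rewrite /m /=; congr (fun_of_matrix (_ *m P) 0 j).
    have [d1 f1 E1] := e1 _ (fixg s); have [d2 f2 E2] := e1 _ (fixg (t - s)).
    have n : \forall x \near e, (act_at (g (t - s)) \o act_at (g s)) x = act_at (g t) x.
      have := uniform_stabilizer ltr01; apply: filterS => x /(_ _ (fixg s))[d _ _ _].
      by rewrite /= -act_atM// -hg subrK.
    have f2' : differentiable (act_at (g (t - s))) (act_at (g s) e) by rewrite E1.
    have C := congr1 (fun h => h w) (@diff_comp _ _ _ _ _ _ _ f1 f2').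
    have E := near_eq_diffE w n (differentiable_comp f1 f2').
    by rewrite /= E1 in C; exact: etrans (esym E) C.
  by have := is_derive_mulmx_coord P j D; rewrite -mulmxA SP mulmx0 mxE.
rewrite /m (one_param0 LU Hg); congr (fun_of_matrix (_ *m P) 0 j).
have n : \forall x \near e, id x = act_at (lie_one U) x.
  apply: filterS (near_img cp (chart_img dp)) => x ix.
  by rewrite /act_at a1; have [_ ->] := chart_imgP cp ix.
have d0 : differentiable (@id 'rV[R]_N) e by exact: (Coo_at_differentiable (Coo_at_id e)).
rewrite -(near_eq_diffE w n d0).
have ci : continuous (idfun : 'rV[R]_N -> 'rV[R]_N) by move=> ?; exact: cvg_id.
by have -> := congr1 (fun h => h w) (@diff_lin _ _ _ (idfun : {linear 'rV[R]_N -> 'rV[R]_N}) e ci).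
Qed.

(* The component of the field along the corange of its derivative at the fixed
   point is invariant up to first order by the closure of the one-parameter
   group, which is compact: if it were not small, the orbit would drift away. *)
Lemma field_corange eps : 0 < eps -> exists2 r : R, 0 < r &
  forall x, ball e r x -> `|W x *m corange_proj S| <= eps * `|W x|.
Proof.
move=> eps0; pose P := corange_proj S; have SP : S *m P = 0 := mul_corange_proj S.
have [C C0 HC] := mulmx_norm_bound P.
have n1 := uniform_stabilizer (divr_gt0 eps0 C0).
have n2 : \forall x \near e, `|x - e| <= 1 := near_norm_le e ltr01.
have n3 := near_img cp (chart_img dp).
have n : \forall x \near e, `|W x *m P| <= eps * `|W x|.
  apply: filterS3 n1 n2 n3 => x H xe ix; have [dx ex] := chart_imgP cp ix.
  set K := eps * _.
  have K0 : 0 <= K by rewrite mulr_ge0// ltW.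
  pose X (s : R) := cfwd phi (a (g s) (cbwd phi x)).
  have [hg _ _] := Hg; have g0 := one_param0 LU Hg.
  have X0 : X 0 = x by rewrite /X g0 a1.
  have dX0 : is_derive (0 : R) 1 X (W x).
    have := orbit_chart_derive LU mZ aM sa Hg (p := p) (z := cbwd phi x) (t := 0).
    by rewrite g0 a1 => /(_ dx); rewrite -/phi ex.
  have dX (s : R) : is_derive s 1 X ('d (act_at (g s)) x (W x)).
    have -> : X = fun t => act_at (g s) (X (t - s)).
      apply/funext => t; have [d _ _ _] := H _ (fixg (t - s)).
      by rewrite /X /act_at (chart_cbwdK cp d) -aM -hg addrC subrK.
    have := is_derive_comp (is_derive_shift s dX0).
    by move=> /(_ _ (act_at (g s))); rewrite subrr X0; apply; have [] := H _ (fixg s).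
  apply: rV_norm_le => // j; set q := (W x *m P) 0 j.
  pose h (s : R) : R := (X s *m P) 0 j.
  have dh (s : R) : 0 <= s -> exists2 h', is_derive s 1 h h' & `|h' - q| <= K.
    move=> s0; exists (('d (act_at (g s)) x (W x) *m P) 0 j).
      exact: is_derive_mulmx_coord.
    have [_ _ _ le] := H _ (fixg s).
    rewrite /q -(diff_flow_proj (W x) SP s0).
    have -> : forall y z : 'rV[R]_N, (y *m P) 0 j - (z *m P) 0 j = ((y - z) *m P) 0 j.
      by move=> y z; rewrite mulmxBl !mxE.
    rewrite (le_trans (coord_norm_le _ _))// (le_trans (HC _))//.
    rewrite /K mulrC -ler_pdivlMr// (le_trans (le _))//.
    by rewrite mulrAC.
  (* The orbit and its starting point both stay within distance 1 of [e], whence a bound independent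
     of [T]. *)
  have hb (T : R) : `|h T - h 0| <= C * 2.
    rewrite /h.
    have -> : forall y z : 'rV[R]_N, (y *m P) 0 j - (z *m P) 0 j = ((y - z) *m P) 0 j.
      by move=> y z; rewrite mulmxBl !mxE.
    rewrite (le_trans (coord_norm_le _ _))// (le_trans (HC _))// ler_pM2l//.
    rewrite X0 (_ : X T - x = (act_at (g T) x - e) - (x - e)); last first.
      by apply/rowP => i; rewrite !mxE /X /act_at; ring.
    rewrite (le_trans (ler_normB _ _))//; have [_ b _ _] := H _ (fixg T).
    by have := lerD b xe.
  have up (T : R) : 0 <= T -> T * q <= C * 2 + T * K.
    move=> T0; have : h 0 - 0 * (q - K) <= h T - T * (q - K).
      apply: (@ndecr_of_derive R (fun s => h s - s * (q - K)) (fun s => 'D_1 h s - (q - K)) T T0) => s /andP[s0 _].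
      have [h' Dh lh] := dh s s0; split; last first.
        by rewrite (@derive_val _ _ _ _ _ _ _ Dh); move: lh; rewrite ler_norml; lra.
      apply: is_deriveB; last first.
        have := is_derive_mulC (q - K) (is_derive_id s (1 : R)).
        by rewrite mulr1; under eq_fun do rewrite mulrC.
      by rewrite (@derive_val _ _ _ _ _ _ _ Dh).
    by have := hb T; rewrite ler_norml mul0r; lra.
  have dn (T : R) : 0 <= T -> - (T * q) <= C * 2 + T * K.
    move=> T0; have : h T - T * (q + K) <= h 0 - 0 * (q + K).
      apply: (@nincr_of_derive R (fun s => h s - s * (q + K)) (fun s => 'D_1 h s - (q + K)) T T0) => s /andP[s0 _].
      have [h' Dh lh] := dh s s0; split; last first.
        by rewrite (@derive_val _ _ _ _ _ _ _ Dh); move: lh; rewrite ler_norml; lra.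
      apply: is_deriveB; last first.
        have := is_derive_mulC (q + K) (is_derive_id s (1 : R)).
        by rewrite mulr1; under eq_fun do rewrite mulrC.
      by rewrite (@derive_val _ _ _ _ _ _ _ Dh).
    by have := hb T; rewrite ler_norml mul0r; lra.
  rewrite leNgt; apply/negP => qK.
  have d0 : 0 < `|q| - K by rewrite subr_gt0.
  (* By this time a drift at speed at least [|q| - K] would exceed the bound [2 C] by 1. *)
  pose T := (C * 2 + 1) / (`|q| - K).
  have T0 : 0 <= T by rewrite divr_ge0// ltW// addr_gt0// mulr_gt0.
  have ET : T * (`|q| - K) = C * 2 + 1 by rewrite /T mulfVK// gt_eqF.
  have := up T T0; have := dn T T0; move: ET.
  by have [q0|q0] := leP 0 q; [rewrite (ger0_norm q0)|rewrite (ltr0_norm q0)]; lra.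
by have /nbhs_ballP[r r0 Hr] := n; exists r.
Qed.
End compact_fixed_point.

(** * Gradient flows near critical points *)

Section complex_structure.
Context {R : realType}.

Lemma Jmul_is_linear n : linear (@Jmul R n).
Proof.
move=> a u v; rewrite /Jmul; apply/rowP => i; rewrite !mxE.
by case: splitP => j _; rewrite !mxE; ring.
Qed.

Lemma JmulK n (v : 'rV[R]_(n + n)) : Jmul (Jmul v) = - v.
Proof.
by rewrite /Jmul row_mxKr row_mxKl -{3}[v]hsubmxK opp_row_mx.
Qed.

Lemma Jmul_norm n (v : 'rV[R]_(n + n)) : `|Jmul v| <= `|v|.
Proof.
apply: rV_norm_le => // i; rewrite /Jmul mxE.
by case: splitP => j _; rewrite !mxE ?normrN; exact: coord_norm_le.
Qed.

Lemma norm_Jmul n (v : 'rV[R]_(n + n)) : `|Jmul v| = `|v|.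
Proof.
apply/eqP; rewrite eq_le Jmul_norm /=.
by have := Jmul_norm (Jmul v); rewrite JmulK normrN.
Qed.

Lemma ex_right (P : R -> Prop) : (\forall r \near (0 : R)^'+, P r) -> exists2 r, 0 < r & P r.
Proof.
move=> H; have [r [r0 Pr]] : exists r : R, 0 < r /\ P r.
  by apply: (@filter_ex _ (0 : R)^'+); apply: filterI => //; exact: nbhs_right_gt.
by exists r.
Qed.

Lemma bilinear_bound n (b : 'rV[R]_n -> 'rV[R]_n -> R) (eta : R) :
  (forall a u v w, b (a *: u + v) w = a * b u w + b v w) ->
  (forall a u v w, b w (a *: u + v) = a * b w u + b w v) ->
  (forall i j, `|b (delta_mx 0 i) (delta_mx 0 j)| <= eta) ->
  forall u v, `|b u v| <= n%:R ^+ 2 * eta * `|u| * `|v|.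
Proof.
move=> bl br H u v.
have bs w m (F : 'I_m -> 'rV[R]_n) : b (\sum_i F i) w = \sum_i b (F i) w.
  elim/big_ind2: _ => // [|x y z t <- <-]; first by have := bl 1 0 0 w; rewrite scale1r addr0 mul1r; lra.
  by have := bl 1 y t w; rewrite scale1r mul1r.
have bs' w m (F : 'I_m -> 'rV[R]_n) : b w (\sum_i F i) = \sum_i b w (F i).
  elim/big_ind2: _ => // [|x y z t <- <-]; first by have := br 1 0 0 w; rewrite scale1r addr0 mul1r; lra.
  by have := br 1 y t w; rewrite scale1r mul1r.
have bz a x w : b (a *: x) w = a * b x w.
  by have := bl a x 0 w; rewrite addr0; have := bl 1 0 0 w; rewrite scale1r addr0 mul1r; lra.
have bz' a x w : b w (a *: x) = a * b w x.
  by have := br a x 0 w; rewrite addr0; have := br 1 0 0 w; rewrite scale1r addr0 mul1r; lra.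
have E0 : n%:R ^+ 2 * eta * `|u| * `|v| = \sum_(i < n) \sum_(j < n) (`|u| * (eta * `|v|)).
  have sn (x : R) : \sum_(i < n) x = n%:R * x by rewrite sumr_const card_ord mulr_natl.
  by rewrite !sn; ring.
rewrite E0 {1}[u]row_sum_delta bs (le_trans (ler_norm_sum _ _ _))//.
apply: ler_sum => i _; rewrite {1}[v]row_sum_delta bs' (le_trans (ler_norm_sum _ _ _))//.
apply: ler_sum => j _; rewrite bz bz' mulrCA !normrM mulrCA.
rewrite ler_pM ?normr_ge0 ?mulr_ge0 ?coord_norm_le//.
by rewrite [leRHS]mulrC ler_pM ?normr_ge0 ?coord_norm_le.
Qed.
End complex_structure.

Lemma chain_near {R : realType} (U V W : normedModType R) (tau : U -> V) (G : V -> W) (P : U -> W)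
  (u w : U) (v : V) : differentiable tau u -> tau u = v -> differentiable G v ->
  (\forall x \near u, G (tau x) = P x) -> 'd G v ('d tau u w) = 'd P u w.
Proof.
move=> d1 tu d2 n; rewrite -tu in d2 *.
rewrite -(near_eq_diffE w n (differentiable_comp d1 d2)).
exact: (esym (congr1 (fun h => h w) (@diff_comp _ _ _ _ _ _ _ d1 d2))).
Qed.

Section left_inverse.
Context {R : realType}.

Lemma linear_left_inverse m n (L : {linear 'rV[R]_m -> 'rV[R]_n}) : injective L ->
  exists Q : 'M[R]_(n, m), forall h, L h *m Q = h.
Proof.
move=> iL; exists (pinvmx (lin1_mx L)) => h; rewrite -mul_rV_lin1 -mulmxA mulmxVp ?mulmx1//.
rewrite -kermx_eq0; apply/eqP/row_matrixP => i; rewrite row0; apply: iL.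
by rewrite linear0 -mul_rV_lin1 -row_mul mulmx_ker row0.
Qed.

Lemma linear_injective_bound m n (L : {linear 'rV[R]_m -> 'rV[R]_n}) : injective L ->
  exists2 C, 0 < C & forall h, `|h| <= C * `|L h|.
Proof.
move=> /linear_left_inverse[Q HQ]; have [C C0 HC] := mulmx_norm_bound Q.
by exists C => // h; rewrite -{1}(HQ h).
Qed.

End left_inverse.

Section lift.
Context {R : realType} {r N : nat} (M : charted_space 'rV[R]_r) (Y : charted_space 'rV[R]_N).
Hypotheses (mM : mfld M) (mY : mfld Y).
Variable iota : M -> Y.
Hypothesis hiota : smooth_embedding iota.

Lemma embedding_smat y : smat iota y.
Proof. by have [s _ _ _] := hiota; exact: ((smooth_smatP mM mY _).1 s). Qed.

Lemma embedding_near (P : set M) y : (\forall m \near y, P m) ->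
  \forall z \near iota y, forall m, iota m = z -> P m.
Proof.
move=> /open_nearP[W [oW Wy WP]]; have [_ _ _ emb] := hiota.
have [B oB EB] := emb W oW.
have : \forall z \near iota y, B z by apply: open_near => //; move: Wy; rewrite EB.
by apply: filterS => z Bz m mz; apply: WP; rewrite EB /preimage /= mz.
Qed.

(* The chart expression of [iota] followed by a left inverse of its derivative
   is a local diffeomorphism of R^r. *)
Lemma smat_lift (E : normedModType R) (X : charted_space E) (mX : mfld X) (f : X -> M) x :
  smat (iota \o f) x -> smat f x.
Proof.
move=> [cf sf]; have cfx : {for x, continuous f}.
  move=> P nP; have n := embedding_near nP.
  have n2 : \forall z \near x, forall m, iota m = iota (f z) -> P m := cf _ n.
  by apply: filterS n2 => z; apply.
split => //; set phi := chart_at (iota (f x)); set psi := chart_at (f x).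
have cphi : is_chart phi := chart_at_is mY _; have cpsi : is_chart psi := chart_at_is mM _.
have dpsi : cdom psi (f x) := dom_at mM _; have dphi : cdom phi (iota (f x)) := dom_at mY _.
pose y0 := cfwd psi (f x); pose P := loc iota (f x).
have [ci CP] := embedding_smat (f x).
have [_ _ inj _] := hiota; have [Q HQ] := linear_left_inverse (inj (f x)).
pose LQ : {linear 'rV[R]_N -> 'rV[R]_r} := mulmxr Q.
have CQ y : Coo_at LQ y by apply: Coo_at_linear; exact: findim_continuous (findim_rV N).
have Ch : Coo_at (LQ \o P) y0 := Coo_at_comp (findim_rV N) CP (CQ _).
have [A [oA Ay hA]] := Ch.
have dh v : 'd (LQ \o P) y0 v = v.
  have dP := Coo_at_differentiable CP; have dL := Coo_at_differentiable (CQ (P y0)).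
  have := congr1 (fun h => h v) (@diff_comp _ _ _ _ _ _ _ dP dL).
  rewrite diff_lin; last exact: findim_continuous (findim_rV N).
  by move=> ->; exact: HQ.
have ih v : 'd (LQ \o P) y0 v = 0 -> v = 0 by rewrite dh.
have [D [D' [g [[oD Dy DA] oD' H1 H2 gC]]]] := inverse_function oA Ay hA ih.
have [D'y _] := H1 y0 Dy.
pose x0 := cfwd (chart_at x) x.
have cx : is_chart (chart_at x) := chart_at_is mX x.
have dx : cdom (chart_at x) x := dom_at mX x.
have n1 : \forall z \near x, cdom psi (f z) /\ D (cfwd psi (f z)).
  have n0 : \forall m \near f x, cdom psi m /\ D (cfwd psi m).
    apply: filterI; first exact: near_dom.
    by apply: (near_cfwd cpsi dpsi (P := D)); exact: open_near.
  exact: cfx n0.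
have n2 : \forall t \near x0, g (LQ (loc (iota \o f) x t)) = loc f x t.
  have := near_cbwd cx dx n1; apply: filterS => t [d1 d2].
  rewrite -[RHS](proj2 (H1 _ d2)); congr g.
  by rewrite /P /loc /= (chart_cbwdK cpsi d1).
apply: (Coo_at_eq n2).
have E0 : LQ (loc (iota \o f) x x0) = (LQ \o P) y0.
  by rewrite /P /loc /x0 /y0 /= (chart_cbwdK cx dx) (chart_cbwdK cpsi dpsi).
have Cg : Coo_at g (LQ (loc (iota \o f) x x0)) by exists D'; rewrite E0.
exact: (Coo_at_comp (findim_rV r) (Coo_at_comp (findim_rV N) sf (CQ _)) Cg).
Qed.
End lift.

Section real_induction.
Context {R : realType}.

(** The infimum of the times at which [P] fails satisfies [P] by the third hypothesis, and the
    second pushes [P] beyond it. *)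
Lemma real_induction (P : R -> Prop) : P 0 -> (forall t, P t -> \forall s \near t, P s) ->
  (forall T : R, 0 < T -> (forall t, 0 <= t < T -> P t) -> P T) -> forall t : R, 0 <= t -> P t.
Proof.
move=> P0 Po Pc t0 t00; apply: contrapT => nP.
pose B := [set t : R | 0 <= t /\ ~ P t].
have hB : has_inf B by split; [exists t0|exists 0 => t []].
pose T := inf B.
have T0 : 0 <= T by apply: lb_le_inf; [exists t0|move=> t []].
have lT t : 0 <= t < T -> P t.
  move=> /andP[t1 t2]; apply: contrapT => nt.
  by have := ge_inf hB.2 (conj t1 nt : B t); rewrite leNgt t2.
have PT : P T.
  by move: T0; rewrite le_eqVlt => /orP[/eqP <-//|T0]; exact: Pc.
have /nbhs_ballP[r /= r0 Hr] := Po T PT.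
have [b [b0 nb] lb] := inf_adherent r0 hB.
have Tb := ge_inf hB.2 (conj b0 nb : B b).
apply: nb; apply: Hr; rewrite -ball_normE /ball_ /=.
by rewrite distrC ger0_norm ?subr_ge0// ltrBlDl.
Qed.

Lemma closed_left_limit (T : topologicalType) (C : set T) (c : R -> T) (t : R) : closed C ->
  {for t, continuous c} -> 0 < t -> (forall s, 0 <= s < t -> C (c s)) -> C (c t).
Proof.
move=> cC cc t0 H; apply: contrapT => nC.
have oC : open (~` C) by rewrite openC.
have n : \forall s \near t, (~` C) (c s) by apply: cc; exact: open_near.
have /nbhs_ballP[r /= r0 Hr] := n.
pose s := t - Num.min r t / 2.
have m0 : 0 < Num.min r t by rewrite lt_min r0.
have [m1 m2] : Num.min r t <= r /\ Num.min r t <= t by rewrite !ge_min !lexx orbT.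
apply: (Hr s); last by apply: H; rewrite /s; lra.
by rewrite -ball_normE /ball_ /= /s opprB addrC subrK ger0_norm; lra.
Qed.
End real_induction.

Section gradient_flow.
Context {R : realType} {n k d : nat}.
Variables (Z : charted_space 'rV[R]_(n + n)) (omega : Z -> {biscalar 'rV[R]_(n + n)})
  (U : lie_space 'rV[R]_k) (H : lie_space 'rV[R]_(d + d)) (c : U -> H) (act : H -> Z -> Z).
Hypotheses (hZ : is_complex_manifold Z) (homega : is_kaehler_form omega)
  (hU : is_lie_group U) (cU : compact [set: U]) (hc : is_complexification c)
  (hact : is_holomorphic_action act).

Lemma cx_mfld : mfld Z. Proof. by apply: is_manifold_mfld; have [] := hZ. Qed.
Lemma cx_hausdorff : hausdorff_space Z. Proof. by have [[]] := hZ. Qed.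
Let mZ := cx_mfld.
Let LU : lieg U := lie_group_lieg hU.
Let LH : lieg H := complexification_lieg hc.
Let mH := lie_mfld LH.
Let mU := lie_mfld LU.

Lemma holo_act1 z : act (lie_one H) z = z. Proof. by have [] := hact. Qed.
Lemma holo_actM g h z : act (lie_mul g h) z = act g (act h z). Proof. by have [_ ->] := hact. Qed.
Lemma holo_act_smat p : smat ((fun p => act p.1 p.2) : prod_space H Z -> Z) p.
Proof. by have [_ _ [s _]] := hact; exact: ((smooth_smatP (prod_mfld mH mZ) mZ _).1 s). Qed.
Let sact := holo_act_smat.

Lemma cplx_smat u : smat c u.
Proof. by have [_ [[s _] _] _ _] := hc; exact: ((smooth_smatP mU mH _).1 s). Qed.
Lemma cplx_mul u v : c (lie_mul u v) = lie_mul (c u) (c v).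
Proof. by have [_ [[_ h] _] _ _] := hc. Qed.
Lemma cplx_one : c (lie_one U) = lie_one H.
Proof. by apply: (lie_hom1 hc); exact: hU. Qed.

(** The action is holomorphic in both variables jointly; its differential is evaluated at
    [(J v, 0)], which is the complex multiple of [(v, 0)]. *)
Lemma orbit_fieldJ xi z : orbit_field act (Jmul xi) z = Jmul (orbit_field act xi z).
Proof.
have [_ _ [_ hJ]] := hact; pose F : prod_space H Z -> Z := fun p => act p.1 p.2.
have E (v : 'rV[R]_(d + d)) : orbit_field act v z = tangent_map F (lie_one H, z) (v, 0).
  have s1 : smat ((fun h => (h, z)) : H -> prod_space H Z) (lie_one H).
    exact: smat_pair (smat_id mH _) (smat_cst z (lie_one H)).
  have := tangent_comp mH (prod_mfld mH mZ) v s1 (sact (lie_one H, z)).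
  have [_ ->] := mdiff_pair (smat_mdiff (smat_id mH (lie_one H))) (smat_mdiff (smat_cst z (lie_one H) : smat (cst z : H -> Z) _)).
  by rewrite tangent_id// tangent_cst.
rewrite !E -hJ; congr (tangent_map _ _ (_, _)); by rewrite /= Jmul0.
Qed.

Definition compact_act (u : U) (z : Z) : Z := act (c u) z.

Lemma compact_act1 z : compact_act (lie_one U) z = z.
Proof. by rewrite /compact_act cplx_one holo_act1. Qed.
Lemma compact_actM u v z : compact_act (lie_mul u v) z = compact_act u (compact_act v z).
Proof. by rewrite /compact_act cplx_mul holo_actM. Qed.
Lemma compact_act_smat p : smat ((fun p => compact_act p.1 p.2) : prod_space U Z -> Z) p.
Proof.
have mP := prod_mfld mU mZ.
apply: (smat_act LH mZ sact mP).
  have S := smat_comp mP mU (smat_fst mU p) (cplx_smat p.1); exact: S.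
exact: (smat_snd mZ p).
Qed.

Variable xi : 'rV[R]_k.
Let beta := Jmul (lie_diff c xi).

(** Since [J beta] is the image of [- xi], the field [J] times the gradient generates a flow of the
    compact group; the estimates of the preceding sections therefore apply to it. *)
Lemma compact_orbit_field z : orbit_field compact_act (- xi) z = Jmul (orbit_field act beta z).
Proof.
rewrite -orbit_fieldJ /beta JmulK.
have s2 := smat_orbit LH mZ sact (c (lie_one U)) z.
have T := tangent_comp mU mH (- xi) (cplx_smat (lie_one U)) s2.
rewrite /orbit_field -[LHS]/(tangent_map ((fun h => act h z) \o c) (lie_one U) (- xi)) T.
by rewrite cplx_one /lie_diff tangentN.
Qed.

Variable p : Z.
Let phi := chart_at p.
Let e := cfwd phi p.
Let cp : is_chart phi := chart_at_is mZ p.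
Let dp : cdom phi p := dom_at mZ p.
Let ap : atlas phi := atlas_at mZ p.
Let N := (n + n)%N.
Let V := chart_field act beta p.

Lemma compact_chart_field x : (cfwd phi @` cdom phi) x ->
  chart_field compact_act (- xi) p x = Jmul (V x).
Proof.
move=> ix; have [dx ex] := chart_imgP cp ix.
rewrite /V /chart_field compact_orbit_field.
have [_ hJ] := hZ; apply: hJ; [exact: atlas_at|exact: ap|].
by exists (cbwd phi x) => //; split => //; exact: dom_at.
Qed.

Definition chart_metric (x u v : 'rV[R]_(n + n)) : R := tensor_in_chart omega phi x u (Jmul v).

Lemma chart_metricE x u v : (cfwd phi @` cdom phi) x ->
  chart_metric x u v = kaehler_metric omega (cbwd phi x)
    (tangent_map (cbwd phi : euclid 'rV[R]_(n + n) -> Z) x u)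
    (tangent_map (cbwd phi : euclid 'rV[R]_(n + n) -> Z) x v).
Proof.
move=> ix; have [dx ex] := chart_imgP cp ix.
rewrite /chart_metric /tensor_in_chart /kaehler_metric /=; congr (omega _ _ _).
have [_ hJ] := hZ; apply: hJ; [exact: ap|exact: atlas_at|].
by exists (cbwd phi x) => //; split => //; exact: dom_at.
Qed.

Lemma chart_metricDl x a u v w :
  chart_metric x (a *: u + v) w = a * chart_metric x u w + chart_metric x v w.
Proof. by rewrite /chart_metric /tensor_in_chart /= linearP linearPl. Qed.

Lemma chart_metricDr x a u v w :
  chart_metric x w (a *: u + v) = a * chart_metric x w u + chart_metric x w v.
Proof.
by rewrite /chart_metric /tensor_in_chart /= Jmul_is_linear linearP linearPr.
Qed.

Lemma chart_metricC x u v : (cfwd phi @` cdom phi) x -> chart_metric x u v = chart_metric x v u.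
Proof.
move=> ix; rewrite !chart_metricE// /kaehler_metric.
have [_ al _ hJ _] := homega; set a := tangent_map _ _ _; set b := tangent_map _ _ _.
rewrite -hJ JmulK linearNr.
have := al (cbwd phi x) (Jmul a + b); rewrite !linearDl !linearDr /= !al add0r addr0.
by move/eqP; rewrite addr_eq0 => /eqP ->; rewrite opprK.
Qed.

Lemma tangent_cbwd_inj x v : (cfwd phi @` cdom phi) x ->
  tangent_map (cbwd phi : euclid 'rV[R]_(n + n) -> Z) x v = 0 -> v = 0.
Proof.
move=> ix; have [dx ex] := chart_imgP cp ix => v0.
have mE : mfld (euclid 'rV[R]_(n + n)) by exact/euclid_mfld/findim_rV.
have s1 : smat (cbwd phi : euclid 'rV[R]_(n + n) -> Z) x := smat_cbwd mZ ap ix.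
have T := tangent_comp mE mZ v s1 (smat_cfwd mZ ap dx).
rewrite v0 tangent0 in T; rewrite -T.
have nE : \forall z \near (x : euclid 'rV[R]_(n + n)), (id : euclid 'rV[R]_(n + n) -> euclid 'rV[R]_(n + n)) z = (cfwd phi \o cbwd phi) z.
  by apply: filterS (near_img cp ix) => z iz; have [_ /= ->] := chart_imgP cp iz.
have [_ ->] := mdiff_eq mE nE (smat_mdiff (smat_id mE x)).
by rewrite tangent_id.
Qed.

Lemma chart_metric_gt0 x v : (cfwd phi @` cdom phi) x -> v != 0 -> 0 < chart_metric x v v.
Proof.
move=> ix v0; rewrite chart_metricE//; have [_ _ _ _ pos] := homega; apply: pos.
by apply: contra v0 => /eqP /(tangent_cbwd_inj ix) ->.
Qed.

Lemma chart_metric_near eps : 0 < eps -> \forall x \near e, forall u v,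
  `|chart_metric x u v - chart_metric e u v| <= eps * `|u| * `|v|.
Proof.
move=> e0.
have sub_lin (a p1 q r s : R) : a * p1 + q - (a * r + s) = a * (p1 - r) + (q - s) by ring.
pose eta := eps / ((n + n)%:R ^+ 2 + 1).
have D0 : 0 < (n + n)%:R ^+ 2 + 1 :> R by rewrite ltr_wpDl// sqr_ge0.
have eta0 : 0 < eta by exact: divr_gt0.
have nij i j : \forall x \near e, `|chart_metric x (delta_mx 0 i) (delta_mx 0 j) -
    chart_metric e (delta_mx 0 i) (delta_mx 0 j)| <= eta.
  have [sm _ _ _ _] := homega.
  have c0 := sm _ ap (delta_mx 0 i) (Jmul (delta_mx 0 j)) 0%N e (chart_img dp).
  by have /(@continuous_normP R _ R^o) := c0; apply.
have : \forall x \near e, forall i j, `|chart_metric x (delta_mx 0 i) (delta_mx 0 j) -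
    chart_metric e (delta_mx 0 i) (delta_mx 0 j)| <= eta.
  exact: (filter_forall _ (fun i => filter_forall _ (nij i))).
apply: filterS => x Hx u v.
apply: le_trans (@bilinear_bound R (n + n) (fun u v => chart_metric x u v - chart_metric e u v) eta _ _ Hx u v) _.
- by move=> a w z t; rewrite (chart_metricDl x) (chart_metricDl e) sub_lin.
- by move=> a w z t; rewrite (chart_metricDr x) (chart_metricDr e) sub_lin.
rewrite ler_wpM2r// ler_wpM2r// /eta mulrCA ger_pMr// ler_pdivrMr// mul1r.
by rewrite lerDl.
Qed.

Variable f : Z -> R.
Hypotheses (sf : forall z, smat (f : Z -> euclid R^o) z)
  (df : forall z v, tangent_map (f : Z -> euclid R^o) z v =
     kaehler_metric omega z (orbit_field act beta z) v).

Let fc (x : 'rV[R]_(n + n)) : R := f (cbwd phi x).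

Lemma chart_fun_Coo x : (cfwd phi @` cdom phi) x -> Coo_at (fc : _ -> R^o) x.
Proof.
move=> ix; have mE : mfld (euclid 'rV[R]_(n + n)) by exact/euclid_mfld/findim_rV.
apply/(smat_euclidP _ _ (findim_rV _) findim_Ro).
exact: (smat_comp mE mZ (smat_cbwd mZ ap ix) (sf _)).
Qed.

Lemma chart_fun_diff x v : (cfwd phi @` cdom phi) x ->
  'd (fc : _ -> R^o) x v = chart_metric x (V x) v.
Proof.
move=> ix; have mE : mfld (euclid 'rV[R]_(n + n)) by exact/euclid_mfld/findim_rV.
rewrite chart_metricE// /V (chart_field_inv mZ act beta ix) -df.
exact: (tangent_comp mE mZ v (smat_cbwd mZ ap ix) (sf _)).
Qed.

Hypothesis Vp : orbit_field act beta p = 0.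

Lemma chart_field_crit : V e = 0.
Proof. by rewrite /V /chart_field (chart_cbwdK cp dp) Vp tangent0. Qed.

(** [Y] is the field of the compact group, so [field_corange] supplies the hypothesis of the
    Lojasiewicz inequality. [Y] has the same norm as the gradient [V], and near [e] the metric is
    comparable to the positive definite form at [e], which turns [|V|^2] into the energy. *)
Lemma crit_local : exists K L r : R, [/\ 0 < K, 0 < L, 0 < r & forall x, ball e r x ->
  [/\ (cfwd phi @` cdom phi) x, `|V x| ^+ 2 <= K * chart_metric x (V x) (V x) &
      `|fc x - fc e| <= L * chart_metric x (V x) (V x)]].
Proof.
have hZ' := cx_hausdorff.
have ie : (cfwd phi @` cdom phi) e := chart_img dp.
have [g Hg] := compact_one_param LU cU (proj1 (let: And4 a _ _ _ := hU in conj (let: And5 h _ _ _ _ := a in h) I)) (- xi).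
pose Y := chart_field compact_act (- xi) p.
have p0 : orbit_field compact_act (- xi) p = 0 by rewrite compact_orbit_field Vp Jmul0.
have CY : Coo_at Y e := chart_field_Coo LU mZ compact_act1 compact_act_smat (- xi) ie.
pose S : 'M[R]_(n + n) := lin1_mx ('d Y e).
have HS v : v *m S = 'd Y e v by rewrite mul_rV_lin1.
have Ye : Y e = 0 by rewrite /Y compact_chart_field// chart_field_crit Jmul0.
have cor := field_corange LU mZ hZ' cU compact_act1 compact_actM compact_act_smat Hg p0 HS.
have [A [oA Ax YA]] := CY.
have strict eps : 0 < eps -> exists2 r : R, 0 < r &
    forall x y, ball e r x -> ball e r y -> `|Y y - Y x - (y - x) *m S| <= eps * `|y - x|.
  move=> eps0; have h := C1_strict (findim_rV _) oA Ax (YA 1%N) eps0.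
  have [r r0 Hr] := ex_right h.
  by exists r => // x y bx b_y; have [_ _ _] := Hr x y bx b_y; rewrite HS.
pose b := chart_metric e.
have bl a u v w := chart_metricDl e a u v w.
have bC u v := chart_metricC u v ie.
have bpos v := @chart_metric_gt0 e v ie.
have [C1 C10 HC1] := bform_bound bl bC.
have [k1 k10 Hk1] := bform_pos bl bC bpos.
have n1 := chart_metric_near (divr_gt0 k10 (ltr0Sn R 1)).
have n2 := near_img cp ie.
have nn : \forall x \near e, (cfwd phi @` cdom phi) x /\ forall u v,
    `|chart_metric x u v - chart_metric e u v| <= k1 / 2 * `|u| * `|v| by apply: filterI n2 n1.
have /nbhs_ballP[r1 /= r10 Hr1] := nn.
have Cf0 : 0 < C1 + k1 / 2 by rewrite addr_gt0// divr_gt0.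
have dfY : exists2 r : R, 0 < r & forall x, ball e r x -> differentiable (fc : _ -> R^o) x /\
    forall v, `|'d (fc : _ -> R^o) x v| <= (C1 + k1 / 2) * `|Y x| * `|v|.
  exists r1 => // x bx; have [ix Hx] := Hr1 x bx; split.
    exact: Coo_at_differentiable (chart_fun_Coo ix).
  move=> v; rewrite chart_fun_diff// /Y compact_chart_field// norm_Jmul.
  rewrite -[chart_metric x _ _](subrK (chart_metric e (V x) v)) (le_trans (ler_normD _ _))//.
  by rewrite !mulrDl addrC lerD.
have [C [r2 [C0 r20 Hr2]]] := lojasiewicz_half Ye strict cor Cf0 dfY.
exists (2 / k1), (C * (2 / k1)), (Num.min r1 r2).
have K0 : 0 < 2 / k1 by rewrite divr_gt0.
split; [by []|exact: mulr_gt0|by rewrite lt_min r10 r20|] => x bx.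
have b1 : ball e r1 x by apply: le_ball bx; rewrite ge_min lexx.
have b2 : ball e r2 x by apply: le_ball bx; rewrite ge_min lexx orbT.
have [ix Hx] := Hr1 x b1.
have q : `|V x| ^+ 2 <= 2 / k1 * chart_metric x (V x) (V x).
  rewrite mulrC mulrA ler_pdivlMr//.
  have gen (t u w : R) : - (k1 / 2 * t) <= u - w -> k1 * t <= w -> t * k1 <= u * 2 by lra.
  have := Hx (V x) (V x); rewrite ler_norml -mulrA -expr2 => /andP[h1 _].
  exact: gen h1 (Hk1 (V x)).
split => //.
have h := Hr2 x b2; apply: (le_trans h).
by rewrite -mulrA ler_pM2l// /Y compact_chart_field// norm_Jmul.
Qed.

Variable g : R -> H.
Hypothesis Hg : one_param_diff beta g.

Definition flow (t : R) (z : Z) : Z := act (g t) z.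

Lemma flow0 z : flow 0 z = z.
Proof. by rewrite /flow (one_param0 LH Hg) holo_act1. Qed.
Lemma flowD s t z : flow (s + t) z = flow s (flow t z).
Proof. by have [h _ _] := Hg; rewrite /flow h holo_actM. Qed.
Lemma flow_smat t z : smat (flow t) z.
Proof. exact: (smat_act_pt LH mZ sact (g t) z). Qed.
Lemma flow_continuous z (t : R) : {for t, continuous (fun s => flow s z)}.
Proof. by have [[]] := orbit_curve LH mZ holo_actM sact Hg z t. Qed.

Definition energy z := kaehler_metric omega z (orbit_field act beta z) (orbit_field act beta z).

Lemma energy_ge0 z : 0 <= energy z.
Proof.
rewrite /energy; have [->|v0] := eqVneq (orbit_field act beta z) 0.
  by rewrite /kaehler_metric linear0l.
by rewrite ltW//; have [_ _ _ _ ->] := homega.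
Qed.

Lemma energy_gt0 z : orbit_field act beta z != 0 -> 0 < energy z.
Proof. by have [_ _ _ _ pos] := homega; exact: pos. Qed.

Lemma energy_eq0 z : energy z = 0 -> orbit_field act beta z = 0.
Proof. by move=> E; apply/eqP; apply: contraT => /energy_gt0; rewrite E ltxx. Qed.

Lemma flow_derive z (t : R) : is_derive t 1 (fun s => f (flow s z)) (energy (flow t z)).
Proof.
have := orbit_derive LH mZ holo_actM sact Hg findim_Ro (sf (act (g t) z)).
by rewrite df.
Qed.

Lemma flow_mono z (s t : R) : s <= t -> f (flow s z) <= f (flow t z).
Proof.
move=> st; have t0 : 0 <= t - s by rewrite subr_ge0.
have := @ndecr_of_derive R (fun u => f (flow u (flow s z))) (fun u => energy (flow u (flow s z))) (t - s) t0.
rewrite flow0 -flowD subrK; apply => u _; split; [exact: flow_derive|exact: energy_ge0].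
Qed.

Lemma energy_chart x : (cfwd phi @` cdom phi) x -> energy (cbwd phi x) = chart_metric x (V x) (V x).
Proof. by move=> ix; rewrite chart_metricE// (chart_field_inv mZ act beta ix). Qed.

Lemma flow_chart_derive z (t : R) : cdom phi (flow t z) ->
  is_derive t 1 (fun s => cfwd phi (flow s z)) (V (cfwd phi (flow t z))).
Proof. exact: (orbit_chart_derive LH mZ holo_actM sact Hg). Qed.

Definition chart_ball (r : R) := [set z | cdom phi z /\ `|cfwd phi z - e| < r].
Definition chart_cball (r : R) := [set z | cdom phi z /\ `|cfwd phi z - e| <= r].

Lemma chart_ball_open r z : chart_ball r z -> \forall y \near z, chart_ball r y.
Proof.
move=> [dz lz]; apply: filterI; first exact: near_dom.
apply: (near_cfwd cp dz (P := fun x => `|x - e| < r)).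
have r0 : 0 < r - `|cfwd phi z - e| by rewrite subr_gt0.
have : \forall x \near cfwd phi z, ball (cfwd phi z) (r - `|cfwd phi z - e|) x by exact: nbhsx_ballx.
apply: filterS => x; rewrite -ball_normE /ball_ /= ltrBrDr distrC; apply: le_lt_trans.
by rewrite -{1}(subrK (cfwd phi z) x) -addrA ler_normD.
Qed.

(** The chart carries a compact ball onto this set, and compact sets are closed in a Hausdorff
    space. *)
Lemma chart_cball_closed r0 r : (forall x, ball e r0 x -> (cfwd phi @` cdom phi) x) -> r < r0 ->
  closed (chart_cball r).
Proof.
move=> Hr rr0; have -> : chart_cball r = cbwd phi @` [set x | `|x - e| <= r].
  apply/seteqP; split => z.
    by move=> [dz lz]; exists (cfwd phi z) => //; exact: chart_cbwdK.
  move=> [x /= lx <-]; have ix : (cfwd phi @` cdom phi) x.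
    by apply: Hr; rewrite -ball_normE /ball_ /= distrC (le_lt_trans lx).
  by have [dx ex] := chart_imgP cp ix; split => //; rewrite ex.
apply: (compact_closed cx_hausdorff); apply: continuous_compact.
  apply: continuous_in_subspaceT => x; rewrite inE /= => lx.
  have ix : (cfwd phi @` cdom phi) x.
    by apply: Hr; rewrite -ball_normE /ball_ /= distrC (le_lt_trans lx).
  by have [_ _ _ _] := cp; apply.
apply: bounded_closed_compact.
  exists (`|e| + r); split; [exact: num_real|move=> K rK x /= lx].
  rewrite (le_trans _ (ltW rK))// -{1}(subrK e x) addrC (le_trans (ler_normD _ _))// lerD2l.
  exact: lx.
have -> : [set x | `|x - e| <= r] = (fun x => `|x - e|) @^-1` [set t : R | t <= r] by [].
apply: preimage_closed; last exact: closed_le.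
move=> x _; apply: (@continuous_comp _ _ _ (fun x => x - e) (fun x => `|x|)); last exact: norm_continuous.
by apply: continuousB => //; exact: cst_continuous.
Qed.

(** Real induction on time. The open ball of radius [r] gives openness; as long as the distance is
    below [s], limit times are handled by the closed ball of radius [s]. *)
Lemma stay_or_reach r0 r s z : (forall x, ball e r0 x -> (cfwd phi @` cdom phi) x) -> s < r0 -> s < r ->
  chart_ball r z -> (forall t : R, 0 <= t -> chart_ball r (flow t z)) \/
  exists2 T : R, 0 <= T & (forall t : R, 0 <= t <= T -> chart_ball r (flow t z)) /\
    s <= `|cfwd phi (flow T z) - e|.
Proof.
move=> Hr sr0 sr bz; apply: contrapT => /not_orP[nA nE]; apply: nA.
have lt T : 0 <= T -> (forall t : R, 0 <= t <= T -> chart_ball r (flow t z)) ->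
    `|cfwd phi (flow T z) - e| < s.
  by move=> T0 HT; rewrite ltNge; apply/negP => sT; apply: nE; exists T.
apply: real_induction; first by rewrite flow0.
  move=> t bt; exact: (@flow_continuous z t _ (chart_ball_open bt)).
move=> T T0 HT.
suff [dT lT] : chart_cball s (flow T z) by split => //; exact: le_lt_trans lT sr.
apply: (closed_left_limit (chart_cball_closed Hr sr0) (@flow_continuous z T) T0) => t /andP[t0 tT].
have [dt _] : chart_ball r (flow t z) by apply: HT; rewrite t0.
split => //; rewrite ltW// lt// => u /andP[u0 ut]; apply: HT; rewrite u0 /=.
exact: le_lt_trans ut tT.
Qed.

(** With these values of [eta] and [delta], [decreasing_length] bounds the displacement by
    [rho / 4 + rho / 4]. Starting within [rho / 4] of the centre, the orbit cannot reach distance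
    [7 / 8 rho]. *)
Lemma trap : exists2 r0 : R, 0 < r0 & forall rho : R, 0 < rho -> rho < r0 -> exists2 delta : R, 0 < delta &
  forall z, chart_ball (rho / 4) z -> f p - f z <= delta -> (forall t : R, 0 <= t -> f (flow t z) <= f p) ->
  forall t : R, 0 <= t -> chart_ball rho (flow t z).
Proof.
have [K [L [r0 [K0 L0 r00 Hr]]]] := crit_local.
exists r0 => // rho rho0 rhor.
pose eta := rho / (4 * L); have eta0 : 0 < eta by rewrite divr_gt0// mulr_gt0.
exists (rho * eta / (4 * K)); first by rewrite divr_gt0// mulr_gt0.
move=> z [dz lz] uz Hz.
have Hi x : ball e r0 x -> (cfwd phi @` cdom phi) x by case/Hr.
have bz : chart_ball rho z by split => //; lra.
have s1 : 7 / 8 * rho < r0 by lra.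
have s2 : 7 / 8 * rho < rho by lra.
have [//|[T T0 [HT lT]]] := stay_or_reach Hi s1 s2 bz; exfalso.
have fe : fc e = f p by rewrite /fc (chart_cbwdK cp dp).
have := @decreasing_length R _ (fun t => cfwd phi (flow t z)) (fun t => V (cfwd phi (flow t z)))
  (fun t => f p - f (flow t z)) (fun t => energy (flow t z)) T K L eta T0 K0 L0 eta0.
have W : forall t : R, 0 <= t <= T ->
    [/\ is_derive t 1 (fun t0 : R => cfwd phi (flow t0 z)) (V (cfwd phi (flow t z))),
     is_derive t 1 (fun t0 : R => f p - f (flow t0 z)) (- energy (flow t z)),
     `|V (cfwd phi (flow t z))| ^+ 2 <= K * energy (flow t z)
    & 0 <= f p - f (flow t z) <= L * energy (flow t z)].
  move=> t tT; have [dt lt] := HT t tT.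
  have bt : ball e r0 (cfwd phi (flow t z)) by rewrite -ball_normE /ball_ /= distrC (lt_trans lt).
  have [ix q1 q2] := Hr _ bt; have Ez := chart_cbwdK cp dt.
  rewrite -(energy_chart ix) Ez in q1 q2; rewrite fe /fc Ez distrC in q2.
  split => //; first exact: flow_chart_derive.
    have := @is_deriveB R R^o R^o (cst (f p)) (fun s => f (flow s z)) t 1 0 _ (is_derive_cst _ _ _) (flow_derive z t).
    by rewrite sub0r.
  have t0 : 0 <= t by case/andP: tT.
  rewrite subr_ge0 Hz//=.
  exact: le_trans (ler_norm _) q2.
move=> /(_ W); rewrite flow0 => le.
have le2 : K * (f p - f z) / eta <= rho / 4.
  rewrite ler_pdivrMr//; move: uz; rewrite ler_pdivlMr ?mulr_gt0//.
  by move=> h; rewrite -(ler_pM2l (ltr0Sn R 3)); lra.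
have le3 : L * eta = rho / 4 by rewrite /eta; field; rewrite gt_eqF.
have tri : `|cfwd phi (flow T z) - e| <= `|cfwd phi (flow T z) - cfwd phi z| + `|cfwd phi z - e|.
  by rewrite (le_trans _ (ler_normD _ _))// addrA subrK.
by move: lT; rewrite leNgt => /negP; apply; lra.
Qed.

Definition linearization : 'M[R]_(n + n) := lin1_mx ('d V e).
Local Notation A := linearization.
Local Notation b := (chart_metric e).
Let ie : (cfwd phi @` cdom phi) e := chart_img dp.
Let CV : Coo_at V e := chart_field_Coo LH mZ holo_act1 sact beta ie.
Let bl : forall a u v w, b (a *: u + v) w = a * b u w + b v w := chart_metricDl e.
Let bC u v : b u v = b v u := chart_metricC u v ie.
Let bpos v : v != 0 -> 0 < b v v := @chart_metric_gt0 e v ie.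

Lemma linearizationE v : v *m A = 'd V e v. Proof. by rewrite mul_rV_lin1. Qed.

Lemma linearization_eps eps : 0 < eps -> \forall x \near e, `|V x - (x - e) *m A| <= eps * `|x - e|.
Proof.
move=> e0; have := is_diff_eps (Coo_at_differentiable CV) e0.
by apply: filterS => x; rewrite chart_field_crit subr0 linearizationE.
Qed.

Lemma hessian_eps eps : 0 < eps -> \forall x \near e, forall v,
  `|chart_metric x (V x) v - b ((x - e) *m A) v| <= eps * `|x - e| * `|v|.
Proof.
move=> e0; have [C1 C10 HC1] := bform_bound bl bC; have [C2 C20 HC2] := mulmx_norm_bound A.
have e1 : 0 < eps / (2 * (C2 + 1)) by rewrite divr_gt0// mulr_gt0// addr_gt0.
have e2 : 0 < Num.min 1 (eps / (2 * C1)) by rewrite lt_min ltr01 divr_gt0// mulr_gt0.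
apply: filterS2 (chart_metric_near e1) (linearization_eps e2) => x Hx lx v.
set h := x - e in lx *; set y := V x in lx *.
have ly : `|y| <= (C2 + 1) * `|h|.
  rewrite -(subrK (h *m A) y) (le_trans (ler_normD _ _))// mulrDl addrC lerD//.
  by rewrite (le_trans lx)// ler_wpM2r// ge_min lexx.
have lx' : `|y - h *m A| <= eps / (2 * C1) * `|h|.
  by rewrite (le_trans lx)// ler_wpM2r// ge_min lexx orbT.
have E : b y v - b (h *m A) v = b (y - h *m A) v by rewrite (bformB bl).
have -> : chart_metric x y v - b (h *m A) v = (chart_metric x y v - b y v) + b (y - h *m A) v.
  by rewrite -E addrA subrK.
rewrite (le_trans (ler_normD _ _))//.
have k1 : `|chart_metric x y v - b y v| <= eps / 2 * (`|h| * `|v|).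
  rewrite (le_trans (Hx y v))// mulrA ler_wpM2r//.
  rewrite (le_trans (ler_wpM2l (ltW e1) ly))// le_eqVlt; apply/orP; left; apply/eqP.
  by field; rewrite gt_eqF// addr_gt0.
have k2 : `|b (y - h *m A) v| <= eps / 2 * (`|h| * `|v|).
  rewrite (le_trans (HC1 _ _))// mulrA ler_wpM2r//.
  rewrite (le_trans (ler_wpM2l (ltW C10) lx'))// le_eqVlt; apply/orP; left; apply/eqP.
  by field; rewrite gt_eqF.
by rewrite (le_trans (lerD k1 k2))// -mulrDl -splitr mulrA.
Qed.

(** At a critical point [b (w A) y] is the second derivative of the function, so this is the
    symmetry of the Hessian. *)
Lemma linearization_sym u v : b (u *m A) v = b u (v *m A).
Proof.
have D (y : 'rV[R]_(n + n)) w : 'd (fun x => 'd (fc : _ -> R^o) x y) e w = b (w *m A) y.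
  have n1 : \forall x \near e, (chart_metric x (V x) y : R^o) = 'd (fc : _ -> R^o) x y.
    by apply: filterS (near_img cp ie) => x ix; rewrite chart_fun_diff.
  have lin : linear ((fun w => b (w *m A) y) : 'rV[R]_(n + n) -> R^o).
    by move=> a u' v'; rewrite mulmxDl -scalemxAl bl.
  have is1 : is_diff e (fun x => chart_metric x (V x) y : R^o) (mklin lin).
    apply/is_diff_epsP; split; first exact: findim_continuous (findim_rV _).
    move=> eps e0; have e1 : 0 < eps / (`|y| + 1) by rewrite divr_gt0// ltr_wpDl.
    apply: filterS (hessian_eps e1) => x Hx.
    have -> : chart_metric e (V e) y = 0 by rewrite chart_field_crit (bform0 bl).
    rewrite subr0; apply: le_trans (Hx y) _; move: `|x - e| (normr_ge0 (x - e)) => t t0.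
    move: `|y| (normr_ge0 y) => s s0.
    have -> : eps / (s + 1) * t * s = eps * t * (s / (s + 1)) by ring.
    apply: ler_piMr; first by rewrite mulr_ge0// ltW.
    by rewrite ler_pdivrMr ?ltr_wpDl// mul1r lerDl.
  have [d0 E] := is_diffE is1.
  by rewrite -(near_eq_diffE w n1 d0) E.
have S := schwarz_symmetry v u (chart_fun_Coo ie).
exact: etrans (esym (D v u)) (etrans S (etrans (D u v) (bC _ _))).
Qed.

(** The mean value theorem produces [t Q] for an unknown [t] between 0 and 1, whence the maximum
    with 0. *)
Lemma second_order_upper eps : 0 < eps -> \forall x \near e,
  fc x - fc e <= Num.max 0 (b ((x - e) *m A) (x - e)) + eps * `|x - e| ^+ 2.
Proof.
move=> e0; have nn : \forall x \near e, (cfwd phi @` cdom phi) x /\ forall v,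
    `|chart_metric x (V x) v - b ((x - e) *m A) v| <= eps * `|x - e| * `|v|.
  exact: filterI (near_img cp ie) (hessian_eps e0).
have /nbhs_ballP[r /= r0 Hr] := nn.
have : \forall x \near e, ball e r x by exact: nbhsx_ballx.
apply: filterS => x bx; set v := x - e; set Q := b _ _.
have seg (t : R) : 0 <= t <= 1 -> ball e r (e + t *: v).
  by move=> t01; apply: (ball_segment (ballxx e r0) bx t01).
have dl (t : R) : 0 <= t <= 1 -> is_derive t 1 (fun s : R => fc (e + s *: v))
    ('d (fc : _ -> R^o) (e + t *: v) v).
  by move=> t01; have [it _] := Hr _ (seg t t01); exact: diff_line (Coo_at_differentiable (chart_fun_Coo it)).
have [| |t t01] := @MVT_segment R (fun s : R => fc (e + s *: v)) (fun s => 'd (fc : _ -> R^o) (e + s *: v) v) 0 1 ler01.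
- by move=> t; rewrite in_itv /= => /andP[t0 t1]; apply: dl; rewrite !ltW.
- apply: derivable_within_continuous => t; rewrite in_itv /= => t01.
  by have [] := dl t t01.
rewrite scale1r scale0r addr0 subr0 mulr1 /v [e + (x - e)]addrC subrK -/v => ->.
move: t01; rewrite in_itv /= => t01; have [it Ht] := Hr _ (seg t t01).
have /andP[t0 t1] := t01.
rewrite chart_fun_diff//; have := Ht v.
have -> : e + t *: v - e = t *: v by rewrite addrC addKr.
rewrite -scalemxAl (bformZ bl) -/Q normrZ (ger0_norm t0) => h.
have h1 : t * Q <= Num.max 0 Q.
  have [Q0|Q0] := leP Q 0.
    exact: mulr_ge0_le0.
  by rewrite ler_piMl// ltW.
have h2 : eps * (t * `|v|) * `|v| <= eps * `|v| ^+ 2.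
  by rewrite expr2 -mulrA ler_pM2l// -mulrA ler_piMl// mulr_ge0.
have gen (m x1 x2 x3 x4 : R) : `|x1 - x2| <= x3 -> x2 <= m -> x3 <= x4 -> x1 <= m + x4.
  by rewrite ler_norml => /andP[_ ?] ? ?; lra.
exact: gen h h1 h2.
Qed.

Variable fB : R.
Hypothesis f_le : forall z, f z <= fB.

(* The energy identity bounds the length of an orbit by the growth of [f], by the
   Lojasiewicz inequality of [crit_local]. *)
Lemma exit_growth : exists k1 r0 : R, [/\ 0 < k1, 0 < r0 & forall rho, 0 < rho -> rho < r0 ->
  forall z, chart_ball (rho / 4) z -> f p < f z ->
  exists2 t : R, chart_ball rho (flow t z) & k1 * rho ^+ 2 <= f (flow t z) - f p].
Proof.
have [K [L [r0 [K0 L0 r00 Hr]]]] := crit_local.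
(* From [rho / 4] to [3 / 4 rho] the length is at least [rho / 2]; the term [L eta = rho / 4] leaves
   [rho / 4 <= K (f - f p) / eta], which is this constant times [rho ^ 2]. *)
exists (16 * K * L)^-1, r0.
split => //; first by rewrite invr_gt0// !mulr_gt0.
move=> rho rho0 rhor z [dz lz] uz.
have Hi x : ball e r0 x -> (cfwd phi @` cdom phi) x by case/Hr.
have bz : chart_ball rho z by split => //; lra.
have fe : fc e = f p by rewrite /fc (chart_cbwdK cp dp).
have pos (t : R) : 0 <= t -> 0 <= f (flow t z) - f p.
  by move=> t0; rewrite subr_ge0 (le_trans (ltW uz))// -{1}(flow0 z) flow_mono.
have W (t : R) : 0 <= t -> chart_ball rho (flow t z) ->
    [/\ is_derive t 1 (fun t0 : R => cfwd phi (flow t0 z)) (V (cfwd phi (flow t z))),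
     is_derive t 1 (fun t0 : R => f (flow t0 z) - f p) (energy (flow t z)),
     `|V (cfwd phi (flow t z))| ^+ 2 <= K * energy (flow t z)
    & 0 <= f (flow t z) - f p <= L * energy (flow t z)].
  move=> t0 [dt lt].
  have bt : ball e r0 (cfwd phi (flow t z)) by rewrite -ball_normE /ball_ /= distrC (lt_trans lt).
  have [ix q1 q2] := Hr _ bt; have Ez := chart_cbwdK cp dt.
  rewrite -(energy_chart ix) Ez in q1 q2; rewrite fe /fc Ez in q2.
  split => //; first exact: flow_chart_derive.
    have := @is_deriveB R R^o R^o (fun s => f (flow s z)) (cst (f p)) t 1 _ 0 (flow_derive z t) (is_derive_cst _ _ _).
    by rewrite subr0.
  by rewrite pos//=; exact: le_trans (ler_norm _) q2.
have s1 : 3 / 4 * rho < r0 by lra.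
have s2 : 3 / 4 * rho < rho by lra.
(* An orbit that stayed for ever would make [f - f p] grow exponentially, beyond the bound [fB]. *)
have [st|[T T0 [HT lT]]] := stay_or_reach Hi s1 s2 bz.
  exfalso; have u0 : 0 < f z - f p by rewrite subr_gt0.
  have Li : 0 < L^-1 by rewrite invr_gt0.
  have [T T0 lT] := unbounded_exponential (fB - f p) Li u0.
  have := @exponential_growth R (fun t => f (flow t z) - f p) (fun t => energy (flow t z)) L^-1.
  have G (t : R) : 0 <= t -> is_derive t 1 (fun t => f (flow t z) - f p) (energy (flow t z)) /\
      L^-1 * (f (flow t z) - f p) <= energy (flow t z).
    move=> t0; have [_ ? _ /andP[_ le]] := W t t0 (st t t0); split => //.
    by rewrite mulrC ler_pdivrMr// mulrC.
  move=> /(_ G T T0); rewrite flow0; have := f_le (flow T z); lra.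
exists T; first by apply: HT; rewrite T0 lexx.
pose eta := rho / (4 * L); have eta0 : 0 < eta by rewrite divr_gt0// mulr_gt0.
have := @increasing_length R _ (fun t => cfwd phi (flow t z)) (fun t => V (cfwd phi (flow t z)))
  (fun t => f (flow t z) - f p) (fun t => energy (flow t z)) T K L eta T0 K0 L0 eta0.
have W' (t : R) : 0 <= t <= T -> _ := fun tT => W t (proj1 (andP tT)) (HT t tT).
move=> /(_ W'); rewrite flow0 => le.
have le3 : L * eta = rho / 4 by rewrite /eta; field; rewrite gt_eqF.
have tri : `|cfwd phi (flow T z) - e| <= `|cfwd phi (flow T z) - cfwd phi z| + `|cfwd phi z - e|.
  by rewrite (le_trans _ (ler_normD _ _))// addrA subrK.
have le4 : rho / 4 <= K * (f (flow T z) - f p) / eta by lra.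
rewrite ler_pdivlMr// in le4.
rewrite mulrC ler_pdivrMr ?mulr_gt0//.
have -> : rho ^+ 2 = 16 * L * (rho / 4 * eta) by rewrite /eta; field; rewrite gt_eqF.
have -> : (f (flow T z) - f p) * (16 * K * L) = 16 * L * (K * (f (flow T z) - f p)) by ring.
by rewrite ler_pM2l// mulr_gt0.
Qed.

Lemma cone_pair cc : 0 < cc -> A - cc%:M \in unitmx -> exists2 r0 : R, 0 < r0 & forall rho, rho < r0 ->
  forall z1 z2, (forall t : R, 0 <= t -> chart_cball rho (flow t z1)) ->
    (forall t : R, 0 <= t -> chart_cball rho (flow t z2)) ->
  cone_form b A cc (cfwd phi z2 - cfwd phi z1) <= 0.
Proof.
move=> c0 uc; have [eps e0 H1] := cone_trapped bl bC bpos linearization_sym c0 uc.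
have [W [oW We VW]] := CV.
have [r0 r00 Hr] := ex_right (C1_strict (findim_rV _) oW We (VW 1%N) e0).
exists r0 => // rho rr z1 z2 s1 s2.
have := H1 (fun t => cfwd phi (flow t z1)) (fun t => cfwd phi (flow t z2))
  (fun t => V (cfwd phi (flow t z1))) (fun t => V (cfwd phi (flow t z2))) (2 * rho).
rewrite !flow0; apply => t t0; have [d1 l1] := s1 t t0; have [d2 l2] := s2 t t0.
have b1 : ball e r0 (cfwd phi (flow t z1)) by rewrite -ball_normE /ball_ /= distrC (le_lt_trans l1).
have b2 : ball e r0 (cfwd phi (flow t z2)) by rewrite -ball_normE /ball_ /= distrC (le_lt_trans l2).
split; [exact: flow_chart_derive|exact: flow_chart_derive| |].
  by have [_ _ _] := Hr _ _ b1 b2; rewrite linearizationE.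
rewrite -(subrK e (cfwd phi (flow t z2))) -addrA (le_trans (ler_normD _ _))//.
by rewrite [`|e - _|]distrC; lra.
Qed.

Section submanifold.
Context {r : nat}.
Variables (M : charted_space 'rV[R]_r) (iota : M -> Z).
Hypotheses (mM : mfld M) (hiota : smooth_embedding iota).
Variable p0 : M.
Hypothesis (Ep : iota p0 = p).
Hypothesis inv_flow : forall t y, exists y', flow t (iota y) = iota y'.
Hypothesis nmax : ~ \forall y \near p0, f (iota y) <= f p.

Let psi := chart_at p0.
Let y0 := cfwd psi p0.
Let cpsi : is_chart psi := chart_at_is mM p0.
Let dpsi : cdom psi p0 := dom_at mM p0.
Definition sub_param (y : 'rV[R]_r) : 'rV[R]_(n + n) := cfwd phi (iota (cbwd psi y)).

Lemma sub_param0 : sub_param y0 = e.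
Proof. by rewrite /sub_param /y0 (chart_cbwdK cpsi dpsi) Ep. Qed.

Lemma sub_param_Coo y : (cfwd psi @` cdom psi) y -> cdom phi (iota (cbwd psi y)) -> Coo_at sub_param y.
Proof.
move=> iy dy; have mE : mfld (euclid 'rV[R]_r) by exact/euclid_mfld/findim_rV.
apply/(smat_euclidP _ _ (findim_rV _) (findim_rV _)).
apply: (smat_comp mE mZ (f := (fun y => iota (cbwd psi y)) : euclid 'rV[R]_r -> Z)).
  exact: (smat_comp mE mM (smat_cbwd mM (atlas_at mM p0) iy) (embedding_smat mM mZ hiota _)).
exact: (smat_cfwd mZ ap dy).
Qed.

Let C0 : Coo_at sub_param y0.
Proof.
apply: sub_param_Coo; first exact: chart_img.
by rewrite /y0 (chart_cbwdK cpsi dpsi) Ep.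
Qed.

Lemma sub_param_inj : injective ('d sub_param y0).
Proof.
have [_ _ inj _] := hiota; have := inj p0.
by rewrite /tangent_map Ep.
Qed.

Lemma chart_ball_sub (P : set Z) : (\forall z \near p, P z) -> exists2 rho : R, 0 < rho &
  forall z, chart_ball rho z -> P z.
Proof.
move=> nP; have n1 : \forall x \near e, P (cbwd phi x) := near_cbwd cp dp nP.
have /nbhs_ballP[rho /= rho0 Hr] := n1; exists rho => // z [dz lz].
by rewrite -(chart_cbwdK cp dz); apply: Hr; rewrite -ball_normE /ball_ /= distrC.
Qed.

(* Otherwise [f] exceeds [f p] by at most [o(rho ^ 2)] on the submanifold, against
   [exit_growth]. *)
Lemma unstable_direction : exists w, 0 < b ('d sub_param y0 w *m A) ('d sub_param y0 w).
Proof.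
apply: contrapT => nw; have le0 w : b ('d sub_param y0 w *m A) ('d sub_param y0 w) <= 0.
  by rewrite leNgt; apply/negP => h; apply: nw; exists w.
have [k1 [r0 [k10 r00 Hexit]]] := exit_growth.
have [C C_0 HC] := linear_injective_bound sub_param_inj.
have [C1 C10 HC1] := bform_bound bl bC; have [C2 C20 HC2] := mulmx_norm_bound A.
pose M0 := C1 * C2 * (2 * C) * 3; have M00 : 0 < M0 by rewrite !mulr_gt0.
(* The first bound yields [|h| <= 2 C |v|]; the second makes the Hessian term at most
   [k1 / 4 |v|^2], given that it is not positive along the submanifold. *)
pose e1 := Num.min (2 * C)^-1 (k1 / (4 * M0)).
have e10 : 0 < e1 by rewrite lt_min; apply/andP; split; [rewrite invr_gt0 mulr_gt0|rewrite divr_gt0// mulr_gt0].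
have le1 : e1 <= (2 * C)^-1 by rewrite ge_min lexx.
have le2 : e1 <= k1 / (4 * M0) by rewrite ge_min lexx orbT.
have n1 := is_diff_eps (Coo_at_differentiable C0) e10.
have k40 : 0 < k1 / 4 by rewrite divr_gt0.
have cC0 := Coo_at_continuous C0.
have n2 : \forall y \near y0, fc (sub_param y) - fc e <=
    Num.max 0 (b ((sub_param y - e) *m A) (sub_param y - e)) + k1 / 4 * `|sub_param y - e| ^+ 2.
  by have := second_order_upper k40; rewrite -sub_param0 => h; exact: cC0 h.
have fe : fc e = f p by rewrite /fc (chart_cbwdK cp dp).
have key : \forall y \near y0, fc (sub_param y) - f p <= k1 / 2 * `|sub_param y - e| ^+ 2.
  apply: filterS2 n1 n2 => y; rewrite sub_param0 fe; set v := sub_param y - e; set h := y - y0.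
  set Dh := 'd sub_param y0 h => l1 l2.
  have lh : `|h| <= 2 * C * `|v|.
    have q1 : `|h| <= C * (`|v| + e1 * `|h|).
      rewrite (le_trans (HC h))// ler_pM2l// -/Dh.
      rewrite -[Dh](subrK v) addrC (le_trans (ler_normD _ _))// lerD2l distrC//.
    have q2 : C * (e1 * `|h|) <= `|h| / 2.
      rewrite mulrA mulrC ler_wpM2l// mulrC.
      rewrite -ler_pdivlMr// (le_trans le1)// invfM mulrC//.
    have {}q1 : `|h| <= C * `|v| + C * (e1 * `|h|) by rewrite -mulrDr.
    have := le_trans q1 (lerD (lexx _) q2); lra.
  have lD : `|Dh| <= 2 * `|v|.
    rewrite -[Dh](subrK v) (le_trans (ler_normD _ _))// mulr_natl mulr2n lerD2r distrC.
    rewrite (le_trans l1)// (le_trans (ler_wpM2l (ltW e10) lh))//.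
    rewrite mulrA ler_piMl// -ler_pdivlMr ?mulr_gt0// mul1r//.
  have B : b (v *m A) v <= M0 * e1 * `|v| ^+ 2.
    have -> : b (v *m A) v = b ((v - Dh) *m A) v + b (Dh *m A) (v - Dh) + b (Dh *m A) Dh.
      have gen (x1 x2 x3 : R) : x1 = x1 - x2 + (x2 - x3) + x3 by ring.
      by rewrite (mulmxBl v Dh A) (bformB bl (v *m A) (Dh *m A) v) (bformBr bl bC (Dh *m A) v Dh) -gen.
    have d1 : `|v - Dh| <= e1 * (2 * C * `|v|).
      by rewrite (le_trans l1)// ler_pM2l.
    have t1 : b ((v - Dh) *m A) v <= C1 * (C2 * (e1 * (2 * C * `|v|))) * `|v|.
      rewrite (le_trans (ler_norm _))// (le_trans (HC1 _ _))// ler_wpM2r// ler_pM2l//.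
      by rewrite (le_trans (HC2 _))// ler_pM2l.
    have t2 : b (Dh *m A) (v - Dh) <= C1 * (C2 * (2 * `|v|)) * (e1 * (2 * C * `|v|)).
      rewrite (le_trans (ler_norm _))// (le_trans (HC1 _ _))//.
      apply: ler_pM => //; first by rewrite mulr_ge0// ltW.
      by rewrite ler_pM2l// (le_trans (HC2 _))// ler_pM2l.
    have gen (x1 x2 x3 y1 y2 y3 : R) : x1 <= y1 -> x2 <= y2 -> x3 <= 0 -> y1 + y2 = y3 -> x1 + x2 + x3 <= y3.
      by move=> h1 h2 h3 <-; rewrite -[leRHS]addr0 !lerD.
    by apply: gen t1 t2 (le0 h) _; rewrite /M0; ring.
  have B2 : b (v *m A) v <= k1 / 4 * `|v| ^+ 2.
    rewrite (le_trans B)// ler_wpM2r ?sqr_ge0// mulrC -ler_pdivlMr//.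
    by rewrite (le_trans le2)// invfM mulrA.
  rewrite (le_trans l2)//; have -> : k1 / 2 = k1 / 4 + k1 / 4 by field.
  by rewrite [leRHS]mulrDl lerD2r ge_max B2 andbT mulr_ge0 ?sqr_ge0// ltW.
have n3 : \forall m \near p0, cdom psi m /\ fc (sub_param (cfwd psi m)) - f p <= k1 / 2 * `|sub_param (cfwd psi m) - e| ^+ 2.
  by apply: filterI; [exact: near_dom|exact: (near_cfwd cpsi dpsi key)].
have n4 := embedding_near hiota n3; rewrite Ep in n4.
have [rho1 rho10 Hrho] := chart_ball_sub n4.
pose rho := Num.min rho1 r0 / 2.
have m0 : 0 < Num.min rho1 r0 by rewrite lt_min rho10.
have [m1 m2] : Num.min rho1 r0 <= rho1 /\ Num.min rho1 r0 <= r0 by rewrite !ge_min !lexx orbT.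
have rho0 : 0 < rho by rewrite divr_gt0.
have rm : rho < Num.min rho1 r0 by rewrite /rho ltr_pdivrMr// ltr_pMr// ltr1n.
have rr0 : rho < r0 := lt_le_trans rm m2.
apply: nmax; have q0 : 0 < rho / 4 by rewrite divr_gt0.
have bp : chart_ball (rho / 4) p by split => //; rewrite subrr normr0.
have [ci _] := embedding_smat mM mZ hiota p0.
have n5 : \forall m \near p0, chart_ball (rho / 4) (iota m).
  by apply: ci; rewrite Ep; exact: chart_ball_open.
apply: filterS n5 => m bm; rewrite leNgt; apply/negP => lt.
(* A point of [M] above the level of [p] would gain at least [k1 rho ^ 2] inside the ball, while
   [key] allows at most half of this on [M], which the flow preserves. *)
have [t bt kt] := Hexit rho rho0 rr0 _ bm lt.
have [m' Em'] := inv_flow t m.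
have bt1 : chart_ball rho1 (flow t (iota m)).
  have [dt lt1] := bt; split => //; apply: lt_le_trans lt1 _.
  exact: le_trans (ltW rm) m1.
have [dm Hm] := Hrho _ bt1 m' (esym Em').
have [dt lt1] := bt; rewrite Em' in dt lt1 kt.
move: Hm; rewrite /sub_param (chart_cbwdK cpsi dm) /fc (chart_cbwdK cp dt) => Hm.
have sq : `|cfwd phi (iota m') - e| ^+ 2 <= rho ^+ 2 by rewrite lerXn2r ?nnegrE// ltW.
have sq0 : 0 < k1 * rho ^+ 2 by rewrite mulr_gt0// exprn_gt0.
have := le_trans kt (le_trans Hm (ler_wpM2l (ltW (divr_gt0 k10 (ltr0Sn R 1))) sq)).
by rewrite mulrAC ler_pdivlMr// mulr_natr mulr2n gerDl leNgt sq0.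
Qed.
Variable flowM : R -> M -> M.
Hypothesis HflowM : forall t y, iota (flowM t y) = flow t (iota y).

Lemma flowM_smat t y : smat (flowM t) y.
Proof.
apply: (smat_lift mM mZ hiota mM).
have -> : iota \o flowM t = flow t \o iota by apply/funext => x; exact: HflowM.
exact: (smat_comp mM mZ (embedding_smat mM mZ hiota y) (flow_smat t _)).
Qed.

Lemma flowMN t y : flowM (- t) (flowM t y) = y.
Proof.
by have [_ inj _ _] := hiota; apply: inj; rewrite !HflowM -flowD addNr flow0.
Qed.

Lemma cone_form_continuous cc v : 0 < cone_form b A cc v ->
  exists2 eps : R, 0 < eps & forall u, `|u - v| <= eps -> 0 < cone_form b A cc u.
Proof.
have [C1 C10 HC1] := bform_bound bl bC; have [C2 C20 HC2] := mulmx_norm_bound A.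
move=> q0; set q := cone_form b A cc v in q0.
pose M1 := (C1 * C2 + `|cc| * C1) * (2 * `|v| + 1) + 1.
have M10 : 0 < M1 by rewrite ltr_wpDl// !(mulr_ge0, addr_ge0)// ltW.
pose eps := Num.min 1 (q / (2 * M1)).
have eps0 : 0 < eps by rewrite lt_min ltr01 divr_gt0// mulr_gt0.
exists eps => // u lu; set h := u - v in lu.
have eu : u = v + h by rewrite /h addrC subrK.
clearbody h.
have lh1 : `|h| <= 1 by rewrite (le_trans lu)// ge_min lexx.
have lh2 : `|h| * M1 <= q / 2.
  rewrite -ler_pdivlMr// (le_trans lu)// ge_min; apply/orP; right.
  by rewrite invfM mulrA.
have bb x y : `|b (x *m A) y - cc * b x y| <= (C1 * C2 + `|cc| * C1) * (`|x| * `|y|).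
  rewrite (le_trans (ler_normB _ _))// mulrDl lerD//.
    rewrite (le_trans (HC1 _ _))// mulrA ler_wpM2r// -[C1 * C2 * _]mulrA ler_pM2l//.
  rewrite normrM -mulrA ler_wpM2l// (le_trans (HC1 _ _))//.
  by rewrite mulrA.
have E : cone_form b A cc u = q + ((b (v *m A) h - cc * b v h) + (b (h *m A) v - cc * b h v) +
    (b (h *m A) h - cc * b h h)).
  rewrite /q /cone_form eu (mulmxDl v h A) !(bformD bl, bformDr bl bC).
  move: (b (v *m A) v) (b (v *m A) h) (b (h *m A) v) (b (h *m A) h) (b v v) (b v h) (b h v) (b h h).
  by move=> *; ring.
rewrite E; have k1 := bb v h; have k2 := bb h v; have k3 := bb h h.
set a1 := _ - _ in k1 *; set a2 := _ - _ in k2 *; set a3 := _ - _ in k3 *.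
set CC := C1 * C2 + _ in k1 k2 k3.
have CC0 : 0 <= CC by rewrite addr_ge0 ?mulr_ge0// ltW.
have kk : `|a1 + a2 + a3| <= `|h| * M1.
  rewrite (le_trans (ler_normD _ _))// (le_trans (lerD (ler_normD _ _) (lexx _)))//.
  rewrite (le_trans (lerD (lerD k1 k2) k3))//.
  have -> : CC * (`|v| * `|h|) + CC * (`|h| * `|v|) + CC * (`|h| * `|h|) = `|h| * (CC * (2 * `|v| + `|h|)) by ring.
  rewrite ler_wpM2l// /M1 -/CC (le_trans (ler_wpM2l CC0 (lerD (lexx _) lh1)))// lerDl//.
have := le_trans kk lh2; rewrite ler_norml => /andP[h1 _].
by move: h1 q0; lra.
Qed.

Lemma cone_formZ cc s v : cone_form b A cc (s *: v) = s ^+ 2 * cone_form b A cc v.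
Proof.
rewrite /cone_form -scalemxAl (bformZ bl) (bformZr bl bC) (bformZ bl) (bformZr bl bC).
by move: (b (v *m A) v) (b v v); move=> *; ring.
Qed.

(* The difference of two orbits staying near [p] cannot lie in the unstable cone,
   where it would grow exponentially. *)
Lemma stable_set_transversal : exists2 r0 : R, 0 < r0 & forall rho, rho < r0 -> forall T y1,
  let D := [set y | forall t, T <= t -> chart_cball rho (flow t (iota y))] in
  let chi := chart_at y1 in
  D y1 -> exists2 w : 'rV[R]_r, w != 0 & exists2 delta : R, 0 < delta &
    forall a a' s, ball (cfwd chi y1) delta a -> ball (cfwd chi y1) delta a' ->
      D (cbwd chi a) -> D (cbwd chi a') -> a' - a = s *: w -> s = 0.
Proof.
have [w bw] := unstable_direction.
have [cc [cc0 uc qw]] := cone_exists bl bpos bw.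
have [r0 r00 Hpair] := cone_pair cc0 uc.
have mE : mfld (euclid 'rV[R]_r) by exact/euclid_mfld/findim_rV.
have n1 : \forall y \near y0, 0 < cone_form b A cc ('d sub_param y w).
  have [eps eps0 He] := cone_form_continuous qw.
  have c1 := Coo_at_continuous (Coo_at_diff w C0).
  rewrite continuous_normP in c1.
  by apply: filterS (c1 eps eps0) => y; exact: He.
have n2 : \forall m \near p0, cdom psi m /\ 0 < cone_form b A cc ('d sub_param (cfwd psi m) w).
  by apply: filterI; [exact: near_dom|exact: (near_cfwd cpsi dpsi n1)].
have n3 := embedding_near hiota n2; rewrite Ep in n3.
have [rho1 rho10 Hrho] := chart_ball_sub n3.
exists (Num.min r0 rho1); first by rewrite lt_min r00.
move=> rho; rewrite lt_min => /andP[lr0 lr1] T y1 D chi Dy1.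
have cchi : is_chart chi := chart_at_is mM y1; have dchi : cdom chi y1 := dom_at mM y1.
have achi : atlas chi := atlas_at mM y1.
pose m1 := flowM T y1; pose u1 := cfwd psi m1; pose a1 := cfwd chi y1.
have [dT lT] := Dy1 T (lexx T).
have [dm1 qm1] : cdom psi m1 /\ 0 < cone_form b A cc ('d sub_param (cfwd psi m1) w).
  apply: (Hrho (flow T (iota y1))); last by rewrite HflowM.
  by split => //; exact: le_lt_trans lT lr1.
pose G (a : 'rV[R]_r) := cfwd phi (flow T (iota (cbwd chi a))).
pose tau (u : 'rV[R]_r) := cfwd chi (flowM (- T) (cbwd psi u)).
have ta : tau u1 = a1 by rewrite /tau /u1 (chart_cbwdK cpsi dm1) flowMN.
have Ctau : Coo_at tau u1.
  apply/(smat_euclidP _ _ (findim_rV _) (findim_rV _)).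
  have s1 : smat (cbwd psi : euclid 'rV[R]_r -> M) u1 := smat_cbwd mM (atlas_at mM p0) (chart_img dm1).
  apply: (smat_comp mE mM (smat_comp mE mM s1 (flowM_smat (- T) _)) (smat_cfwd mM achi _)).
  by rewrite /u1 /= (chart_cbwdK cpsi dm1) flowMN.
have CG : Coo_at G a1.
  apply/(smat_euclidP _ _ (findim_rV _) (findim_rV _)).
  have s1 : smat (cbwd chi : euclid 'rV[R]_r -> M) a1 := smat_cbwd mM achi (chart_img dchi).
  have s2 := smat_comp mE mM s1 (embedding_smat mM mZ hiota _).
  apply: (smat_comp mE mZ (smat_comp mE mZ s2 (flow_smat T _)) (smat_cfwd mZ ap _)).
  by rewrite /a1 /= (chart_cbwdK cchi dchi).
(* The unstable direction is known near [p0]; the flow at time [- T] brings it back to the chart at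
   [y1]. *)
pose w' := 'd tau u1 w.
have dGw : 'd G a1 w' = 'd sub_param u1 w.
  have nG : \forall u \near u1, (G \o tau) u = sub_param u.
    have nn : \forall u \near u1, cdom chi (flowM (- T) (cbwd psi u)).
      have [cf _] := smat_comp mE mM (smat_cbwd mM (atlas_at mM p0) (chart_img dm1)) (flowM_smat (- T) _).
      apply: cf; apply: (near_dom cchi).
      by rewrite /= (chart_cbwdK cpsi dm1) flowMN.
    apply: filterS nn => u du.
    by rewrite /= /G /tau (chart_cbwdK cchi du) HflowM -flowD subrr flow0.
  exact: chain_near (Coo_at_differentiable Ctau) ta (Coo_at_differentiable CG) nG.
have qw' : 0 < cone_form b A cc ('d G a1 w') by rewrite dGw.
have [eps eps0 He] := cone_form_continuous qw'.
exists w'.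
  apply/eqP => w0; move: qw'; rewrite w0 linear0.
  by rewrite /cone_form mul0mx !(bform0 bl) mulr0 subrr ltxx.
have e1 : 0 < eps / (`|w'| + 1) by rewrite divr_gt0// ltr_wpDl.
have [W [oW We WG]] := CG.
have [delta d0 Hd] := ex_right (C1_strict (findim_rV _) oW We (WG 1%N) e1).
exists delta => // a a' s ba ba' Da Da' Es; apply/eqP; apply: contraT => s0.
have fT z t : flow t (flow T (iota z)) = flow (t + T) (iota z) by rewrite flowD.
have h1 (t : R) : 0 <= t -> chart_cball rho (flow t (flow T (iota (cbwd chi a)))).
  by move=> t0; rewrite fT; apply: Da; rewrite lerDr.
have h2 (t : R) : 0 <= t -> chart_cball rho (flow t (flow T (iota (cbwd chi a')))).
  by move=> t0; rewrite fT; apply: Da'; rewrite lerDr.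
have := Hpair rho lr0 _ _ h1 h2; rewrite -/(G a) -/(G a').
have [_ _ _] := Hd a a' ba ba'; rewrite Es => le.
(* The difference quotient is within [eps] of ['d G a1 w'], hence in the open cone; the form being
   quadratic, multiplication by [s] does not leave the cone. *)
have -> : G a' - G a = s *: (s^-1 *: (G a' - G a)) by rewrite scalerA mulfV// scale1r.
rewrite cone_formZ pmulr_rle0 ?exprn_even_gt0//.
have /He/lt_geF -> // : `|s^-1 *: (G a' - G a) - 'd G a1 w'| <= eps.
have -> : s^-1 *: (G a' - G a) - 'd G a1 w' = s^-1 *: (G a' - G a - 'd G a1 (s *: w')).
  have Zs : 'd G a1 (s *: w') = s *: 'd G a1 w' by exact: linearZ.
  by rewrite Zs [in RHS]scalerBr scalerA mulVf// scale1r.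
rewrite normrZ normfV mulrC ler_pdivrMr ?normr_gt0//; apply: le_trans le _; rewrite normrZ.
move: `|s| (normr_ge0 s) `|w'| (normr_ge0 w') => S S0 W0 W00.
have -> : eps / (W0 + 1) * (S * W0) = eps * S * (W0 / (W0 + 1)) by ring.
apply: ler_piMr; first by rewrite mulr_ge0// ltW.
by rewrite ler_pdivrMr ?ltr_wpDl// mul1r lerDl.
Qed.

End submanifold.

(** Critical points near [p] have the value [f p], by the Lojasiewicz inequality at zero energy. An
    orbit that accumulates at such a [q] thus enters the trap centred at the fixed point [p]; this
    lets a finite cover of the critical set capture all orbits. *)
Lemma capture : exists2 r0 : R, 0 < r0 & forall rho : R, 0 < rho -> rho < r0 -> \forall q \near p,
  orbit_field act beta q = 0 -> forall z, (forall t, f (flow t z) <= f q) ->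
  (forall (P : set Z) (T : R), (\forall y \near q, P y) -> exists2 t, T <= t & P (flow t z)) ->
  exists T, forall t, T <= t -> chart_ball rho (flow t z).
Proof.
have [r0 r00 Htrap] := trap; have [K [L [r1 [K0 L0 r10 Hr]]]] := crit_local.
exists r0 => // rho rho0 rr; have [delta d0 Hd] := Htrap rho rho0 rr.
have q0 : 0 < rho / 4 by rewrite divr_gt0.
have bp s : 0 < s -> chart_ball s p by move=> s0; split => //; rewrite subrr normr0.
apply: filterS2 (chart_ball_open (bp _ q0)) (chart_ball_open (bp _ r10)) => q bq [dq lq] q00 z Hz clz.
have fq : f q = f p.
  have bq1 : ball e r1 (cfwd phi q) by rewrite -ball_normE /ball_ /= distrC.
  have [iq _] := Hr _ bq1; rewrite -(energy_chart iq) (chart_cbwdK cp dq).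
  rewrite {1}/energy q00 /kaehler_metric linear0l mulr0 normr_le0 subr_eq0 /fc.
  by rewrite (chart_cbwdK cp dq) (chart_cbwdK cp dp) => /eqP.
have nq : \forall y \near q, chart_ball (rho / 4) y /\ f p - f y <= delta.
  apply: filterI; first exact: chart_ball_open.
  have [cf _] := sf q; have n2 : \forall y \near (f q : R^o), f p - y <= delta.
    have := @nbhsx_ballx R _ (f q) delta d0; apply: filterS => y; rewrite -ball_normE /ball_ /= fq.
    by move=> /ltW; apply: le_trans; exact: ler_norm.
  exact: cf n2.
have [t _ [bt ut]] := clz _ 0 nq.
exists t => u tu; have := Hd _ bt ut.
have H2 s : 0 <= s -> f (flow s (flow t z)) <= f p by move=> _; rewrite -flowD -fq.
move=> /(_ H2 (u - t)); rewrite subr_ge0 => /(_ tu).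
by rewrite -flowD subrK.
Qed.

End gradient_flow.

(** * Null sets of smooth measures *)

Section borel.
Context {R : realType}.

Lemma borel_open (T : ptopologicalType) (A : set T) : open A -> measurable (A : set (borel T)).
Proof. by move=> oA; exact: sub_sigma_algebra. Qed.

Lemma borel_closed (T : ptopologicalType) (A : set T) : closed A -> measurable (A : set (borel T)).
Proof.
move=> cA; rewrite -(setCK A); apply: measurableC; apply: borel_open.
by rewrite openC.
Qed.

Lemma continuous_borel (T S : ptopologicalType) (f : T -> S) : continuous f ->
  measurable_fun [set: borel T] (f : borel T -> borel S).
Proof.
move=> cf; apply: (@measurability _ _ (borel T) (borel S) setT f (@open S)) => // _ [A oA <-].
rewrite setTI; apply: borel_open; apply: open_comp => // x _; exact: cf.
Qed.

Lemma continuous_on_borel (T : ptopologicalType) (A : set T) (f : T -> R) : open A ->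
  (forall x, A x -> {for x, continuous (f : T -> R^o)}) ->
  measurable_fun (A : set (borel T)) (f : borel T -> R).
Proof.
move=> oA cf; apply: (@measurability _ _ (borel T) _ A f _ (measurable_realfun.RGenOInfty.measurableE R)) => _ [B [x ->] <-].
apply: borel_open; apply: open_in_near => z [Az /= xz].
have : \forall y \near z, A y by apply: open_near.
have n : \forall y \near (f z : R^o), x < y.
  by apply: (@open_near R^o [set y : R | x < y]); [exact: open_gt|move: xz; rewrite /= in_itv /= andbT].
have n2 : \forall y \near z, x < f y := cf z Az _ n.
by apply: filterS2 n2 => y /= h1 h2; split => //; rewrite /= in_itv /= h1.
Qed.

Section null_cover.
Variables (M : ptopologicalType) (nu : {measure set (borel M) -> \bar R}).

(** A finite subcover reduces this to a finite union of null sets. *)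
Lemma compact_locally_null (K : set M) : compact K -> measurable (K : set (borel M)) ->
  (forall y, K y -> exists2 W : set M, open W /\ W y & nu.-negligible (K `&` W : set (borel M))) ->
  nu (K : set (borel M)) = 0%E.
Proof.
move=> cK mK H; apply/negligibleP => //.
pose W y := if pselect (K y) is left h then sval (cid2 (H y h)) else set0.
have HW y : K y -> [/\ open (W y), W y y & nu.-negligible (K `&` W y : set (borel M))].
  by rewrite /W; case: pselect => // h _; case: cid2 => /= X [].
rewrite compact_cover in cK.
have [|x Kx|D HD KD] := cK M K W; first by move=> y /HW[].
  by exists x => //; have [] := HW x Kx.
pose l := finmap.enum_fset D.
have sub : K `<=` \big[setU/set0]_(y <- l) (K `&` W y).
  by move=> x Kx; have [y yD Wy] := KD x Kx; rewrite -bigcup_seq; exists y.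
suff N : nu.-negligible (\big[setU/set0]_(y <- l) (K `&` W y) : set (borel M)).
  by have [X [mX X0 sX]] := N; exists X; split => //; exact: subset_trans sub sX.
have : forall y, y \in l -> K y by move=> y /HD; rewrite inE.
elim: l {sub} => [|y s IH] Hs; first by rewrite big_nil; exact: negligible_set0.
rewrite big_cons; apply: negligibleU.
  by have [] := HW y (Hs y (mem_head _ _)).
by apply: IH => z zs; apply: Hs; rewrite inE zs orbT.
Qed.
End null_cover.

Section lebesgue.
Context {r : nat}.
Local Notation E := ('rV[R]_r).
Variable lam : {measure set (borel E) -> \bar R}.
Hypothesis hlam : is_lebesgue lam.

Definition rbox (a b : E) : set E := [set x : E | forall i, a 0 i <= x 0 i <= b 0 i].
Definition rboxes : set (set E) := [set A | exists a b, A = rbox a b].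

Lemma rbox_closed a b : closed (rbox a b).
Proof.
have -> : rbox a b = \bigcap_(i in [set: 'I_r]) ((fun x : E => x 0 i) @^-1` [set t | a 0 i <= t <= b 0 i]).
  by apply/seteqP; split => [x h i _ //|x h i]; exact: h.
apply: closed_bigI => i _; apply: preimage_closed; first by move=> x _; exact: coord_continuous.
have -> : [set t | a 0 i <= t <= b 0 i] = [set t : R | a 0 i <= t] `&` [set t | t <= b 0 i].
  by apply/seteqP; split => [t /= /andP[]//|t /= [h1 h2]]; rewrite h1.
by apply: closedI; [exact: closed_ge|exact: closed_le].
Qed.

Lemma rboxes_setI : setI_closed rboxes.
Proof.
move=> _ _ [a [b ->]] [a' [b' ->]].
exists (\row_i Num.max (a 0 i) (a' 0 i)), (\row_i Num.min (b 0 i) (b' 0 i)).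
apply/seteqP; split => x /=.
  by move=> [h1 h2] i; rewrite !mxE ge_max le_min; have /andP[-> ->] := h1 i; have /andP[-> ->] := h2 i.
by move=> h; split => i; have := h i; rewrite !mxE ge_max le_min => /andP[/andP[h1 h2] /andP[h3 h4]];
    rewrite ?h1 ?h2 ?h3 ?h4.
Qed.

(** An open set is the countable union of the boxes that it contains, with rational centre and
    half-width [1 / (n + 1)]. *)
Lemma open_rboxes (A : set E) : open A -> <<s rboxes >> A.
Proof.
move=> oA.
pose B (q : 'rV[rat]_r * nat) := rbox (\row_i (ratr (q.1 0 i) - q.2.+1%:R^-1)) (\row_i (ratr (q.1 0 i) + q.2.+1%:R^-1)).
pose F k := if unpickle k is Some q then (if pselect (B q `<=` A) then B q else set0) else set0.
have -> : A = \bigcup_k F k.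
  apply/seteqP; split => x; last first.
    by move=> [k _]; rewrite /F; case: unpickle => // q; case: pselect => // h; exact: h.
  move=> Ax; have : \forall y \near x, A y by exact: open_near.
  move=> /nbhs_ballP[e /= e0 He].
  have e40 : 0 < e / 4 by rewrite divr_gt0.
  pose k := Num.truncn (e / 4)^-1.
  have hk : k.+1%:R^-1 < e / 4.
    rewrite invf_plt ?posrE//; exact: truncnS_gt.
  have kp : 0 < k.+1%:R^-1 :> R by rewrite invr_gt0.
  have ex i : exists q : rat, ratr q \in `](x 0 i - k.+1%:R^-1), (x 0 i + k.+1%:R^-1)[.
    by apply: rat_in_itvoo; rewrite ltrBlDr -addrA ltrDl addr_gt0.
  pose q : 'rV[rat]_r := \row_i sval (cid (ex i)).
  have Hq i : x 0 i - k.+1%:R^-1 < ratr (q 0 i) < x 0 i + k.+1%:R^-1.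
    by rewrite /q mxE; case: cid => /= z; rewrite in_itv.
  have gen (u v l : R) : v - l < u < v + l -> u - l <= v <= u + l.
    by move=> /andP[? ?]; apply/andP; split; lra.
  clearbody q; exists (pickle (q, k)) => //; rewrite /F pickleK; case: pselect => [h|].
    by move=> i; rewrite !mxE /=; exact: gen (Hq i).
  move=> nh; exfalso; apply: nh => y hy; apply: He; rewrite -ball_normE /ball_ /=.
  apply: (@le_lt_trans _ _ (e / 2)); last by lra.
  apply: rV_norm_le => [|i]; first by lra.
  rewrite !mxE ler_norml; have := hy i; have := Hq i; rewrite !mxE /=.
  move: hk; move: (_.+1%:R^-1) (ratr _) => l u hk /andP[? ?] /andP[? ?].
  by apply/andP; split; lra.
apply: sigma_algebra_bigcup => k; rewrite /F; case: unpickle => [q|]; last exact: sigma_algebra0.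
case: pselect => h; last exact: sigma_algebra0.
by apply: sub_sigma_algebra; eexists; eexists.
Qed.

Lemma borel_rboxes : measurable = <<s (rboxes : set (set (borel E))) >>.
Proof.
apply/seteqP; split => A.
  apply: smallest_sub; first exact: smallest_sigma_algebra.
  by move=> B; exact: open_rboxes.
apply: smallest_sub; first exact: smallest_sigma_algebra.
by move=> _ [a [b ->]]; apply: borel_closed; exact: rbox_closed.
Qed.

Lemma rbox_empty (a b : E) i : b 0 i < a 0 i -> rbox a b = set0.
Proof.
move=> h; apply/seteqP; split => // x /= /(_ i) /andP[h1 h2].
by have := le_trans h1 h2; rewrite leNgt h.
Qed.

Lemma shift_continuous (v : E) : continuous (fun x : E => x + v).
Proof. by move=> x; apply: continuousD => //; exact: cst_continuous. Qed.

(** [is_lebesgue] prescribes the measure of boxes. These are stable under intersection and generate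
    the Borel sets, so the measure and its translate agree by uniqueness. *)
Lemma lebesgue_shift (v : E) (A : set (borel E)) : measurable A ->
  lam ((fun x : E => x + v) @^-1` A) = lam A.
Proof.
move=> mA; have mf := continuous_borel (@shift_continuous v).
pose m1 : {measure set (borel E) -> \bar R} :=
  measure_function_pushforward__canonical__measure_function_Measure lam mf.
rewrite -[LHS]/(m1 A).
pose G (k : nat) : set (borel E) := rbox (const_mx (- k%:R)) (const_mx k%:R).
have GG i : rboxes (G i) by eexists; eexists.
have UG : \bigcup_k G k = [set: borel E].
  apply/seteqP; split => // x _; exists (Num.truncn `|x|).+1 => // i; rewrite !mxE -ler_norml.
  by rewrite (le_trans (coord_norm_le x i))// ltW// truncnS_gt.
have pre a b : (fun x : E => x + v) @^-1` rbox a b = rbox (a - v) (b - v).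
  by apply/seteqP; split => x /= h i; have := h i; rewrite !mxE lerBlDr lerBrDr.
have eqm B : rboxes B -> m1 B = lam B.
  move=> [a [b ->]]; rewrite /m1 /= /pushforward pre.
  have [H|nH] := pselect (forall i, a 0 i <= b 0 i).
    by rewrite !hlam// => [|i]; [congr (_%:E); apply: eq_bigr => i _; rewrite !mxE; ring|rewrite !mxE lerD2r].
  (* A box with a reversed side is empty, and so is its translate. *)
  have [i hi] : exists i, b 0 i < a 0 i.
    by apply: contrapT => h; apply: nH => i; rewrite leNgt; apply/negP => hi; apply: h; exists i.
  by rewrite (rbox_empty hi) (@rbox_empty (a - v) (b - v) i)// !mxE ltrD2r.
have fin k : (m1 (G k) < +oo)%E.
  rewrite eqm// hlam ?ltry// => i; rewrite !mxE.
  by rewrite (@le_trans _ _ 0) ?oppr_le0.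
exact: (@measure_unique _ R (borel E) rboxes G borel_rboxes rboxes_setI GG UG m1 lam eqm fin A mA).
Qed.

(* The translates of [A] by small multiples of [w] are disjoint and of the same
   measure. *)
Lemma lebesgue_transversal0 (A : set (borel E)) (K : R) (w : E) : measurable A ->
  (forall x, A x -> `|x| <= K) -> w != 0 ->
  (forall a a' s, A a -> A a' -> a' - a = s *: w -> s = 0) -> lam A = 0%E.
Proof.
move=> mA AK w0 HA.
(* Distinct multiples, at most 1, so that all the translates lie in one bounded box. *)
pose t (k : nat) : R := k.+1%:R^-1.
pose B k : set (borel E) := (fun x : E => x + t k *: w) @^-1` A.
have mB k : measurable (B k).
  by have := continuous_borel (@shift_continuous (t k *: w)); move=> /(_ measurableT A mA); rewrite setTI.
have tB : trivIset setT B.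
  apply/trivIsetP => i j _ _ ij; apply/seteqP; split => // x [Bi Bj] /=.
  have E0 : (x + t j *: w) - (x + t i *: w) = (t j - t i) *: w.
    by apply/rowP => l; rewrite !mxE; ring.
  have := HA _ _ _ Bi Bj E0; move/eqP; rewrite subr_eq0 /t (inj_eq invr_inj) eqr_nat eqSS => /eqP ji.
  by move: ij; rewrite ji eqxx.
pose C : R := \prod_(i < r) ((K + `|w|) - (- (K + `|w|))).
have [[x Ax]|nA] := pselect (A !=set0); last first.
  have -> : A = set0 by apply/seteqP; split => // x Ax; apply: nA; exists x.
  exact: measure0.
have K0 : 0 <= K by exact: le_trans (AK x Ax).
have KW : 0 <= K + `|w| by rewrite addr_ge0.
have lB k : lam (B k) = lam A by exact: lebesgue_shift.
have sumE N : (N%:R%:E * lam A = \sum_(i < N) lam A)%E.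
  elim: N => [|N IH]; first by rewrite big_ord0 mul0e.
  by rewrite big_ord_recr /= -IH -natr1 EFinD ge0_muleDl ?lee_fin// mul1e.
have lb N : (N%:R%:E * lam A <= C%:E)%E.
  have -> : (N%:R%:E * lam A = lam (\big[setU/set0]_(i < N) B i))%E.
    rewrite measure_bigsetU// (eq_bigr (fun=> lam A)) => [|i _]; last exact: lB.
    exact: sumE.
  have -> : C%:E = lam (rbox (const_mx (- (K + `|w|))) (const_mx (K + `|w|))).
    rewrite hlam => [|i]; last by rewrite !mxE; lra.
    by congr (_%:E); apply: eq_bigr => i _; rewrite !mxE.
  apply: le_measure; rewrite ?inE; first exact: bigsetU_measurable.
    by apply: borel_closed; exact: rbox_closed.
  rewrite -bigcup_mkord => y [k _] By i; rewrite !mxE -ler_norml.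
  rewrite (le_trans (coord_norm_le y i))// -(addrK (t k *: w) y) (le_trans (ler_normB _ _))//.
  rewrite lerD ?(AK _ By)// normrZ ler_piMl// ger0_norm ?invr_ge0// invf_le1// ler1n//.
have C0 : 0 <= C by apply: prodr_ge0 => i _; lra.
have := lb 1%N; rewrite mul1e => l1.
have fA : lam A \is a fin_num.
  by rewrite ge0_fin_numE ?measure_ge0// (le_lt_trans l1)// ltry.
rewrite -(fineK fA); have f0 : 0 <= fine (lam A) by rewrite fine_ge0.
congr (_%:E); apply/eqP; rewrite eq_le f0 andbT leNgt; apply/negP => f1.
pose N := (Num.truncn (C / fine (lam A))).+1.
have := lb N; rewrite -(fineK fA) -EFinM lee_fin leNgt => /negP; apply.
by rewrite -ltr_pdivrMr// truncnS_gt.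
Qed.
End lebesgue.
End borel.
Section transversal_null.
Context {R : realType} {r : nat}.

Lemma closed_norm_ball_compact (a : 'rV[R]_r) (rho : R) : compact [set x : 'rV[R]_r | `|x - a| <= rho].
Proof.
apply: bounded_closed_compact.
  exists (`|a| + rho); split; [exact: num_real|move=> K rK x /= lx].
  rewrite (le_trans _ (ltW rK))// -{1}(subrK a x) addrC (le_trans (ler_normD _ _))// lerD2l.
  exact: lx.
have -> : [set x : 'rV[R]_r | `|x - a| <= rho] = (fun x : 'rV[R]_r => `|x - a|) @^-1` [set t : R | t <= rho] by [].
apply: preimage_closed; last exact: closed_le.
move=> x _; apply: (@continuous_comp _ _ _ (fun x : 'rV[R]_r => x - a) (fun x : 'rV[R]_r => `|x|)); last exact: norm_continuous.
by apply: continuousB => //; exact: cst_continuous.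
Qed.

Variables (M : charted_space 'rV[R]_r) (hM : is_manifold M).
Variables (nu : {measure set (borel M) -> \bar R}) (hnu : is_smooth_measure nu).
Let mM := is_manifold_mfld hM.
Let hausM : hausdorff_space M. Proof. by case: hM. Qed.

Lemma smooth_chart_at y : is_smooth_chart (chart_at y : chart _ M).
Proof.
split; first exact: chart_at_is mM y.
by move=> psi apsi; have [_ _ _ + _] := hM; apply => //; exact: atlas_at mM y.
Qed.

(** Near each of its points the set is read in a chart, where the density reduces the claim to
    [lebesgue_transversal0]. Cutting with a closed coordinate ball keeps the pieces compact, hence
    Borel on both sides of the chart. *)
Lemma transversal_null (D : set M) : compact D ->
  (forall y1, D y1 -> exists2 w : 'rV[R]_r, w != 0 & exists2 delta : R, 0 < delta &
     forall a a' s, ball (cfwd (chart_at y1) y1) delta a -> ball (cfwd (chart_at y1) y1) delta a' ->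
      D (cbwd (chart_at y1) a) -> D (cbwd (chart_at y1) a') -> a' - a = s *: w -> s = 0) ->
  nu (D : set (borel M)) = 0%E.
Proof.
move=> cD H; have clD : closed D := compact_closed hausM cD.
apply: compact_locally_null => //; first exact: borel_closed.
move=> y1 Dy1; have [w w0 [delta d0 Hw]] := H y1 Dy1.
set chi := chart_at y1 in Hw *; set a1 := cfwd chi y1 in Hw *.
have cchi : is_chart chi := chart_at_is mM y1; have dchi : cdom chi y1 := dom_at mM y1.
have ia1 : (cfwd chi @` cdom chi) a1 := chart_img dchi.
have [lam hlam dens] := hnu; have [rho [Crho rho0 Hrho]] := dens chi (smooth_chart_at y1).
have /nbhs_ballP[d1 /= d10 Hd1] := near_img cchi ia1.
pose dl := Num.min delta d1 / 2; have m0 : 0 < Num.min delta d1 by rewrite lt_min d0.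
have dl0 : 0 < dl by rewrite divr_gt0.
have [m1 m2] : Num.min delta d1 <= delta /\ Num.min delta d1 <= d1 by rewrite !ge_min !lexx orbT.
have dl1 : dl < delta by rewrite /dl; lra.
have dl2 : dl < d1 by rewrite /dl; lra.
pose C := [set x : 'rV[R]_r | `|x - a1| <= dl].
have Ci x : C x -> (cfwd chi @` cdom chi) x.
  by move=> lx; apply: Hd1; rewrite -ball_normE /ball_ /= distrC (le_lt_trans lx).
have cC : compact (cbwd chi @` C).
  apply: continuous_compact; last exact: closed_norm_ball_compact.
  apply: continuous_in_subspaceT => x; rewrite inE /= => Cx.
  by have [_ _ _ _] := cchi; apply; exact: Ci.
pose N0 := D `&` cbwd chi @` C.
have cN0 : compact N0 by apply: compact_closedI => //; exact: compact_closed hausM cC.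
have N0d : N0 `<=` cdom chi by move=> _ [_ [x Cx <-]]; have [] := chart_imgP cchi (Ci x Cx).
pose X := cfwd chi @` N0.
have cX : compact X.
  apply: continuous_compact => //; apply: continuous_in_subspaceT => y; rewrite inE => /N0d dy.
  by have [_ _ _ c _] := cchi; exact: c.
have mX : measurable (X : set (borel 'rV[R]_r)).
  by apply: borel_closed; apply: compact_closed cX; exact: norm_hausdorff.
have XP a : X a -> [/\ C a, D (cbwd chi a) & (cfwd chi @` cdom chi) a].
  move=> [y [Dy [x Cx xy]] <-]; rewrite -xy in Dy *; have [dx ex] := chart_imgP cchi (Ci x Cx).
  by rewrite ex; split => //; exact: Ci.
have lX : lam (X : set (borel 'rV[R]_r)) = 0%E.
  apply: (lebesgue_transversal0 hlam (K := `|a1| + dl) mX _ w0).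
    move=> x /XP[Cx _ _]; rewrite -(subrK a1 x) addrC (le_trans (ler_normD _ _))// lerD2l.
    exact: Cx.
  move=> a a' s /XP[Ca Da _] /XP[Ca' Da' _]; apply: Hw => //;
    by rewrite -ball_normE /ball_ /= distrC (le_lt_trans _ dl1).
have nN0 : nu (N0 : set (borel M)) = 0%E.
  rewrite Hrho//; last by apply: borel_closed; exact: compact_closed hausM cN0.
  have oI : open (cfwd chi @` cdom chi) by have [_] := cchi.
  apply: null_set_integral => //; apply/measurable_EFinP.
  apply: (@measurable_funS _ _ _ _ (cfwd chi @` cdom chi : set (borel 'rV[R]_r))).
  - exact: borel_open.
  - by move=> a /XP[].
  - apply: (continuous_on_borel oI) => x ix; exact: (Crho 0%N x ix).
exists [set y | cdom chi y /\ `|cfwd chi y - a1| < dl].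
  split; last by split => //; rewrite subrr normr0.
  apply: open_in_near => y [dy ly]; apply: filterI; first exact: near_dom.
  apply: (near_cfwd cchi dy (P := fun x => `|x - a1| < dl)).
  have r0 : 0 < dl - `|cfwd chi y - a1| by rewrite subr_gt0.
  have : \forall x \near cfwd chi y, ball (cfwd chi y) (dl - `|cfwd chi y - a1|) x by exact: nbhsx_ballx.
  apply: filterS => x; rewrite -ball_normE /ball_ /= ltrBrDr distrC; apply: le_lt_trans.
  by rewrite -{1}(subrK (cfwd chi y) x) -addrA ler_normD.
exists N0; split => //; first by apply: borel_closed; exact: compact_closed hausM cN0.
move=> y [Dy [dy ly]]; split => //; exists (cfwd chi y); last exact: chart_cbwdK.
exact: ltW.
Qed.
End transversal_null.

(** * Convergence of almost every orbit to the maximum *)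

Section generic_limit.
Context {R : realType} {n k d r : nat}.
Variables (Z : charted_space 'rV[R]_(n + n)) (omega : Z -> {biscalar 'rV[R]_(n + n)})
  (U : lie_space 'rV[R]_k) (H : lie_space 'rV[R]_(d + d)) (c : U -> H) (act : H -> Z -> Z).
Hypotheses (hZ : is_complex_manifold Z) (homega : is_kaehler_form omega)
  (hU : is_lie_group U) (cU : compact [set: U]) (hc : is_complexification c)
  (hact : is_holomorphic_action act).
Variables (xi : 'rV[R]_k) (f : Z -> R).
Let beta := Jmul (lie_diff c xi).
Hypotheses (sf : forall z, smat (f : Z -> euclid R^o) z)
  (df : forall z v, tangent_map (f : Z -> euclid R^o) z v =
     kaehler_metric omega z (orbit_field act beta z) v).
Variable g : R -> H.
Hypothesis Hg : one_param_diff beta g.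
Variable fB : R.
Hypothesis f_le : forall z, f z <= fB.
Variables (M : charted_space 'rV[R]_r) (hM : is_manifold M) (cM : compact [set: M]) (iota : M -> Z).
Hypothesis hiota : smooth_embedding iota.
Variable flowM : R -> M -> M.
Hypothesis HflowM : forall t y, iota (flowM t y) = flow act g t (iota y).
Variables (nu : {measure set (borel M) -> \bar R}) (hnu : is_smooth_measure nu).
Hypothesis hmax : unique_local_max (fun x : M => f (iota x)).
Variable mx : R.
Hypothesis mxP : exists y, f (iota y) = mx.
Let mZ := cx_mfld hZ.
Let mM := is_manifold_mfld hM.
Local Notation fl := (flow act g).
Let fl0 z : fl 0 z = z := flow0 hc hact Hg z.
Let flD s t z : fl (s + t) z = fl s (fl t z) := flowD hact Hg s t z.

Lemma f_continuous : continuous (f : Z -> R^o).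
Proof. by move=> z; have [] := sf z. Qed.
Lemma fl_continuous t : continuous (fl t).
Proof. by move=> z; have [] := flow_smat hZ hc hact g t z. Qed.
Lemma iota_continuous : continuous iota.
Proof. by move=> y; have [] := embedding_smat mM mZ hiota y. Qed.

Lemma range_iota_compact : compact (range iota).
Proof.
apply: continuous_compact => //; apply: continuous_subspaceT; exact: iota_continuous.
Qed.

(** Constancy of [f] along the orbit makes the energy vanish. In this form criticality is visibly a
    closed condition, which yields compact critical sets below. *)
Lemma critP z : orbit_field act beta z = 0 <-> forall t, f (fl t z) = f z.
Proof.
split=> [V0 t|H0].
  by rewrite /flow (fixed_of_field0 (complexification_lieg hc) mZ (holo_act1 hact) (holo_actM hact)
    (holo_act_smat hZ hc hact) Hg V0).
apply: (energy_eq0 homega (c := c)).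
have := flow_derive hZ hc hact sf df Hg z 0; rewrite fl0.
have -> : (fun s => f (fl s z)) = cst (f z) by apply/funext => t; exact: H0.
by move=> D; have := @derive_val _ _ _ _ _ _ _ D; rewrite derive_cst.
Qed.

(** The forward orbit accumulates in the compact image of [M]. As [f] is monotone along it, [f]
    cannot vary along the orbit of an accumulation point, which is therefore critical. *)
Lemma limit_critical z : range iota z -> exists q, [/\ range iota q, orbit_field act beta q = 0,
  forall t, f (fl t z) <= f q &
  forall (P : set Z) (T : R), (\forall y \near q, P y) -> exists2 t, T <= t & P (fl t z)].
Proof.
move=> [y _ yz].
have FK : ((fun t => fl t z) @ +oo%R) (range iota).
  have : \forall t \near +oo%R, range iota (fl t z).
    by apply: nearW => t; exists (flowM t y) => //; rewrite HflowM yz.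
  exact.
have [q [rq clq]] := range_iota_compact _ FK.
have cl (P : set Z) (T : R) : (\forall y \near q, P y) -> exists2 t, T <= t & P (fl t z).
  move=> nP; have FT : ((fun t => fl t z) @ +oo%R) [set fl t z | t in [set t | T <= t]].
    have : \forall t \near +oo%R, T <= t by apply: nbhs_pinfty_ge; exact: num_real.
    by apply: filterS => t Tt; exists t.
  by have [_ [[t Tt <-] Pt]] := clq _ _ FT nP; exists t.
have mono s t : s <= t -> f (fl s z) <= f (fl t z).
  exact: (flow_mono hZ homega hc hact sf df Hg).
have lefq t : f (fl t z) <= f q.
  rewrite leNgt; apply/negP => lt.
  have n1 : \forall y \near q, f y < f (fl t z).
    have n0 : \forall x \near (f q : R^o), x < f (fl t z).
      by apply: (@open_near R^o [set x : R | x < f (fl t z)]); [exact: open_lt|].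
    exact: f_continuous n0.
  by have [s ts] := cl _ t n1; rewrite ltNge mono.
have crit t : f (fl t q) = f q.
  apply/eqP; rewrite eq_le; apply/andP; split; rewrite leNgt; apply/negP => lt.
    have n1 : \forall y \near q, f q < f (fl t y).
      have n0 : \forall x \near (f (fl t q) : R^o), f q < x.
        by apply: (@open_near R^o [set x : R | f q < x]); [exact: open_gt|].
      have n2 : \forall y \near fl t q, f q < f y := @f_continuous _ _ n0.
      exact: (@fl_continuous t q _ n2).
    by have [s _] := cl _ 0 n1; rewrite -flD ltNge lefq.
  pose m := (f (fl t q) + f q) / 2.
  have n1 : \forall y \near q, f (fl t y) < m /\ m < f y.
    apply: filterI.
      have n0 : \forall x \near (f (fl t q) : R^o), x < m.
        by apply: (@open_near R^o [set x : R | x < m]); [exact: open_lt|rewrite /= /m; lra].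
      have n2 : \forall y \near fl t q, f y < m := @f_continuous _ _ n0.
      exact: (@fl_continuous t q _ n2).
    have n0 : \forall x \near (f q : R^o), m < x.
      by apply: (@open_near R^o [set x : R | m < x]); [exact: open_gt|rewrite /= /m; lra].
    exact: f_continuous n0.
  have [s _ [s1 s2]] := cl _ 0 n1.
  (* For [t >= 0] the drop from above [m] to below [m] contradicts monotonicity at once. For [t < 0]
     a second return at a time [v >= s - t] is needed, so that [s <= t + v]. *)
  have [t0|t0] := leP 0 t.
    have := mono s (t + s); rewrite lerDr => /(_ t0); rewrite flD; move: s1 s2; lra.
  have [v sv [v1 v2]] := cl _ (s - t) n1.
  have := mono s (t + v); rewrite flD => h.
  have : s <= t + v by lra.
  by move=> /h; move: v1 s2; lra.
by exists q; split => //; exact/critP.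
Qed.

Lemma noncritical_max q : range iota q -> f q < mx -> forall p0, iota p0 = q ->
  ~ \forall y \near p0, f (iota y) <= f q.
Proof.
move=> _ lt p0 Ep; rewrite -Ep => loc.
have [y yE] := mxP; have := hmax loc y; rewrite yE Ep leNgt.
by rewrite lt.
Qed.

(** The captured set is an intersection of closed conditions over the times [t >= T], hence compact,
    and [stable_set_transversal] makes it transversal to a direction at each of its points. *)
Lemma stable_set_null p : range iota p -> orbit_field act beta p = 0 -> f p < mx ->
  exists2 r0 : R, 0 < r0 & forall rho, rho < r0 -> forall T,
   nu.-negligible ([set y | forall t, T <= t -> chart_cball p rho (fl t (iota y))] : set (borel M)).
Proof.
move=> rp Vp lt; have [p0 _ Ep] := rp.
have nmax := noncritical_max rp lt Ep.
have inv_fl t y : exists y', fl t (iota y) = iota y' by exists (flowM t y).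
have [r0 r00 Htr] := stable_set_transversal hZ homega hU cU hc hact sf df Vp Hg f_le mM hiota Ep
  inv_fl nmax HflowM.
have [K [L [r1 [_ _ r10 Hr]]]] := crit_local hZ homega hU cU hc hact sf df Vp.
exists (Num.min r0 r1); first by rewrite lt_min r00.
move=> rho; rewrite lt_min => /andP[lr0 lr1] T.
set D := [set y | _].
have cD : compact D.
  apply: (subclosed_compact _ cM) => //.
  have -> : D = \bigcap_(t in [set t | T <= t]) ((fun y => fl t (iota y)) @^-1` chart_cball p rho).
    by apply/seteqP; split => y h t Tt; exact: h.
  apply: closed_bigI => t _; apply: preimage_closed.
    move=> y _; apply: (@continuous_comp _ _ _ iota (fl t)); first exact: iota_continuous.
    exact: fl_continuous.
  by apply: (chart_cball_closed hZ _ lr1) => x /Hr[].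
have hausM : hausdorff_space M by case: hM.
apply/negligibleP; first by apply: borel_closed; exact: compact_closed.
apply: (transversal_null hM hnu cD) => y1 Dy1; exact: (Htr rho lr0 T y1 Dy1).
Qed.

(* A forward orbit which does not reach the maximum accumulates at a critical
   point, is captured near it, and countably many such neighbourhoods suffice. *)
Lemma below_max_null : nu.-negligible
  ([set y | exists2 eps, 0 < eps & forall t, f (fl t (iota y)) <= mx - eps] : set (borel M)).
Proof.
(* Staying at a definite distance below the maximum makes the critical set closed, hence compact;
   countably many [j] cover all orbits that miss the maximum. *)
pose K (j : nat) := [set q | [/\ range iota q, orbit_field act beta q = 0 & f q <= mx - j.+1%:R^-1]].
have cK j : compact (K j).
  have -> : K j = range iota `&` (\bigcap_(t in [set: R]) [set q | f (fl t q) - f q = 0] `&` [set q | f q <= mx - j.+1%:R^-1]).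
    apply/seteqP; split => q.
      by move=> [rq /critP cq lq]; split => //; split => // t _; rewrite /= cq subrr.
    by move=> [rq [cq lq]]; split => //; apply/critP => t; apply/eqP; rewrite -subr_eq0; apply/eqP; exact: cq.
  apply: compact_closedI; first exact: range_iota_compact.
  apply: closedI.
    apply: closed_bigI => t _.
    apply: (@preimage_closed _ R^o (fun q => f (fl t q) - f q) [set x : R | x = 0]); last exact: closed_eq.
    move=> q _; apply: (@continuousB R R^o Z (fun q => f (fl t q)) f q); last exact: f_continuous.
    by apply: (@continuous_comp _ _ _ (fl t) (f : Z -> R^o)); [exact: fl_continuous|exact: f_continuous].
  apply: (@preimage_closed _ R^o f [set x : R | x <= mx - j.+1%:R^-1]); last exact: closed_le.
  by move=> q _; exact: f_continuous.
have loc j q : K j q -> exists WS : set Z * (nat -> set (borel M)),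
    [/\ open WS.1, WS.1 q, forall N, nu.-negligible (WS.2 N) &
    forall q', WS.1 q' -> orbit_field act beta q' = 0 -> forall y, (forall t, f (fl t (iota y)) <= f q') ->
      (forall (P : set Z) (T : R), (\forall y \near q', P y) -> exists2 t, T <= t & P (fl t (iota y))) ->
      exists N, WS.2 N y].
  move=> [rq Vq lq]; have lt : f q < mx by rewrite (le_lt_trans lq)// ltrBlDr ltrDl invr_gt0.
  have [r0 r00 Hnull] := stable_set_null rq Vq lt.
  have [r1 r10 Hcap] := capture hZ homega hU cU hc hact sf df Vq Hg.
  pose rho := Num.min r0 r1 / 2; have m0 : 0 < Num.min r0 r1 by rewrite lt_min r00.
  have [m1 m2] : Num.min r0 r1 <= r0 /\ Num.min r0 r1 <= r1 by rewrite !ge_min !lexx orbT.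
  have rho0 : 0 < rho by rewrite divr_gt0.
  have lr0 : rho < r0 by rewrite /rho; lra.
  have lr1 : rho < r1 by rewrite /rho; lra.
  have /open_nearP[W [oW Wq HW]] := Hcap rho rho0 lr1.
  exists (W, fun N => [set y | forall t, N%:R <= t -> chart_cball q rho (fl t (iota y))]).
  split => // [N|q' Wq' V' y l1 l2]; first exact: Hnull.
  have [T HT] := HW q' Wq' V' _ l1 l2; exists (Num.truncn T).+1 => t Tt.
  have Tt' : T <= t by apply: le_trans Tt; rewrite ltW// truncnS_gt.
  by have [dt /ltW ltt] := HT t Tt'; split.
pose A (j : nat) : set (borel M) := [set y | forall t, f (fl t (iota y)) <= mx - j.+1%:R^-1].
suff NA j : nu.-negligible (A j).
  apply: negligibleS (negligible_bigcup NA) => y [eps e0 He].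
  exists (Num.truncn eps^-1) => // t; apply: le_trans (He t) _; rewrite lerD2l lerN2.
  by rewrite ltW// invf_plt ?posrE// truncnS_gt.
pose WS q := if pselect (K j q) is left h then sval (cid (loc j q h)) else (set0, fun=> set0).
pose W q := (WS q).1; pose S q := (WS q).2.
have HW q : K j q -> [/\ open (W q), W q q, forall N, nu.-negligible (S q N) &
    forall q', W q q' -> orbit_field act beta q' = 0 -> forall y, (forall t, f (fl t (iota y)) <= f q') ->
      (forall (P : set Z) (T : R), (\forall y \near q', P y) -> exists2 t, T <= t & P (fl t (iota y))) ->
      exists N, S q N y].
  by move=> h; rewrite /W /S /WS; case: pselect => // h'; case: (cid _).
have := cK j; rewrite compact_cover => cj.
have [|q Kq|D HD KD] := cj Z (K j) W; first by move=> q /HW[].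
  by exists q => //; have [] := HW q Kq.
pose l := finmap.enum_fset D.
have Hl q : q \in l -> K j q by move=> /HD; rewrite inE.
have sub : A j `<=` \big[setU/set0]_(q <- l) (\bigcup_N S q N).
  move=> y Ay; have [q [rq Vq lq cq]] := limit_critical (imageT iota y).
  have Kq : K j q.
    split => //; rewrite leNgt; apply/negP => lt.
    have n1 : \forall z \near q, mx - j.+1%:R^-1 < f z.
      have n0 : \forall x \near (f q : R^o), mx - j.+1%:R^-1 < x.
        by apply: (@open_near R^o [set x : R | mx - j.+1%:R^-1 < x]); [exact: open_gt|].
      exact: f_continuous n0.
    by have [t _] := cq _ 0 n1; rewrite ltNge Ay.
  have [q' q'l Wq] := KD q Kq.
  rewrite -bigcup_seq; exists q' => //.
  by have [_ _ _ /(_ q Wq Vq y lq cq)[N SN]] := HW q' (Hl q' q'l); exists N.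
suff N : nu.-negligible (\big[setU/set0]_(q <- l) (\bigcup_N S q N)).
  by have [X [mX X0 sX]] := N; exists X; split => //; exact: subset_trans sub sX.
elim: l Hl {sub} => [|q s IH] Hs; first by rewrite big_nil; exact: negligible_set0.
rewrite big_cons; apply: negligibleU.
  by apply: negligible_bigcup => N; have [] := HW q (Hs q (mem_head _ _)).
by apply: IH => z zs; apply: Hs; rewrite inE zs orbT.
Qed.

End generic_limit.

(** * Integrals of vector-valued functions *)

Section vector_integral.
Context {R : realType} (M : ptopologicalType) (cM : compact [set: M]).
Variable nu : probability (borel M) R.
Local Notation vint := (vec_integral nu).

Lemma continuous_bounded (f : M -> R) : continuous (f : M -> R^o) -> exists2 K : R, 0 <= K & forall y, `|f y| <= K.
Proof.
move=> cf; have cI : compact ((f : M -> R^o) @` setT).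
  by apply: continuous_compact => //; exact: continuous_subspaceT.
have [K [_ HK]] := compact_bounded cI.
exists (`|K| + 1) => // y; apply: HK; last by exists y.
by rewrite (le_lt_trans (ler_norm K))// ltrDl.
Qed.

Lemma continuous_borel_fun (f : M -> R) : continuous (f : M -> R^o) ->
  measurable_fun [set: borel M] (f : borel M -> R).
Proof. by move=> cf; apply: (continuous_on_borel openT) => x _; exact: cf. Qed.

Lemma continuous_integrable (f : M -> R) : continuous (f : M -> R^o) ->
  nu.-integrable [set: borel M] (EFin \o (f : borel M -> R)).
Proof.
move=> cf; apply: measurable_bounded_integrable => //.
- by rewrite (le_lt_trans (probability_le1 _ _))// ltry.
- exact: continuous_borel_fun.
- have [K K0 HK] := continuous_bounded cf; exists K; split; first exact: num_real.
  by move=> x Kx y _; apply: (le_trans (HK y)); exact: ltW.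
Qed.

Definition rint (f : M -> R) : R := fine (\int[nu]_(x in [set: borel M]) (f x)%:E).

Lemma rint_fin f : continuous (f : M -> R^o) ->
  (\int[nu]_(x in [set: borel M]) (f x)%:E)%E \is a fin_num.
Proof. by move=> cf; apply: integrable_fin_num => //; exact: continuous_integrable. Qed.

Lemma rintD f g : continuous (f : M -> R^o) -> continuous (g : M -> R^o) ->
  rint (fun y => f y + g y) = rint f + rint g.
Proof.
move=> cf cg; rewrite /rint -fineD ?rint_fin// -integralD//; exact: continuous_integrable.
Qed.

Lemma rintZ a f : continuous (f : M -> R^o) -> rint (fun y => a * f y) = a * rint f.
Proof.
move=> cf; rewrite /rint -[a in RHS]/(fine a%:E) -fineM ?rint_fin// -integralZl//.
exact: continuous_integrable.
Qed.

Lemma rint_cst a : rint (cst a) = a.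
Proof. have := @integral_cst _ _ _ nu [set: borel M] measurableT a%:E.
move=> E; rewrite /rint -[RHS]/(fine a%:E); congr fine.
rewrite -[RHS]mule1 -(@probability_setT _ _ _ nu); exact: E. Qed.

Lemma rint_le f g : continuous (f : M -> R^o) -> continuous (g : M -> R^o) ->
  (forall y, f y <= g y) -> rint f <= rint g.
Proof.
move=> cf cg fg; rewrite /rint fine_le ?rint_fin//.
by apply: le_integral => //; [exact: continuous_integrable|exact: continuous_integrable|move=> y _; rewrite lee_fin].
Qed.

(** Markov's inequality at the level [f y0 / 2]: a zero integral would make a nonempty open set
    null. *)
Lemma rint_gt0 f : continuous (f : M -> R^o) -> (forall y, 0 <= f y) ->
  (forall A : set M, open A -> A !=set0 -> (0 < nu (A : set (borel M)))%E) ->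
  (exists y, 0 < f y) -> 0 < rint f.
Proof.
move=> cf f0 full [y0 fy0].
have r0 : 0 <= rint f by rewrite -(rint_cst 0); apply: rint_le => //; exact: cst_continuous.
rewrite lt_neqAle r0 andbT eq_sym; apply/eqP => E0.
pose A := [set y | f y0 / 2 < f y].
have oA : open A.
  by apply: (@open_comp _ R^o f [set t : R | f y0 / 2 < t]) => [x _|]; [exact: cf|exact: open_gt].
have Ay : A y0 by rewrite /A /=; lra.
have := full A oA (ex_intro _ y0 Ay); rewrite ltNge => /negP; apply.
have I0 : (\int[nu]_(x in [set: borel M]) (f x)%:E = 0)%E.
  by rewrite -(fineK (rint_fin cf)) -/(rint f) E0.
have mf : measurable_fun [set: borel M] (EFin \o (f : borel M -> R)).
  by apply/measurable_EFinP; exact: continuous_borel_fun.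
have hA : 0 < f y0 / 2 by rewrite divr_gt0.
have := le_integral_abse nu measurableT mf hA.
have -> : (\int[nu]_(x in [set: borel M]) `|(EFin \o (f : borel M -> R)) x| = 0)%E.
  by rewrite -I0; apply: eq_integral => x _; rewrite /= ger0_norm.
have mA : measurable (A : set (borel M)) by exact: borel_open.
move=> le; have := @le_measure _ _ _ nu (A : set (borel M)) ([set: borel M] `&` [set x | ((f y0 / 2)%:E <= `|(EFin \o (f : borel M -> R)) x|)%E]).
rewrite !inE => h; have {}h := h mA.
apply: le_trans (h _ _) _.
- by apply: emeasurable_fun_c_infty => //; exact: measurableT_comp.
- by move=> y /= /ltW lt; split => //; rewrite lee_fin ger0_norm.
move: le; rewrite -[leRHS](mule0 (f y0 / 2)%:E) lee_pmul2l ?lte_fin//.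
Qed.

(** Dominated convergence: outside the null set the monotone sequence [h N y] tends to [mx]. *)
Lemma rint_limit (h : nat -> M -> R) (mx : R) : (forall N, continuous (h N : M -> R^o)) ->
  (forall i j y, (i <= j)%N -> h i y <= h j y) -> (forall N y, h N y <= mx) ->
  nu.-negligible ([set y | exists2 eps, 0 < eps & forall N, h N y <= mx - eps] : set (borel M)) ->
  forall eps : R, 0 < eps -> exists N, mx - eps <= rint (h N).
Proof.
move=> ch mono le null eps eps0.
have [K K0 HK] := continuous_bounded (ch 0%N).
have [|||||_ _ cv] := @dominated_convergence _ _ _ nu [set: borel M] measurableT
  (fun N => EFin \o (h N : borel M -> R)) (cst mx%:E) (cst (`|mx| + K)%:E).
- by move=> N; apply/measurable_EFinP; exact: continuous_borel_fun.
- exact: measurable_cst.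
- apply: negligibleS null => y /= ny; apply: contrapT => nE; apply: ny => _.
  apply/fine_cvgP; split; first exact: nearW.
  apply/cvgrPdist_le => e e0; apply: contrapT => nn; apply: nE; exists e => // N.
  rewrite leNgt; apply/negP => lt; apply: nn; near=> j.
  have Nj : (N <= j)%N by near: j; exact: nbhs_infty_ge.
  have := mono _ _ y Nj; have := le j y.
  by rewrite /= => l1 l2; rewrite ger0_norm; lra.
- exact: (@continuous_integrable (cst (`|mx| + K)) (@cst_continuous _ _ _)).
- apply/aeW => y N _; rewrite /= lee_fin ler_norml; have := le N y; have := mono _ _ y (leq0n N).
  have := HK y; rewrite ler_norml => /andP[h1 _] h2 h3; have := ler_norm mx; have := ler_norm (- mx).
  by rewrite normrN => h4 h5; apply/andP; split; lra.
have E : (\int[nu]_(x in [set: borel M]) cst mx%:E x = mx%:E)%E.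
  have := @integral_cst _ _ _ nu [set: borel M] measurableT mx%:E => E.
  rewrite -[RHS]mule1 -(@probability_setT _ _ _ nu); exact: E.
rewrite E in cv; have /fine_cvgP[_ cv2] := cv.
have /cvgrPdist_le /(_ eps eps0) [N _ HN] := cv2.
exists N; have := HN N (leqnn N); rewrite /= -/(rint (h N)) ler_norml; lra.
Unshelve. all: by end_near.
Qed.

Lemma vintE n (f : M -> 'rV[R]_n) i : vint f 0 i = rint (fun y => f y 0 i).
Proof. by rewrite mxE. Qed.

Lemma coord_continuous_fun n (f : M -> 'rV[R]_n) i : continuous f -> continuous ((fun y => f y 0 i) : M -> R^o).
Proof. by move=> cf y; apply: (@continuous_comp _ _ _ f (fun x : 'rV[R]_n => x 0 i)); [exact: cf|exact: coord_continuous]. Qed.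

Lemma continuous_sum_fun n (F : 'I_n -> M -> R) : (forall i, continuous (F i : M -> R^o)) ->
  continuous ((fun y => \sum_i F i y) : M -> R^o).
Proof.
elim: n F => [|n IH] F cF.
  have -> : (fun y => \sum_i F i y) = cst 0 by apply/funext => y; rewrite big_ord0.
  exact: cst_continuous.
have -> : (fun y => \sum_i F i y) = (fun y => F ord0 y + \sum_i F (lift ord0 i) y).
  by apply/funext => y; rewrite big_ord_recl.
move=> y; apply: (@continuousD R R^o M (F ord0)); first exact: cF.
exact: IH.
Qed.

Lemma rint_sum n (F : 'I_n -> M -> R) : (forall i, continuous (F i : M -> R^o)) ->
  rint (fun y => \sum_i F i y) = \sum_i rint (F i).
Proof.
elim: n F => [|n IH] F cF.
  rewrite big_ord0 -[RHS](rint_cst 0); congr rint; apply/funext => y; by rewrite big_ord0.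
have -> : (fun y => \sum_i F i y) = (fun y => F ord0 y + \sum_i F (lift ord0 i) y).
  by apply/funext => y; rewrite big_ord_recl.
rewrite rintD//; first by rewrite IH// big_ord_recl.
exact: continuous_sum_fun.
Qed.

Lemma rint_linear n (f : M -> 'rV[R]_n) (L : {linear 'rV[R]_n -> R^o}) : continuous f ->
  L (vint f) = rint (fun y => L (f y)).
Proof.
move=> cf; have E (v : 'rV[R]_n) : L v = \sum_i L (delta_mx 0 i) * v 0 i.
  rewrite {1}[v]row_sum_delta linear_sum; apply: eq_bigr => i _.
  by rewrite linearZ /= mulrC.
rewrite E; have -> : (fun y => L (f y)) = (fun y => \sum_i L (delta_mx 0 i) * f y 0 i).
  by apply/funext => y; rewrite E.
rewrite rint_sum => [|i].
  by apply: eq_bigr => i _; rewrite vintE rintZ//; exact: coord_continuous_fun.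
by move=> y; apply: (@continuousM R M (cst _) (fun y => f y 0 i)); [exact: cst_continuous|exact: coord_continuous_fun].
Qed.

Lemma vint_linear n m (f : M -> 'rV[R]_n) (L : {linear 'rV[R]_n -> 'rV[R]_m}) : continuous f ->
  L (vint f) = vint (fun y => L (f y)).
Proof.
move=> cf; apply/rowP => i; rewrite vintE.
have lin : linear (fun v : 'rV[R]_n => L v 0 i : R^o) by move=> a u v; rewrite linearP !mxE.
exact: (rint_linear (mklin lin) cf).
Qed.

Lemma vintD n (f g : M -> 'rV[R]_n) : continuous f -> continuous g ->
  vint (fun y => f y + g y) = vint f + vint g.
Proof.
move=> cf cg; apply/rowP => i; rewrite vintE mxE !vintE -rintD; try exact: coord_continuous_fun.
by congr rint; apply/funext => y; rewrite mxE.
Qed.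

Lemma vintZ n a (f : M -> 'rV[R]_n) : continuous f -> vint (fun y => a *: f y) = a *: vint f.
Proof.
move=> cf; apply/rowP => i; rewrite vintE mxE vintE -rintZ; last exact: coord_continuous_fun.
by congr rint; apply/funext => y; rewrite mxE.
Qed.

Lemma continuous_scale n (a : R) (f : M -> 'rV[R]_n) : continuous f -> continuous (fun y => a *: f y).
Proof. by move=> cf y; apply: continuousZr => //; exact: cf. Qed.

Lemma continuous_sub n (f g : M -> 'rV[R]_n) : continuous f -> continuous g -> continuous (fun y => f y - g y).
Proof. by move=> cf cg y; apply: continuousB; [exact: cf|exact: cg]. Qed.

Lemma vint_bound n (f : M -> 'rV[R]_n) K : continuous f -> 0 <= K -> (forall y, `|f y| <= K) -> `|vint f| <= K.
Proof.
move=> cf K0 H; apply: rV_norm_le => // i; rewrite vintE ler_norml.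
have ci := coord_continuous_fun (i := i) cf.
have Hi y : - K <= f y 0 i <= K by rewrite -ler_norml (le_trans (coord_norm_le _ _)).
apply/andP; split.
  by rewrite -(rint_cst (- K)); apply: rint_le => // [|y]; [exact: cst_continuous|case/andP: (Hi y)].
by rewrite -(rint_cst K); apply: rint_le => // [|y]; [exact: cst_continuous|case/andP: (Hi y)].
Qed.

End vector_integral.

(** * Differentiation under the integral sign *)

Section parametric_integral.
Context {R : realType} {e N r : nat} (M : charted_space 'rV[R]_r).
Hypotheses (mM : mfld M) (cM : compact [set: M]).
Variable nu : probability (borel M) R.
Local Notation vint := (vec_integral nu).
Local Notation E := 'rV[R]_e.
Local Notation P := (prod_space (euclid E) M).
Let mE : mfld (euclid E) := euclid_mfld (@findim_rV R e).
Let mP := prod_mfld mE mM.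
Let fE := @findim_rV R e.

Definition dparam (v : E) (F : P -> 'rV[R]_N) (p : P) : 'rV[R]_N := 
  'd ((fun a : E => F (a, p.2)) : E -> 'rV[R]_N) (p.1 : E) v.

Let lc (F : P -> 'rV[R]_N) (y0 : M) (q : E * 'rV[R]_r) : 'rV[R]_N := F (q.1, cbwd (chart_at y0) q.2).

Lemma param_chart_Coo F y0 a y : smat (F : P -> euclid 'rV[R]_N) (a, y) -> cdom (chart_at y0) y ->
  Coo_at (lc F y0) (a, cfwd (chart_at y0) y).
Proof.
move=> sF dy; have ay0 := atlas_at mM y0.
have cc := atlas_chart mM ay0.
have fP : findim (E * 'rV[R]_r)%type by exact/findim_prod/findim_rV/findim_rV.
have mQ := euclid_mfld fP.
apply/(smat_euclidP _ _ fP (findim_rV N)).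
apply: (smat_comp mQ mP (f := (fun q => (q.1, cbwd (chart_at y0) q.2)) : euclid (E * 'rV[R]_r)%type -> P)).
  apply: smat_pair.
    apply/(smat_euclidP _ _ fP fE); exact: (Coo_at_fst (Coo_at_id (a, cfwd (chart_at y0) y))).
  apply: (smat_comp mQ (euclid_mfld (findim_rV r)) (f := (snd : euclid (E * 'rV[R]_r)%type -> euclid 'rV[R]_r))).
    apply/(smat_euclidP _ _ fP (findim_rV r)); exact: (Coo_at_snd (Coo_at_id (a, cfwd (chart_at y0) y))).
  exact: (smat_cbwd mM ay0 (chart_img dy)).
by rewrite /= (chart_cbwdK cc dy).
Qed.

Lemma dparam_chart F y0 a y v : smat (F : P -> euclid 'rV[R]_N) (a, y) -> cdom (chart_at y0) y ->
  differentiable (fun a' : E => F (a', y)) a /\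
  dparam v F (a, y) = 'd (lc F y0) (a, cfwd (chart_at y0) y) (v, 0).
Proof.
move=> sF dy; have C := Coo_at_differentiable (param_chart_Coo sF dy).
have [D E0] := is_diff_fst C.
have Ef : (fun a' : E => F (a', y)) = (fun z => lc F y0 (z, cfwd (chart_at y0) y)).
  apply/funext => z; rewrite /lc /= (chart_cbwdK (atlas_chart mM (atlas_at mM y0)) dy) //.
by rewrite /dparam /= Ef; split => //; exact: E0.
Qed.

Lemma dparam_smat F v : (forall p, smat (F : P -> euclid 'rV[R]_N) p) ->
  forall p, smat (dparam v F : P -> euclid 'rV[R]_N) p.
Proof.
move=> sF [a y]; have mN := euclid_mfld (@findim_rV R N).
pose psi := chart_at y; have cpsi : is_chart psi := chart_at_is mM y.
have dy : cdom psi y := dom_at mM y.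
pose G (q : E * 'rV[R]_r) := 'd (lc F y) q (v, 0).
have CG : Coo_at G (a, cfwd psi y) := Coo_at_diff _ (param_chart_Coo (sF (a, y)) dy).
have fP : findim (E * 'rV[R]_r)%type by exact/findim_prod/findim_rV/findim_rV.
have sG : smat (G : euclid (E * 'rV[R]_r)%type -> euclid 'rV[R]_N) (a, cfwd psi y).
  by apply/(smat_euclidP _ _ fP (findim_rV N)).
have sp : smat ((fun p => (p.1, cfwd psi p.2)) : P -> euclid (E * 'rV[R]_r)%type) (a, y).
  have s1 : smat (fst : P -> euclid E) (a, y) by exact: (smat_fst mE).
  have s2 : smat (fun p : P => cfwd psi p.2 : euclid 'rV[R]_r) (a, y).
    exact: (smat_comp mP mM (smat_snd mM (a, y)) (smat_cfwd mM (atlas_at mM y) dy)).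
  have s3 := smat_pair s1 s2.
  exact: s3.
have s := smat_comp mP (euclid_mfld fP) sp sG.
apply: (smat_eq mP _ s).
have [cs _] : smat (snd : P -> M) (a, y) by exact: (smat_snd mM).
have n : \forall p \near ((a, y) : P), cdom psi p.2 by apply: cs; exact: (near_dom cpsi dy).
apply: filterS n => -[a' y'] dy' /=.
by have [_ ->] := dparam_chart v (sF (a', y')) dy'.
Qed.

Lemma param_continuous F a : (forall p, smat (F : P -> euclid 'rV[R]_N) p) ->
  continuous (fun y => F (a, y)).
Proof.
move=> sF y; have [c _] := sF (a, y).
apply: (@continuous_comp _ _ _ (fun y => (a, y) : P) F); last exact: c.
have [cp _] := smat_pair (smat_cst (a : euclid E) y) (smat_id mM y); exact: cp.
Qed.

(** Strict differentiability in a chart around each point of [M], made uniform by compactness of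
    [M]. *)
Lemma param_uniform F a eps : (forall p, smat (F : P -> euclid 'rV[R]_N) p) -> 0 < eps ->
  \forall a' \near a, forall y, `|F (a', y) - F (a, y)| <= eps /\
    `|F (a', y) - F (a, y) - dparam (a' - a) F (a, y)| <= eps * `|a' - a|.
Proof.
move=> sF eps0.
have := (compact_near_coveringP [set: M]).1 cM E (nbhs a) (fun a' y => `|F (a', y) - F (a, y)| <= eps /\
    `|F (a', y) - F (a, y) - dparam (a' - a) F (a, y)| <= eps * `|a' - a|).
move=> /(_ (nbhs_filter a)) H; suff K : forall y : M, [set: M] y -> \forall y' \near y & a' \near a,
    `|F (a', y') - F (a, y')| <= eps /\
    `|F (a', y') - F (a, y') - dparam (a' - a) F (a, y')| <= eps * `|a' - a|.
  by apply: filterS (H K) => a' h y; exact: h.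
move=> y _ {H}; pose psi := chart_at y; have cpsi : is_chart psi := chart_at_is mM y.
have dy : cdom psi y := dom_at mM y.
have C := param_chart_Coo (sF (a, y)) dy.
have e20 : 0 < eps / 2 by rewrite divr_gt0.
have fP : findim (E * 'rV[R]_r)%type by exact/findim_prod/findim_rV/findim_rV.
have [W [oW We WC]] := C.
have [dl d0 Hd] := ex_right (C1_strict fP oW We (WC 1%N) e20).
have cF := Coo_at_continuous C; rewrite continuous_normP in cF.
have n1 := cF _ e20.
have n2 : \forall q \near ((a, cfwd psi y) : E * 'rV[R]_r), ball (a, cfwd psi y) dl q by exact: nbhsx_ballx.
have [[A B] /= [nA nB] AB] := filterI n1 n2.
exists ([set y' | cdom psi y' /\ B (cfwd psi y')], A).
  split => //=; apply: filterI; first exact: near_dom.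
  exact: (near_cfwd cpsi dy nB).
move=> [y' a'] /= [[dy' By'] Aa'].
have [h1 h2] := AB (a', cfwd psi y') (conj Aa' By').
have [h1' h2'] := AB (a, cfwd psi y') (conj (nbhs_singleton nA) By').
have EF z : F (z, y') = lc F y (z, cfwd psi y') by rewrite /lc /= (chart_cbwdK cpsi dy').
split.
  by rewrite !EF; apply: (dist_le_split erefl erefl h1 h1').
have [_ ED] := dparam_chart (a' - a) (sF (a, y')) dy'.
have [_ _ _ s1] := Hd _ _ h2' h2; have [_ _ s2 _] := Hd _ _ h2' h2.
have Eq : (a', cfwd psi y') - (a, cfwd psi y') = (a' - a, 0) :> (E * 'rV[R]_r)%type.
  by rewrite -[LHS]/(a' - a, cfwd psi y' - cfwd psi y') subrr.
rewrite Eq norm_inl in s1; have {}s2 := s2 (a' - a, 0); rewrite norm_inl in s2.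
rewrite mulrAC in s1; rewrite mulrAC in s2.
rewrite !EF ED.
exact: dist_le_split erefl erefl s1 s2.
Qed.

Definition pint (F : P -> 'rV[R]_N) (a : E) : 'rV[R]_N := vint (fun y => F (a, y)).

Lemma dparam_linear F (p : P) a u v : dparam (a *: u + v) F p = a *: dparam u F p + dparam v F p.
Proof. by rewrite /dparam linearP. Qed.

Lemma vintB n' (f g : M -> 'rV[R]_n') : continuous f -> continuous g ->
  vint (fun y => f y - g y) = vint f - vint g.
Proof.
move=> cf cg; rewrite -scaleN1r -vintZ// -vintD//.
  by congr vec_integral; apply/funext => y; rewrite scaleN1r.
exact: continuous_scale.
Qed.

Lemma pint_diff F a : (forall p, smat (F : P -> euclid 'rV[R]_N) p) ->
  differentiable (pint F) a /\ forall v, 'd (pint F) a v = pint (dparam v F) a.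
Proof.
move=> sF; have cF := @param_continuous F ^~ sF.
have cD v := @param_continuous (dparam v F) ^~ (dparam_smat v sF).
have lin : linear (fun v => pint (dparam v F) a).
  move=> s u v; rewrite /pint -vintZ// -vintD//.
    by congr vec_integral; apply/funext => y; rewrite dparam_linear.
  exact: continuous_scale (cD u a).
suff D : is_diff a (pint F) (mklin lin) by exact: is_diffE D.
apply/is_diff_epsP; split; first exact: findim_continuous fE.
move=> eps e0; apply: filterS (param_uniform a sF e0) => a' H.
rewrite /pint /= -!vintB//; last first.
  exact: continuous_sub (cF a') (cF a).
apply: vint_bound => //.
- exact: continuous_sub (continuous_sub (cF a') (cF a)) (cD (a' - a) a).
- by rewrite mulr_ge0// ltW.
- by move=> y; have [] := H y.
Qed.

(** The derivative is again an integral of this form, with the smooth integrand [dparam v F]; hence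
    the induction. *)
Lemma pint_Ck k F : (forall p, smat (F : P -> euclid 'rV[R]_N) p) -> Ck k setT (pint F).
Proof.
elim: k F => [|k IH] F sF.
  by move=> a _; apply: differentiable_continuous; have [] := pint_diff a sF.
split=> [a _|v]; first by have [] := pint_diff a sF.
have -> : (fun a => 'd (pint F) a v) = pint (dparam v F).
  by apply/funext => a; have [_ ->] := pint_diff a sF.
exact: IH (dparam_smat v sF).
Qed.

Lemma pint_Coo F a : (forall p, smat (F : P -> euclid 'rV[R]_N) p) -> Coo_at (pint F) a.
Proof. by move=> sF; exists setT; split => // [|k]; [exact: openT|exact: pint_Ck]. Qed.

End parametric_integral.

Lemma diff_linear_comp {R : realType} (U V W : normedModType R) (L : {linear V -> W}) (f : U -> V) a v :
  continuous L -> differentiable f a -> 'd (L \o f) a v = L ('d f a v).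
Proof.
move=> cL df; rewrite -[RHS](congr1 (fun h => h ('d f a v)) (@diff_lin _ _ _ L (f a) cL)).
exact: (esym (@chain_near R U V W f L (L \o f) a v (f a) df erefl (linear_differentiable (f a) cL) (filterE _ (fun=> erefl)))).
Qed.

(** * Proper local diffeomorphisms onto convex sets *)

Section proper_diffeo.
Context {R : realType} {e N : nat}.
Variables (Pm : 'M[R]_(e, N)) (Q : 'M[R]_(N, e)).
Hypothesis PQ : Pm *m Q = 1%:M.
(** The row space of [Pm], as an equation: [Q] gives the coordinates of a point and [Pm] the point
    with given coordinates. *)
Definition in_plane : set 'rV[R]_N := [set x | x *m Q *m Pm = x].
Local Notation p := in_plane.
Variable C : set 'rV[R]_N.
Hypotheses (Cp : C `<=` p)
  (cvxC : forall x y (l : R), C x -> C y -> 0 < l -> l < 1 -> C (l *: x + (1 - l) *: y)).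
Local Notation Om := (relative_interior p C).
Hypothesis Om0 : Om 0.

Lemma in_plane_mul a : p (a *m Pm).
Proof. by rewrite /in_plane /= -[a *m Pm *m Q]mulmxA PQ mulmx1. Qed.

Lemma in_planeD x y : p x -> p y -> p (x + y).
Proof. by rewrite /in_plane /= !mulmxDl => -> ->. Qed.

Lemma in_planeZ a x : p x -> p (a *: x).
Proof. by rewrite /in_plane /= -!scalemxAl => ->. Qed.

Lemma in_planeB x y : p x -> p y -> p (x - y).
Proof. by move=> px py; rewrite -scaleN1r; apply: in_planeD => //; exact: in_planeZ. Qed.

Lemma in_plane_inj x y : p x -> p y -> x *m Q = y *m Q -> x = y.
Proof. by rewrite /in_plane /= => {2}<- {2}<- ->. Qed.

(* [y] is a convex combination of a point of [C] close to [(1 + d) y] and of a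
   point close to 0. *)
Lemma closure_convex_point y : p y -> (\forall z \near y, p z -> closure C z) -> C y.
Proof.
move=> py ny; have [_ n0] := Om0.
have /nbhs_ballP[r0 /= r00 H0] := n0; have /nbhs_ballP[r1 /= r10 H1] := ny.
pose d := r1 / (2 * (`|y| + 1)); have y1 : 0 < `|y| + 1 by rewrite ltr_wpDl.
have d0 : 0 < d by rewrite divr_gt0// mulr_gt0.
have b1 : ball y r1 ((1 + d) *: y).
  rewrite -ball_normE /ball_ /= scalerDl scale1r opprD addrA subrr add0r normrN normrZ ger0_norm ?ltW//.
  have : d * (2 * (`|y| + 1)) = r1 by rewrite divfK// gt_eqF// mulr_gt0.
  have : 0 <= d * `|y| by rewrite mulr_ge0// ltW.
  rewrite -/d; move: d0; move: (`|y|) => u; nra.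
have cl := H1 _ b1 (in_planeZ (1 + d) py).
have dr : 0 < d * r0 by rewrite mulr_gt0.
have [c [Cc bc]] := cl _ (nbhsx_ballx ((1 + d) *: y) _ dr).
pose z := d^-1 *: ((1 + d) *: y - c).
have Cz : C z.
  apply: H0; last by apply: in_planeZ; apply: in_planeB; [exact: in_planeZ|exact: Cp].
  rewrite -ball_normE /ball_ /= sub0r normrN normrZ gtr0_norm ?invr_gt0// mulrC ltr_pdivrMr// mulrC.
  by move: bc; rewrite -ball_normE.
have l0 : 0 < (1 + d)^-1 by rewrite invr_gt0; lra.
have l1 : (1 + d)^-1 < 1 by rewrite invf_lt1; lra.
have := cvxC Cc Cz l0 l1; congr C; apply/rowP => i; rewrite !mxE.
by field; rewrite !gt_eqF//; lra.
Qed.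

Lemma closure_convex_interior y : p y -> (\forall z \near y, p z -> closure C z) -> Om y.
Proof.
move=> py ny; split => //.
have : \forall z \near y, \forall w \near z, p w -> closure C w by apply: nbhs_interior.
by apply: filterS => z nz pz; exact: closure_convex_point.
Qed.

Lemma Om_convex x y (l : R) : Om x -> Om y -> 0 < l -> l < 1 -> Om (l *: x + (1 - l) *: y).
Proof.
move=> [px nx] [py ny] l0 l1; have l10 : 0 < 1 - l by rewrite subr_gt0.
split; first by apply: in_planeD; exact: in_planeZ.
have /nbhs_ballP[r0 /= r00 H0] := nx.
have lr : 0 < l * r0 by rewrite mulr_gt0.
have : \forall w \near l *: x + (1 - l) *: y, ball (l *: x + (1 - l) *: y) (l * r0) w by exact: nbhsx_ballx.
apply: filterS => w bw pw.
pose x' := l^-1 *: (w - (1 - l) *: y).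
have px' : p x' by apply: in_planeZ; apply: in_planeB => //; exact: in_planeZ.
have Cx' : C x'.
  apply: H0 => //; move: bw; rewrite -!ball_normE /ball_ /= => bw.
  have -> : x - x' = l^-1 *: (l *: x + (1 - l) *: y - w).
    by apply/rowP => i; rewrite !mxE; field; rewrite gt_eqF.
  by rewrite normrZ gtr0_norm ?invr_gt0// mulrC ltr_pdivrMr// mulrC.
have Cy : C y by exact: nbhs_singleton ny py.
have := cvxC Cx' Cy l0 l1; congr C; apply/rowP => i; rewrite !mxE.
by field; rewrite gt_eqF.
Qed.

Variable B : {biscalar 'rV[R]_N}.
Variable Phi : 'rV[R]_e -> 'rV[R]_N.
Hypotheses (PhiC : forall a, Coo_at Phi a) (Phip : forall a, p (Phi a))
  (Phi_inj : forall a v, 'd Phi a v = 0 -> v = 0) (Phi_cl : forall a, closure C (Phi a))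
  (Phi_strict : forall a, a != 0 -> 0 < B (Phi a - Phi 0) (a *m Pm))
  (Phi_mono : forall (s t : R) v, 0 <= s -> s <= t -> B (Phi (s *: v)) (v *m Pm) <= B (Phi (t *: v)) (v *m Pm))
  (Phi_lim : forall v y, v != 0 -> Om y -> exists2 T : R, 0 <= T & B y (v *m Pm) < B (Phi (T *: v)) (v *m Pm)).

Let LQ : {linear 'rV[R]_N -> 'rV[R]_e} := mulmxr Q.
Let cLQ : continuous LQ := findim_continuous (findim_rV N).

Lemma biscalar_bound n (b : {biscalar 'rV[R]_n}) : exists2 K, 0 < K & forall u v, `|b u v| <= K * `|u| * `|v|.
Proof.
pose eta := \sum_i \sum_j `|b (delta_mx 0 i) (delta_mx 0 j)|.
have Hij i j : `|b (delta_mx 0 i) (delta_mx 0 j)| <= eta.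
  rewrite /eta (bigD1 i)//= (bigD1 j)//= -addrA lerDl addr_ge0//; first exact: sumr_ge0.
  by apply: sumr_ge0 => ? _; apply: sumr_ge0.
exists (n%:R ^+ 2 * eta + 1).
  by rewrite ltr_wpDl// mulr_ge0 ?sqr_ge0//; apply: sumr_ge0 => ? _; apply: sumr_ge0.
move=> u v; apply: le_trans (bilinear_bound _ _ Hij u v) _.
- by move=> a x y w; rewrite linearPl.
- by move=> a x y w; rewrite linearPr.
have gen (x y : R) : x <= x + 1 -> 0 <= y -> x * y <= (x + 1) * y by move=> h y0; rewrite ler_wpM2r.
by rewrite -[leLHS]mulrA -[leRHS]mulrA; apply: gen; rewrite ?mulr_ge0// lerDl.
Qed.

(** [Phi] stays in the plane, so following it by the coordinates [Q] loses nothing: the composite is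
    a map of [R^e] whose differential is still injective, and the inverse function theorem applies
    to it. *)
Lemma local_inverse a : exists (D : set 'rV[R]_e) (E : set 'rV[R]_e) (gl : 'rV[R]_e -> 'rV[R]_e),
  [/\ open D, D a, open E, Coo E gl &
  (forall x, D x -> E (Phi x *m Q) /\ gl (Phi x *m Q) = x) /\
  (forall y, E y -> D (gl y) /\ Phi (gl y) *m Q = y)].
Proof.
have CLQ y : Coo_at LQ y by apply: Coo_at_linear.
have Cf : Coo_at (LQ \o Phi) a := Coo_at_comp (findim_rV N) (PhiC a) (CLQ _).
have [A [oA Aa fA]] := Cf.
have inj v : 'd (LQ \o Phi) a v = 0 -> v = 0.
  move=> dv0; apply: (Phi_inj (a := a)).
  pose LP : {linear 'rV[R]_e -> 'rV[R]_N} := mulmxr Pm.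
  have cLP : continuous LP := findim_continuous (findim_rV e).
  have E1 := diff_linear_comp v cLP (Coo_at_differentiable Cf).
  have E2 : LP \o (LQ \o Phi) = Phi by apply/funext => x; exact: Phip.
  by rewrite E2 dv0 linear0 in E1.
have [D [E [gl [[oD Da _] oE H1 H2 gC]]]] := inverse_function oA Aa fA inj.
by exists D, E, gl; split.
Qed.

Lemma near_mulQ (y : 'rV[R]_N) (P : set 'rV[R]_e) : (\forall x \near y *m Q, P x) -> \forall z \near y, P (z *m Q).
Proof. by move=> n; exact: (@cLQ y _ n). Qed.

(** The local inverse puts a neighbourhood of [Phi a] in the plane inside the closure of [C], and a
    convex set contains the interior of its closure. *)
Lemma Phi_Om a : Om (Phi a).
Proof.
have [D [E [gl [oD Da oE _ [H1 H2]]]]] := local_inverse a.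
apply: closure_convex_interior => //.
have n : \forall x \near Phi a *m Q, E x by apply: open_near => //; have [] := H1 a Da.
apply: filterS (near_mulQ n) => z Ez pz; have [_ E0] := H2 _ Ez.
by rewrite -(in_plane_inj (Phip (gl (z *m Q))) pz E0); exact: Phi_cl.
Qed.

Lemma Phi_continuous : continuous Phi.
Proof. by move=> a; exact: Coo_at_continuous. Qed.

(** For one unit vector this is [Phi_lim]; monotonicity extends it to later times, continuity to
    nearby vectors, and compactness of the sphere makes it uniform. The same [dl] bounds the gap
    and, inverted, the time, so that a single filter at 0 suffices. *)
Lemma ray_separation y : Om y -> exists2 dl : R, 0 < dl & forall v : 'rV[R]_e, `|v| = 1 ->
  forall t : R, dl^-1 <= t -> dl <= B (Phi (t *: v) - y) (v *m Pm).
Proof.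
move=> Oy; pose S := [set v : 'rV[R]_e | `|v| = 1].
have cS : compact S.
  have clS : closed S.
    apply: (@preimage_closed _ _ (fun x : 'rV[R]_e => `|x|) [set t : R | t = 1]); last exact: closed_eq.
    by move=> x _; exact: norm_continuous.
  have cB : compact [set x : 'rV[R]_e | `|x - 0| <= 1] by exact: closed_norm_ball_compact.
  by apply: (subclosed_compact clS cB) => x; rewrite /S /= subr0 => ->.
pose P (dl : R) (v : 'rV[R]_e) := forall t : R, dl^-1 <= t -> dl <= B (Phi (t *: v) - y) (v *m Pm).
have H := (compact_near_coveringP S).1 cS R ((0 : R)^'+) P.
suff K v : S v -> \forall v' \near v & dl \near 0^'+, P dl v'.
  have [dl d0 Hdl] := ex_right (H _ K); exists dl => // v Sv; exact: Hdl.
move=> Sv; have v0 : v != 0 by rewrite -normr_eq0 Sv oner_eq0.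
have [T T0 HT] := Phi_lim v0 Oy.
pose h (v' : 'rV[R]_e) : R := B (Phi (T *: v') - y) (v' *m Pm).
have hv : 0 < h v by rewrite /h linearBl subr_gt0.
have ch : {for v, continuous (h : _ -> R^o)}.
  have [K K0 HK] := biscalar_bound B; have [K2 K20 HK2] := mulmx_norm_bound Pm.
  pose X v' := Phi (T *: v') - y.
  have cX : {for v, continuous X}.
    apply: continuousB; last exact: cst_continuous.
    apply: (@continuous_comp _ _ _ (fun v' : 'rV[R]_e => T *: v') Phi); last exact: Phi_continuous.
    by apply: continuousZr => //.
  have bil x x' w w' : B x w - B x' w' = B x (w - w') + B (x - x') w'.
    by rewrite linearBr linearBl addrA subrK.
  apply/(@continuous_normP _ _ R^o) => eps e0.
  pose M1 := K * K2 * (`|X v| + 1 + `|v|).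
  have M1p : 0 <= M1 by apply: mulr_ge0; [exact: mulr_ge0 (ltW K0) (ltW K20)|rewrite !addr_ge0].
  have M10 : 0 < M1 + 1 by rewrite ltr_wpDl.
  pose eta := Num.min 1 (eps / (M1 + 1)).
  have eta0 : 0 < eta by rewrite lt_min ltr01 divr_gt0.
  have n1 : \forall v' \near v, `|X v' - X v| <= eta.
    by have := cX; rewrite continuous_normP; apply.
  have n2 : \forall v' \near v, `|v' - v| <= eta by exact: near_norm_le.
  apply: filterS2 n1 n2 => v' l1 l2.
  have -> : h v' - h v = B (X v') ((v' - v) *m Pm) + B (X v' - X v) (v *m Pm).
    by rewrite mulmxBl; exact: bil.
  have l3 : `|X v'| <= `|X v| + 1.
    rewrite -(subrK (X v) (X v')) addrC (le_trans (ler_normD _ _))// lerD2l (le_trans l1)//.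
    by rewrite ge_min lexx.
  rewrite (le_trans (ler_normD _ _))//.
  have k1 : `|B (X v') ((v' - v) *m Pm)| <= K * (`|X v| + 1) * (K2 * eta).
    rewrite (le_trans (HK _ _))//; apply: ler_pM => //; first by rewrite mulr_ge0// ltW.
      by rewrite ler_pM2l.
    by rewrite (le_trans (HK2 _))// ler_pM2l.
  have k2 : `|B (X v' - X v) (v *m Pm)| <= K * eta * (K2 * `|v|).
    rewrite (le_trans (HK _ _))//; apply: ler_pM => //; first by rewrite mulr_ge0// ltW.
      by rewrite ler_pM2l.
  apply: (le_trans (lerD k1 k2)).
  have -> : K * (`|X v| + 1) * (K2 * eta) + K * eta * (K2 * `|v|) = M1 * eta by rewrite /M1; ring.
  apply: (@le_trans _ _ (M1 * (eps / (M1 + 1)))).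
    by rewrite ler_wpM2l// ge_min lexx orbT.
  rewrite [leLHS]mulrA ler_pdivrMr// mulrDr mulr1 [leLHS]mulrC lerDl; exact: ltW.
have n1 : \forall v' \near v, h v / 2 < h v'.
  have n0 : \forall x \near (h v : R^o), h v / 2 < x.
    by apply: (@open_near R^o [set x : R | h v / 2 < x]); [exact: open_gt|rewrite /=; lra].
  exact: ch n0.
exists ([set v' | h v / 2 < h v'], [set dl : R | 0 < dl /\ dl <= Num.min (T + 1)^-1 (h v / 2)]).
  split => //=; apply: filterI; first exact: nbhs_right_gt.
  apply: nbhs_right_le; rewrite lt_min invr_gt0 divr_gt0 ?andbT//; lra.
move=> [v' dl] /= [hv' [d0 dl1]] t tt.
have T1 : 0 < T + 1 by lra.
have Tt : T <= t.
  have : T + 1 <= t.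
    rewrite (le_trans _ tt)// -[T + 1]invrK lef_pV2 ?posrE ?invr_gt0//.
    by rewrite (le_trans dl1)// ge_min lexx.
  lra.
have dl2 : dl <= h v / 2 by rewrite (le_trans dl1)// ge_min lexx orbT.
have gen (x1 x2 x3 x4 : R) : dl <= x4 / 2 -> x4 / 2 < x1 - x3 -> x1 <= x2 -> dl <= x2 - x3 by lra.
rewrite linearBl; move: hv'; rewrite {2}/h linearBl => hv'.
exact: gen dl2 hv' (Phi_mono v' T0 Tt).
Qed.

(** For large [a] the gap of [ray_separation] in the direction of [a] forces [Phi a] away from [y],
    because [B] is bounded. *)
Lemma Phi_proper y : Om y -> exists K eps : R, [/\ 0 <= K, 0 < eps & forall a, `|Phi a - y| <= eps -> `|a| <= K].
Proof.
move=> Oy; have [dl d0 Hd] := ray_separation Oy.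
have [K K0 HK] := biscalar_bound B; have [K2 K20 HK2] := mulmx_norm_bound Pm.
exists dl^-1, (dl / (2 * (K * K2))); have KK : 0 < K * K2 by rewrite mulr_gt0.
split; [by rewrite invr_ge0 ltW|by rewrite divr_gt0// mulr_gt0|].
move=> a la; rewrite leNgt; apply/negP => da.
have na : 0 < `|a| by rewrite (lt_trans _ da)// invr_gt0.
pose v := `|a|^-1 *: a.
have nv : `|v| = 1 by rewrite normrZ gtr0_norm ?invr_gt0// mulVf// gt_eqF.
have av : `|a| *: v = a by rewrite scalerA mulfV ?scale1r// gt_eqF.
have := Hd v nv `|a| (ltW da); rewrite av leNgt => /negP; apply.
rewrite (le_lt_trans (ler_norm _))// (le_lt_trans (HK _ _))//.
have lv : `|v *m Pm| <= K2 by rewrite (le_trans (HK2 v))// nv mulr1.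
apply: (@le_lt_trans _ _ (K * (dl / (2 * (K * K2))) * K2)).
  by apply: ler_pM => //; [rewrite mulr_ge0// ltW|rewrite ler_pM2l].
have -> : K * (dl / (2 * (K * K2))) * K2 = dl / 2 by field; rewrite !gt_eqF.
lra.
Qed.

Definition one_preimage (y : 'rV[R]_N) := exists! a, Phi a = y.

Lemma avoid_compact y (X : set 'rV[R]_e) : compact X -> (forall a, X a -> Phi a <> y) ->
  \forall z \near y, forall a, X a -> Phi a <> z.
Proof.
move=> cX H; have cI : closed (Phi @` X).
  apply: compact_closed; first exact: norm_hausdorff.
  by apply: continuous_compact => //; apply: continuous_subspaceT; exact: Phi_continuous.
have : \forall z \near y, (~` (Phi @` X)) z.
  by apply: open_near; [rewrite openC|move=> [a Xa /H]].
by apply: filterS => z nz a Xa E; apply: nz; exists a.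
Qed.

Lemma near_preimage a : exists (D : set 'rV[R]_e), [/\ open D, D a &
  \forall z \near Phi a, p z -> exists2 x, D x & Phi x = z /\ forall x', D x' -> Phi x' = z -> x' = x].
Proof.
have [D [E [gl [oD Da oE _ [H1 H2]]]]] := local_inverse a.
exists D; split => //.
have n : \forall x \near Phi a *m Q, E x by apply: open_near => //; have [] := H1 a Da.
apply: filterS (near_mulQ n) => z Ez pz; have [Dz E0] := H2 _ Ez.
exists (gl (z *m Q)) => //; split; first exact: in_plane_inj E0.
by move=> x' Dx' <-; have [_ ->] := H1 x' Dx'.
Qed.

(** The local inverse gives exactly one preimage close to [a]; by properness any other would lie in
    a fixed compact set away from [a], which [Phi] keeps at a distance from [y]. *)
Lemma one_preimage_open y : Om y -> one_preimage y -> \forall z \near y, p z -> one_preimage z.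
Proof.
move=> Oy [a [Ea ua]]; have [D [oD Da n1]] := near_preimage a.
have [K [eps [K0 e0 HK]]] := Phi_proper Oy.
pose X := [set x : 'rV[R]_e | `|x - 0| <= K] `&` ~` D.
have cX : compact X.
  by apply: compact_closedI; [exact: closed_norm_ball_compact|rewrite closedC].
have n2 : \forall z \near y, forall x, X x -> Phi x <> z.
  by apply: avoid_compact => // x [_ nD] /ua ax; apply: nD; rewrite -ax.
have n3 : \forall z \near y, `|z - y| <= eps by exact: near_norm_le.
rewrite Ea in n1.
apply: filterS3 n1 n2 n3 => z h1 h2 h3 pz; have [x Dx [Ex ux]] := h1 pz.
exists x; split => // x' Ex'; apply/esym; apply: ux => //.
apply: contrapT => nD; apply: (h2 x') => //; split => //=.
by rewrite subr0; apply: HK; rewrite Ex'.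
Qed.

(** Both ways to fail persist nearby: absence of preimages by properness, two distinct preimages by
    the local inverses on disjoint neighbourhoods. *)
Lemma one_preimage_closed y : Om y -> ~ one_preimage y -> \forall z \near y, p z -> ~ one_preimage z.
Proof.
move=> Oy nU; have [[a Ea]|nE] := pselect (exists a, Phi a = y); last first.
  have [K [eps [K0 e0 HK]]] := Phi_proper Oy.
  have n2 : \forall z \near y, forall x, [set x : 'rV[R]_e | `|x - 0| <= K] x -> Phi x <> z.
    by apply: avoid_compact => [|x _ Ex]; [exact: closed_norm_ball_compact|apply: nE; exists x].
  have n3 : \forall z \near y, `|z - y| <= eps by exact: near_norm_le.
  apply: filterS2 n2 n3 => z h2 h3 _ [x [Ex _]]; apply: (h2 x) => //=.
  by rewrite subr0; apply: HK; rewrite Ex.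
have [a' [Ea' aa']] : exists a', Phi a' = y /\ a' <> a.
  apply: contrapT => h; apply: nU; exists a; split => // x Ex.
  by apply: contrapT => ax; apply: h; exists x; split => // xa; apply: ax.
have [D [oD Da n1]] := near_preimage a; have [D' [oD' Da' n1']] := near_preimage a'.
have na : 0 < `|a' - a| / 2 by rewrite divr_gt0// normr_gt0 subr_eq0; apply/eqP.
have [W [W' [nW nW' dW]]] : exists W W' : set 'rV[R]_e, [/\ nbhs a W, nbhs a' W' & forall x, W x -> W' x -> False].
  exists (ball a (`|a' - a| / 2)), (ball a' (`|a' - a| / 2)); split; try exact: nbhsx_ballx.
  move=> x; rewrite -!ball_normE /ball_ /= => l1 l2.
  have : `|a' - a| <= `|a' - x| + `|a - x|.
    by rewrite -[`|a - x|]normrN opprB (le_trans _ (ler_normD _ _))// addrA subrK.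
  lra.
have small b (V : set 'rV[R]_e) : nbhs b V -> \forall z \near Phi b, p z -> exists2 x, V x & Phi x = z.
  move=> nV; have [Db [Eb [gl [oDb Dbb oEb gC [H1 H2]]]]] := local_inverse b.
  have [Eb0 glb] := H1 b Dbb.
  have cg : {for Phi b *m Q, continuous gl} by exact: (gC 0%N _ Eb0).
  have n : \forall x \near Phi b *m Q, Eb x /\ V (gl x).
    have nE : \forall x \near Phi b *m Q, Eb x by apply: open_near.
    have nV' : \forall x \near Phi b *m Q, V (gl x) by apply: cg; rewrite glb.
    by apply: filterS2 nE nV' => x.
  apply: filterS (near_mulQ n) => z [Ez Vz] pz; have [_ E0] := H2 _ Ez.
  by exists (gl (z *m Q)) => //; exact: in_plane_inj E0.
have s1 := small a W nW; have s2 := small a' W' nW'; rewrite Ea in s1; rewrite Ea' in s2.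
apply: filterS2 s1 s2 => z h1 h2 pz [x [Ex ux]].
have [x1 W1 E1] := h1 pz; have [x2 W2 E2] := h2 pz.
by apply: (dW x1) => //; rewrite -(ux _ E1) (ux _ E2).
Qed.

(** Strict growth along rays separates [Phi a] from [Phi 0]; the continuity argument starts here. *)
Lemma one_preimage_base : one_preimage (Phi 0).
Proof.
exists 0; split => // a Ea; apply/esym/eqP; apply: contraT => a0.
by have := Phi_strict a0; rewrite Ea subrr linear0l ltxx.
Qed.

(* The points of the segment from [Phi 0] to [y] with exactly one preimage form
   an open and closed set. *)
Lemma one_preimage_Om y : Om y -> one_preimage y.
Proof.
move=> Oy; pose y0 := Phi 0; pose c (s : R) := s *: y + (1 - s) *: y0.
have Oc (s : R) : 0 <= s <= 1 -> Om (c s).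
  move=> /andP[]; rewrite le_eqVlt => /orP[/eqP <- _|s0].
    by rewrite /c scale0r add0r subr0 scale1r; exact: Phi_Om.
  rewrite le_eqVlt => /orP[/eqP ->|s1]; first by rewrite /c scale1r subrr scale0r addr0.
  by apply: Om_convex => //; exact: Phi_Om.
have py : p y by case: Oy.
have pc s : p (c s) by apply: in_planeD; apply: in_planeZ => //; exact: Phip.
have cc (s : R) : {for s, continuous (c : R^o -> _)}.
  have d : differentiable (c : R^o -> 'rV[R]_N) s.
    have -> : c = fun s => y0 + s *: (y - y0).
      by apply/funext => u; apply/rowP => i; rewrite /c !mxE; ring.
    have D := @diff_line R 'rV[R]_N 'rV[R]_N id y0 (y - y0) s (Coo_at_differentiable (Coo_at_id _)).
    by have [D' _] := D; exact/derivable1_diffP.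
  exact: differentiable_continuous.
pose P s := 0 <= s -> s <= 1 -> one_preimage (c s).
have HP : forall t : R, 0 <= t -> P t.
  apply: real_induction.
  - by move=> _ _; rewrite /c scale0r add0r subr0 scale1r; exact: one_preimage_base.
  - move=> t Pt; have [t1|t1] := leP t 1; last first.
      have : \forall s \near t, 1 < s.
        by apply: (@open_near R^o [set x : R | 1 < x]); [exact: open_gt|].
      by apply: filterS => s s1 _; rewrite leNgt s1.
    have [t0|t0] := leP 0 t.
      have n := one_preimage_open (Oc t (introT andP (conj t0 t1))) (Pt t0 t1).
      have n2 : \forall s \near t, p (c s) -> one_preimage (c s) := cc t _ n.
      by apply: filterS n2 => s h _ _; exact: h.
    have : \forall s \near t, s < 0.
      by apply: (@open_near R^o [set x : R | x < 0]); [exact: open_lt|].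
    by apply: filterS => s s1; rewrite /P leNgt s1.
  - move=> T T0 HT _ T1; apply: contrapT => nU.
    have n := one_preimage_closed (Oc T (introT andP (conj (ltW T0) T1))) nU.
    have n2 : \forall s \near T, p (c s) -> ~ one_preimage (c s) := cc T _ n.
    have /nbhs_ballP[r /= r0 Hr] := n2.
    pose s := T - Num.min r T / 2.
    have m0 : 0 < Num.min r T by rewrite lt_min r0.
    have [m1 m2] : Num.min r T <= r /\ Num.min r T <= T by rewrite !ge_min !lexx orbT.
    apply: (Hr s) => //; last by apply: HT; rewrite /s; (try (apply/andP; split)); lra.
    by rewrite -ball_normE /ball_ /= /s opprB addrC subrK ger0_norm; lra.
have := HP 1 ler01 ler01 (lexx 1).
by rewrite /c scale1r subrr scale0r addr0.
Qed.

Theorem proper_inverse : exists G : 'rV[R]_N -> 'rV[R]_e,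
  [/\ forall a, Om (Phi a), cancel Phi G, forall y, Om y -> Phi (G y) = y &
   forall y, Om y -> exists (W : set 'rV[R]_N) (gl : 'rV[R]_N -> 'rV[R]_e),
    [/\ open W, W y, forall z, W z -> Coo_at gl z & forall z, W z -> Om z -> gl z = G z]].
Proof.
pose G y := xget 0 [set a | Phi a = y].
have GP y : Om y -> Phi (G y) = y.
  by move=> /one_preimage_Om[a [Ea _]]; rewrite /G; case: xgetP => [b _ //|/(_ a)].
have inj a b : Phi a = Phi b -> a = b.
  by move=> E; have [x [_ ux]] := one_preimage_Om (Phi_Om b); rewrite -(ux a E) (ux b erefl).
exists G; split => //; first exact: Phi_Om.
  by move=> a; apply: inj; apply: GP; exact: Phi_Om.
move=> y Oy; have [D [E [gl [oD Da oE gC [H1 H2]]]]] := local_inverse (G y).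
exists [set z | E (z *m Q)], (fun z => gl (z *m Q)); split.
- by apply: (@open_comp _ _ LQ E) => // x _; exact: cLQ.
- by have [] := H1 _ Da; rewrite (GP _ Oy).
- move=> z Ez; have Cg : Coo_at gl (LQ z) by exists E.
  have CL : Coo_at LQ z by exact: Coo_at_linear.
  exact: (Coo_at_comp (findim_rV e) CL Cg).
- move=> z Ez Oz; apply: inj; rewrite GP//.
  by have [_ E0] := H2 _ Ez; apply: in_plane_inj E0 => //; have [] := Oz.
Qed.

End proper_diffeo.

(** * Convex hulls and averages *)

Section convexity.
Context {R : realType} {N : nat}.
Implicit Types (A C D : set 'rV[R]_N).

Definition segment_closed C :=
  forall x y (l : R), C x -> C y -> 0 < l -> l < 1 -> C (l *: x + (1 - l) *: y).

Lemma convex_setP C : @convex_set R 'rV[R]_N C <-> segment_closed C.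
Proof.
rewrite convex_setW; split.
  move=> h x y l Cx Cy l0 l1.
  by have := h x y (mem_set Cx) (mem_set Cy) (Itv01 (ltW l0) (ltW l1)) l0 l1; rewrite inE.
move=> h x y Cx Cy l l0 l1; rewrite inE; rewrite inE in Cx; rewrite inE in Cy.
exact: (h x y l%:num Cx Cy l0 l1).
Qed.

Lemma hull_segment A : segment_closed (convex_hull A).
Proof.
move=> x y l hx hy l0 l1 D [cD AD].
by move/convex_setP : (cD) => h; apply: h => //; [exact: hx|exact: hy].
Qed.

Lemma hull_min A D : segment_closed D -> A `<=` D -> convex_hull A `<=` D.
Proof. by move=> /convex_setP cD AD; exact: smallest_sub. Qed.

Lemma sub_hull A : A `<=` convex_hull A.
Proof. exact: sub_gen_smallest. Qed.

Lemma linear_halfspace (L : 'rV[R]_N -> R) (m : R) : linear (L : _ -> R^o) ->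
  segment_closed [set x | L x <= m].
Proof.
move=> lL x y l /= hx hy l0 l1.
have E : L (l *: x + (1 - l) *: y) = l * L x + (1 - l) * L y.
  rewrite lL; congr (_ + _).
  have := lL (1 - l) y 0; rewrite addr0 => ->.
  have := lL 1 0 0; rewrite scale1r addr0 scale1r => h.
  have -> : L 0 = 0 by apply: (addrI (L 0)); rewrite addr0 -h.
  by rewrite addr0.
rewrite E; nra.
Qed.

Lemma closure_segment C z y (l : R) : segment_closed C -> C z -> closure C y -> 0 < l -> l < 1 ->
  closure C (l *: z + (1 - l) *: y).
Proof.
move=> sC Cz cy l0 l1 V nV.
have c : {for y, continuous (fun y : 'rV[R]_N => l *: z + (1 - l) *: y)}.
  by apply: continuousD; [exact: cst_continuous|apply: continuousZr].
have n : \forall y' \near y, V (l *: z + (1 - l) *: y') := c _ nV.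
have [y' [Cy Vy]] := cy _ n; exists (l *: z + (1 - l) *: y'); split => //; exact: sC.
Qed.

Definition dot (u v : 'rV[R]_N) : R := \sum_i u 0 i * v 0 i.

Lemma dotP u : linear (dot u : _ -> R^o).
Proof.
move=> a x y; rewrite /dot /= scaler_sumr -big_split /=; apply: eq_bigr => i _.
by rewrite !mxE /GRing.scale /=; ring.
Qed.

Lemma dotB u v w : dot u (v - w) = dot u v - dot u w.
Proof. by rewrite /dot -sumrB; apply: eq_bigr => i _; rewrite !mxE; ring. Qed.

Lemma dot_eq0 u : dot u u <= 0 -> u = 0.
Proof.
move=> h; have : dot u u == 0.
  by rewrite eq_le h sumr_ge0// => i _; rewrite -expr2 sqr_ge0.
rewrite psumr_eq0 => [/allP u0|i _]; last by rewrite -expr2 sqr_ge0.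
apply/rowP => i; rewrite mxE; apply/eqP.
by have := u0 i (mem_index_enum i); rewrite mulf_eq0 orbb.
Qed.

Lemma dot_sub u v : dot (u - v) (u - v) = dot u u - 2 * dot u v + dot v v.
Proof.
rewrite /dot mulr_sumr -sumrB -big_split /=; apply: eq_bigr => i _.
by rewrite !mxE; ring.
Qed.

Lemma dot_continuous (x : 'rV[R]_N) : continuous (fun z : 'rV[R]_N => dot (x - z) (x - z) : R^o).
Proof.
apply: continuous_sum_fun => i z.
have c : {for z, continuous (fun z : 'rV[R]_N => (x - z) 0 i : R^o)}.
  apply: (@continuous_comp _ _ _ (fun z : 'rV[R]_N => x - z) (fun z : 'rV[R]_N => z 0 i)).
    by apply: continuousB => //; exact: cst_continuous.
  exact: coord_continuous.
exact: continuousM.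
Qed.

End convexity.

Section average.
Context {R : realType} (M : ptopologicalType) (cM : compact [set: M]).
Variable nu : probability (borel M) R.
Context {N : nat} (f : M -> 'rV[R]_N) (cf : continuous f).

(* Otherwise the nearest point of the closure would separate. *)
Lemma average_hull : closure (convex_hull (range f)) (vec_integral nu f).
Proof.
set x0 := vec_integral nu f; set C := convex_hull (range f).
have cn : continuous ((fun y => `|f y|) : M -> R^o).
  by move=> y; apply: (@continuous_comp _ _ _ f (fun x : 'rV[R]_N => `|x|)); [exact: cf|exact: norm_continuous].
have [K K0 HK] := continuous_bounded cM cn.
have CK : C `<=` [set x | `|x| <= K].
  apply: hull_min => [x y l /= hx hy l0 l1|_ [y _ <-] /=]; last by have := HK y; rewrite normr_id.
  rewrite (le_trans (ler_normD _ _))// !normrZ !gtr0_norm ?subr_gt0//.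
  have : l * `|x| <= l * K by rewrite ler_pM2l.
  have : (1 - l) * `|y| <= (1 - l) * K by rewrite ler_pM2l// subr_gt0.
  lra.
have cB : closed [set x : 'rV[R]_N | `|x| <= K].
  apply: (@preimage_closed _ _ (fun x : 'rV[R]_N => `|x|) [set t : R | t <= K]); last exact: closed_le.
  by move=> x _; exact: norm_continuous.
have cC : compact (closure C).
  have k : compact [set x : 'rV[R]_N | `|x - 0| <= K] by exact: closed_norm_ball_compact.
  apply: (subclosed_compact (@closed_closure _ C) k) => x /(closureS CK).
  by rewrite -((closure_id _).1 cB) /= subr0.
have C0 : closure C !=set0 by exists (f point); apply: subset_closure; apply: sub_hull; exists point.
have [y0] := EVT_min_rV C0 cC (continuous_subspaceT (@dot_continuous R N x0)).
rewrite inE => Dy0 Hmin; pose w := x0 - y0.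
have key z : C z -> dot w z <= dot w y0.
  move=> Cz; rewrite -subr_le0 -dotB leNgt; apply/negP => w0.
  pose D := dot (z - y0) (z - y0); have D0 : 0 <= D by rewrite sumr_ge0// => i _; rewrite -expr2 sqr_ge0.
  (* A step short enough for the linear gain to exceed the quadratic term, [l D < dot w (z - y0)],
     with the summand 1 ensuring [l < 1]. *)
  pose l := dot w (z - y0) / (dot w (z - y0) + D + 1).
  have d0 : 0 < dot w (z - y0) + D + 1 by lra.
  have l0 : 0 < l by rewrite divr_gt0.
  have l1 : l < 1 by rewrite ltr_pdivrMr//; lra.
  have lD : l * D < dot w (z - y0).
    by rewrite /l mulrAC ltr_pdivrMr// ltr_pM2l//; lra.
  have := Hmin (l *: z + (1 - l) *: y0); rewrite inE => /(_ (closure_segment (hull_segment (A := range f)) Cz Dy0 l0 l1)).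
  have -> : x0 - (l *: z + (1 - l) *: y0) = w - l *: (z - y0).
    by apply/rowP => i; rewrite !mxE; ring.
  rewrite -/w [leRHS]dot_sub.
  have E1 : dot w (l *: (z - y0)) = l * dot w (z - y0).
    by rewrite /dot mulr_sumr; apply: eq_bigr => i _; rewrite !mxE; ring.
  have E2 : dot (l *: (z - y0)) (l *: (z - y0)) = l * (l * D).
    by rewrite /D /dot !mulr_sumr; apply: eq_bigr => i _; rewrite !mxE; ring.
  rewrite E1 E2; move: lD l0 w0; move: (dot w (z - y0)) (dot w w) => a b; nra.
have cdot : continuous ((fun y => dot w (f y)) : M -> R^o).
  have cl := findim_continuous (findim_rV N) (L := mklin (dotP w)).
  by move=> y; apply: (@continuous_comp _ _ _ f (dot w : _ -> R^o)); [exact: cf|exact: cl].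
have : dot w x0 <= dot w y0.
  have := rint_linear cM nu (mklin (dotP w)) cf => /= ->.
  rewrite -(rint_cst nu (dot w y0)); apply: rint_le => //; first exact: cst_continuous.
  by move=> y; apply: key; apply: sub_hull; exists y.
rewrite -subr_le0 -dotB => /dot_eq0 /eqP; rewrite subr_eq0 => /eqP ->; exact: Dy0.
Qed.
End average.

Section full_support.
Context {R : realType} {r : nat} (M : charted_space 'rV[R]_r) (hM : is_manifold M).
Variables (nu : {measure set (borel M) -> \bar R}) (hnu : is_smooth_measure nu).
Let mM := is_manifold_mfld hM.

(** A small box in the chart image has positive Lebesgue measure, and there the density is bounded
    below by half its value at the centre. *)
Lemma smooth_measure_support (A : set M) : open A -> A !=set0 -> (0 < nu (A : set (borel M)))%E.
Proof.
move=> oA [y1 Ay1]; set chi := chart_at y1.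
have cchi : is_chart chi := chart_at_is mM y1; have dchi : cdom chi y1 := dom_at mM y1.
have [lam hlam dens] := hnu; have [rho [Crho rho0 Hrho]] := dens chi (smooth_chart_at hM y1).
pose O := A `&` cdom chi.
have oO : open O by apply: openI => //; case: cchi.
have mO : measurable (O : set (borel M)) := borel_open oO.
apply: (@lt_le_trans _ _ (nu (O : set (borel M)))); last first.
  by apply: le_measure; rewrite ?inE//; [exact: borel_open|move=> x []].
have Od : O `<=` cdom chi by move=> x [].
rewrite (Hrho _ mO Od).
pose X := cfwd chi @` O.
have oX : open X := open_chart_image cchi oO Od.
have mX : measurable (X : set (borel 'rV[R]_r)) := borel_open oX.
have XI x : X x -> (cfwd chi @` cdom chi) x by move=> [y [_ dy] <-]; exact: chart_img.
pose a1 := cfwd chi y1; have Xa : X a1 by exists y1.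
have c1 : {for a1, continuous (rho : _ -> R^o)} := Crho 0%N a1 (XI _ Xa).
have r0 : 0 < rho a1 by apply: rho0; exact: XI.
have n1 : \forall x \near a1, rho a1 / 2 < rho x.
  have n0 : \forall t \near (rho a1 : R^o), rho a1 / 2 < t.
    by apply: (@open_near R^o [set x : R | rho a1 / 2 < x]); [exact: open_gt|rewrite /=; lra].
  exact: c1 n0.
have n2 : \forall x \near a1, X x by apply: open_near.
have /nbhs_ballP[dl /= dl0 Hd] : \forall x \near a1, X x /\ rho a1 / 2 < rho x.
  by apply: filterS2 n2 n1 => x; split.
pose ep := dl / 2; have ep0 : 0 < ep by rewrite divr_gt0.
pose lo : 'rV[R]_r := \row_i (a1 0 i - ep); pose hi : 'rV[R]_r := \row_i (a1 0 i + ep).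
pose bx := [set x : 'rV[R]_r | forall i, lo 0 i <= x 0 i <= hi 0 i].
have bxX x : bx x -> X x /\ rho a1 / 2 < rho x.
  move=> hx; apply: Hd; rewrite -ball_normE /ball_ /=; apply: (@le_lt_trans _ _ ep); last by rewrite /ep; lra.
  apply: rV_norm_le; first exact: ltW.
  by move=> i; rewrite !mxE ler_norml; have := hx i; rewrite !mxE => /andP[h1 h2]; apply/andP; split; lra.
have lbx : lam (bx : set (borel 'rV[R]_r)) = ((2 * ep) ^+ r)%:E.
  rewrite hlam; last by move=> i; rewrite !mxE; lra.
  congr EFin; rewrite (eq_bigr (fun=> 2 * ep)); last by move=> i _; rewrite !mxE; ring.
  by rewrite prodr_const card_ord.
have mbx : measurable (bx : set (borel 'rV[R]_r)) by apply: borel_closed; exact: rbox_closed.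
have mrho : measurable_fun (X : set (borel 'rV[R]_r)) (fun y : borel 'rV[R]_r => (rho y)%:E).
  apply/measurable_EFinP; apply: continuous_on_borel => // x /XI; exact: (Crho 0%N).
have L1 : (\int[lam]_(y in (bx : set (borel 'rV[R]_r))) (rho a1 / 2)%:E <= \int[lam]_(y in (X : set (borel 'rV[R]_r))) (rho y)%:E)%E.
  apply: (@le_trans _ _ (\int[lam]_(y in (bx : set (borel 'rV[R]_r))) (rho y)%:E)%E).
    apply: ge0_le_integral => //.
    - by move=> x _; rewrite lee_fin; lra.
    - by apply: measurable_funS mrho => // x /bxX[].
    - by move=> x /bxX[_ h]; rewrite lee_fin; lra.
  apply: ge0_subset_integral => //.
  - by move=> x /XI h; rewrite lee_fin ltW// rho0.
  - by move=> x /bxX[].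
apply: (lt_le_trans _ L1); rewrite integral_cst// lbx -EFinM lte_fin.
by rewrite mulr_gt0 ?exprn_gt0 ?mulr_gt0//; lra.
Qed.
End full_support.

(** * Compatible subgroups *)

Section compatible.
Context {R : realType} {k d m : nat} (U : lie_space 'rV[R]_k) (H : lie_space 'rV[R]_(d + d))
  (c : U -> H) (hU : is_lie_group U) (hc : is_complexification c)
  (G : lie_space 'rV[R]_m) (j : G -> H) (hG : is_compatible_subgroup c j).
Let LU : lieg U := lie_group_lieg hU.
Let LH : lieg H := complexification_lieg hc.
Let mH := lie_mfld LH.
Let mU := lie_mfld LU.
Local Notation "x ** y" := (lie_mul x y) (at level 40, left associativity).

Lemma sub_lieg : lieg G. Proof. by have [[h _ _ _] _ _ _ _] := hG; exact: lie_group_lieg. Qed.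
Let LG := sub_lieg.
Let mG := lie_mfld LG.

Lemma sub_embedding : smooth_embedding j. Proof. by have [[_ _ ? _] _ _ _ _] := hG. Qed.

Lemma sub_smat g : smat j g.
Proof. by have [s _ _ _] := sub_embedding; exact: ((smooth_smatP mG mH _).1 s). Qed.

Lemma sub_inj : injective j. Proof. by have [_ ? _ _] := sub_embedding. Qed.

Lemma sub_mul x y : j (x ** y) = j x ** j y.
Proof. by have [[_ [_ h] _ _] _ _ _ _] := hG. Qed.

Lemma sub_one : j (lie_one G) = lie_one H.
Proof. by apply: (@lmul_injl _ _ _ LH (j (lie_one G))); rewrite -sub_mul (lmul1 LG) (lmulr1 LH). Qed.

Lemma sub_inv x : j (lie_inv x) = lie_inv (j x).
Proof. by apply: (@lmul_injl _ _ _ LH (j x)); rewrite -sub_mul (lmulrV LG) sub_one (lmulrV LH). Qed.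

Lemma cplx_inv x : c (lie_inv x) = lie_inv (c x).
Proof.
apply: (@lmul_injl _ _ _ LH (c x)).
by rewrite -(cplx_mul hc) (lmulrV LU) (cplx_one hU hc) (lmulrV LH).
Qed.

Lemma liealg_p_J beta : liealg_p c j beta -> exists xi, beta = Jmul (lie_diff c xi).
Proof. by move=> [_ [_ [xi _ <-] <-]]; exists xi. Qed.

Definition exp_curve (beta : 'rV[R]_(d + d)) (t : R) : H := lie_exp H (t *: beta).

Lemma exp_curve_diff xi : one_param_diff (Jmul (lie_diff c xi)) (exp_curve (Jmul (lie_diff c xi))).
Proof.
have [g Hg] := complexification_one_param hc xi.
have -> : exp_curve (Jmul (lie_diff c xi)) = g by apply/funext => t; exact: lie_expZ.
exact: one_parameter_subgroup_diff.
Qed.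

Lemma exp_curve_p beta : liealg_p c j beta -> one_param_diff beta (exp_curve beta).
Proof. by move=> /liealg_p_J[xi ->]; exact: exp_curve_diff. Qed.

Lemma lie_expN_p beta : liealg_p c j beta -> lie_exp H (- beta) = lie_inv (lie_exp H beta).
Proof.
move=> pb; have := one_paramN LH 1 (exp_curve_p pb).
by rewrite /exp_curve scale1r scaleN1r.
Qed.

(** Conjugation by [g s] fixes every point of the curve [g], hence its velocity at 0. *)
Lemma Ad_one_param beta (g : R -> H) s : one_param_diff beta g -> Ad (g s) beta = beta.
Proof.
move=> Hg; have [hg dg tg] := Hg.
have mR : mfld (euclid R^o) := euclid_mfld (@findim_Ro R).
pose F := (fun h : H => g s ** h ** lie_inv (g s)).
have sF h : smat F h.
  apply: (smat_lmul LH mH); last exact: smat_cst.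
  by apply: (smat_lmul LH mH); [exact: smat_cst|exact: smat_id].
have [_ T] := mdiff_comp mR mH dg (smat_mdiff (sF (g 0))).
have E : F \o g = g.
  apply/funext => t /=; rewrite /F -hg addrC hg -(lmulA LH) (lmulrV LH) (lmulr1 LH) //.
have := T 1; rewrite E tg (one_param0 LH Hg) => {2}->.
by rewrite /Ad.
Qed.

Lemma AdZ g (a : R) u : Ad (g : H) (a *: u) = a *: Ad g u. Proof. exact: tangentZ. Qed.

Lemma line_abelian beta : liealg_p c j beta -> abelian_subalgebra H [set x : 'rV[R]_(d + d) | exists s : R, x = s *: beta].
Proof.
move=> pb; split.
- by exists 0; rewrite scale0r.
- by move=> t _ _ [s ->] [s' ->]; exists (t * s + s'); rewrite scalerDl scalerA.
- move=> _ _ [s ->] [s' ->]; rewrite /lie_bracket.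
  have -> : (fun t : R => Ad (lie_exp H (t *: (s *: beta))) (s' *: beta)) = cst (s' *: beta).
    apply/funext => t; rewrite scalerA AdZ; congr (_ *: _).
    exact: (Ad_one_param (t * s) (exp_curve_p pb)).
  by rewrite derive1E derive_cst.
Qed.

Lemma bracket_chain (P : set (set 'rV[R]_(d + d))) (a0 : set 'rV[R]_(d + d)) :
  abelian_subalgebra H a0 -> total_on P subset ->
  (forall X, P X -> abelian_subalgebra H (a0 `|` X)) ->
  abelian_subalgebra H (a0 `|` \bigcup_(X in P) X).
Proof.
move=> ab0 tot ab; have [a00 aZ aB] := ab0.
have two xi eta : (a0 `|` \bigcup_(X in P) X) xi -> (a0 `|` \bigcup_(X in P) X) eta ->
    (a0 xi /\ a0 eta) \/ exists2 X, P X & (a0 `|` X) xi /\ (a0 `|` X) eta.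
  move=> [x0|[X PX Xx]] [y0|[Y PY Yy]]; first by left.
  - by right; exists Y => //; split; [left|right].
  - by right; exists X => //; split; [right|left].
  - have [XY|YX] := tot X Y PX PY; right.
      by exists Y => //; split; right => //; exact: XY.
    by exists X => //; split; right => //; exact: YX.
split; first by left.
- move=> t xi eta hx hy; have [[x0 y0]|[X PX [Xx Xy]]] := two xi eta hx hy; first by left; exact: aZ.
  have [_ XZ _] := ab X PX; have [h|h] := XZ t xi eta Xx Xy; first by left.
  by right; exists X.
- move=> xi eta hx hy; have [[x0 y0]|[X PX [Xx Xy]]] := two xi eta hx hy; first exact: aB.
  by have [_ _ XB] := ab X PX; exact: XB.
Qed.

(** This brings the hypothesis on maximal Abelian subalgebras to bear on every element of [p].
    Zorn's lemma is applied to the sets that become Abelian subalgebras of [p] once the line through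
    [beta] is adjoined, which makes the empty chain harmless. *)
Lemma maximal_abelian_exists beta : liealg_p c j beta ->
  exists2 a, maximal_abelian_in_p c j a & a beta.
Proof.
move=> pb; pose a0 := [set x : 'rV[R]_(d + d) | exists s : R, x = s *: beta].
have ab0 : abelian_subalgebra H a0 := line_abelian pb.
pose P (X : set 'rV[R]_(d + d)) := abelian_subalgebra H (a0 `|` X) /\ a0 `|` X `<=` liealg_p c j.
have p0 : a0 `<=` liealg_p c j.
  move=> _ [s ->]; have [[v _ Ev] [_ [u _ <-] Eu]] := pb.
  split; first by exists (s *: v) => //; rewrite /lie_diff tangentZ -Ev.
  exists (s *: lie_diff c u); first by exists (s *: u) => //; rewrite /lie_diff tangentZ.
  by have := @Jmul_is_linear R d s (lie_diff c u) 0; rewrite Jmul0 !addr0 Eu.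
have [F FP tot|A [[abA pA] maxA]] := @Zorn_bigcup 'rV[R]_(d + d) P.
  split; first by apply: bracket_chain => // X /FP[].
  by move=> x [/p0//|[X FX Xx]]; have [_] := FP X FX; apply; right.
exists (a0 `|` A); last by left; exists 1; rewrite scale1r.
split => // b abb pb' sub.
have E : a0 `|` b = b by apply/setUidPr => x a0x; apply: sub; left.
have Pb : P b by rewrite /P E.
have Ab : A `<=` b by move=> x Ax; apply: sub; right.
have bA : b `<=` A.
  by apply: contrapT => nbA; apply: (maxA b) => //; split.
by apply/seteqP; split => // x /bA; right.
Qed.

(** [p] is the intersection of two row spaces, those of the differential of [j] and of [J] times the
    differential of [c]; [Pm] is a row base of it and [Qm] a right inverse of [Pm]. *)
Lemma liealg_p_basis : exists (e : nat) (Pm : 'M[R]_(e, d + d)) (Qm : 'M[R]_(d + d, e)),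
  Pm *m Qm = 1%:M /\ liealg_p c j = in_plane Pm Qm.
Proof.
have lJ : linear (fun u => Jmul (lie_diff c u)).
  move=> a u v; rewrite -Jmul_is_linear; congr Jmul; exact: tangent_linear.
pose A1 := lin1_mx (mklin (@tangent_linear _ _ _ _ _ j (lie_one G))).
pose A2 := lin1_mx (mklin lJ).
pose Pm := row_base (A1 :&: A2)%MS.
exists (\rank (A1 :&: A2)%MS), Pm, (pinvmx Pm).
split; first by rewrite mulmxVp// row_base_free.
apply/seteqP; split => beta.
  move=> [[v _ Ev] [_ [u _ <-] Eu]]; rewrite /in_plane /= mulmxKpV// /Pm eq_row_base sub_capmx.
  apply/andP; split; apply/submxP.
    by exists v; rewrite mul_rV_lin1 -Ev.
  by exists u; rewrite mul_rV_lin1 -Eu.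
rewrite /in_plane /= => <-; set x := beta *m pinvmx Pm.
have : (x *m Pm <= A1 :&: A2)%MS by rewrite (submx_trans (submxMl _ _))// /Pm eq_row_base.
rewrite sub_capmx => /andP[/submxP[v Ev] /submxP[u Eu]]; split.
  by exists v => //; rewrite Ev mul_rV_lin1.
by exists (lie_diff c u); [exists u|rewrite Eu mul_rV_lin1].
Qed.
End compatible.

Section polar.
Context {R : realType} {k d m e : nat} (U : lie_space 'rV[R]_k) (H : lie_space 'rV[R]_(d + d))
  (c : U -> H) (hU : is_lie_group U) (hc : is_complexification c)
  (G : lie_space 'rV[R]_m) (j : G -> H) (hG : is_compatible_subgroup c j).
Variables (Pm : 'M[R]_(e, d + d)) (Qm : 'M[R]_(d + d, e)).
Hypotheses (PQ : Pm *m Qm = 1%:M) (pE : liealg_p c j = in_plane Pm Qm).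
Let LU : lieg U := lie_group_lieg hU.
Let LH : lieg H := complexification_lieg hc.
Let mH := lie_mfld LH.
Let mU := lie_mfld LU.
Let LG := sub_lieg hG.
Let mG := lie_mfld LG.
Let mE : mfld (euclid 'rV[R]_e) := euclid_mfld (findim_rV e).
Local Notation "x ** y" := (lie_mul x y) (at level 40, left associativity).

Lemma plane_p a : liealg_p c j (a *m Pm).
Proof. by rewrite pE; exact: in_plane_mul. Qed.

Lemma opp_p beta : liealg_p c j beta -> liealg_p c j (- beta).
Proof. by rewrite pE -scaleN1r; exact: in_planeZ. Qed.

Definition exp_p (a : 'rV[R]_e) : H := lie_exp H (a *m Pm).

Let lJ : linear (fun u => Jmul (lie_diff c u)).
Proof. by move=> a u v; rewrite -Jmul_is_linear; congr Jmul; exact: tangent_linear. Qed.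

Let Theta : prod_space U (euclid 'rV[R]_k) -> H :=
  fun p => c p.1 ** lie_exp H (Jmul (lie_diff c p.2)).
Let mUk : mfld (prod_space U (euclid 'rV[R]_k)) := prod_mfld mU (euclid_mfld (findim_rV k)).

(** On [p] the exponential is the Cartan decomposition at the identity of [U], preceded by a linear
    preimage under [J] times the differential of [c]; so its smoothness is part of the Cartan
    decomposition. *)
Lemma exp_p_smat a : smat (exp_p : euclid 'rV[R]_e -> H) a.
Proof.
pose A2 := lin1_mx (mklin lJ).
have A2E u : u *m A2 = Jmul (lie_diff c u) by rewrite mul_rV_lin1.
pose L : {linear 'rV[R]_e -> 'rV[R]_k} := mulmxr (Pm *m pinvmx A2).
have LE x : Jmul (lie_diff c (L x)) = x *m Pm.
  rewrite -A2E /= mulmxA mulmxKpV//; apply/submxP.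
  by have [u Eu] := liealg_p_J (plane_p x); exists u; rewrite A2E.
have -> : exp_p = Theta \o (fun x => (lie_one U, L x)).
  by apply/funext => x; rewrite /Theta /= LE (cplx_one hU hc) (lmul1 LH).
have [_ _ _ [sT _]] := hc.
apply: (smat_comp mE mUk (f := (fun x => (lie_one U, L x)) : euclid 'rV[R]_e -> prod_space U (euclid 'rV[R]_k))).
  apply: smat_pair; first exact: smat_cst.
  apply/(smat_euclidP _ _ (findim_rV e) (findim_rV k)).
  by apply: Coo_at_linear; exact: findim_continuous (findim_rV e).
exact: ((smooth_smatP mUk mH _).1 sT).
Qed.

Lemma exp_p0 : exp_p 0 = lie_one H.
Proof. by rewrite /exp_p mul0mx lie_exp0. Qed.

Lemma exp_p_lift : exists E : 'rV[R]_e -> G, (forall a, j (E a) = exp_p a) /\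
  forall a, smat (E : euclid 'rV[R]_e -> G) a.
Proof.
have [_ _ _ rg _] := hG.
have /choice[E HE] : forall a, exists g, j g = exp_p a.
  by move=> a; have [g _ Eg] := rg _ (plane_p a); exists g.
exists E; split => // a; apply: (smat_lift mG mH (sub_embedding hG) mE).
have -> : j \o E = exp_p by apply/funext => x; exact: HE.
exact: exp_p_smat.
Qed.

Lemma grp_K_inv x : grp_K c j x -> grp_K c j (lie_inv x).
Proof.
move=> [u _ Eu]; exists (lie_inv u) => //.
by rewrite (cplx_inv hU hc) Eu (sub_inv hc hG).
Qed.

(** The decomposition has its exponential factor on the right. Applied to the inverse of [g] it puts
    that factor on the left, with opposite sign, so that the coordinate is constant on the cosets
    [g K]; it is smooth because the inverse of the Cartan decomposition is. *)
Lemma polar_coordinate : exists b : G -> 'rV[R]_e,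
  [/\ forall g, smat (b : G -> euclid 'rV[R]_e) g,
      forall g x, grp_K c j x -> b (g ** x) = b g,
      forall a g, j g = exp_p a -> b g = a &
      forall g, exists2 x, grp_K c j x & j g = exp_p (b g) ** j x].
Proof.
have [_ _ _ [sT [Ti [sTi TK KT]]]] := hc; have [_ _ _ _ dec] := hG.
pose b g := (- Jmul (lie_diff c (Ti (j (lie_inv g))).2)) *m Qm.
have bE g u eta : j (lie_inv g) = c u ** lie_exp H (Jmul (lie_diff c eta)) ->
    b g = (- Jmul (lie_diff c eta)) *m Qm.
  by move=> E; rewrite /b E -[_ ** _]/(Theta (u, eta)) TK.
have jinv g x beta : j (lie_inv g) = j x ** lie_exp H beta -> liealg_p c j beta ->
    j g = lie_exp H (- beta) ** j (lie_inv x).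
  move=> E pb; rewrite (lie_expN_p hc pb) (sub_inv hc hG) -(linvM LH) -E.
  by rewrite (sub_inv hc hG) (linvK LH).
exists b; split.
- move=> g.
  have lin : linear (fun eta => (- Jmul (lie_diff c eta)) *m Qm).
    by move=> a x y; rewrite lJ opprD mulmxDl -scalerN -scalemxAl.
  have s1 : smat (fun g => Ti (j (lie_inv g))) g.
    have s0 : smat (fun g => j (lie_inv g)) g.
      apply: (smat_comp mG mG (f := @lie_inv _ _ G) (g := j)); last exact: (sub_smat hc hG).
      exact: (smat_linv LG mG (smat_id mG g)).
    exact: (smat_comp mG mH s0 ((smooth_smatP mH mUk _).1 sTi _)).
  have s2 := smat_comp mG mUk s1 (smat_snd (euclid_mfld (findim_rV k)) _).
  have s3 y : smat (mklin lin : euclid 'rV[R]_k -> euclid 'rV[R]_e) y.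
    apply/(smat_euclidP _ _ (findim_rV k) (findim_rV e)).
    by apply: Coo_at_linear; exact: findim_continuous (findim_rV k).
  exact: (smat_comp mG (euclid_mfld (findim_rV k)) s2 (s3 _)).
- move=> g x [ux _ Eux]; have [x' [u _ Eu] [beta pb Eg]] := dec (lie_inv g).
  have [eta Eb] := liealg_p_J pb; rewrite Eb -Eu in Eg.
  rewrite (bE g _ _ Eg) (bE _ (lie_inv ux ** u) eta)//.
  rewrite (linvM LG) (sub_mul hG) Eg (cplx_mul hc) (cplx_inv hU hc) Eux (sub_inv hc hG).
  by rewrite (lmulA LH).
- move=> a g Eg; have [eta Eb] := liealg_p_J (opp_p (plane_p a)).
  rewrite (bE g (lie_one U) eta).
    by rewrite -Eb opprK -mulmxA PQ mulmx1.
  by rewrite (sub_inv hc hG) Eg /exp_p -(lie_expN_p hc (plane_p a)) Eb (cplx_one hU hc) (lmul1 LH).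
- move=> g; have [x [u _ Eu] [beta pb Eg]] := dec (lie_inv g).
  exists (lie_inv x); first by apply: grp_K_inv; exists u.
  rewrite (jinv _ _ _ Eg pb); congr (_ ** _).
  have [eta Eb] := liealg_p_J pb.
  rewrite /exp_p (bE g u eta); last by rewrite -Eb Eu.
  rewrite -Eb; congr lie_exp.
  by have := opp_p pb; rewrite pE /in_plane /= => ->.
Qed.
End polar.

(** * The gradient map along an orbit of measures *)

Section heights.
Context {R : realType} {n k d m r e : nat}.
Variables (Z : charted_space 'rV[R]_(n + n)) (omega : Z -> {biscalar 'rV[R]_(n + n)})
  (U : lie_space 'rV[R]_k) (H : lie_space 'rV[R]_(d + d)) (c : U -> H) (act : H -> Z -> Z)
  (G : lie_space 'rV[R]_m) (j : G -> H) (s B : {biscalar 'rV[R]_(d + d)})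
  (mu mup : Z -> 'rV[R]_(d + d)).
Hypotheses (hZ : is_complex_manifold Z) (cZ : compact [set: Z]) (homega : is_kaehler_form omega)
  (hU : is_lie_group U) (cU : compact [set: U]) (hc : is_complexification c)
  (hact : is_holomorphic_action act) (hs : Ad_invariant_scalar_product c s)
  (smu : smooth (mu : Z -> euclid 'rV[R]_(d + d))) (hB : is_invariant_form c B)
  (hG : is_compatible_subgroup c j) (hmup : is_gradient_map c j s mu mup)
  (hgrad : gradient_normalization omega c act j B mup).
Variables (Pm : 'M[R]_(e, d + d)) (Qm : 'M[R]_(d + d, e)).
Hypotheses (PQ : Pm *m Qm = 1%:M) (pE : liealg_p c j = in_plane Pm Qm).
Let mZ := cx_mfld hZ.
Let LH : lieg H := complexification_lieg hc.
Let LG := sub_lieg hG.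
Let mG := lie_mfld LG.
Let N := (d + d)%N.
Let act1 := holo_act1 hact.
Let actA := holo_actM hact.
Let sact := holo_act_smat hZ hc hact.
Local Notation p := (liealg_p c j).

Lemma fundamental_orbit beta z : p beta -> fundamental_field act beta z = orbit_field act beta z.
Proof.
move=> pb; have [_ E] := orbit_curve LH mZ actA sact (exp_curve_p hc pb) z 0.
by rewrite (one_param0 LH (exp_curve_p hc pb)) act1 in E.
Qed.

Lemma Jmul_p_u beta : p beta -> liealg_u c (Jmul beta).
Proof. by move=> /liealg_p_J[u ->]; rewrite JmulK; exists (- u) => //; rewrite /lie_diff tangentN. Qed.

(** [mup] is specified pointwise, by scalar products with [J p]. Positivity of [s] on the Lie
    algebra of [U] makes these equations uniquely solvable, by a matrix independent of [z];
    smoothness of [mup] follows from that of [mu]. *)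
Lemma gradient_map_linear : exists L : {linear 'rV[R]_(d + d) -> 'rV[R]_(d + d)}, forall z, mup z = L (mu z).
Proof.
have [sC spos _] := hs.
have lT : linear (fun w => \row_i s w (Jmul (row i Pm)) : 'rV[R]_e).
  by move=> a u v; apply/rowP => i; rewrite !mxE linearPl.
have lT' : linear (fun a => (\row_i s (Jmul (a *m Pm)) (Jmul (row i Pm)) : 'rV[R]_e)).
  by move=> a u v; rewrite mulmxDl -scalemxAl Jmul_is_linear; apply/rowP => i; rewrite !mxE linearPl.
have inj : injective (mklin lT').
  apply: raddf_inj => a /= Ta; have pa : p (a *m Pm) := plane_p PQ pE a.
  have E0 : s (Jmul (a *m Pm)) (Jmul (a *m Pm)) = 0.
    have lr w0 : linear (fun w => s w0 (Jmul w) : R^o).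
      by move=> t u v; rewrite Jmul_is_linear linearPr.
    have van w0 : (forall i, s w0 (Jmul (row i Pm)) = 0) -> s w0 (Jmul (a *m Pm)) = 0.
      move=> h; rewrite -[LHS]/(mklin (lr w0) (a *m Pm)) mulmx_sum_row linear_sum big1// => i _.
      by rewrite linearZ /= h scaler0.
    by apply: van => i; have := congr1 (fun v : 'rV[R]_e => v 0 i) Ta; rewrite !mxE.
  have J0 : Jmul (a *m Pm) = 0.
    by apply/eqP; apply: contraT => /(spos _ (Jmul_p_u pa)); rewrite E0 ltxx.
  have P0 : a *m Pm = 0 by apply/eqP; rewrite -oppr_eq0 -JmulK J0 Jmul0.
  by rewrite -[a]mulmx1 -PQ mulmxA P0 mul0mx.
have [Qi HQ] := linear_left_inverse inj.
have lL : linear (fun w => (mklin lT w) *m Qi *m Pm).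
  by move=> a u v; rewrite linearP !mulmxDl -!scalemxAl.
exists (mklin lL) => z /=; have [pz hz] := hmup z.
have -> : (\row_i s (mu z) (Jmul (row i Pm))) = mklin lT' (mup z *m Qm).
  apply/rowP => i; rewrite !mxE.
  have -> : mup z *m Qm *m Pm = mup z by move: pz; rewrite pE.
  apply/eqP; rewrite -subr_eq0 -linearBl; apply/eqP; apply: hz.
  by rewrite rowE; exact: (plane_p PQ pE).
by rewrite HQ; move: pz; rewrite pE => ->.
Qed.

Lemma mup_p z : p (mup z). Proof. by have [] := hmup z. Qed.

Lemma mup_smat z : smat (mup : Z -> euclid 'rV[R]_(d + d)) z.
Proof.
have [L HL] := gradient_map_linear.
have -> : mup = L \o mu by apply/funext => y; exact: HL.
have mN : mfld (euclid 'rV[R]_(d + d)) := euclid_mfld (findim_rV _).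
have s1 : smat (mu : Z -> euclid 'rV[R]_(d + d)) z := (smooth_smatP mZ mN _).1 smu z.
apply: (smat_comp mZ mN s1); apply/(smat_euclidP _ _ (findim_rV _) (findim_rV _)).
by apply: Coo_at_linear; exact: findim_continuous (findim_rV _).
Qed.

Definition height (beta : 'rV[R]_(d + d)) (z : Z) : R := B (mup z) beta.
Definition speed (beta : 'rV[R]_(d + d)) (z : Z) : R :=
  kaehler_metric omega z (orbit_field act beta z) (orbit_field act beta z).
Definition grad_flow (beta : 'rV[R]_(d + d)) : R -> Z -> Z := flow act (exp_curve H beta).

Lemma heightP (beta : 'rV[R]_(d + d)) : linear (fun x => B x beta : R^o).
Proof. by move=> a x y; rewrite linearPl. Qed.

Lemma height_smat beta z : smat (height beta : Z -> euclid R^o) z.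
Proof.
have mN : mfld (euclid 'rV[R]_(d + d)) := euclid_mfld (findim_rV _).
apply: (smat_comp mZ mN (mup_smat z) (g := (fun x => B x beta : R^o) : euclid 'rV[R]_(d + d) -> euclid R^o)).
apply/(smat_euclidP _ _ (findim_rV _) findim_Ro).
by apply: (Coo_at_linear (L := mklin (heightP beta))); exact: findim_continuous (findim_rV _).
Qed.

Lemma height_diff beta z v : p beta ->
  tangent_map (height beta : Z -> euclid R^o) z v = kaehler_metric omega z (orbit_field act beta z) v.
Proof. by move=> pb; rewrite -(fundamental_orbit z pb); exact: hgrad. Qed.

Lemma speed_ge0 beta z : p beta -> 0 <= speed beta z.
Proof. by move=> /liealg_p_J[xi ->]; exact: (energy_ge0 c act homega). Qed.

Lemma speed_gt0 beta z : p beta -> orbit_field act beta z != 0 -> 0 < speed beta z.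
Proof. by move=> /liealg_p_J[xi ->]; exact: (energy_gt0 homega). Qed.

Lemma grad_flow0 beta z : p beta -> grad_flow beta 0 z = z.
Proof. by move=> pb; have Hg := exp_curve_p hc pb; rewrite /grad_flow /flow (one_param0 LH Hg). Qed.

Lemma height_derive beta z (t : R) : p beta ->
  is_derive t 1 (fun u => height beta (grad_flow beta u z)) (speed beta (grad_flow beta t z)).
Proof.
move=> pb; have df z' v := height_diff z' v pb; have Hg := exp_curve_p hc pb.
have [xi Exi] := liealg_p_J pb; rewrite Exi in df Hg *.
exact: (flow_derive hZ hc hact (height_smat _) df Hg).
Qed.

Lemma height_mono beta z (t t' : R) : p beta -> t <= t' ->
  height beta (grad_flow beta t z) <= height beta (grad_flow beta t' z).
Proof.
move=> pb; have df z' v := height_diff z' v pb; have Hg := exp_curve_p hc pb.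
have [xi Exi] := liealg_p_J pb; rewrite Exi in df Hg *.
exact: (flow_mono hZ homega hc hact (height_smat _) df Hg).
Qed.

Lemma grad_flow_fixed beta z (t : R) : p beta -> orbit_field act beta z = 0 -> grad_flow beta t z = z.
Proof. by move=> pb h; exact: (fixed_of_field0 LH mZ act1 actA sact (exp_curve_p hc pb) h). Qed.

(** By the mean value theorem the increase is the speed at some intermediate time. It is positive,
    since an orbit through a zero of the field is constant. *)
Lemma height_strict beta z : p beta -> orbit_field act beta z != 0 ->
  height beta z < height beta (grad_flow beta 1 z).
Proof.
move=> pb v0; pose h u := height beta (grad_flow beta u z).
have D (t : R) : is_derive t 1 h (speed beta (grad_flow beta t z)) := height_derive z t pb.
have ch : {within `[0, 1], continuous (h : R -> R)}.
  apply: derivable_within_continuous => t _; by have := D t.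
have [t _ E] := @MVT R h (fun t => speed beta (grad_flow beta t z)) 0 1 ltr01 (fun t _ => D t) ch.
have : 0 < speed beta (grad_flow beta t z).
  apply: (speed_gt0 pb); apply/eqP => f0; move/eqP: v0; apply.
  have F := grad_flow_fixed (- t) pb f0.
  have [hg _ _] := exp_curve_p hc pb.
  have zt : grad_flow beta t z = z.
    rewrite -[LHS]F /grad_flow /flow -actA -hg addNr; exact: (grad_flow0 z pb).
  by rewrite -{1}zt.
have h0 : h 0 = height beta z by rewrite /h grad_flow0.
by move: E; rewrite subr0 mulr1 h0 => <-; rewrite subr_gt0.
Qed.

Lemma height_bounded beta : exists fB, forall z, height beta z <= fB.
Proof.
have [K _ HK] := continuous_bounded cZ (fun z => (height_smat beta z).1).
by exists K => z; rewrite (le_trans (ler_norm _)).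
Qed.

Section submanifold.
Variables (M : charted_space 'rV[R]_r) (iota : M -> Z) (actM : G -> M -> M).
Hypotheses (hM : is_manifold M) (cM : compact [set: M]) (hiota : smooth_embedding iota)
  (hactM : forall g x, iota (actM g x) = act (j g) (iota x)).
Hypothesis hmax : forall a, maximal_abelian_in_p c j a -> forall beta, a beta ->
  unique_local_max (fun x : M => B (mup (iota x)) beta).
Variables (nu : probability (borel M) R).
Hypothesis hnu : is_smooth_measure nu.
Local Notation hull := (convex_hull (range (mup \o iota))).
Local Notation Om := (relative_interior (in_plane Pm Qm) hull).
Hypothesis Om0 : Om 0.
Let mM := is_manifold_mfld hM.

Lemma iota_smat y : smat iota y. Proof. exact: embedding_smat. Qed.

Lemma height_iota_continuous beta : continuous ((fun y => height beta (iota y)) : M -> R^o).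
Proof.
move=> y; have [ci _] := iota_smat y; have [ch _] := height_smat beta (iota y).
exact: (@continuous_comp _ _ _ iota (height beta : Z -> R^o)).
Qed.

Lemma height_max beta : exists y0, forall y, height beta (iota y) <= height beta (iota y0).
Proof.
have ne : [set: M] !=set0 by exists point.
have [y0 _ Hy] := compact_EVT_max ne cM (continuous_subspaceT (@height_iota_continuous beta)).
by exists y0 => y; apply: Hy; rewrite inE.
Qed.

Lemma flow_lift beta : p beta -> exists flowM : R -> M -> M,
  forall t y, iota (flowM t y) = grad_flow beta t (iota y).
Proof.
move=> pb; have [_ _ _ rg _] := hG.
have /choice[g Hg] : forall t : R, exists g, j g = exp_curve H beta t.
  move=> t; have pt : p (t *: beta) by move: pb; rewrite pE; exact: in_planeZ.
  by have [g _ Eg] := rg _ pt; exists g.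
by exists (fun t => actM (g t)) => t y; rewrite hactM Hg.
Qed.

Lemma limit_null beta mx : p beta -> (exists y, height beta (iota y) = mx) ->
  nu.-negligible ([set y | exists2 eps : R, 0 < eps & forall t : R,
    height beta (grad_flow beta t (iota y)) <= mx - eps] : set (borel M)).
Proof.
move=> pb mxP; have df z' v := height_diff z' v pb; have Hg := exp_curve_p hc pb.
have [fB f_le] := height_bounded beta; have [flowM HflowM] := flow_lift pb.
have [a maxa ab] := maximal_abelian_exists hc pb.
have um := hmax maxa ab.
rewrite /grad_flow in HflowM *.
have [xi Exi] := liealg_p_J pb; rewrite Exi in df Hg um mxP HflowM f_le *.
exact: (below_max_null hZ homega hU cU hc hact (height_smat _) df Hg f_le hM cM hiota HflowM hnu um mxP).
Qed.

Lemma hull_p : hull `<=` in_plane Pm Qm.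
Proof.
apply: hull_min => [x y l px py _ _|_ [y _ <-] /=]; first by apply: in_planeD; exact: in_planeZ.
by have := mup_p (iota y); rewrite pE.
Qed.

Lemma hull_le beta mx : (forall y, height beta (iota y) <= mx) -> hull `<=` [set x | B x beta <= mx].
Proof.
move=> h; apply: hull_min; last by move=> _ [y _ <-] /=; exact: h.
exact: (@linear_halfspace R _ (fun x => B x beta) mx (heightP beta)).
Qed.

Lemma form_gt0 beta : p beta -> beta != 0 -> 0 < B beta beta.
Proof.
move=> pb b0; have [_ _ _ pos _] := hB.
have [xi Exi] := liealg_p_J pb.
have [|_] := pos (lie_diff c xi) (ex_intro2 _ _ xi I erefl) _.
  by apply: contraNneq b0 => d0; rewrite Exi d0 Jmul0.
by rewrite -Exi.
Qed.

(** A small move in the direction [beta] stays in the hull and raises the value, because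
    [B beta beta] is positive. *)
Lemma Om_below beta mx y : p beta -> beta != 0 -> (forall y, height beta (iota y) <= mx) ->
  Om y -> B y beta < mx.
Proof.
move=> pb b0 h [py ny].
have /nbhs_ballP[dl /= dl0 Hd] := ny.
have nb : 0 < `|beta| by rewrite normr_gt0.
pose t := dl / 2 / `|beta|; have t0 : 0 < t by rewrite !divr_gt0.
have hy : hull (y + t *: beta).
  apply: Hd; last by apply: in_planeD => //; apply: in_planeZ; rewrite -pE.
  rewrite -ball_normE /ball_ /= opprD addrA subrr add0r normrN normrZ gtr0_norm//.
  by rewrite /t divfK ?gt_eqF//; lra.
have := hull_le h hy; rewrite /= linearDl /= linearZl_LR /=.
by have := mulr_gt0 t0 (form_gt0 pb b0); lra.
Qed.

(* If the flow fixed all of [M], the set of points below the maximum would be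
   null by [limit_null], hence empty, and 0 would not be interior to the hull. *)
Lemma moving_point beta : p beta -> beta != 0 -> exists y, orbit_field act beta (iota y) != 0.
Proof.
move=> pb b0; apply: contrapT => H0.
have fixed t y : grad_flow beta t (iota y) = iota y.
  apply: grad_flow_fixed => //; apply/eqP; apply: contraT => h.
  by case: H0; exists y.
have [y0 Hy0] := height_max beta; set mx := height beta (iota y0) in Hy0.
have m0 : 0 < mx by have := Om_below pb b0 Hy0 Om0; rewrite linear0l.
have [y1 Hy1] : exists y1, height beta (iota y1) < mx.
  apply: contrapT => h.
  have pN : p (- beta) := opp_p pE pb.
  have hN y : height (- beta) (iota y) <= - mx.
    rewrite /height linearNr lerN2 leNgt; apply/negP => lt; apply: h; exists y; exact: lt.
  have := Om_below pN _ hN Om0; rewrite oppr_eq0 linear0l => /(_ b0); lra.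
have [X [mX X0 sX]] := limit_null pb (ex_intro _ y0 erefl).
pose A := [set y | height beta (iota y) < mx].
have oA : open A.
  apply: (@open_comp _ _ (fun y => height beta (iota y) : R^o) [set t : R | t < mx]); last exact: open_lt.
  by move=> y _; exact: height_iota_continuous.
have AX : A `<=` X.
  move=> y Ay; apply: sX; exists (mx - height beta (iota y)); first by rewrite subr_gt0.
  by move=> t; rewrite fixed; lra.
have := smooth_measure_support hM hnu oA (ex_intro _ y1 Hy1).
have : (nu (A : set (borel M)) <= nu X)%E by apply: le_measure; rewrite ?inE//; exact: borel_open.
by rewrite X0 => /le_lt_trans h /h; rewrite ltxx.
Qed.

Lemma actM_smat g y : smat (actM g) y.
Proof.
apply: (smat_lift mM mZ hiota mM).
have -> : iota \o actM g = act (j g) \o iota by apply/funext => x; exact: hactM.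
exact: (smat_comp mM mZ (iota_smat y) (smat_act_pt LH mZ sact (j g) (iota y))).
Qed.

Lemma iota_inj : injective iota. Proof. by have [] := hiota. Qed.

Lemma actM_mul g h y : actM (lie_mul g h) y = actM g (actM h y).
Proof. by apply: iota_inj; rewrite !hactM (sub_mul hG) actA. Qed.

Lemma actM_one y : actM (lie_one G) y = y.
Proof. by apply: iota_inj; rewrite hactM (sub_one hc hG) act1. Qed.

Lemma mup_iota_continuous : continuous (mup \o iota).
Proof.
move=> y; have [ci _] := iota_smat y; have [cm _] := mup_smat (iota y).
exact: (@continuous_comp _ _ _ iota mup).
Qed.

Lemma mup_actM_continuous g : continuous (fun y => mup (iota (actM g y))).
Proof.
move=> y; have [ca _] := actM_smat g y.
exact: (@continuous_comp _ _ _ (actM g) (mup \o iota) _ ca (@mup_iota_continuous _)).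
Qed.

Local Notation F := (orbit_gradient_map actM (mup \o iota) nu).

Lemma push_integral (f : M -> R) g : continuous (f : M -> R^o) ->
  (\int[push (actM g) nu]_(x in [set: borel M]) (f x)%:E =
   \int[nu]_(x in [set: borel M]) (f (actM g x))%:E)%E.
Proof.
move=> cf; have ca : continuous (actM g) by move=> y; have [] := actM_smat g y.
have ma : measurable_fun [set: borel M] (actM g : borel M -> borel M) := continuous_borel ca.
have cfa : continuous ((fun y => f (actM g y)) : M -> R^o).
  by move=> y; apply: (@continuous_comp _ _ _ (actM g) (f : M -> R^o)); [exact: ca|exact: cf].
rewrite /push integral_pushforward ?preimage_setT//.
- by apply/measurable_EFinP; apply: continuous_on_borel => [|x _]; [exact: openT|exact: cf].
- exact: continuous_integrable.
Qed.

Lemma orbit_gradientE g : F g = vec_integral nu (fun y => mup (iota (actM g y))).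
Proof.
apply/rowP => i; rewrite vintE /orbit_gradient_map /vec_integral mxE /rint.
rewrite (@push_integral (fun x => mup (iota x) 0 i) g)//.
exact: coord_continuous_fun mup_iota_continuous.
Qed.

Hypothesis hnuK : forall g, grp_K c j g -> forall A : set (borel M), measurable A ->
  push (actM g) nu A = nu A.

(** The element [x] is moved from the integrand to the measure, where invariance removes it. *)
Lemma orbit_gradientK g x : grp_K c j x -> F (lie_mul g x) = F g.
Proof.
move=> Kx; rewrite !orbit_gradientE; apply/rowP => i; rewrite !vintE /rint.
have ci : continuous ((fun y => mup (iota (actM g y)) 0 i) : M -> R^o) := coord_continuous_fun (@mup_actM_continuous g).
have ca : continuous (actM x) by move=> y; have [] := actM_smat x y.
have ma : measurable_fun [set: borel M] (actM x : borel M -> borel M) := continuous_borel ca.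
under eq_integral do rewrite actM_mul.
rewrite -(push_integral x ci) /push; congr fine.
by apply: eq_measure_integral => A mA _; exact: hnuK.
Qed.

Variables (b : G -> 'rV[R]_e) (E : 'rV[R]_e -> G).
Hypotheses (bs : forall g, smat (b : G -> euclid 'rV[R]_e) g)
  (bE : forall a g, j g = exp_p H Pm a -> b g = a)
  (bdec : forall g, exists2 x, grp_K c j x & j g = lie_mul (exp_p H Pm (b g)) (j x))
  (jE : forall a, j (E a) = exp_p H Pm a) (sE : forall a, smat (E : euclid 'rV[R]_e -> G) a).
Let mE : mfld (euclid 'rV[R]_e) := euclid_mfld (findim_rV e).
Let mEM : mfld (prod_space (euclid 'rV[R]_e) M) := prod_mfld mE mM.
Let mN : mfld (euclid 'rV[R]_(d + d)) := euclid_mfld (findim_rV _).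

Lemma polar_decomposition g : exists2 x, grp_K c j x & g = lie_mul (E (b g)) x.
Proof.
have [x Kx Eg] := bdec g; exists x => //.
by apply: (sub_inj hG); rewrite (sub_mul hG) jE.
Qed.

Definition polar_gradient (a : 'rV[R]_e) := F (E a).

Lemma polar_gradientE g : F g = polar_gradient (b g).
Proof.
by have [x Kx Eg] := polar_decomposition g; rewrite {1}Eg orbit_gradientK.
Qed.

(** The element [h] serves to differentiate away from 0: with [h = E a] the parameter acts by left
    translation from the orbit point [a], and the derivative is still taken at parameter 0. *)
Definition orbit_param (h : G) (q : prod_space (euclid 'rV[R]_e) M) : 'rV[R]_(d + d) :=
  mup (act (exp_p H Pm q.1) (act (j h) (iota q.2))).

Lemma orbit_param_smat h q : smat (orbit_param h : prod_space (euclid 'rV[R]_e) M -> euclid 'rV[R]_(d + d)) q.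
Proof.
have s1 : smat (fun q : prod_space (euclid 'rV[R]_e) M => exp_p H Pm q.1) q.
  exact: (smat_comp mEM mE (smat_fst mE q) (exp_p_smat hU hc PQ pE q.1)).
have s2 : smat (fun q : prod_space (euclid 'rV[R]_e) M => act (j h) (iota q.2)) q.
  apply: (smat_comp mEM mM (smat_snd mM q) (g := fun y => act (j h) (iota y))).
  exact: (smat_comp mM mZ (iota_smat q.2) (smat_act_pt LH mZ sact (j h) (iota q.2))).
have s3 := smat_act LH mZ sact mEM s1 s2.
exact: (smat_comp mEM mZ s3 (mup_smat _)).
Qed.

Lemma pint_orbit_param h a : pint nu (orbit_param h) a = F (lie_mul (E a) h).
Proof.
rewrite orbit_gradientE; congr vec_integral; apply/funext => y.
by rewrite /orbit_param /= hactM (sub_mul hG) jE actA.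
Qed.

Lemma polar_gradient_Coo a : Coo_at polar_gradient a.
Proof.
have -> : polar_gradient = pint nu (orbit_param (lie_one G)).
  by apply/funext => x; rewrite pint_orbit_param (lmulr1 LG).
exact: (pint_Coo mM cM nu a (orbit_param_smat (lie_one G))).
Qed.

Lemma polar_gradient_p a : in_plane Pm Qm (polar_gradient a).
Proof.
rewrite /polar_gradient orbit_gradientE /in_plane /=.
have := vint_linear cM nu (mulmxr (Qm *m Pm)) (mup_actM_continuous (g := E a)).
rewrite /= mulmxA => ->; congr vec_integral; apply/funext => y.
by rewrite mulmxA; have := mup_p (iota (actM (E a) y)); rewrite pE.
Qed.

Lemma iota_flow v (t : R) y : iota (actM (E (t *: v)) y) = grad_flow (v *m Pm) t (iota y).
Proof. by rewrite hactM jE /exp_p -scalemxAl. Qed.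

Lemma flow_height_continuous v (t : R) :
  continuous ((fun y => height (v *m Pm) (grad_flow (v *m Pm) t (iota y))) : M -> R^o).
Proof.
move=> y; have -> : (fun y => height (v *m Pm) (grad_flow (v *m Pm) t (iota y))) =
    (fun y => height (v *m Pm) (iota y)) \o actM (E (t *: v)).
  by apply/funext => y' /=; rewrite iota_flow.
have [ca _] := actM_smat (E (t *: v)) y.
exact: (@continuous_comp _ _ _ (actM (E (t *: v))) (fun y => height (v *m Pm) (iota y) : R^o) _ ca (@height_iota_continuous _ _)).
Qed.

Lemma polar_gradient_height v (t : R) : B (polar_gradient (t *: v)) (v *m Pm) =
  rint nu (fun y => height (v *m Pm) (grad_flow (v *m Pm) t (iota y))).
Proof.
rewrite /polar_gradient orbit_gradientE.
have := rint_linear cM nu (mklin (heightP (v *m Pm))) (mup_actM_continuous (g := E (t *: v))).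
by move=> /= ->; congr rint; apply/funext => y; rewrite iota_flow.
Qed.

Lemma polar_gradient_mono (u t : R) v : 0 <= u -> u <= t ->
  B (polar_gradient (u *: v)) (v *m Pm) <= B (polar_gradient (t *: v)) (v *m Pm).
Proof.
move=> _ ut; rewrite !polar_gradient_height.
apply: (rint_le cM) => [||y]; [exact: flow_height_continuous..|].
exact: (height_mono _ (plane_p PQ pE v) ut).
Qed.

Lemma plane_neq0 (v : 'rV[R]_e) : v != 0 -> v *m Pm != 0.
Proof.
move=> v0; apply: contraNneq v0 => h.
by rewrite -[v]mulmx1 -PQ mulmxA h mul0mx.
Qed.

Lemma nu_support (A : set M) : open A -> A !=set0 -> (0 < nu (A : set (borel M)))%E.
Proof. exact: smooth_measure_support. Qed.

(** The integrand, the growth of the height up to time 1, is nonnegative and positive at a moving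
    point; the measure charges open sets. *)
Lemma polar_gradient_strict a : a != 0 -> 0 < B (polar_gradient a - polar_gradient 0) (a *m Pm).
Proof.
move=> a0; have pb := plane_p PQ pE a; have b0 := plane_neq0 a0.
pose h1 y := height (a *m Pm) (grad_flow (a *m Pm) 1 (iota y)).
pose h0 y := height (a *m Pm) (grad_flow (a *m Pm) 0 (iota y)).
have E1 : B (polar_gradient a) (a *m Pm) = rint nu h1 by rewrite -polar_gradient_height scale1r.
have E0 : B (polar_gradient 0) (a *m Pm) = rint nu h0 by rewrite -polar_gradient_height scale0r.
rewrite linearBl E1 E0.
have c1 : continuous (h1 : M -> R^o) := @flow_height_continuous a 1.
have c0 : continuous (h0 : M -> R^o) := @flow_height_continuous a 0.
have cN : continuous ((fun y => -1 * h0 y) : M -> R^o).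
  by move=> y; apply: (@continuous_comp _ _ _ h0 (fun t : R^o => -1 * t : R^o)); [exact: c0|exact: mulrl_continuous].
have -> : rint nu h1 - rint nu h0 = rint nu (fun y => h1 y + -1 * h0 y).
  by rewrite (rintD cM) // (rintZ cM)// mulN1r.
apply: (rint_gt0 cM).
- by move=> y; apply: (@continuousD R R^o M h1 (fun y => -1 * h0 y)); [exact: c1|exact: cN].
- by move=> y; rewrite mulN1r subr_ge0; exact: (height_mono _ pb ler01).
- exact: nu_support.
have [y Vy] := moving_point pb b0; exists y; rewrite mulN1r subr_gt0 /h0 /h1.
by rewrite (grad_flow0 _ pb); exact: height_strict.
Qed.

(** An interior [y] lies strictly below the maximum [mx] in direction [beta], while the average
    heights tend to [mx]; integer times suffice by monotonicity. *)
Lemma polar_gradient_lim v y : v != 0 -> Om y ->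
  exists2 T : R, 0 <= T & B y (v *m Pm) < B (polar_gradient (T *: v)) (v *m Pm).
Proof.
move=> v0 Oy; have pb := plane_p PQ pE v; have b0 := plane_neq0 v0.
set beta := v *m Pm in pb b0 *.
have [y0 Hy0] := height_max beta; set mx := height beta (iota y0) in Hy0.
have lt := Om_below pb b0 Hy0 Oy.
have e0 : 0 < (mx - B y beta) / 2 by lra.
pose h n' y := height beta (grad_flow beta n'%:R (iota y)).
have ch n' : continuous (h n' : M -> R^o) := @flow_height_continuous v n'%:R.
have mh i l y' : (i <= l)%N -> h i y' <= h l y'.
  by move=> il; apply: height_mono => //; rewrite ler_nat.
have lh n' y' : h n' y' <= mx by rewrite /h -(iota_flow v); exact: Hy0.
have [|n0 Hn] := rint_limit cM ch mh lh _ (nu := nu) e0.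
  have := limit_null pb (ex_intro _ y0 erefl); apply: negligibleS => z [eps ep Heps].
  exists eps => // t; apply: le_trans (height_mono (iota z) pb _) (Heps (Num.bound `|t|)).
  by rewrite (le_trans (ler_norm _))// ltW// archi_boundP.
exists n0%:R => //; rewrite polar_gradient_height -/beta; lra.
Qed.

Lemma polar_gradient_hull a : closure hull (polar_gradient a).
Proof.
rewrite /polar_gradient orbit_gradientE.
apply: closureS (average_hull (nu := nu) cM (@mup_actM_continuous (E a))).
apply: hull_min; first exact: hull_segment.
by move=> _ [y _ <-]; apply: sub_hull; exists (actM (E a) y).
Qed.

Lemma orbit_param_diff h y : differentiable (fun a : 'rV[R]_e => orbit_param h (a, y)) 0.
Proof.
apply: Coo_at_differentiable; apply/(smat_euclidP _ _ (findim_rV e) (findim_rV _)).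
apply: (smat_comp mE mEM (f := (fun a => (a, y)) : euclid 'rV[R]_e -> prod_space (euclid 'rV[R]_e) M)).
  by apply: smat_pair; [exact: smat_id|exact: smat_cst].
exact: orbit_param_smat.
Qed.

(** In the direction [w] the parameter follows the gradient flow of [w Pm], along which the height
    grows at this speed. *)
Lemma dparam_speed h w y :
  B (dparam w (orbit_param h) (0, y)) (w *m Pm) = speed (w *m Pm) (act (j h) (iota y)).
Proof.
set beta := w *m Pm; set z := act (j h) (iota y); have pb : p beta := plane_p PQ pE w.
pose f (a : 'rV[R]_e) := orbit_param h (a, y).
have df : differentiable f (0 + (0 : R) *: w) by rewrite scale0r addr0; exact: orbit_param_diff.
have cL := findim_continuous (findim_rV _) (L := mklin (heightP beta)).
have dLf : differentiable (mklin (heightP beta) \o f) (0 + (0 : R) *: w).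
  exact: differentiable_comp df (linear_differentiable _ cL).
have D1 := diff_line dLf.
have D2 := height_derive z 0 pb; rewrite (grad_flow0 z pb) in D2.
have Ef : (fun u : R => (mklin (heightP beta) \o f) (0 + u *: w)) = (fun u => height beta (grad_flow beta u z)).
  by apply/funext => u; rewrite add0r /f /= /orbit_param /height /= /exp_p -scalemxAl.
rewrite Ef in D1.
have E1 := @derive_val _ _ _ _ _ _ _ D1; have E2 := @derive_val _ _ _ _ _ _ _ D2.
rewrite -E2 E1 (diff_linear_comp w cL df) /dparam /= /f scale0r addr0.
by [].
Qed.

Lemma orbit_param_pos h w : w != 0 ->
  0 < B ('d (pint nu (orbit_param h)) 0 w) (w *m Pm).
Proof.
move=> w0; have pb := plane_p PQ pE w; have b0 := plane_neq0 w0.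
have [_ ->] := pint_diff mM cM nu 0 (orbit_param_smat h).
have ds := dparam_smat mM w (orbit_param_smat h).
have cd : continuous (fun y => dparam w (orbit_param h) (0, y)) := param_continuous mM ds.
rewrite -[B _ _]/(mklin (heightP (w *m Pm)) _) (rint_linear cM nu _ cd) /=.
have cs : continuous ((fun y => B (dparam w (orbit_param h) (0, y)) (w *m Pm)) : M -> R^o).
  have cl := findim_continuous (findim_rV _) (L := mklin (heightP (w *m Pm))).
  move=> y; apply: (@continuous_comp _ _ _ (fun y => dparam w (orbit_param h) (0, y)) (fun x => B x (w *m Pm) : R^o)).
    exact: cd.
  exact: cl.
apply: (rint_gt0 cM) => //.
- by move=> y; rewrite dparam_speed; exact: speed_ge0.
- exact: nu_support.
(* Moved back by the inverse of [h], so that the translate by [h] is the moving point. *)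
have [y Vy] := moving_point pb b0; exists (actM (lie_inv h) y).
by rewrite dparam_speed -hactM -actM_mul (lmulrV LG) actM_one; exact: speed_gt0.
Qed.

(* Differentiate [x |-> F (E x E a)] instead of [x |-> F (E (a + x))]: its derivative
   at 0 is the integral of a positive definite form over the orbit of [E a]. *)
Lemma polar_gradient_inj a v : 'd polar_gradient a v = 0 -> v = 0.
Proof.
pose tau x := b (lie_mul (E x) (E a)).
have ta : tau 0 = a.
  rewrite /tau; have -> : E 0 = lie_one G.
    by apply: (sub_inj hG); rewrite jE (exp_p0 hc) (sub_one hc hG).
  by rewrite (lmul1 LG); exact: bE.
have st : Coo_at tau 0.
  apply/(smat_euclidP _ _ (findim_rV e) (findim_rV e)).
  have s1 : smat ((fun x => lie_mul (E x) (E a)) : euclid 'rV[R]_e -> G) 0.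
    by apply: (smat_lmul LG mE); [exact: sE|exact: smat_cst].
  exact: (smat_comp mE mG s1 (bs _)).
have chain w : 'd polar_gradient a ('d tau 0 w) = 'd (pint nu (orbit_param (E a))) 0 w.
  have nn : \forall x \near (0 : 'rV[R]_e), polar_gradient (tau x) = pint nu (orbit_param (E a)) x.
    by apply: filterE => x; rewrite pint_orbit_param polar_gradientE.
  exact: (chain_near w (Coo_at_differentiable st) ta (Coo_at_differentiable (polar_gradient_Coo a)) nn).
have inj : injective ('d tau 0).
  apply: raddf_inj => w tw; apply/eqP; apply: contraT => w0.
  have := orbit_param_pos (E a) w0; rewrite -chain.
  have -> : 'd polar_gradient a ('d tau 0 w) = 0 by rewrite tw linear0.
  by rewrite linear0l ltxx.
have [Qi HQ] := linear_left_inverse inj.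
have T1 : lin1_mx ('d tau 0) *m Qi = 1%:M.
  by apply/row_matrixP => i; rewrite row_mul !rowE mul_rV_lin1 HQ mulmx1.
(* In equal dimensions the left inverse of the injective differential is also a right inverse, so
   every [v] is a value of it. *)
have vE : v = 'd tau 0 (v *m Qi).
  by rewrite -mul_rV_lin1 -mulmxA (mulmx1C T1) mulmx1.
move=> dv; apply/eqP; apply: contraT => v0.
have w0 : v *m Qi != 0.
  by apply: contraNneq v0 => h; rewrite vE h linear0.
have := orbit_param_pos (E a) w0; rewrite -chain.
have -> : 'd polar_gradient a ('d tau 0 (v *m Qi)) = 0 by rewrite -vE.
by rewrite linear0l ltxx.
Qed.

Theorem polar_gradient_inverse : exists Gi : 'rV[R]_(d + d) -> 'rV[R]_e,
  [/\ forall a, Om (polar_gradient a), cancel polar_gradient Gi,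
      forall y, Om y -> polar_gradient (Gi y) = y &
   forall y, Om y -> exists (W : set 'rV[R]_(d + d)) (gl : 'rV[R]_(d + d) -> 'rV[R]_e),
    [/\ open W, W y, forall z, W z -> Coo_at gl z & forall z, W z -> Om z -> gl z = Gi z]].
Proof.
have P := @proper_inverse R e (d + d) Pm Qm hull hull_p (hull_segment (A := _)) Om0 B polar_gradient
  polar_gradient_Coo polar_gradient_p polar_gradient_inj polar_gradient_hull polar_gradient_strict
  polar_gradient_mono polar_gradient_lim.
exact: P.
Qed.
End submanifold.
End heights.

(** * Local sections of submersions *)

Section submersion.
Context {R : realType} {m q : nat} (X : charted_space 'rV[R]_m) (Y : charted_space 'rV[R]_q).
Hypotheses (mX : mfld X) (mY : mfld Y).
Variable f : X -> Y.
Hypothesis sf : forall x, smat f x.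

(** On the affine slice through [x0] spanned by a right inverse [Rm] of the tangent map, [f] has the
    identity as differential and is invertible near [x0]. *)
Lemma submersion_section x0 : (forall w, exists v, tangent_map f x0 v = w) ->
  exists sigma : Y -> X, smat sigma (f x0) /\ \forall y \near f x0, f (sigma y) = y.
Proof.
move=> surj; set chi := chart_at x0; set psi := chart_at (f x0).
have cchi : is_chart chi := chart_at_is mX x0; have cpsi : is_chart psi := chart_at_is mY (f x0).
have dchi : cdom chi x0 := dom_at mX x0; have dpsi : cdom psi (f x0) := dom_at mY (f x0).
have achi := atlas_at mX x0; have apsi := atlas_at mY (f x0).
pose e0 := cfwd chi x0; pose P := loc f x0; have [_ CP] := sf x0.
have /choice[v Hv] : forall i : 'I_q, exists v, tangent_map f x0 v = delta_mx 0 i.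
  by move=> i; exact: surj.
pose Rm : 'M[R]_(q, m) := \matrix_(i, l) v i 0 l.
have HRm w : tangent_map f x0 (w *m Rm) = w.
  rewrite mulmx_sum_row {1}/tangent_map linear_sum [RHS]row_sum_delta; apply: eq_bigr => i _.
  have -> : row i Rm = v i by apply/rowP => l; rewrite !mxE.
  by rewrite linearZ; congr (_ *: _); exact: Hv.
pose A (w : 'rV[R]_q) : 'rV[R]_m := e0 + w *m Rm.
pose LR : {linear 'rV[R]_q -> 'rV[R]_m} := mulmxr Rm.
have CA w : Coo_at A w.
  have C1 : Coo_at LR w by apply: Coo_at_linear; exact: findim_continuous (findim_rV q).
  have [W [oW Ww kW]] := C1; exists W; split => // l.
  by apply: (@CkD R _ _ l W (cst e0) LR oW) => //; exact: Ck_cst.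
have A0 : A 0 = e0 by rewrite /A mul0mx addr0.
have CPA : Coo_at P (A 0) by rewrite A0.
have Ch : Coo_at (P \o A) 0 := Coo_at_comp (findim_rV m) (CA 0) CPA.
have dA w : 'd A 0 w = w *m Rm.
  have cLR : continuous LR := findim_continuous (findim_rV q).
  have E0 := congr1 (fun h => h w) (diffD (differentiable_cst e0 (0 : 'rV[R]_q)) (linear_differentiable (0 : 'rV[R]_q) cLR)).
  have E1 := congr1 (fun h => h w) (@diff_cst _ 'rV[R]_q _ e0 0).
  have E2 := congr1 (fun h => h w) (@diff_lin _ _ _ LR 0 cLR).
  have gen (u v1 v2 v3 : 'rV[R]_m) : u = v1 + v2 -> v1 = 0 -> v2 = v3 -> u = v3 by move=> -> -> ->; rewrite add0r.
  exact: gen E0 E1 E2.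
have dPA w : 'd (P \o A) 0 w = w.
  have := chain_near w (Coo_at_differentiable (CA 0)) A0 (Coo_at_differentiable CP) (filterE _ (fun=> erefl)) (P := P \o A).
  by rewrite dA => <-; exact: HRm.
have [W [oW W0 hW]] := Ch.
have inj w : 'd (P \o A) 0 w = 0 -> w = 0 by rewrite dPA.
have [D [D' [g [[oD D0 DW] oD' H1 H2 gC]]]] := inverse_function oW W0 hW inj.
have P0 : (P \o A) 0 = cfwd psi (f x0) by rewrite /= A0 /P /loc /= (chart_cbwdK cchi dchi).
have [D'0 g0] := H1 0 D0; rewrite P0 in D'0 g0.
pose sigma y := cbwd chi (A (g (cfwd psi y))).
have sE : sigma (f x0) = x0 by rewrite /sigma g0 A0 (chart_cbwdK cchi dchi).
have ss : smat sigma (f x0).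
  have mq : mfld (euclid 'rV[R]_q) := euclid_mfld (findim_rV q).
  have mm : mfld (euclid 'rV[R]_m) := euclid_mfld (findim_rV m).
  have Cg : Coo_at g (cfwd psi (f x0)) by exists D'.
  have CAg : Coo_at (A \o g) (cfwd psi (f x0)) := Coo_at_comp (findim_rV q) Cg (CA _).
  have s1 : smat (fun y => (A \o g) (cfwd psi y) : euclid 'rV[R]_m) (f x0).
    apply: (smat_comp mY mq (smat_cfwd mY apsi dpsi) (g := (A \o g : euclid 'rV[R]_q -> euclid 'rV[R]_m))).
    exact/(smat_euclidP _ _ (findim_rV q) (findim_rV m)).
  have s2 : smat (cbwd chi : euclid 'rV[R]_m -> X) ((A \o g) (cfwd psi (f x0))).
    have E0 : (A \o g) (cfwd psi (f x0)) = e0 by rewrite /= g0 A0.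
    by rewrite E0; exact: (smat_cbwd mX achi (chart_img dchi)).
  exact: (smat_comp mY mm s1 s2).
exists sigma; split => //.
have n1 : \forall y \near f x0, cdom psi y by exact: near_dom.
have n2 : \forall y \near f x0, D' (cfwd psi y).
  by apply: (near_cfwd cpsi dpsi (P := D')); exact: open_near.
have n3 : \forall y \near f x0, cdom psi (f (sigma y)).
  have [cs _] := ss; have [cf _] := sf x0.
  have n0 : \forall x \near sigma (f x0), cdom psi (f x) by rewrite sE; apply: cf.
  exact: cs n0.
apply: filterS3 n1 n2 n3 => y d1 d2 d3; have [_ E] := H2 _ d2.
by rewrite -[RHS](chart_cbwdK cpsi d1) -[LHS](chart_cbwdK cpsi d3); exact: (congr1 (cbwd psi) E).
Qed.
End submersion.

(** The polar coordinate identifies [G/K] with [R^e]: it is constant on cosets and descends to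
    [bbar], with inverse [pi \o E]. The result for [polar_gradient] is then transported to [Q]. *)
Theorem corollary5p3 (R : realType) (n k d m r q : nat)
    (* the compact connected Kaehler manifold Z *)
    (Z : charted_space 'rV[R]_(n + n))
    (omega : Z -> {biscalar 'rV[R]_(n + n)})
    (hZ : is_complex_manifold Z) (hZc : compact_connected Z)
    (homega : is_kaehler_form omega)
    (* the compact connected Lie group U, its complexification c : U -> H, and
       the Hamiltonian action *)
    (U : lie_space 'rV[R]_k) (hU : is_lie_group U) (hUc : compact_connected U)
    (H : lie_space 'rV[R]_(d + d)) (c : U -> H) (hc : is_complexification c)
    (act : H -> Z -> Z) (hact : is_holomorphic_action act)
    (hUomega : preserves_form omega c act)
    (s : {biscalar 'rV[R]_(d + d)}) (hs : Ad_invariant_scalar_product c s)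
    (mu : Z -> 'rV[R]_(d + d)) (hmu : is_momentum_map omega c act s mu)
    (B : {biscalar 'rV[R]_(d + d)}) (hB : is_invariant_form c B)
    (* the compatible subgroup G = range j and its gradient map *)
    (G : lie_space 'rV[R]_m) (j : G -> H) (hG : is_compatible_subgroup c j)
    (mup : Z -> 'rV[R]_(d + d)) (hmup : is_gradient_map c j s mu mup)
    (hgrad : gradient_normalization omega c act j B mup)
    (* the compact G-stable submanifold M, embedded by iota *)
    (M : charted_space 'rV[R]_r) (hM : is_manifold M) (hMc : compact [set: M])
    (iota : M -> Z) (hiota : smooth_embedding iota)
    (actM : G -> M -> M)
    (hactM : forall g x, iota (actM g x) = act (j g) (iota x))
    (hmax : forall a, maximal_abelian_in_p c j a -> forall beta, a beta ->
       unique_local_max (fun x : M => B (mup (iota x)) beta))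
    (* the smooth K-invariant measure nu *)
    (nu : probability (borel M) R) (hnu : is_smooth_measure nu)
    (hnuK : forall g, grp_K c j g -> forall A : set (borel M), measurable A ->
       push (actM g) nu A = nu A)
    (hOmega : relative_interior (liealg_p c j)
                (convex_hull (range (mup \o iota))) 0)
    (* the homogeneous manifold Q = G/K *)
    (Q : charted_space 'rV[R]_q) (pi : G -> Q)
    (hQ : is_homogeneous_space (grp_K c j) pi) :
  exists Fbar : Q -> 'rV[R]_(d + d),
    (forall g, Fbar (pi g) = orbit_gradient_map actM (mup \o iota) nu g) /\
    diffeomorphism_onto
      (relative_interior (liealg_p c j)
         (convex_hull (range (mup \o iota)))) Fbar.
Proof.
have [cZ _] := hZc; have [cU _] := hUc; have [_ smu _ _] := hmu.
have [e [Pm [Qm [PQ pE]]]] := liealg_p_basis c j; rewrite pE in hOmega *.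
have [b [bs bK bE bdec]] := polar_coordinate hU hc hG PQ pE.
have [E [jE sE]] := exp_p_lift hU hc hG PQ pE.
have [Gi [PG GK KG Gloc]] := polar_gradient_inverse hZ cZ homega hU cU hc hact hs smu hB hG hmup hgrad
  PQ pE hM hMc hiota hactM hmax hnu hOmega hnuK bs bE bdec jE sE.
have FE := polar_gradientE hZ hc hact hs smu hG hmup PQ pE hM hMc hiota hactM hnuK bdec jE.
have CPG := polar_gradient_Coo hZ hU hc hact hs smu hG hmup PQ pE hM hMc hiota hactM nu jE.
set PGr := polar_gradient _ _ _ _ _ in PG GK KG FE CPG.
have [mQ' spi surj sub fib] := hQ; have mQ := is_manifold_mfld mQ'.
have LG := sub_lieg hG; have mG := lie_mfld LG.
have mE : mfld (euclid 'rV[R]_e) := euclid_mfld (findim_rV e).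
have mN : mfld (euclid 'rV[R]_(d + d)) := euclid_mfld (findim_rV _).
have sp g : smat pi g := (smooth_smatP mG mQ _).1 spi g.
have /choice[sec Hsec] := surj.
(* [sec] is an arbitrary choice of representatives; smoothness comes from replacing it near each
   point by a smooth local section, which gives the same value of [b]. *)
pose bbar x := b (sec x).
have bbarE g : bbar (pi g) = b g.
  have /fib Kx : pi g = pi (sec (pi g)) by rewrite Hsec.
  by rewrite -(bK g _ Kx) (lmulA LG) (lmulrV LG) (lmul1 LG).
have bE' a : b (E a) = a by exact: bE.
have piE g : pi (E (b g)) = pi g.
  have [x Kx Eg] := polar_decomposition hG bdec jE g.
  by apply/fib; rewrite {2}Eg (lmulA LG) (lmulV LG) (lmul1 LG).
have sbbar x : smat (bbar : Q -> euclid 'rV[R]_e) x.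
  rewrite -(Hsec x); have [sigma [ss ns]] := submersion_section mG mQ sp (sub (sec x)).
  have s1 : smat (b \o sigma : Q -> euclid 'rV[R]_e) (pi (sec x)) := smat_comp mQ mG ss (bs _).
  have n1 : \forall y \near pi (sec x), ((b \o sigma) : Q -> euclid 'rV[R]_e) y = bbar y.
    by apply: filterS ns => y Ey /=; rewrite -bbarE Ey.
  have := smat_eq mQ n1 s1.
  exact.
exists (PGr \o bbar); split => [g|]; first by rewrite /= bbarE FE.
split.
  apply/(smooth_smatP mQ mN) => x; apply: (smat_comp mQ mE (sbbar x) (g := (PGr : euclid 'rV[R]_e -> euclid 'rV[R]_(d + d)))).
  exact/(smat_euclidP _ _ (findim_rV e) (findim_rV _)).
exists (pi \o E \o Gi); split.
- by move=> x; exact: PG.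
- by move=> x /=; rewrite GK /bbar piE Hsec.
- by move=> y Oy /=; rewrite bbarE bE' KG.
move=> y Oy; have [W [gl [oW Wy Cgl glE]]] := Gloc y Oy.
exists W, (pi \o E \o gl); split => //.
  apply/(smooth_on_smatP mN mQ) => // z Wz.
  have s1 : smat (gl : euclid 'rV[R]_(d + d) -> euclid 'rV[R]_e) z.
    by apply/(smat_euclidP _ _ (findim_rV _) (findim_rV e)); exact: Cgl.
  exact: (smat_comp mN mG (smat_comp mN mE s1 (sE _)) (sp _)).
by move=> z Wz Oz /=; rewrite glE.
Qed.
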